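(* Let $N\in\mathbb N$ and let $\{X_n\}_{n=0}^N$ be random variables with $X_n\in L_G^1(\Omega_n)$ for every $n=0,1,\dots,N$. Define $\{V_n\}_{n=0}^N$ by backward induction: $V_N=X_N$ and $$V_n=\max\{X_n,\hat{\mathbb E}_n[V_{n+1}]\},\qquad n\le N-1 .$$ Then: (1) $\{V_n\}_{n=0}^N$ is the smallest $G$-supermartingale dominating $\{X_n\}_{n=0}^N$. (2) For $j\le N$ let $\mathcal T_{j,N}$ be the set of all $G$-stopping times taking values in $\{j,\dots,N\}$, and set $\tau_j=\inf\{l\ge j: V_l=X_l\}$. Then $\tau_j$ is a $G$-stopping time and $V_{n\wedge\tau_j}\in L_G^{*1}(\Omega_n)$ for all $j\le N$, $n\le N$. Furthermore $\{V_{n\wedge\tau_j}, n=j,j+1,\dots,N\}$ is a $G$-martingale, and for every $j\le N$, $$V_j=\hat{\mathbb E}_j[X_{\tau_j}]=\operatorname*{ess\,sup}_{\tau\in\mathcal T_{j,N}}\hat{\mathbb E}_j[X_\tau].$$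
   Context: Framework. Fix $0\le\underline\sigma\le\bar\sigma<\infty$ and $G(a)=\frac12(\bar\sigma^2a^+-\underline\sigma^2a^-)$. $\Omega=C_0([0,\infty);\mathbb R)$ is the space of continuous paths starting at $0$ (locally uniform topology, Borel $\sigma$-field $\mathcal B(\Omega)$), $B$ the canonical process, $\Omega_t=\{\omega_{\cdot\wedge t}:\omega\in\Omega\}$. $L_{ip}(\Omega_t)=\{\varphi(B_{t_1},\dots,B_{t_m}): m\ge1,\ t_i\in[0,t],\ \varphi \text{ bounded Lipschitz}\}$, $L_{ip}(\Omega)=\bigcup_tL_{ip}(\Omega_t)$. $\hat{\mathbb E}$ is the $G$-expectation, with conditional $G$-expectations $\hat{\mathbb E}_t$: for $X=\varphi(B_{t_1},B_{t_2}-B_{t_1},\dots,B_{t_m}-B_{t_{m-1}})$ one sets $\hat{\mathbb E}_{t_j}[X]=\varphi_j(B_{t_1},\dots,B_{t_j}-B_{t_{j-1}})$, where $\varphi_m=\varphi$ and $\varphi_{i-1}(x_1,\dots,x_{i-1})=u(t_i-t_{i-1},0)$ with $u$ the viscosity solution of $\partial_tu=G(\partial^2_{yy}u)$, $u(0,y)=\varphi_i(x_1,\dots,x_{i-1},y)$; $\hat{\mathbb E}=\hat{\mathbb E}_0$. $L_G^p(\Omega_t)$ is the completion of $L_{ip}(\Omega_t)$ under $\hat{\mathbb E}[|\cdot|^p]^{1/p}$. $\mathcal P$ is the weakly compact set of all probability measures $P$ on $\Omega$ with $E^P[X]\le\hat{\mathbb E}[X]$ for all $X\in L_{ip}(\Omega)$;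 it represents $\hat{\mathbb E}$, and for Borel $X$ such that $E^P[X]$ exists for all $P\in\mathcal P$ one sets $\hat{\mathbb E}[X]=\sup_{P\in\mathcal P}E^P[X]$. $c(A)=\sup_{P\in\mathcal P}P(A)$; ''q.s.'' means outside a set of capacity $c$ zero. Relations between random variables are q.s. Spaces. $L^0(\Omega)$: Borel maps $\Omega\to[-\infty,\infty]$; $\mathcal L(\Omega)$: those $X\in L^0(\Omega)$ for which $E^P[X]$ exists for every $P\in\mathcal P$; $\mathbb L^1(\Omega)=\{X\in L^0(\Omega):\hat{\mathbb E}[|X|]<\infty\}$; $L_G^{1^*}(\Omega)$: $X\in\mathbb L^1(\Omega)$ with $X_n\downarrow X$ q.s. for some $\{X_n\}\subset L_G^1(\Omega)$; $L_G^{*1}(\Omega)=\{X-Y:X,Y\in L_G^{1^*}(\Omega)\}$; $L_G^{1^*_*}(\Omega)$: $X\in\mathbb L^1(\Omega)$ with $X_n\uparrow X$ q.s. for some $\{X_n\}\subset L_G^{1^*}(\Omega)$; $\bar L_G^{1^*_*}(\Omega)$: $X\in\mathbb L^1(\Omega)$ with $\hat{\mathbb E}[|X_n-X|]\to0$ for some $\{X_n\}\subset L_G^{1^*_*}(\Omega)$. The same definitions with $\Omega_t$ in place of $\Omega$ give the spaces over $\Omega_t$. Conditional expectation on $\bar L_G^{1^*_*}(\Omega)$. $\hat{\mathbb E}_t$ is extended from $L_{ip}(\Omega)$ to $L^1_G(\Omega)$ and $\bar L_G^{1^*_*}(\Omega)$ by norm limits and monotone limits; it is characterized by $\hat{\mathbb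 E}_t[X]=\operatorname{ess\,sup}^P_{Q\in\mathcal P(t,P)}E^Q[X|\mathcal F_t]$ $P$-a.s. for every $P\in\mathcal P$, where $\mathcal F_t=\mathcal B(\Omega_t)$ and $\mathcal P(t,P)=\{Q\in\mathcal P:E^Q[X]=E^P[X]\ \forall X\in L_{ip}(\Omega_t)\}$. A random time $\tau:\Omega\to[0,\infty)$ is a $G$-stopping time if $I_{\{\tau\le t\}}\in L_G^{1^*}(\Omega_t)$ for each $t\ge0$. $X_\tau$ denotes $\omega\mapsto X_{\tau(\omega)}(\omega)$. $\{M_n\}$ is a $G$-martingale (resp. $G$-supermartingale) if $M_n\in\bar L_G^{1^*_*}(\Omega_n)$ for each $n$ and $\hat{\mathbb E}_m[M_n]=M_m$ (resp. $\le M_m$) for all $m\le n$. $V$ dominates $X$ if $V_n\ge X_n$ for all $n$; smallest means that every $G$-supermartingale $U$ dominating $X$ satisfies $U_n\ge V_n$ for all $n$. Essential supremum (quasi-sure): for $\mathcal H\subset\mathbb L^1(\Omega)$, $\operatorname{ess\,sup}_{\xi\in\mathcal H}\xi$ is a random variable $\eta\in L^0(\Omega)$ with (i) $\eta\ge\xi$ q.s. for all $\xi\in\mathcal H$, and (ii) if $\eta'\in\mathcal L(\Omega)$ satisfies $\eta'\ge\xi$ q.s. for all $\xi\in\mathcal H$ then $\eta\le\eta'$ q.s. It need not exist in general, but is unique if it does; the asserted equality includes existence. *)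

(* Defs.v *)
From HB Require Import structures.
From mathcomp Require Import all_boot all_order all_algebra.
From mathcomp Require Import all_classical all_reals all_analysis.
From mathcomp Require Import measurable_realfun.

Set Implicit Arguments.
Unset Strict Implicit.
Unset Printing Implicit Defensive.

Import Order.TTheory GRing.Theory Num.Theory.
Import numFieldNormedType.Exports.

Local Open Scope classical_set_scope.
Local Open Scope ring_scope.

(* A continuous path on [0,oo) starting at 0 is stored as its extension by 0 to
   the negative half-line: this extension is unique and continuous, and locally
   uniform convergence on R of the extensions is locally uniform convergence on
   [0,oo) of the paths. *)
Record cpath (R : realType) := CPath {
  path_fun : R -> R ;
  path_continuous : continuous path_fun ;
  path_nonpos : forall s, s <= 0 -> path_fun s = 0 }.

Section canonical_space.
Context (R : realType).

HB.instance Definition _ := gen_eqMixin (cpath R).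
HB.instance Definition _ := gen_choiceMixin (cpath R).

Lemma zero_path_continuous : continuous (fun _ : R => 0 : R).
Proof. by move=> x; exact: cvg_cst. Qed.

Definition zero_path : cpath R :=
  CPath zero_path_continuous (fun _ _ => erefl).

HB.instance Definition _ := isPointed.Build (cpath R) zero_path.

Definition path_compact_open (w : cpath R) : {compact-open, R -> R} :=
  path_fun w.

HB.instance Definition _ :=
  Topological.copy (cpath R) (@initial_topology _ _ path_compact_open).

Definition Omega := g_sigma_algebraType (@open (cpath R)).

Definition B (t : R) (w : Omega) : R := path_fun (w : cpath R) t.

Lemma stop_continuous (t : R) (w : cpath R) :
  continuous (fun s => path_fun w (Num.min s t)).
Proof.
move=> s; apply: (@continuous_comp _ _ _ (fun s => Num.min s t) (path_fun w)).
  by apply: continuous_min; [exact: cvg_id | exact: cvg_cst].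
exact: path_continuous.
Qed.

Lemma stop_nonpos (t : R) (w : cpath R) s :
  s <= 0 -> path_fun w (Num.min s t) = 0.
Proof. by move=> s0; rewrite path_nonpos// ge_min s0. Qed.

Definition stop (t : R) (w : Omega) : Omega :=
  CPath (@stop_continuous t w) (@stop_nonpos t w).

(* The horizon [T] is [t%:E] for the sigma-field of [Omega_t], and [+oo] for
   that of [Omega]; only horizons in [0, +oo] are ever used. *)
Definition Filt (T : \bar R) : set (set Omega) :=
  if T is t%:E then preimage_set_system setT (stop t) measurable
  else measurable.

End canonical_space.

Section G_heat.
Context (R : realType) (sl sh : R).

Definition G (a : R) : R :=
  2^-1 * (sh ^+ 2 * Num.max a 0 - sl ^+ 2 * Num.max (- a) 0).

Definition d_t (psi : R -> R -> R) (t y : R) : R := derive1 (psi^~ y) t.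
Definition d_y (psi : R -> R -> R) (t y : R) : R := derive1 (psi t) y.
Definition d_yy (psi : R -> R -> R) (t y : R) : R := derive1 (d_y psi t) y.

Definition jointly_continuous_at (f : R -> R -> R) (t y : R) : Prop :=
  {for ((t, y) : R * R), continuous (fun z : R * R => f z.1 z.2)}.

Definition C12 (psi : R -> R -> R) : Prop :=
  forall t y, 0 < t ->
    [/\ derivable (psi^~ y) t 1, derivable (psi t) y 1
      & derivable (d_y psi t) y 1] /\
    [/\ jointly_continuous_at psi t y, jointly_continuous_at (d_t psi) t y,
        jointly_continuous_at (d_y psi) t y
      & jointly_continuous_at (d_yy psi) t y].

Definition viscosity_subsolution (u : R -> R -> R) : Prop :=
  forall psi t y, C12 psi -> 0 < t ->
    (\forall z \near ((t, y) : R * R),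
       u z.1 z.2 - psi z.1 z.2 <= u t y - psi t y) ->
    d_t psi t y <= G (d_yy psi t y).

Definition viscosity_supersolution (u : R -> R -> R) : Prop :=
  forall psi t y, C12 psi -> 0 < t ->
    (\forall z \near ((t, y) : R * R),
       u t y - psi t y <= u z.1 z.2 - psi z.1 z.2) ->
    G (d_yy psi t y) <= d_t psi t y.

(* The initial data considered are bounded, and boundedness is the growth
   condition under which the viscosity solution is unique. *)
Definition viscosity_solution (f : R -> R) (u : R -> R -> R) : Prop :=
  [/\ {within [set z : R * R | 0 <= z.1], continuous (fun z => u z.1 z.2)},
      (exists K, forall t y, 0 <= t -> `|u t y| <= K),
      (forall y, u 0 y = f y),
      viscosity_subsolution u
    & viscosity_supersolution u].

End G_heat.

Section G_expectation.
Context (R : realType) (sl sh : R).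

Definition bounded_lipschitz m (phi : 'rV[R]_m -> R) : Prop :=
  [bounded phi x | x in setT] /\ [lipschitz phi x | x in setT].

Definition Lip (T : \bar R) (X : Omega R -> R) : Prop :=
  exists (m : nat) (s : 'I_m -> R) (phi : 'rV[R]_m -> R),
    [/\ (0 < m)%N, (forall i, 0 <= s i /\ ((s i)%:E <= T)%E),
        bounded_lipschitz phi
      & X = fun w => phi (\row_i B (s i) w)].

Definition snoc i (x : 'rV[R]_i) (y : R) : 'rV[R]_i.+1 :=
  \row_(k < i.+1) if unlift ord_max k is Some k' then x 0 k' else y.

Definition increments (s : nat -> R) i (w : Omega R) : 'rV[R]_i :=
  \row_(k < i) (B (s k.+1) w - B (s k) w).

(* [Y] is the conditional G-expectation of [X] at time [t], for [X] a function
   [Phi m] of the increments of [B] along [0 = s_0 < s_1 < ... < s_m] with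
   [t = s_j]; as [B 0 = 0], the first increment is [B (s 1)].
   Any cylinder function can be so written, by refining its time grid. *)
Definition condE_Lip (t : R) (X Y : Omega R -> R) : Prop :=
  exists (m j : nat) (s : nat -> R) (Phi : forall i, 'rV[R]_i -> R),
    [/\ s 0%N = 0, (forall i, (i < m)%N -> s i < s i.+1),
        (j <= m)%N, s j = t
      & bounded_lipschitz (Phi m)] /\
    [/\ X = (fun w => Phi m (increments s m w)),
        Y = (fun w => Phi j (increments s j w))
      & forall i, (j <= i < m)%N -> forall x : 'rV[R]_i,
          exists2 u, viscosity_solution sl sh (fun y => Phi i.+1 (snoc x y)) u
                   & Phi i x = u (s i.+1 - s i) 0].

Definition PP : set (probability (Omega R) R) :=
  [set P | forall X c, condE_Lip 0 X (cst c) ->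
     (\int[P]_w (X w)%:E <= c%:E)%E].

Local Open Scope ereal_scope.

Definition Ehat (X : Omega R -> \bar R) : \bar R :=
  ereal_sup [set \int[P]_w X w | P in PP].

Definition capacity (A : set (Omega R)) : \bar R :=
  ereal_sup [set P A | P in PP].

Definition qs (Q : set (Omega R)) : Prop :=
  exists A, [/\ measurable A, capacity A = 0 & ~` Q `<=` A].

Definition qs_eq (X Y : Omega R -> \bar R) : Prop := qs [set w | X w = Y w].
Definition qs_le (X Y : Omega R -> \bar R) : Prop := qs [set w | X w <= Y w].

Definition qs_decr (Xn : nat -> Omega R -> \bar R) (X : Omega R -> \bar R) :=
  qs [set w | (forall n, Xn n.+1 w <= Xn n w) /\ Xn ^~ w @ \oo --> X w].
Definition qs_incr (Xn : nat -> Omega R -> \bar R) (X : Omega R -> \bar R) :=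
  qs [set w | (forall n, Xn n w <= Xn n.+1 w) /\ Xn ^~ w @ \oo --> X w].
Definition norm_cvg (Xn : nat -> Omega R -> \bar R) (X : Omega R -> \bar R) :=
  (fun n => Ehat (fun w => `|Xn n w - X w|)) @ \oo --> 0.

(* Random variables are honest Borel functions on [Omega], but only their
   quasi-sure class matters: measurability with respect to [Omega_t] is required
   of some quasi-sure version.
   [L0], [LL], [LL1], [LG1], [LG1s], [LGs1], [LG1ss], [LGbar] stand for
   [L^0], [\mathcal L], [\mathbb L^1], [L_G^1], [L_G^{1^*}], [L_G^{*1}],
   [L_G^{1^*_*}], [\bar L_G^{1^*_*}] over the given horizon. *)
Definition L0 (T : \bar R) (X : Omega R -> \bar R) : Prop :=
  measurable_fun setT X /\
  exists2 Y : Omega R -> \bar R,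
    (forall A, measurable A -> Filt T (Y @^-1` A)) & qs_eq X Y.

(* [E^P[X]] exists, in [-oo, +oo], for all [P]. *)
Definition LL (X : Omega R -> \bar R) : Prop :=
  measurable_fun setT X /\
  forall P, PP P -> \int[P]_w (X^\+ w) < +oo \/ \int[P]_w (X^\- w) < +oo.

Definition LL1 (T : \bar R) (X : Omega R -> \bar R) : Prop :=
  L0 T X /\ Ehat (fun w => `|X w|) < +oo.

(* The completion of [Lip T], realised inside [LL1 T]. *)
Definition LG1 (T : \bar R) (X : Omega R -> \bar R) : Prop :=
  LL1 T X /\
  exists2 Xn : nat -> Omega R -> R,
    (forall n, Lip T (Xn n)) & norm_cvg (fun n w => (Xn n w)%:E) X.

Definition LG1s (T : \bar R) (X : Omega R -> \bar R) : Prop :=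
  LL1 T X /\ exists2 Xn, (forall n, LG1 T (Xn n)) & qs_decr Xn X.

Definition LGs1 (T : \bar R) (Z : Omega R -> \bar R) : Prop :=
  measurable_fun setT Z /\
  exists X Y, [/\ LG1s T X, LG1s T Y & qs_eq Z (fun w => X w - Y w)].

Definition LG1ss (T : \bar R) (X : Omega R -> \bar R) : Prop :=
  LL1 T X /\ exists2 Xn, (forall n, LG1s T (Xn n)) & qs_incr Xn X.

Definition LGbar (T : \bar R) (X : Omega R -> \bar R) : Prop :=
  LL1 T X /\ exists2 Xn, (forall n, LG1ss T (Xn n)) & norm_cvg Xn X.

(* [condE_* t X Y]: [Y] is a version of the conditional expectation of [X] at
   time [t], obtained by extending [condE_Lip] successively to [LG1 +oo],
   [LG1s +oo], [LG1ss +oo] and [LGbar +oo]. *)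
Definition condE_G1 (t : R) (X Y : Omega R -> \bar R) : Prop :=
  [/\ LG1 +oo X, measurable_fun setT Y
    & exists Xn Yn : nat -> Omega R -> R,
        [/\ (forall n, condE_Lip t (Xn n) (Yn n)),
            norm_cvg (fun n w => (Xn n w)%:E) X
          & norm_cvg (fun n w => (Yn n w)%:E) Y]].

Definition condE_G1s (t : R) (X Y : Omega R -> \bar R) : Prop :=
  [/\ LG1s +oo X, measurable_fun setT Y
    & exists Xn Yn, [/\ (forall n, condE_G1 t (Xn n) (Yn n)),
                        qs_decr Xn X & qs_decr Yn Y]].

Definition condE_G1ss (t : R) (X Y : Omega R -> \bar R) : Prop :=
  [/\ LG1ss +oo X, measurable_fun setT Y
    & exists Xn Yn, [/\ (forall n, condE_G1s t (Xn n) (Yn n)),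
                        qs_incr Xn X & qs_incr Yn Y]].

Definition is_condE (t : R) (X Y : Omega R -> \bar R) : Prop :=
  [/\ LGbar +oo X, measurable_fun setT Y
    & exists Xn Yn, [/\ (forall n, condE_G1ss t (Xn n) (Yn n)),
                        norm_cvg Xn X & norm_cvg Yn Y]].

(* A version of the conditional expectation; the default value is irrelevant on
   [LGbar +oo]. *)
Definition condE (t : R) (X : Omega R -> \bar R) : Omega R -> \bar R :=
  xget (cst 0) [set Y | is_condE t X Y].

Definition G_stopping_time (tau : Omega R -> R) : Prop :=
  (forall w, (0 <= tau w)%R) /\
  forall t : R, (0 <= t)%R ->
    LG1s t%:E (fun w => (\1_[set w | (tau w <= t)%R] w)%:E).

(* [T_{j,N}]; such times are kept as [nat]-valued maps, so that [X_tau] is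
   [fun w => X (tau w) w]. *)
Definition stopping_times (j N : nat) : set (Omega R -> nat) :=
  [set tau | (forall w, (j <= tau w <= N)%N) /\
             G_stopping_time (fun w => (tau w)%:R)].

(* Processes indexed by [{j, ..., N}]. *)
Definition G_martingale (j N : nat) (M : nat -> Omega R -> \bar R) : Prop :=
  (forall n, (j <= n <= N)%N -> LGbar n%:R%:E (M n)) /\
  (forall m n, (j <= m <= n)%N -> (n <= N)%N -> qs_eq (condE m%:R (M n)) (M m)).

Definition G_supermartingale (j N : nat) (M : nat -> Omega R -> \bar R) : Prop :=
  (forall n, (j <= n <= N)%N -> LGbar n%:R%:E (M n)) /\
  (forall m n, (j <= m <= n)%N -> (n <= N)%N -> qs_le (condE m%:R (M n)) (M m)).

Definition dominates (N : nat) (V X : nat -> Omega R -> \bar R) : Prop :=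
  forall n, (n <= N)%N -> qs_le (X n) (V n).

Definition smallest_dominating_supermartingale
    (N : nat) (X V : nat -> Omega R -> \bar R) : Prop :=
  [/\ G_supermartingale 0 N V, dominates N V X
    & forall U, G_supermartingale 0 N U -> dominates N U X -> dominates N U V].

Definition is_ess_sup (H : set (Omega R -> \bar R)) (eta : Omega R -> \bar R) :
    Prop :=
  [/\ (forall xi, H xi -> LL1 +oo xi),
      measurable_fun setT eta,
      (forall xi, H xi -> qs_le xi eta)
    & forall eta', LL eta' -> (forall xi, H xi -> qs_le xi eta') ->
        qs_le eta eta'].

(* [inf {l >= j : V_l = X_l}], for processes indexed by [{0, ..., N}]. The set is
   never empty when [V N = X N] and [j <= N]. *)
Definition first_contact (j N : nat) (X V : nat -> Omega R -> \bar R)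
    (w : Omega R) : nat :=
  (\big[minn/N]_(j <= l < N.+1 | V l w == X l w) l)%N.

End G_expectation.

(* Main.v *)
(* The scheme w(t + h) = max over sigma of the mean of w(t) under a random walk of
   volatility sigma satisfies, in the limit, a comparison with quartic polynomials,
   which characterises the viscosity solutions of the G-heat equation. This gives
   their existence and uniqueness, hence the conditional G-expectation E_t of
   cylinder functions as a sublinear, monotone and time-consistent operator.

   A linear functional dominated by E_0 is a probability on Omega: Daniell's
   condition follows from the fourth-moment bound E_0[(B_t - B_s)^4] <= C (t - s)^2.
   With Hahn-Banach, E_t[X] is under each P the essential supremum of E^Q[X | F_t]
   over the laws Q that agree with P up to t. This description survives norm limits,
   increasing limits and, as the set of such Q is compact, decreasing limits of
   continuous functions; it makes the extended E_t monotone, time-consistent and local.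

   A process stopped at tau is frozen on {tau <= n} and moves as V on {tau > n}. Since
   V_n >= E_n[V_(n+1)], with equality before the contact time tau_j, V stopped at any
   tau is a supermartingale and V stopped at tau_j is a martingale; as V dominates X
   and equals X at tau_j, the theorem follows. The event {tau_j <= k} is the union
   of the events {V_l = X_l}, j <= l <= k, whose indicators are decreasing limits of
   max(0, 1 - m |V_l - X_l|), so tau_j is a G-stopping time. *)
Require Import Defs.
From HB Require Import structures.
From mathcomp Require Import all_boot all_order all_algebra.
From mathcomp Require Import all_classical all_reals all_analysis.
From mathcomp Require Import measurable_realfun.
From mathcomp Require Import ring lra.

Set Implicit Arguments.
Unset Strict Implicit.
Unset Printing Implicit Defensive.

Import Order.TTheory GRing.Theory Num.Theory.
Import numFieldNormedType.Exports.

Local Open Scope classical_set_scope.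
Local Open Scope ring_scope.

(** * Smoothing and finite difference schemes *)

(** Three obstacles shape the proof. First, uniqueness for the equation is obtained without doubling
    of variables: bounded functions are compared only with polynomials a + b y + c y^2 / 2 + d y^4,
    whose quartic term absorbs both the cubic Taylor remainder and the growth at infinity, and whose
    evolution is bounded by an explicit heat polynomial. A maximum of two smooth functions is not
    smooth, so the bound of the scheme by the solution has to smooth anew before each choice of
    volatility; the scheme therefore keeps one volatility during very many tiny steps. Secondly,
    random variables matter only quasi-surely, whereas measurability at time t is exact; limits are
    therefore built pointwise, as upper limits, so that they stay invariant under stopping the path
    at t. Thirdly, a conditional expectation of an element of the largest class is not shown to
    belong to that class again, so iterated conditioning rests on integral inequalities over the
    events prior to t and not on a composition of operators. *)

Section smoothing.
Context (R : realType).
Implicit Types (f g F : R -> R) (x y e L M : R).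

Lemma continuous_is_derive f df : (forall x, is_derive x (1:R) f (df x)) ->
  continuous f.
Proof.
move=> h x; apply: differentiable_continuous; apply/derivable1_diffP.
by have [] := h x.
Qed.

Lemma mvt_convex f df x y : (forall z, is_derive z (1:R) f (df z)) ->
  exists2 l, 0 <= l <= 1 & f y - f x = df (x + l * (y - x)) * (y - x).
Proof.
move=> h; have cf := continuous_is_derive h.
have [xy|yx|->] := ltgtP x y.
- have [|c + e] := MVT xy (fun z _ => h z); first exact: continuous_subspaceT.
  rewrite in_itv/= => /andP[c1 c2].
  have yx0 : 0 < y - x by rewrite subr_gt0.
  exists ((c - x) / (y - x)); last by rewrite divfK ?gt_eqF// (addrC x) subrK.
  by apply/andP; split; [apply: divr_ge0; lra | rewrite ler_pdivrMr//; lra].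
- have [|c + e] := MVT yx (fun z _ => h z); first exact: continuous_subspaceT.
  rewrite in_itv/= => /andP[c1 c2].
  have yx0 : 0 < x - y by rewrite subr_gt0.
  exists ((x - c) / (x - y)).
    by apply/andP; split; [apply: divr_ge0; lra | rewrite ler_pdivrMr//; lra].
  have -> : x + (x - c) / (x - y) * (y - x) = c by field; rewrite gt_eqF.
  by rewrite -(opprB x y) mulrN -e opprB.
- by exists 0; rewrite ?lexx ?ler01// !subrr !mulr0.
Qed.

Lemma mvt f df x y : (forall z, is_derive z (1:R) f (df z)) ->
  exists2 c, `|c - x| <= `|y - x| & f y - f x = df c * (y - x).
Proof.
move=> /(mvt_convex x y)[l /andP[l0 l1] e]; exists (x + l * (y - x)) => //.
by rewrite addrAC subrr add0r normrM ger0_norm// ler_piMl.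
Qed.

(** The integral from -n differentiates to [f] only to the right of -n. Normalised to vanish at 0,
    these integrals agree wherever they are defined, so n may be chosen from the point. *)
Lemma antiderivative_exists f : continuous f ->
  exists F, forall x, is_derive x (1:R) F (f x).
Proof.
move=> cf.
pose G (n : nat) x := \int[lebesgue_measure]_(t in `[- n%:R, x]) f t.
have intf a b : (@lebesgue_measure R).-integrable `[a, b] (EFin \o f).
  apply: continuous_compact_integrable; first exact: segment_compact.
  exact: continuous_subspaceT.
have dG n x : - n%:R < x -> is_derive x (1:R) (G n) (f x).
  move=> nx; have x1 : x < x + 1 by rewrite ltrDl.
  have [d e] := @continuous_FTC1_closed R f (- n%:R) x (x + 1) x1
    (intf (- n%:R) (x + 1)) nx (cf x).
  by rewrite derive1E in e; exact: (DeriveDef d e).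
pose H n x := G n x - G n 0.
have dH n x : - n%:R < x -> is_derive x (1:R) (H n) (f x).
  move=> nx; rewrite -[f x]subr0.
  by apply: is_deriveB; exact: dG.
have HE n m x : (0 < n)%N -> (n <= m)%N -> - n%:R < x -> H n x = H m x.
  move=> n0 nm nx.
  have mn : - m%:R <= - n%:R :> R by rewrite lerN2 ler_nat.
  have d0 (z : R) : - n%:R < z -> is_derive z (1:R) (H n \- H m) 0.
    move=> nz; rewrite -(subrr (f z)); apply: is_deriveB; first exact: dH.
    by apply: dH; exact: le_lt_trans nz.
  have n0' : - n%:R < 0 :> R by rewrite oppr_lt0 ltr0n.
  suff : (H n \- H m) x = (H n \- H m) 0.
    move=> e; have : H n x - H m x = H n 0 - H m 0 := e.
    by rewrite /H; lra.
  have cst (a b : R) : a < b -> - n%:R < a -> (H n \- H m) b = (H n \- H m) a.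
    move=> ab na; have da (z : R) : a <= z -> is_derive z (1:R) (H n \- H m) 0.
      by move=> az; apply: d0; exact: lt_le_trans az.
    have ci : {within `[a, b], continuous (H n \- H m)}.
      apply: derivable_within_continuous => z; rewrite in_itv/= => /andP[az _].
      by have [] := da z az.
    have di (z : R) : z \in `]a, b[ -> is_derive z (1:R) (H n \- H m) (cst 0 z : R).
      by rewrite in_itv/= => /andP[az _]; apply: da; exact: ltW.
    have [c _] := MVT ab di ci.
    by rewrite mul0r => /eqP; rewrite subr_eq0 => /eqP.
  by have [x0|x0|->//] := ltgtP x 0; [apply/esym|]; apply: cst.
pose N x := (Num.truncn `|x|).+1.
have xN x : `|x| < (N x)%:R by apply: truncnS_gt.
exists (fun x => H (N x) x) => x.
have : is_derive x (1:R) (H (N x).+1) (f x).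
  apply: dH; rewrite ltrNl; apply: (le_lt_trans (ler_norm _)); rewrite normrN.
  by apply: lt_trans (xN x) _; rewrite ltr_nat.
apply: near_eq_is_derive; near=> z.
have zN : `|z| < (N x)%:R.
  near: z; apply: (cvgr_lt `|x|); last exact: xN.
  by apply: cvg_norm; exact: cvg_id.
apply/esym/HE => //; last first.
  by rewrite ltrNl; apply: (le_lt_trans (ler_norm _)); rewrite normrN.
suff : (N z <= N x)%N by move/leqW.
rewrite /N -(ltr_nat R).
by apply: le_lt_trans zN; rewrite truncn_le.
Unshelve. all: by end_near. Qed.

Definition lipf L f := forall x y, `|f x - f y| <= L * `|x - y|.

Lemma lipf_continuous L f : lipf L f -> continuous f.
Proof.
move=> lf x; apply/cvgrPdist_lt => e e0.
have L1 : 0 < `|L| + 1 by rewrite ltr_pwDr.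
near=> z.
apply: (le_lt_trans (lf x z)).
apply: (@le_lt_trans _ _ ((`|L| + 1) * `|x - z|)).
  by rewrite ler_wpM2r// (le_trans (ler_norm _))// lerDl.
rewrite mulrC -ltr_pdivlMr//.
near: z; apply: (@cvgr_dist_lt _ _ _ (nbhs x) _ id x); first exact: cvg_id.
by rewrite divr_gt0.
Unshelve. all: by end_near. Qed.

(** The moving average of [f] over [x, x + e], written with an antiderivative so that its estimates
    follow from the mean value theorem; for continuous [f] the default of [xget] is never met. *)
Definition box e f x : R :=
  let F := xget (cst 0) [set F | forall z, is_derive z (1:R) F (f z)] in
  (F (x + e) - F x) / e.

Lemma boxE e f F x : (forall z, is_derive z (1:R) F (f z)) ->
  box e f x = (F (x + e) - F x) / e.
Proof.
move=> dF; rewrite /box; case: xgetP => [F' _ /= dF'|/(_ F)]; last by [].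
have d0 z : is_derive z (1:R) (F' \- F) (0 : R).
  by rewrite -(subrr (f z)); apply: is_deriveB.
have [c _] := mvt (df := cst 0) x (x + e) d0.
rewrite mul0r => e0.
have : F' (x + e) - F (x + e) - (F' x - F x) = 0 := e0.
by move=> {}e0; congr (_ / _); lra.
Qed.

Lemma box_mvt e f x : continuous f -> 0 < e ->
  exists2 c, `|c - x| <= e & box e f x = f c.
Proof.
move=> /antiderivative_exists[F dF] e0.
have [c cx E] := mvt x (x + e) dF.
exists c; first by move: cx; rewrite addrAC subrr add0r (gtr0_norm e0).
by rewrite (boxE _ _ dF) E addrAC subrr add0r mulfK// gt_eqF.
Qed.

Lemma box_dist L e f x : 0 < e -> lipf L f -> 0 <= L ->
  `|box e f x - f x| <= L * e.
Proof.
move=> e0 lf L0; have [c cx ->] := box_mvt x (lipf_continuous lf) e0.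
by apply: le_trans (lf _ _) _; rewrite ler_wpM2l.
Qed.

Lemma box_le e f g x : 0 < e -> continuous f -> continuous g ->
  (forall z, f z <= g z) -> box e f x <= box e g x.
Proof.
move=> e0 /antiderivative_exists[F dF] /antiderivative_exists[H dH] fg.
rewrite (boxE _ _ dF) (boxE _ _ dH) ler_pM2r ?invr_gt0//.
have [c _] := mvt x (x + e) (fun z => is_deriveB (dH z) (dF z)).
rewrite [x + e - x]addrAC [x - x]subrr add0r => E.
have {E} : H (x + e) - F (x + e) - (H x - F x) = (g c - f c) * e := E.
have := mulr_ge0 (_ : 0 <= g c - f c) (ltW e0); rewrite subr_ge0 => /(_ (fg c)).
by lra.
Qed.

Lemma is_derive_shift F df a x : is_derive (x + a) (1:R) F df ->
  is_derive x (1:R) (fun z => F (z + a)) df.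
Proof.
move=> dF; have da : is_derive x (1:R) (fun z : R => z + a) 1.
  by rewrite -[X in is_derive _ _ _ X]addr0; apply: is_deriveD.
by have := @is_derive1_comp R F (fun z => z + a) x _ _ dF da; rewrite mulr1.
Qed.

Lemma box_derive e f x : continuous f ->
  is_derive x (1:R) (box e f) ((f (x + e) - f x) / e).
Proof.
move=> /antiderivative_exists[F dF].
have -> : box e f = fun x => e^-1 *: (F (x + e) - F x).
  by apply/funext => z; rewrite (boxE _ _ dF) mulrC.
rewrite mulrC; apply: is_deriveZ; apply: is_deriveB.
exact: is_derive_shift.
Qed.

Lemma box_lipf e f L : 0 < e -> 0 <= L -> lipf L f -> lipf L (box e f).
Proof.
move=> e0 L0 lf x y.
have [c _ ->] := mvt y x (fun z => box_derive e z (lipf_continuous lf)).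
rewrite normrM ler_wpM2r// normf_div (gtr0_norm e0) ler_pdivrMr//.
by rewrite (le_trans (lf _ _))// addrAC subrr add0r (gtr0_norm e0).
Qed.

Definition avg r f x : R := (f (x + r) + f (x - r)) / 2.

Lemma box_avg e r f x : continuous f -> box e (avg r f) x = avg r (box e f) x.
Proof.
move=> /antiderivative_exists[F dF].
have dA z : is_derive z (1:R) (avg r F) (avg r f z).
  have -> : avg r F = fun z => 2^-1 *: (F (z + r) + F (z - r)).
    by apply/funext => y; rewrite /avg mulrC.
  rewrite /avg mulrC.
  by apply: is_deriveZ; apply: is_deriveD; exact: is_derive_shift.
rewrite (boxE _ _ dA) /avg !(boxE _ _ dF) !(addrAC _ _ e).
by lra.
Qed.

(** [g1] and [g2] stand for the first two derivatives of [g]. The error, a small quadratic plus a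
    quartic, has the shape accepted by the comparison with quartics, and the bound survives
    averaging. *)
Definition qcl theta d g (g1 g2 : R -> R) := forall x y,
  `|g (x + y) - g x - g1 x * y - g2 x / 2 * y ^+ 2|
    <= theta / 2 * y ^+ 2 + d * y ^+ 4.

Lemma qcl_avg theta d g g1 g2 r : qcl theta d g g1 g2 ->
  qcl theta d (avg r g) (avg r g1) (avg r g2).
Proof.
move=> h x y; have := h (x + r) y; have := h (x - r) y.
rewrite /avg (addrAC x y r) (addrAC x y (- r)) !ler_norml.
by move=> /andP[? ?] /andP[? ?]; apply/andP; split; lra.
Qed.

(** Young's inequality: theta times the difference of the two sides is half of (theta |y| - M y^2)^2
    + y^4. The summand 1 keeps the quartic coefficient positive even if [M] is 0. *)
Lemma cubic_le (M theta y : R) : 0 < theta ->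
  M * `|y| ^+ 3 <= theta / 2 * y ^+ 2 + (M ^+ 2 + 1) / (2 * theta) * y ^+ 4.
Proof.
move=> t0.
have E : theta * (theta / 2 * y ^+ 2 + (M ^+ 2 + 1) / (2 * theta) * y ^+ 4)
   = (theta ^+ 2 * y ^+ 2 + (M ^+ 2 + 1) * y ^+ 4) / 2.
  by field; rewrite gt_eqF.
rewrite -(ler_pM2l t0) E.
have -> : y ^+ 2 = `|y| ^+ 2 by rewrite real_normK ?num_real.
have -> : y ^+ 4 = `|y| ^+ 4 by rewrite -[4%N]/(2 * 2)%N !exprM real_normK ?num_real.
set a := `|y|.
have := sqr_ge0 (theta * a - M * a ^+ 2); have := sqr_ge0 (a ^+ 2).
by lra.
Qed.

(** Two averages give a Lipschitz function a second derivative that is Lipschitz again, which is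
    what a cubic remainder needs. *)
Definition smooth2 e f := box e (box e f).

Lemma smooth2_dist L e f x : 0 < e -> 0 <= L -> lipf L f ->
  `|smooth2 e f x - f x| <= 2 * (L * e).
Proof.
move=> e0 L0 lf; have := box_dist x e0 (box_lipf e0 L0 lf) L0.
have := box_dist x e0 lf L0.
rewrite !ler_norml => /andP[? ?] /andP[? ?]; rewrite /smooth2; apply/andP.
by split; lra.
Qed.

(** The second derivative is the iterated difference quotient of [f]; each quotient costs a factor 2
    / e, hence the Lipschitz constant 4 L / e^2. The cubic Taylor remainder is then split by
    [cubic_le]. *)
Lemma smooth2_qcl L e f theta : 0 < e -> 0 <= L -> lipf L f -> 0 < theta ->
  exists g1 g2, qcl theta (((4 * L / e ^+ 2) ^+ 2 + 1) / (2 * theta))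
    (smooth2 e f) g1 g2.
Proof.
move=> e0 L0 lf t0; set M := 4 * L / e ^+ 2.
pose D (f : R -> R) x := (f (x + e) - f x) / e.
have cb := lipf_continuous (box_lipf e0 L0 lf).
have d1 z : is_derive z (1:R) (smooth2 e f) (D (box e f) z).
  exact: box_derive.
have d2 z : is_derive z (1:R) (D (box e f)) (D (D f) z).
  have -> : D (box e f) = fun z => e^-1 *: (box e f (z + e) - box e f z).
    by apply/funext => y; rewrite /D mulrC.
  rewrite {1}/D mulrC; apply: is_deriveZ; apply: is_deriveB.
    by apply: is_derive_shift; apply: box_derive; exact: lipf_continuous lf.
  by apply: box_derive; exact: lipf_continuous lf.
have l2 : lipf M (D (D f)).
  have lD (g : R -> R) K : lipf K g -> lipf (2 * K / e) (D g).
    move=> lg x y; rewrite /D.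
    have -> : (g (x + e) - g x) / e - (g (y + e) - g y) / e =
      (g (x + e) - g (y + e) + (g y - g x)) / e by lra.
    have ei : 0 <= e^-1 by rewrite invr_ge0 ltW.
    rewrite normrM (ger0_norm ei) [leRHS]mulrAC ler_pM2r ?invr_gt0//.
    rewrite (le_trans (ler_normD _ _))//.
    have := lg (x + e) (y + e); have := lg y x.
    by rewrite (distrC y x) (_ : x + e - (y + e) = x - y); [lra|ring].
  have := lD _ _ (lD _ _ lf); congr lipf.
  by rewrite /M; field; rewrite gt_eqF.
have M0 : 0 <= M.
  by apply: divr_ge0; [exact: mulr_ge0 | apply: exprn_ge0; exact: ltW].
exists (D (box e f)), (D (D f)) => x y.
apply: le_trans (cubic_le M y t0).
pose dphi z := D (box e f) z - D (box e f) x - D (D f) x * (z - x).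
pose phi z := smooth2 e f z - D (box e f) x * (z - x)
  - D (D f) x / 2 * (z - x) ^+ 2.
have dp z : is_derive z (1:R) phi (dphi z).
  have dl : is_derive z (1:R) (fun z : R => z - x) 1.
    by rewrite -[X in is_derive _ _ _ X]subr0; apply: is_deriveB.
  have -> : phi = (smooth2 e f \- (D (box e f) x \*: (fun z : R => z - x)))
      \- ((D (D f) x / 2) \*: ((fun z : R => z - x) * (fun z : R => z - x))).
    by apply/funext => u; rewrite /phi /GRing.sub_fun /= expr2.
  have -> : dphi z = (D (box e f) z - D (box e f) x *: 1) -
     (D (D f) x / 2) *: ((z - x) *: 1 + (z - x) *: 1).
    by rewrite /dphi /GRing.scale/=; lra.
  exact: (is_deriveB (is_deriveB (d1 z) (is_deriveZ _ dl))
    (is_deriveZ _ (is_deriveM dl dl))).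
have b1 z : `|dphi z| <= M * `|z - x| ^+ 2.
  rewrite /dphi; have [c cx ->] := mvt x z d2.
  rewrite -mulrBl normrM expr2 mulrA ler_wpM2r//.
  by rewrite (le_trans (l2 _ _))// ler_wpM2l.
have [c cx E] := mvt x (x + y) dp.
have xyx : x + y - x = y by ring.
rewrite xyx in cx E; rewrite /phi xyx in E.
have -> : smooth2 e f (x + y) - smooth2 e f x - D (box e f) x * y -
   D (D f) x / 2 * y ^+ 2 = dphi c * y by rewrite -E; ring.
rewrite normrM [in leRHS]exprSr mulrA ler_wpM2r// (le_trans (b1 _))//.
by rewrite ler_wpM2l// lerXn2r ?nnegrE.
Qed.

Lemma smooth2_avg L e r f x : 0 < e -> 0 <= L -> lipf L f ->
  smooth2 e (avg r f) x = avg r (smooth2 e f) x.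
Proof.
move=> e0 L0 lf; rewrite /smooth2.
have -> : box e (avg r f) = avg r (box e f).
  by apply/funext => z; rewrite box_avg//; exact: lipf_continuous lf.
by rewrite box_avg//; exact: lipf_continuous (box_lipf e0 L0 lf).
Qed.

Lemma smooth2_le L K e f g x : 0 < e -> 0 <= L -> lipf L f -> 0 <= K -> lipf K g ->
  (forall z, f z <= g z) -> smooth2 e f x <= smooth2 e g x.
Proof.
move=> e0 L0 lf K0 lg fg; apply: box_le => //.
- exact: lipf_continuous (box_lipf e0 L0 lf).
- exact: lipf_continuous (box_lipf e0 K0 lg).
move=> z; apply: box_le => //.
- exact: lipf_continuous lf.
- exact: lipf_continuous lg.
Qed.

End smoothing.

(** * Sublinear shift-invariant operators and averages *)

Section scheme.
Context (R : realType).
Implicit Types (f g : R -> R) (T : (R -> R) -> R -> R).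

Record sublinear_op T : Prop := SublinearOp {
  sop_le : forall f g, (forall x, f x <= g x) -> forall x, T f x <= T g x ;
  sop_cst : forall f c x, T (fun y => f y + c) x = T f x + c ;
  sop_sub : forall f g x, T (fun y => f y + g y) x <= T f x + T g x ;
  sop_hom : forall f a x, 0 <= a -> T (fun y => a * f y) x = a * T f x ;
  sop_shift : forall f z x, T (fun y => f (y + z)) x = T f (x + z) }.

Lemma avg_sublinear r : sublinear_op (@avg R r).
Proof.
split; rewrite /avg.
- by move=> f g fg x; have := fg (x + r); have := fg (x - r); lra.
- by move=> f c x; field.
- by move=> f g x; rewrite le_eqVlt; apply/orP; left; apply/eqP; field.
- by move=> f a x _; field.
- by move=> f z x; rewrite (addrAC x r z) (addrAC x (- r) z).
Qed.

Lemma iter_sublinear T m : sublinear_op T -> sublinear_op (iter m T).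
Proof.
case=> le cst sub hom shift; elim: m => [|m [le' cst' sub' hom' shift']].
  by split => //= *; rewrite ?lerD//; by [].
split => /=.
- by move=> f g fg x; apply: le => y; exact: le'.
- move=> f c x; rewrite -cst; congr (T _ x).
  by apply/funext => y; rewrite cst'.
- by move=> f g x; apply: le_trans (sub _ _ _); apply: le => y; exact: sub'.
- move=> f a x a0; rewrite -hom//; congr (T _ x).
  by apply/funext => y; rewrite hom'.
- move=> f z x; rewrite -shift; congr (T _ x).
  by apply/funext => y; rewrite shift'.
Qed.

Lemma max_sublinear T T' : sublinear_op T -> sublinear_op T' ->
  sublinear_op (fun f x => Num.max (T f x) (T' f x)).
Proof.
case=> le cst sub hom shift [le' cst' sub' hom' shift']; split.
- by move=> f g fg x; rewrite ge_max !le_max (le _ _ fg) (le' _ _ fg) orbT.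
- by move=> f c x; rewrite cst cst' addr_maxl.
- move=> f g x; rewrite ge_max; apply/andP; split.
    by apply: le_trans (sub _ _ _) _; apply: lerD; rewrite le_max lexx.
  by apply: le_trans (sub' _ _ _) _; apply: lerD; rewrite le_max lexx orbT.
- by move=> f a x a0; rewrite hom// hom'// maxr_pMr.
- by move=> f z x; rewrite shift shift'.
Qed.

Lemma sop_lipf T L f : sublinear_op T -> lipf L f -> lipf L (T f).
Proof.
move=> sT lf.
have H x z : T f (x + z) <= T f x + L * `|z|.
  rewrite -(sop_shift sT) -(sop_cst sT); apply: (sop_le sT) => y.
  by have := lf (y + z) y; rewrite addrAC subrr add0r ler_norml => /andP[? ?]; lra.
move=> x y; rewrite ler_norml; apply/andP; split.
  have := H x (y - x); rewrite (_ : x + (y - x) = y); last by ring.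
  by rewrite distrC; lra.
have := H y (x - y); rewrite (_ : y + (x - y) = x); last by ring.
by lra.
Qed.

Lemma sop0 T x : sublinear_op T -> T (fun=> 0) x = 0.
Proof.
move=> sT; have -> : (fun=> 0) = (fun y : R => 0 * (cst 0 y : R)).
  by apply/funext => y; rewrite mul0r.
by rewrite (sop_hom sT)// mul0r.
Qed.

Lemma sop_const T c x : sublinear_op T -> T (fun=> c) x = c.
Proof.
move=> sT; have {1}-> : (fun=> c) = (fun y : R => (cst 0 y : R) + c).
  by apply/funext => y; rewrite add0r.
by rewrite (sop_cst sT) sop0// add0r.
Qed.

Lemma sop_bound T f (K : R) x : sublinear_op T -> (forall y, `|f y| <= K) ->
  `|T f x| <= K.
Proof.
move=> sT fK; rewrite ler_norml; apply/andP; split.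
  rewrite -(sop_const (- K) x sT); apply: (sop_le sT) => y.
  by have := fK y; rewrite ler_norml => /andP[].
rewrite -[leRHS](sop_const K x sT); apply: (sop_le sT) => y.
by have := fK y; rewrite ler_norml => /andP[].
Qed.

Lemma sop_contract T f g e x : sublinear_op T -> (forall y, f y <= g y + e) ->
  T f x <= T g x + e.
Proof. by move=> sT fg; rewrite -(sop_cst sT); exact: (sop_le sT). Qed.

Lemma iter_avg_opp r m f x :
  iter m (avg r) (fun y => - f y) x = - iter m (avg r) f x.
Proof.
elim: m f x => //= m IH f x.
have -> : iter m (avg r) (fun y => - f y) = fun y => - iter m (avg r) f y.
  by apply/funext.
by rewrite /avg; lra.
Qed.

Lemma iter_avg_smooth2 L e r m f x : 0 < e -> 0 <= L -> lipf L f ->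
  smooth2 e (iter m (avg r) f) x = iter m (avg r) (smooth2 e f) x.
Proof.
move=> e0 L0 lf; elim: m x => //= m IH x.
rewrite (@smooth2_avg R L)//; last by apply: sop_lipf => //; exact/iter_sublinear/avg_sublinear.
by congr (avg r _ x); apply/funext.
Qed.

Lemma iter_avg_qcl theta d g (g1 g2 : R -> R) r m : qcl theta d g g1 g2 ->
  qcl theta d (iter m (avg r) g) (iter m (avg r) g1) (iter m (avg r) g2).
Proof. by move=> h; elim: m => //= m IH; exact: qcl_avg. Qed.

(** y^4 + 6 D s y^2 + 3 D^2 s^2 is the fourth moment of y plus a centred Gaussian of variance D s:
    the quartic part follows the heat equation of variance [D], while [q] is the speed of the
    quadratic part. *)
Definition hpoly (a b c d q D s y : R) : R :=
  a + b * y + c / 2 * y ^+ 2 + q * s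
  + d * (y ^+ 4 + 6 * D * s * y ^+ 2 + 3 * D ^+ 2 * s ^+ 2).

(** A symmetric two-point step has variance at most [D] k and a fourth moment below the Gaussian
    one; the difference of the two sides is displayed as a sum of nonnegative terms. *)
Lemma avg_hpoly (a b c d q D s y sigma k : R) :
  0 <= d -> 0 <= s -> 0 <= k -> sigma ^+ 2 <= D -> sigma ^+ 2 * c / 2 <= q ->
  avg (sigma * Num.sqrt k) (hpoly a b c d q D s) y <= hpoly a b c d q D (s + k) y.
Proof.
move=> d0 s0 k0 sD cq; rewrite -subr_ge0.
set r := sigma * Num.sqrt k.
have r2 : r ^+ 2 = sigma ^+ 2 * k by rewrite exprMn sqr_sqrtr.
have D0 : 0 <= D := le_trans (sqr_ge0 _) sD.
have v0 : 0 <= r ^+ 2 by exact: sqr_ge0.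
have vD : r ^+ 2 <= D * k by rewrite r2 ler_wpM2r.
have vq : r ^+ 2 * c / 2 <= q * k.
  by rewrite r2 (_ : _ / 2 = sigma ^+ 2 * c / 2 * k); [rewrite ler_wpM2r|field].
have -> : hpoly a b c d q D (s + k) y - avg r (hpoly a b c d q D s) y =
  (q * k - r ^+ 2 * c / 2) + d * (6 * y ^+ 2 * (D * k - r ^+ 2)
    + 6 * (D * s) * (D * k - r ^+ 2)
    + (D * k - r ^+ 2) * (D * k + r ^+ 2) + 2 * (D * k) ^+ 2).
  by rewrite /avg /hpoly; field.
rewrite addr_ge0 ?subr_ge0// mulr_ge0//.
have Dk : 0 <= D * k - r ^+ 2 by rewrite subr_ge0.
apply: addr_ge0; last by rewrite mulr_ge0// sqr_ge0.
apply: addr_ge0; last by rewrite mulr_ge0// addr_ge0// mulr_ge0.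
by apply: addr_ge0; apply: mulr_ge0 => //; apply: mulr_ge0; rewrite ?sqr_ge0 ?mulr_ge0.
Qed.

Lemma iter_avg_hpoly (a b c d q D s y sigma k : R) m :
  0 <= d -> 0 <= s -> 0 <= k -> sigma ^+ 2 <= D -> sigma ^+ 2 * c / 2 <= q ->
  iter m (avg (sigma * Num.sqrt k)) (hpoly a b c d q D s) y
    <= hpoly a b c d q D (s + m%:R * k) y.
Proof.
move=> d0 s0 k0 sD cq; elim: m y => [|m IH] y; first by rewrite /= mul0r addr0.
rewrite iterS; apply: le_trans (sop_le (avg_sublinear _) IH y) _.
rewrite -natr1 mulrDl mul1r addrA; apply: avg_hpoly => //.
by rewrite addr_ge0// mulr_ge0.
Qed.

End scheme.

(** * The nonlinear scheme and its comparison with quartic bounds *)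

Section nonlinear_scheme.
Context (R : realType) (sl sh : R) (h0 : 0 <= sl) (hs : sl <= sh).
Implicit Types (f g : R -> R).
Notation G := (G sl sh).
Notation D := (sh ^+ 2).

Lemma sh0 : 0 <= sh. Proof. exact: le_trans hs. Qed.

Lemma sl2 : sl ^+ 2 <= D.
Proof. by rewrite lerXn2r ?nnegrE// sh0. Qed.

Lemma G_ge_l c : sl ^+ 2 * c / 2 <= G c.
Proof.
rewrite /Defs.G; have := sl2; have := sqr_ge0 sl.
have [c0|c0] := leP 0 c.
  by rewrite (max_idPr _) ?oppr_le0//; nra.
have -> : Num.max (- c) 0 = - c by apply/max_idPl; rewrite oppr_ge0 ltW.
by nra.
Qed.

Lemma G_ge_h c : sh ^+ 2 * c / 2 <= G c.
Proof.
rewrite /Defs.G; have := sl2; have := sqr_ge0 sl.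
have [c0|c0] := leP 0 c.
  by rewrite (max_idPr _) ?oppr_le0//; nra.
have -> : Num.max (- c) 0 = - c by apply/max_idPl; rewrite oppr_ge0 ltW.
by nra.
Qed.

Lemma G_attained c : G c = sl ^+ 2 * c / 2 \/ G c = sh ^+ 2 * c / 2.
Proof.
rewrite /Defs.G; have [c0|c0] := leP 0 c.
  by right; rewrite (max_idPr _) ?oppr_le0//; lra.
have -> : Num.max (- c) 0 = - c by apply/max_idPl; rewrite oppr_ge0 ltW.
by left; lra.
Qed.

Lemma G_add c e : 0 <= e -> G c <= G (c + e) /\ G (c + e) <= G c + D / 2 * e.
Proof.
move=> e0; have sl0 := sqr_ge0 sl; have s2 := sl2.
have Gl := G_ge_l; have Gh := G_ge_h.
split.
  have [->|->] := G_attained c; [apply: le_trans (Gl _)|apply: le_trans (Gh _)].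
    by nra.
  by nra.
have [->|->] := G_attained (c + e).
  by apply: (@le_trans _ _ (sl ^+ 2 * c / 2 + D / 2 * e)); [nra|rewrite lerD2r].
by apply: (@le_trans _ _ (sh ^+ 2 * c / 2 + D / 2 * e)); [nra|rewrite lerD2r].
Qed.

(** If u solves the equation for [G], then -u solves it for [Gc]; lower bounds on u become upper
    bounds governed by [Gc]. *)
Definition Gc (a : R) := - G (- a).

Lemma Gc_add c e : 0 <= e -> Gc c <= Gc (c + e) /\ Gc (c + e) <= Gc c + D / 2 * e.
Proof.
move=> e0; rewrite /Gc; have [] := G_add (- (c + e)) e0.
rewrite opprD subrK -opprD => ? ?; split; first by lra.
by lra.
Qed.

(** A macro step h = [tstep n] consists of (n+1)^9 micro steps k = [mstep n] with one common
    volatility. In [scheme_lower] a macro step costs a smoothing error of order h^2 and a micro step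
    an error of order d k^2. With smoothing width h^2 and tolerance h, the constant d is of order
    h^(-9), and k = h^10 brings d k down to order h. *)
Definition tstep (n : nat) : R := n.+1%:R^-1.
Definition mstep (n : nat) : R := n.+1%:R ^- 10.

Lemma tstep_gt0 n : 0 < tstep n. Proof. by rewrite invr_gt0. Qed.
Lemma mstep_gt0 n : 0 < mstep n. Proof. by rewrite invr_gt0 exprn_gt0. Qed.
Lemma tstep_mstep n : (n.+1 ^ 9)%:R * mstep n = tstep n.
Proof.
rewrite /mstep /tstep natrX [n.+1%:R ^+ 10]exprSr invfM mulrA mulfV ?mul1r//.
Qed.

Definition heat (sigma : R) n f := iter (n.+1 ^ 9) (avg (sigma * Num.sqrt (mstep n))) f.
Definition step n f x := Num.max (heat sl n f x) (heat sh n f x).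

Lemma heat_sublinear sigma n : sublinear_op (heat sigma n).
Proof. exact/iter_sublinear/avg_sublinear. Qed.

Lemma step_sublinear n : sublinear_op (step n).
Proof. by apply: max_sublinear; exact: heat_sublinear. Qed.

Lemma heat_hpoly a b c d q s y sigma n :
  0 <= d -> 0 <= s -> sigma ^+ 2 <= D -> sigma ^+ 2 * c / 2 <= q ->
  heat sigma n (hpoly a b c d q D s) y <= hpoly a b c d q D (s + tstep n) y.
Proof.
move=> d0 s0 sD cq; rewrite -tstep_mstep; apply: iter_avg_hpoly => //.
exact/ltW/mstep_gt0.
Qed.

Lemma step_hpoly a b c d s y n : 0 <= d -> 0 <= s ->
  step n (hpoly a b c d (G c) D s) y <= hpoly a b c d (G c) D (s + tstep n) y.
Proof.
by move=> d0 s0; rewrite /step ge_max !heat_hpoly// ?sl2// ?G_ge_l ?G_ge_h.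
Qed.

Lemma stepN_hpoly a b c d s y n : 0 <= d -> 0 <= s ->
  - step n (fun y => - hpoly a b c d (Gc c) D s y) y
    <= hpoly a b c d (Gc c) D (s + tstep n) y.
Proof.
move=> d0 s0; rewrite lerNl /step le_max /heat !iter_avg_opp !lerN2.
by have [E|E] := G_attained (- c); apply/orP; [left|right];
  apply: heat_hpoly => //; rewrite ?sl2// /Gc E; lra.
Qed.

Definition scheme n j f := iter j (step n) f.

Lemma scheme_sublinear n j : sublinear_op (scheme n j).
Proof. exact/iter_sublinear/step_sublinear. Qed.

(* The inequality satisfied by viscosity subsolutions of [u_t = F (u_yy)] that
   lie below a quartic at some time. *)
Definition quartic_bound (F : R -> R) (w : R -> R -> R) :=
  forall t s x a b c d, 0 <= t -> 0 <= s -> 0 < d ->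
    (forall y, w t (x + y) <= a + b * y + c / 2 * y ^+ 2 + d * y ^+ 4) ->
    w (t + s) x <= a + F c * s + 3 * d * D ^+ 2 * s ^+ 2.

(** Smoothing commutes with the linear averages, and by monotonicity the smoothed scheme dominates
    the average taken with the volatility that attains [G]. The maximum is on the favourable side,
    so one smoothing width serves all steps. *)
Lemma scheme_upper w f L T eta : 0 <= L -> lipf L f -> quartic_bound G w ->
  (forall x, w 0 x <= f x) -> 0 <= T -> 0 < eta ->
  \forall n \near \oo, forall j, j%:R * tstep n <= T ->
    forall x, w (j%:R * tstep n) x <= scheme n j f x + eta.
Proof.
move=> L0 lf wq wf T0 e0.
(* [eta] is spent in thirds: on smoothing, on the tolerance [theta] accumulated up to [T], and on
   the quartic terms, which vanish with the time step. *)
pose eps := eta / (12 * (L + 1)).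
pose theta := eta / (3 * (T + 1) * (D + 1)).
pose d := ((4 * L / eps ^+ 2) ^+ 2 + 1) / (2 * theta).
have D0 : 0 <= D := sqr_ge0 _.
have eps0 : 0 < eps by rewrite divr_gt0// mulr_gt0// ltr_wpDl.
have th0 : 0 < theta by rewrite divr_gt0// !mulr_gt0// ltr_wpDl.
have d0 : 0 < d.
  by apply: divr_gt0; [rewrite ltr_wpDl// sqr_ge0|rewrite mulr_gt0].
near=> n.
have hn : 6 * d * D ^+ 2 * T * tstep n <= eta / 3.
  near: n.
  have : (fun n => 6 * d * D ^+ 2 * T * tstep n) @ \oo --> 6 * d * D ^+ 2 * T * 0.
    by apply: cvgMr; exact: cvg_harmonic.
  rewrite mulr0 => /cvgr_le; apply; by rewrite divr_gt0.
have hp := tstep_gt0 n; set h := tstep n in hn hp *.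
have lv j : lipf L (scheme n j f) by apply: sop_lipf => //; exact: scheme_sublinear.
pose g j := smooth2 eps (scheme n j f).
have claim j x : w (j%:R * h) x <= g j x + 2 * (L * eps)
   + j%:R * (D * theta * h + 6 * d * D ^+ 2 * h ^+ 2).
  elim: j x => [|j IH] x.
    rewrite !mul0r addr0; apply: le_trans (wf x) _.
    by have := smooth2_dist x eps0 L0 lf; rewrite /g /= ler_norml => /andP[? ?]; lra.
  have [g1 [g2 Q]] := smooth2_qcl eps0 L0 (lv j) th0; rewrite -/d -/(g j) in Q.
  rewrite -natr1 mulrDl mul1r.
  apply: (@le_trans _ _ (g j x + 2 * (L * eps)
     + j%:R * (D * theta * h + 6 * d * D ^+ 2 * h ^+ 2)
     + G (g2 x + theta) * h + 3 * d * D ^+ 2 * h ^+ 2)).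
    apply: (wq _ _ _ _ (g1 x)) => //.
    - by rewrite mulr_ge0// ltW.
    - exact: ltW.
    move=> y; apply: le_trans (IH _) _.
    by have := Q x y; rewrite ler_norml => /andP[? ?]; lra.
  have Gt : G (g2 x + theta) <= G (g2 x) + D / 2 * theta.
    by have [] := G_add (g2 x) (ltW th0).
  have gS : g j x + h * G (g2 x) - h * (D / 2 * theta) - 3 * d * D ^+ 2 * h ^+ 2
      <= g j.+1 x.
    (* The expansion of [- g j] at x lies below a quartic; as [heat] is linear, [heat_hpoly] turns
       this into a lower bound on the average of [g j]. *)
    have key sigma : sigma ^+ 2 <= D -> G (g2 x) = sigma ^+ 2 * g2 x / 2 ->
        (forall z, heat sigma n (scheme n j f) z <= scheme n j.+1 f z) ->
        g j x + h * G (g2 x) - h * (D / 2 * theta) - 3 * d * D ^+ 2 * h ^+ 2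
      <= g j.+1 x.
      move=> sD E hle.
      apply: (@le_trans _ _ (smooth2 eps (heat sigma n (scheme n j f)) x)); last first.
        apply: smooth2_le (L0) _ (L0) _ hle => //.
        by apply: sop_lipf => //; exact: heat_sublinear.
      rewrite /heat (iter_avg_smooth2 _ _ _ eps0 L0)// -/(heat _ _ _) -/(g j).
      rewrite -[x in leRHS]add0r -(sop_shift (heat_sublinear _ _)).
      have := @heat_hpoly (- g j x) (- g1 x) (theta - g2 x) d
        (sigma ^+ 2 * (theta - g2 x) / 2) 0 0 sigma n (ltW d0) (lexx 0) sD (lexx _).
      rewrite add0r -/h {2}/hpoly => H.
      have : heat sigma n (fun y => - g j (y + x)) 0 <=
        heat sigma n (hpoly (- g j x) (- g1 x) (theta - g2 x) d
          (sigma ^+ 2 * (theta - g2 x) / 2) D 0) 0.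
        apply: (sop_le (heat_sublinear _ _)) => y; rewrite addrC /hpoly.
        by have := Q x y; rewrite ler_norml => /andP[? ?]; lra.
      rewrite {1}/heat iter_avg_opp -/(heat _ _ _) => H'.
      rewrite E; have t1 : sigma ^+ 2 * theta <= D * theta by rewrite ler_pM2r.
      have t2 : sigma ^+ 2 * theta * h <= D * theta * h by rewrite ler_pM2r.
      by lra.
    have [E|E] := G_attained (g2 x).
      by apply: (key _ sl2 E) => z; rewrite /scheme iterS /step le_max lexx.
    by apply: (key _ (lexx _) E) => z; rewrite /scheme iterS /step le_max lexx orbT.
  have Gt' : G (g2 x + theta) * h <= (G (g2 x) + D / 2 * theta) * h by rewrite ler_pM2r.
  by lra.
move=> j jT x; apply: le_trans (claim j x) _.
have := smooth2_dist x eps0 L0 (lv j); rewrite -/(g j) ler_norml => /andP[_ gd].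
have Leps : L * eps <= eta / 12.
  rewrite /eps mulrA ler_pdivrMr; last by rewrite mulr_gt0// ltr_wpDl.
  by nra.
have E1 : j%:R * (D * theta * h + 6 * d * D ^+ 2 * h ^+ 2) =
   (j%:R * h) * (D * theta) + 6 * d * D ^+ 2 * (j%:R * h) * h by ring.
have E2 : (j%:R * h) * (D * theta) <= eta / 3.
  apply: (@le_trans _ _ (T * (D * theta))); first by rewrite ler_wpM2r// mulr_ge0// ltW.
  rewrite /theta mulrA mulrA mulrA ler_pdivrMr; last by rewrite !mulr_gt0// ltr_wpDl.
  by nra.
have E3 : 6 * d * D ^+ 2 * (j%:R * h) * h <= 6 * d * D ^+ 2 * T * h.
  by rewrite ler_pM2r// ler_wpM2l// mulr_ge0 ?sqr_ge0// mulr_ge0// ltW.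
by rewrite E1; lra.
Unshelve. all: by end_near. Qed.

(** Here the maximum in [step] is on the unfavourable side, since expansions do not pass through it.
    The scheme is smoothed afresh at each macro step, and within it [w] is compared with linear
    iterates, all of which satisfy the same expansion bound by [iter_avg_qcl]. *)
Lemma scheme_lower w f L T eta : 0 <= L -> lipf L f ->
  quartic_bound Gc (fun t x => - w t x) ->
  (forall x, f x <= w 0 x) -> 0 <= T -> 0 < eta ->
  \forall n \near \oo, forall j, j%:R * tstep n <= T ->
    forall x, scheme n j f x - eta <= w (j%:R * tstep n) x.
Proof.
move=> L0 lf wq wf T0 e0.
have D0 : 0 <= D := sqr_ge0 _.
(* The three summands bound the smoothing error, the tolerance [theta] and the quartic error 4 (d k)
   D^2, per unit of time and divided by h. *)
pose C := 4 * L + D + 4 * (8 * L ^+ 2 + 1) * D ^+ 2.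
near=> n.
have hn : T * C * tstep n <= eta.
  near: n.
  have : (fun n => T * C * tstep n) @ \oo --> T * C * 0.
    by apply: cvgMr; exact: cvg_harmonic.
  by rewrite mulr0 => /cvgr_le; apply.
have hp := tstep_gt0 n; set h := tstep n in hn hp *.
have h1 : h <= 1 by rewrite invf_le1// ler1n.
have kp := mstep_gt0 n; set k := mstep n in kp.
have kh : k = h ^+ 10 by rewrite /k /h /mstep /tstep exprVn.
pose eps := h ^+ 2; pose theta := h.
have eps0 : 0 < eps by rewrite exprn_gt0.
pose d := ((4 * L / eps ^+ 2) ^+ 2 + 1) / (2 * theta).
have d0 : 0 < d.
  by apply: divr_gt0; [rewrite ltr_wpDl// sqr_ge0|rewrite mulr_gt0].
have dk : d * k <= (8 * L ^+ 2 + 1) * h.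
  have -> : d * k = 8 * L ^+ 2 * h + h ^+ 9 / 2.
    rewrite /d kh /eps /theta; field; rewrite gt_eqF//.
  rewrite mulrDl mul1r.
  have : h ^+ 9 <= h by rewrite -[leRHS]mulr1 exprS ler_wpM2l ?exprn_ile1// ltW.
  by lra.
have lv j : lipf L (scheme n j f) by apply: sop_lipf => //; exact: scheme_sublinear.
pose micro := D * theta * k + 4 * d * D ^+ 2 * k ^+ 2.
(* In one micro step the average gains at most sigma^2 k (g2 + theta) / 2, while [w] gains at least
   - [Gc (theta - g2)] k, which is no less than sigma^2 k (g2 - theta) / 2; quartic terms come on
   top. *)
have mic t g g1 g2 e sigma i : qcl theta d g g1 g2 -> sigma ^+ 2 <= D ->
   (forall c, sigma ^+ 2 * c / 2 <= G c) -> 0 <= t ->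
   (forall x, g x - e <= w t x) -> forall x,
   iter i (avg (sigma * Num.sqrt k)) g x - e - i%:R * micro <= w (t + i%:R * k) x.
  move=> Q sD sG t0 gw; elim: i => [|i IH] x; first by rewrite /= !mul0r addr0 subr0.
  have {}Q := iter_avg_qcl (sigma * Num.sqrt k) i Q.
  rewrite iterS; set g' := iter i _ g in Q IH *.
  set g1' := iter i _ g1 in Q; set g2' := iter i _ g2 in Q.
  rewrite -!natr1 !mulrDl !mul1r (addrA t).
  have := wq (t + i%:R * k) k x (- g' x + e + i%:R * micro) (- g1' x) (theta - g2' x) d.
  have t1 : 0 <= t + i%:R * k by rewrite addr_ge0// mulr_ge0// ltW.
  move=> /(_ t1 (ltW kp) d0) H.
  have {}H : - w (t + i%:R * k + k) x <= - g' x + e + i%:R * micro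
      + Gc (theta - g2' x) * k + 3 * d * D ^+ 2 * k ^+ 2.
    apply: H => y; have := IH (x + y).
    by have := Q x y; rewrite ler_norml => /andP[? ?]; lra.
  have r2 : (sigma * Num.sqrt k) ^+ 2 = sigma ^+ 2 * k.
    by rewrite exprMn sqr_sqrtr// ltW.
  have A : avg (sigma * Num.sqrt k) g' x <=
      g' x + sigma ^+ 2 * k / 2 * (g2' x + theta) + d * (sigma ^+ 2 * k) ^+ 2.
    rewrite /avg -r2; set r := _ * Num.sqrt k.
    have := Q x r; have := Q x (- r); rewrite !ler_norml => /andP[_ ?] /andP[_ ?].
    by lra.
  have Gct : Gc (theta - g2' x) <= sigma ^+ 2 * (theta - g2' x) / 2.
    by rewrite /Gc; have := sG (- (theta - g2' x)); lra.
  have Gk : Gc (theta - g2' x) * k <= sigma ^+ 2 * (theta - g2' x) / 2 * k.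
    by rewrite ler_pM2r.
  have s1 : sigma ^+ 2 * theta * k <= D * theta * k by rewrite !ler_pM2r.
  have s2 : d * (sigma ^+ 2 * k) ^+ 2 <= d * (D * k) ^+ 2.
    rewrite ler_pM2l//; apply: lerXn2r; rewrite ?nnegrE ?ler_pM2r//.
      by rewrite mulr_ge0 ?sqr_ge0// ltW.
    by rewrite mulr_ge0// ltW.
  have Em : micro = D * theta * k + 4 * d * D ^+ 2 * k ^+ 2 by [].
  by clearbody micro; lra.
have claim j x : scheme n j f x - j%:R * (4 * (L * eps) + (n.+1 ^ 9)%:R * micro)
    <= w (j%:R * h) x.
  elim: j x => [|j IH] x; first by rewrite !mul0r subr0; exact: wf.
  set E := j%:R * _ in IH.
  pose g x := smooth2 eps (scheme n j f) x.
  have gd z : `|g z - scheme n j f z| <= 2 * (L * eps) by exact: smooth2_dist.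
  have [g1 [g2 Q]] := smooth2_qcl eps0 L0 (lv j) hp; rewrite -/d in Q.
  have half sigma : sigma ^+ 2 <= D -> (forall c, sigma ^+ 2 * c / 2 <= G c) ->
     heat sigma n (scheme n j f) x - (j.+1)%:R * (4 * (L * eps) + (n.+1 ^ 9)%:R * micro)
       <= w (j.+1%:R * h) x.
    move=> sD sG.
    have := mic (j%:R * h) g g1 g2 (2 * (L * eps) + E) sigma (n.+1 ^ 9)%N Q sD sG.
    have jh : 0 <= j%:R * h by rewrite mulr_ge0// ltW.
    move=> /(_ jh) H.
    have {}H := H _ x.
    rewrite tstep_mstep -/h in H.
    have -> : j.+1%:R * (4 * (L * eps) + (n.+1 ^ 9)%:R * micro) =
        E + (4 * (L * eps) + (n.+1 ^ 9)%:R * micro).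
      by rewrite -natr1 mulrDl mul1r.
    have -> : j.+1%:R * h = j%:R * h + h by rewrite -natr1 mulrDl mul1r.
    apply: le_trans (H _); last first.
      by move=> z; have := IH z; have := gd z; rewrite ler_norml => /andP[? ?]; lra.
    have := @sop_contract R _ (scheme n j f) g (2 * (L * eps)) x (heat_sublinear sigma n).
    rewrite /heat -/k => H1.
    have H2 : iter (n.+1 ^ 9) (avg (sigma * Num.sqrt k)) (scheme n j f) x <=
       iter (n.+1 ^ 9) (avg (sigma * Num.sqrt k)) g x + 2 * (L * eps).
      by apply: H1 => y; move: (gd y); rewrite ler_norml => /andP[? ?]; lra.
    by lra.
  rewrite /scheme iterS -/(scheme n j f) /step.
  by rewrite /Num.max; case: ifP => _; apply: half => //; [exact: G_ge_h|exact: sl2|exact: G_ge_l].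
move=> j jT x; apply: le_trans (claim j x).
rewrite lerD2l lerN2; apply: le_trans hn.
have -> : j%:R * (4 * (L * eps) + (n.+1 ^ 9)%:R * micro) =
  (j%:R * h) * (4 * L * h + D * h + 4 * (d * k) * D ^+ 2).
  rewrite /micro.
  have -> : (n.+1 ^ 9)%:R * (D * theta * k + 4 * d * D ^+ 2 * k ^+ 2) =
   ((n.+1 ^ 9)%:R * k) * (D * theta + 4 * d * D ^+ 2 * k) by ring.
  by rewrite tstep_mstep -/h /eps /theta; ring.
apply: (@le_trans _ _ (T * (4 * L * h + D * h + 4 * (d * k) * D ^+ 2))).
  have h_ge0 := ltW hp; have dk0 : 0 <= d * k by rewrite mulr_ge0// ltW.
  apply: ler_wpM2r => //; apply: addr_ge0; last first.
    by apply: mulr_ge0; [exact: mulr_ge0 | exact: sqr_ge0].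
  by apply: addr_ge0; apply: mulr_ge0 => //; exact: mulr_ge0.
rewrite -(mulrA T C h); apply: ler_wpM2l => //; rewrite /C.
have : 4 * (d * k) * D ^+ 2 <= 4 * ((8 * L ^+ 2 + 1) * h) * D ^+ 2.
  by rewrite ler_wpM2r ?sqr_ge0// ler_pM2l.
by lra.
Unshelve. all: by end_near. Qed.

End nonlinear_scheme.

(** * Limits along a free ultrafilter *)

Section ultralimit.
Context (R : realType).
Implicit Types (x y : nat -> R).

Lemma free_ultrafilter : {U : set_system nat | UltraFilter U /\ \oo `<=` U}.
Proof. exact/cid/ultraFilterLemma. Qed.

Definition ultra : set_system nat := sval free_ultrafilter.

#[global] Instance ultra_ultra : UltraFilter ultra.
Proof. by have [] := svalP free_ultrafilter. Qed.

Lemma near_ultra (P : set nat) : (\forall n \near \oo, P n) -> ultra P.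
Proof. by have [_] := svalP free_ultrafilter; apply. Qed.

Definition ulim x : R := sup [set a | ultra [set n | a <= x n]].

Definition bseq x := exists K, forall n, `|x n| <= K.

Lemma ulimP x : bseq x -> x @ ultra --> ulim x.
Proof.
move=> [K xK].
pose A := [set a | ultra [set n | a <= x n]].
have A0 : A (- K).
  by apply: filterE => n /=; have := xK n; rewrite ler_norml => /andP[].
have Aub : ubound A K.
  move=> a Aa; have /filter_ex[n /= an] : ultra [set n | a <= x n] by [].
  by rewrite (le_trans an)// (le_trans (ler_norm _)).
have hA : has_sup A by split; [exists (- K) | exists K].
apply/cvgrPdist_lt => e e0.
have [a Aa sa] := sup_adherent e0 hA.
have Un : ultra [set n | x n < sup A + e / 2].
  have [//|H] := in_ultra_setVsetC [set n | x n < sup A + e / 2] ultra_ultra.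
  have : sup A + e / 2 <= sup A.
    apply: sup_upper_bound => //; rewrite /A/=; apply: filterS H => n /=.
    by move=> /negP; rewrite -leNgt.
  by rewrite gerDl leNgt divr_gt0.
have : ultra ([set n | a <= x n] `&` [set n | x n < sup A + e / 2]).
  exact: filterI.
apply: filterS => n [/= an nx]; rewrite /ulim -/A ltr_norml; apply/andP; split.
  by lra.
by lra.
Qed.

(** Convergence bounds the sequence on a set of the ultrafilter; outside of it the sequence is
    replaced by 0, which does not change [ulim]. *)
Lemma ulim_cvg x l : x @ ultra --> l -> ulim x = l.
Proof.
move=> xl.
have bU : exists K, ultra [set n | `|x n| <= K].
  exists (`|l : R| + 1); move/cvgrPdist_le : xl => /(_ 1 ltr01).
  apply: filterS => n /= h; rewrite -(subrK (l : R) (x n)).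
  by rewrite (le_trans (ler_normD _ _))// addrC lerD2l distrC.
case: bU => K UK.
pose x' n := if `|x n| <= K then x n else 0.
have K0 : 0 <= K by have /filter_ex[n /=] := UK; exact: le_trans.
have bx' : bseq x' by exists K => n; rewrite /x'; case: ifP => //; rewrite normr0.
have e : ulim x = ulim x'.
  congr sup; apply/seteqP; split => a /= h.
    have : ultra ([set n | a <= x n] `&` [set n | `|x n| <= K]) by exact: filterI.
    by apply: filterS => n [/= ? h']; rewrite /x' h'.
  have : ultra ([set n | a <= x' n] `&` [set n | `|x n| <= K]) by exact: filterI.
  by apply: filterS => n [/=]; rewrite /x'; case: ifP.
have xx' : x' @ ultra --> l.
  apply: cvg_trans xl; apply: near_eq_cvg.
  by apply: filterS UK => n /= h; rewrite /x' h.
rewrite e; apply: (cvg_unique _ (ulimP bx') xx').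
exact: Rhausdorff.
Qed.

Lemma ulim_cvg_oo x l : x @ \oo --> l -> ulim x = l.
Proof.
move=> xl; apply: ulim_cvg; apply: cvg_trans xl => A; exact: near_ultra.
Qed.

Lemma ulim_cst (a : R) : ulim (fun=> a) = a.
Proof. by apply: ulim_cvg; exact: cvg_cst. Qed.

Lemma ulim_le x y : bseq x -> bseq y -> ultra [set n | x n <= y n] ->
  ulim x <= ulim y.
Proof.
move=> bx yb xy; apply: ler_cvg_to (ulimP bx) (ulimP yb) _.
exact: xy.
Qed.

Lemma ulim_ge_cst x a : bseq x -> ultra [set n | a <= x n] -> a <= ulim x.
Proof.
by move=> bx h; rewrite -(ulim_cst a); apply: ulim_le => //; exists `|a|.
Qed.

Lemma ulim_le_cst x a : bseq x -> ultra [set n | x n <= a] -> ulim x <= a.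
Proof.
by move=> bx h; rewrite -(ulim_cst a); apply: ulim_le => //; exists `|a|.
Qed.

Lemma ulimD x y : bseq x -> bseq y -> ulim (fun n => x n + y n) = ulim x + ulim y.
Proof. by move=> bx yb; apply: ulim_cvg; apply: cvgD; exact: ulimP. Qed.

Lemma ulimZ x a : bseq x -> ulim (fun n => a * x n) = a * ulim x.
Proof. by move=> bx; apply: ulim_cvg; apply: cvgMr; exact: ulimP. Qed.

Lemma ulimN x : bseq x -> ulim (fun n => - x n) = - ulim x.
Proof. by move=> bx; apply: ulim_cvg; apply: cvgN; exact: ulimP. Qed.

Lemma bseqD x y : bseq x -> bseq y -> bseq (fun n => x n + y n).
Proof.
move=> [K xK] [L yL]; exists (K + L) => n.
by rewrite (le_trans (ler_normD _ _))// lerD.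
Qed.

Lemma bseqZ x a : bseq x -> bseq (fun n => a * x n).
Proof.
by move=> [K xK]; exists (`|a| * K) => n; rewrite normrM ler_wpM2l.
Qed.

Lemma bseq_cst (a : R) : bseq (fun=> a).
Proof. by exists `|a|. Qed.

Lemma ulim_bound x (K : R) : (forall n, `|x n| <= K) -> `|ulim x| <= K.
Proof.
move=> xK; have bx : bseq x by exists K.
rewrite ler_norml; apply/andP; split.
  by apply: ulim_ge_cst => //; apply: filterE => n /=; have := xK n; rewrite ler_norml => /andP[].
by apply: ulim_le_cst => //; apply: filterE => n /=; have := xK n; rewrite ler_norml => /andP[].
Qed.

End ultralimit.

(** * Continuity in time and space *)

Section joint_continuity.
Context (R : realType).
Implicit Types f g : R * R -> R.

Definition jc (z : R * R) f := {for z, continuous f}.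

Lemma jc_cst z (c : R) : jc z (fun=> c). Proof. exact: cvg_cst. Qed.
Lemma jc_fst z : jc z (fun z => z.1). Proof. exact: cvg_fst. Qed.
Lemma jc_snd z : jc z (fun z => z.2). Proof. exact: cvg_snd. Qed.
Lemma jcD z f g : jc z f -> jc z g -> jc z (fun z => f z + g z).
Proof. by move=> jf jg; exact: (cvgD jf jg). Qed.
Lemma jcN z f : jc z f -> jc z (fun z => - f z).
Proof. by move=> jf; exact: (cvgN jf). Qed.
Lemma jcM z f g : jc z f -> jc z g -> jc z (fun z => f z * g z).
Proof. by move=> jf jg; exact: (cvgM jf jg). Qed.
Lemma jcX z f n : jc z f -> jc z (fun z => f z ^+ n).
Proof.
move=> jf; elim: n => [|n IH]; first exact: cvg_cst.
rewrite /jc (_ : (fun z => _) = fun z => f z * f z ^+ n); first exact: jcM.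
by apply/funext => u; rewrite exprS.
Qed.

End joint_continuity.

Ltac jcont := repeat lazymatch goal with
  | |- jc _ (fun _ => ?c) => apply: jc_cst
  | |- jc _ fst => apply: jc_fst
  | |- jc _ snd => apply: jc_snd
  | |- jc _ (fun z => z.1) => apply: jc_fst
  | |- jc _ (fun z => z.2) => apply: jc_snd
  | |- jc _ (fun z => _ + _) => apply: jcD
  | |- jc _ (fun z => - _) => apply: jcN
  | |- jc _ (fun z => _ * _) => apply: jcM
  | |- jc _ (fun z => _ ^+ _) => apply: jcX
  end.

(** * Viscosity solutions of the G-heat equation *)

Section viscosity.
Context (R : realType) (D : R) (F : R -> R).
Hypothesis D0 : 0 <= D.
Hypothesis F_add : forall c e, 0 <= e -> F c <= F (c + e) /\ F (c + e) <= F c + D / 2 * e.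

Section test_function.
Variables (t x a b c d q e : R).
(** The term with [e] makes the heat polynomial a strict supersolution, and its square keeps maxima
    of w - [tpoly] away from the final time. *)
Definition tpoly (t' y' : R) : R :=
  hpoly a b c d q D (t' - t) (y' - x) + e * ((t' - t) + (t' - t) ^+ 2).

Lemma is_derive_sub (x0 z : R) : is_derive z (1:R) (fun y : R => y - x0) 1.
Proof. by rewrite -[X in is_derive _ _ _ X]subr0; apply: is_deriveB. Qed.

Lemma d_tE : d_t tpoly = fun t' y' => q + d * (6 * D * (y' - x) ^+ 2
  + 6 * D ^+ 2 * (t' - t)) + e * (1 + 2 * (t' - t)).
Proof.
apply/funext => t'; apply/funext => y'; rewrite /d_t derive1E.
suff : is_derive t' (1:R) (tpoly^~ y') (q + d * (6 * D * (y' - x) ^+ 2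
  + 6 * D ^+ 2 * (t' - t)) + e * (1 + 2 * (t' - t))) by move=> h; exact: derive_val.
have dt := is_derive_sub t t'.
have dt2 := is_deriveM dt dt.
pose c0 : R := a + b * (y' - x) + c / 2 * (y' - x) ^+ 2 + d * (y' - x) ^+ 4.
pose c1 : R := q + d * (6 * D) * (y' - x) ^+ 2 + e.
pose c2 : R := d * 3 * D ^+ 2 + e.
have H := is_deriveD (is_deriveD (is_derive_cst c0 t' (1:R)) (is_deriveZ c1 dt)) (is_deriveZ c2 dt2).
have -> : tpoly^~ y' = (cst c0 + c1 \*: (fun y : R => y - t)) +
    c2 \*: ((fun y : R => y - t) * (fun y : R => y - t)).
  apply/funext => u; rewrite /tpoly /hpoly !fctE/= /GRing.scale/= /c0 /c1 /c2.
  by ring.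
apply: is_derive_eq H _; rewrite /GRing.scale/= /c1 /c2; ring.
Qed.

Lemma derivable_t t' y' : derivable (tpoly^~ y') t' 1.
Proof.
have dt := is_derive_sub t t'.
have dt2 := is_deriveM dt dt.
pose c0 : R := a + b * (y' - x) + c / 2 * (y' - x) ^+ 2 + d * (y' - x) ^+ 4.
pose c1 : R := q + d * (6 * D) * (y' - x) ^+ 2 + e.
pose c2 : R := d * 3 * D ^+ 2 + e.
have H := is_deriveD (is_deriveD (is_derive_cst c0 t' (1:R)) (is_deriveZ c1 dt)) (is_deriveZ c2 dt2).
have -> : tpoly^~ y' = (cst c0 + c1 \*: (fun y : R => y - t)) +
    c2 \*: ((fun y : R => y - t) * (fun y : R => y - t)).
  apply/funext => u; rewrite /tpoly /hpoly !fctE/= /GRing.scale/= /c0 /c1 /c2.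
  by ring.
by case: H.
Qed.

Lemma is_derive_y t' y' : is_derive y' (1:R) (tpoly t')
  (b + c * (y' - x) + d * (4 * (y' - x) ^+ 3 + 12 * D * (t' - t) * (y' - x))).
Proof.
have dt := is_derive_sub x y'.
have dt2 := is_deriveM dt dt.
have dt4 := is_deriveM dt2 dt2.
pose c0 : R := a + q * (t' - t) + d * (3 * D ^+ 2 * (t' - t) ^+ 2) + e * ((t' - t) + (t' - t) ^+ 2).
pose c2 : R := c / 2 + d * (6 * D * (t' - t)).
have H := is_deriveD (is_deriveD (is_deriveD (is_derive_cst c0 y' (1:R)) (is_deriveZ b dt)) (is_deriveZ c2 dt2)) (is_deriveZ d dt4).
have -> : tpoly t' = (cst c0 + b \*: (fun y : R => y - x)) +
    c2 \*: ((fun y : R => y - x) * (fun y : R => y - x)) +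
    d \*: (((fun y : R => y - x) * (fun y : R => y - x)) *
     ((fun y : R => y - x) * (fun y : R => y - x))).
  apply/funext => u; rewrite /tpoly /hpoly !fctE/= /GRing.scale/= /c0 /c2.
  by ring.
apply: is_derive_eq H _; rewrite /GRing.scale/= !fctE /c2; by field.
Qed.

Lemma d_yE : d_y tpoly = fun t' y' => b + c * (y' - x)
  + d * (4 * (y' - x) ^+ 3 + 12 * D * (t' - t) * (y' - x)).
Proof.
apply/funext => t'; apply/funext => y'; rewrite /d_y derive1E.
by have h := is_derive_y t' y'; exact: derive_val.
Qed.

Lemma is_derive_yy t' y' : is_derive y' (1:R) (d_y tpoly t')
  (c + d * (12 * (y' - x) ^+ 2 + 12 * D * (t' - t))).
Proof.
rewrite d_yE.
have dt := is_derive_sub x y'.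
have dt3 := is_deriveM (is_deriveM dt dt) dt.
pose c1 : R := c + d * (12 * D * (t' - t)).
have H := is_deriveD (is_deriveD (is_derive_cst b y' (1:R)) (is_deriveZ c1 dt)) (is_deriveZ (4 * d) dt3).
have -> : (fun y' : R => b + c * (y' - x)
  + d * (4 * (y' - x) ^+ 3 + 12 * D * (t' - t) * (y' - x))) =
   (cst b + c1 \*: (fun y : R => y - x)) +
    (4 * d) \*: ((fun y : R => y - x) * (fun y : R => y - x) * (fun y : R => y - x)).
  apply/funext => u; rewrite !fctE/= /GRing.scale/= /c1.
  by ring.
apply: is_derive_eq H _; rewrite /GRing.scale/= !fctE /c1; ring.
Qed.

Lemma d_yyE : d_yy tpoly = fun t' y' =>
  c + d * (12 * (y' - x) ^+ 2 + 12 * D * (t' - t)).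
Proof.
apply/funext => t'; apply/funext => y'; rewrite /d_yy derive1E.
by have h := is_derive_yy t' y'; exact: derive_val.
Qed.

Lemma tpoly_C12 : C12 tpoly.
Proof.
move=> t' y' _; split; split.
- exact: derivable_t.
- by have [] := is_derive_y t' y'.
- by have [] := is_derive_yy t' y'.
- suff : jc (t', y') (fun z => tpoly z.1 z.2) by [].
  by rewrite /tpoly /hpoly; jcont.
- suff : jc (t', y') (fun z => d_t tpoly z.1 z.2) by [].
  by rewrite d_tE; jcont.
- suff : jc (t', y') (fun z => d_y tpoly z.1 z.2) by [].
  by rewrite d_yE; jcont.
- suff : jc (t', y') (fun z => d_yy tpoly z.1 z.2) by [].
  by rewrite d_yyE; jcont.
Qed.

End test_function.

Definition visc_sub (w : R -> R -> R) := forall psi t y, C12 psi -> 0 < t ->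
    (\forall z \near ((t, y) : R * R),
       w z.1 z.2 - psi z.1 z.2 <= w t y - psi t y) ->
    d_t psi t y <= F (d_yy psi t y).

(** If the bound failed, w - [tpoly] would have a positive maximum over a rectangle. It is interior:
    time t is excluded by assumption, the sides by the quartic term, the final time by the quadratic
    term in time. At the maximum D / 2 times the increase of the second space derivative equals the
    increase of the time derivative apart from [eta], so strictness contradicts the subsolution
    property. *)
Lemma visc_sub_quartic (w : R -> R -> R) (K : R) :
  {within [set z : R * R | 0 <= z.1], continuous (fun z => w z.1 z.2)} ->
  (forall t y, 0 <= t -> w t y <= K) -> visc_sub w ->
  forall t s x a b c d, 0 <= t -> 0 <= s -> 0 < d ->
    (forall y, w t (x + y) <= a + b * y + c / 2 * y ^+ 2 + d * y ^+ 4) ->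
    w (t + s) x <= a + F c * s + 3 * d * D ^+ 2 * s ^+ 2.
Proof.
move=> cw wK vw t s x a b c d t0 s0 d0 wt.
rewrite leNgt; apply/negP => bad.
set q := F c in bad *.
pose gap := w (t + s) x - (a + q * s + 3 * d * D ^+ 2 * s ^+ 2).
have gap0 : 0 < gap by rewrite subr_gt0.
(* The strictness term at time s must use up less than the violation [gap]. *)
pose eta := gap / (2 * (s + s ^+ 2 + 1)).
have ss0 : 0 < s + s ^+ 2 + 1 by rewrite ltr_wpDl// addr_ge0// exprn_ge0.
have eta0 : 0 < eta by rewrite divr_gt0// mulr_gt0.
have etas : eta * (s + s ^+ 2) < gap.
  have E : eta * (s + s ^+ 2 + 1) = gap / 2.
    by rewrite /eta; field; rewrite gt_eqF.
  by lra.
pose psi := tpoly t x a b c d q eta.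
pose abc : R := `|a| + `|b| + `|c|.
have abc0 : 0 <= abc by do 2! apply: addr_ge0 => //.
(* q^2 / (4 eta) is the largest value of - (q tau + eta tau^2), so [K'] bounds w minus the time
   terms; at distance [r] the quartic exceeds it. *)
pose K' : R := `|K| + q ^+ 2 / (4 * eta).
have K'0 : 0 <= K'.
  apply: addr_ge0 => //; apply: divr_ge0; first exact: sqr_ge0.
  by apply: mulr_ge0 => //; exact: ltW.
pose r : R := 1 + (abc + K') / d.
have r1 : 1 <= r.
  by rewrite lerDl; apply: divr_ge0; [exact: addr_ge0|exact: ltW].
pose C0 : R := abc * r ^+ 2.
have C00 : 0 <= C0 by rewrite mulr_ge0// sqr_ge0.
(* The rectangle extends beyond s, to where eta tau^2 beats the drift q tau, the bound on w and the
   lower bound on the polynomial. *)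
pose T : R := 1 + s + (`|q| + `|K| + C0) / eta.
have Tb : 0 <= (`|q| + `|K| + C0) / eta.
  apply: divr_ge0; last exact: ltW.
  by do 2! apply: addr_ge0 => //.
have T1 : 1 <= T by rewrite /T -addrA lerDl addr_ge0.
have sT : s < T by rewrite /T; lra.
have T0 : 0 < T by lra.
have poly_lb y : `|y| <= r -> - C0 <= a + b * y + c / 2 * y ^+ 2.
  move=> yr; have y0 := normr_ge0 y.
  have r2 : 1 <= r ^+ 2 by rewrite exprn_ege1.
  have yr2 : `|y| ^+ 2 <= r ^+ 2 by rewrite lerXn2r ?nnegrE// (le_trans y0).
  have rr2 : r <= r ^+ 2 by rewrite expr2 ler_peMl// (le_trans _ r1).
  have h1 : `|a| <= `|a| * r ^+ 2 by rewrite ler_peMr.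
  have h2 : `|b * y| <= `|b| * r ^+ 2 by rewrite normrM ler_wpM2l// (le_trans yr).
  have h3 : `|c / 2 * y ^+ 2| <= `|c| * r ^+ 2.
    rewrite normrM normrX normrM (ger0_norm (_ : 0 <= 2^-1 :> R))//.
    have : `|c| * `|y| ^+ 2 <= `|c| * r ^+ 2 by rewrite ler_wpM2l.
    have := mulr_ge0 (normr_ge0 c) (sqr_ge0 r).
    by lra.
  have := ler_norm (- a); have := ler_norm (- (b * y)).
  have := ler_norm (- (c / 2 * y ^+ 2)); rewrite !normrN /C0 /abc.
  by lra.
have poly_lb2 y : `|y| = r -> K' <= a + b * y + c / 2 * y ^+ 2 + d * y ^+ 4.
  move=> yr; have := @poly_lb y; rewrite yr lexx => /(_ isT).
  have -> : y ^+ 4 = r ^+ 4.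
    by rewrite -yr -[4%N]/(2 * 2)%N !exprM real_normK ?num_real.
  have h1 : (abc + K') * r ^+ 3 <= d * r ^+ 4.
    have -> : d * r ^+ 4 = (d * r) * r ^+ 3 by ring.
    rewrite ler_wpM2r ?exprn_ge0 ?(le_trans _ r1)//.
    have -> : d * r = d + (abc + K') by rewrite /r; field; rewrite gt_eqF.
    by rewrite lerDr ltW.
  have h2 : abc * r ^+ 2 <= abc * r ^+ 3.
    rewrite ler_wpM2l// [leRHS]exprS ler_peMl// sqr_ge0//.
  have h3 : K' <= K' * r ^+ 3 by rewrite ler_peMr// exprn_ege1.
  by rewrite /C0; lra.
have qs tau : 0 <= tau -> - (q ^+ 2 / (4 * eta)) <= q * tau + eta * tau ^+ 2.
  move=> _; rewrite -subr_ge0.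
  have -> : q * tau + eta * tau ^+ 2 - - (q ^+ 2 / (4 * eta)) =
    (q / 2 + eta * tau) ^+ 2 / eta by field; rewrite gt_eqF.
  by rewrite divr_ge0 ?sqr_ge0// ltW.
pose A : set (R * R) := `[t, t + T]%classic `*` `[x - r, x + r]%classic.
have cA : compact A by apply: compact_setX; exact: segment_compact.
have AP z : A z <-> (0 <= z.1 - t <= T) /\ (`|z.2 - x| <= r).
  rewrite /A /setX/= !in_itv/= ler_distl.
  by split => -[/andP[? ?] ?]; split => //; apply/andP; split; lra.
have tsx : A (t + s, x).
  by apply/AP; rewrite /= addrAC subrr add0r subrr normr0 s0 ltW//=; lra.
have cwA : {within A, continuous (fun z : R * R => w z.1 z.2)}.
  by apply: (continuous_subspaceW _ cw) => u /AP[/andP[u1 _] _] /=; lra.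
have cpsi : {within A, continuous (fun z : R * R => psi z.1 z.2)}.
  apply: continuous_subspaceT => u.
  suff : jc u (fun z => psi z.1 z.2) by [].
  by rewrite /psi /tpoly /hpoly; jcont.
have cwpsi : {within A, continuous (fun z : R * R => w z.1 z.2 - psi z.1 z.2)}.
  by move=> z; exact: (cvgB (cwA z) (cpsi z)).
have [[t1 y1] + zmax] := compact_EVT_max (ex_intro _ _ tsx) cA cwpsi.
rewrite inE => /AP/=[/andP[t10 t1T] y1r].
have {}zmax (z : R * R) : A z -> w z.1 z.2 - psi z.1 z.2 <= w t1 y1 - psi t1 y1.
  by move=> Az; apply: zmax; exact: mem_set.
have pos : 0 < w t1 y1 - psi t1 y1.
  apply: lt_le_trans (zmax _ tsx).
  have tst : t + s - t = s by ring.
  rewrite /psi /tpoly /hpoly /= tst subrr.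
  by rewrite /gap in etas; rewrite !expr0n/=; lra.
have dD y : 0 <= d * (6 * D * (t1 - t) * y ^+ 2 + 3 * D ^+ 2 * (t1 - t) ^+ 2).
  apply: mulr_ge0; first exact: ltW.
  by apply: addr_ge0; apply: mulr_ge0; rewrite ?sqr_ge0//; apply: mulr_ge0;
    rewrite ?sqr_ge0// mulr_ge0.
have wt1 : w t1 y1 <= `|K| by rewrite (le_trans (wK _ _ _)) ?ler_norm//; lra.
have tau0 : 0 < t1 - t.
  rewrite lt_neqAle t10 andbT eq_sym; apply/eqP => t1t.
  have {}t1t : t1 = t by lra.
  move: pos; rewrite t1t /psi /tpoly /hpoly subrr.
  have := wt (y1 - x); rewrite addrC subrK !expr0n/=.
  by lra.
have tauT : t1 - t < T.
  rewrite lt_neqAle t1T andbT; apply/eqP => t1t.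
  move: pos; rewrite /psi /tpoly /hpoly t1t.
  have := poly_lb _ y1r; have := dD (y1 - x); rewrite t1t.
  have : 0 <= d * (y1 - x) ^+ 4.
    by rewrite mulr_ge0 ?(ltW d0)// -[4%N]/(2 * 2)%N exprM sqr_ge0.
  have h1 : `|q| + `|K| + C0 <= eta * T.
    have -> : eta * T = eta * (1 + s) + (`|q| + `|K| + C0).
      by rewrite /T; field; rewrite gt_eqF.
    by rewrite lerDr mulr_ge0 ?(ltW eta0)//; lra.
  have h2 : (`|q| + `|K| + C0) * T <= eta * T ^+ 2.
    by rewrite expr2 mulrA ler_pM2r.
  have h3 : `|K| <= `|K| * T by rewrite ler_peMr.
  have h4 : C0 <= C0 * T by rewrite ler_peMr.
  have h5 : - (`|q| * T) <= q * T.
    by rewrite -mulNr ler_pM2r// lerNl -normrN ler_norm.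
  have h6 : 0 <= eta * T by rewrite mulr_ge0// ltW.
  by lra.
have yr : `|y1 - x| < r.
  rewrite lt_neqAle y1r andbT; apply/eqP => yr.
  move: pos; rewrite /psi /tpoly /hpoly.
  have := poly_lb2 _ yr; have := dD (y1 - x); have := qs _ t10.
  have : 0 <= eta * (t1 - t) by rewrite mulr_ge0// ltW.
  by rewrite /K'; lra.
have t1pos : 0 < t1 by lra.
have := vw psi t1 y1 (tpoly_C12 _ _ _ _ _ _ _ _) t1pos.
have nearA : \forall z \near ((t1, y1) : R * R), A z.
  have : \forall z \near ((t1, y1) : R * R), (0 < z.1 - t < T) && (`|z.2 - x| < r).
    near=> z; apply/andP; split; [apply/andP; split|].
    - rewrite subr_gt0; near: z.
      apply: (cvgr_gt t1); [exact: cvg_fst | by rewrite -subr_gt0].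
    - rewrite ltrBlDr; near: z.
      apply: (cvgr_lt t1); [exact: cvg_fst | by rewrite -ltrBlDr].
    - near: z; apply: (cvgr_lt `|y1 - x|) => //.
      by apply: cvg_norm; apply: cvgB; [exact: cvg_snd | exact: cvg_cst].
  by apply: filterS => z /andP[/andP[z1 z2] z3]; apply/AP; rewrite !ltW.
have h : \forall z \near ((t1, y1) : R * R),
    w z.1 z.2 - psi z.1 z.2 <= w t1 y1 - psi t1 y1.
  by apply: filterS nearA => z Az; exact: zmax.
move=> /(_ h); rewrite /psi d_tE d_yyE.
have e0 : 0 <= d * (12 * (y1 - x) ^+ 2 + 12 * D * (t1 - t)).
  apply: mulr_ge0; first exact: ltW.
  by apply: addr_ge0; apply: mulr_ge0; rewrite ?sqr_ge0// mulr_ge0.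
have [_ Fc] := F_add c e0; rewrite -/q in Fc.
have : 0 < eta * (1 + 2 * (t1 - t)) by rewrite mulr_gt0//; lra.
by lra.
Unshelve. all: by end_near. Qed.

End viscosity.

(** * From quartic bounds back to the viscosity inequality *)

Section quartic_to_viscosity.
Context (R : realType).
Implicit Types (f : R -> R).

(** The convex form of the mean value theorem keeps the intermediate points between x and x + y,
    which gives the product of increments a sign and lets a one-sided bound on [f2] suffice. *)
Lemma taylor2_le f f1 f2 (C rho x y : R) :
  (forall z, is_derive z (1:R) f (f1 z)) ->
  (forall z, is_derive z (1:R) f1 (f2 z)) ->
  (forall z, `|z - x| < rho -> f2 z <= C) -> `|y| < rho ->
  f (x + y) <= f x + f1 x * y + C / 2 * y ^+ 2.
Proof.
move=> d1 d2 hC yr.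
pose dphi z := f1 z - f1 x - C * (z - x).
pose phi z := f z - f1 x * (z - x) - C / 2 * (z - x) ^+ 2.
have dp z : is_derive z (1:R) phi (dphi z).
  have dl := is_derive_sub x z.
  have -> : phi = (f \- (f1 x \*: (fun z : R => z - x)))
      \- ((C / 2) \*: ((fun z : R => z - x) * (fun z : R => z - x))).
    by apply/funext => u; rewrite /phi /GRing.sub_fun /= expr2.
  have -> : dphi z = (f1 z - f1 x *: 1) -
     (C / 2) *: ((z - x) *: 1 + (z - x) *: 1).
    by rewrite /dphi /GRing.scale/=; lra.
  exact: (is_deriveB (is_deriveB (d1 z) (is_deriveZ _ dl))
    (is_deriveZ _ (is_deriveM dl dl))).
have [l /andP[l0 l1] E] := mvt_convex x (x + y) dp.
have xyx : x + y - x = y by ring.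
rewrite xyx in E; rewrite /phi xyx in E.
suff : dphi (x + l * y) * y <= 0 by rewrite -E subrr expr0n/=; lra.
have [l' /andP[l'0 l'1] E'] := mvt_convex x (x + l * y) d2.
have xlx : x + l * y - x = l * y by ring.
rewrite xlx in E'; rewrite /dphi xlx E'.
have -> : (f2 (x + l' * (l * y)) * (l * y) - C * (l * y)) * y =
  - ((C - f2 (x + l' * (l * y))) * (l * y ^+ 2)) by ring.
rewrite oppr_le0 mulr_ge0//; last by rewrite mulr_ge0// sqr_ge0.
rewrite subr_ge0; apply: hC; rewrite addrAC subrr add0r.
apply: le_lt_trans yr; rewrite !normrM mulrA ler_piMl//.
by rewrite !ger0_norm// mulr_ile1.
Qed.

(** It confines to a bounded set the points at which a bounded function exceeds a quartic. *)
Lemma quartic_coercive (a b c d K y : R) : 0 < d ->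
  a + b * y + c / 2 * y ^+ 2 + d * y ^+ 4 <= K ->
  `|y| <= 1 + (`|a| + `|b| + `|c| + `|K|) / d.
Proof.
move=> d0 h; rewrite leNgt; apply/negP => yr.
set M := `|a| + `|b| + `|c| + `|K| in yr.
have M0 : 0 <= M by do 3! apply: addr_ge0 => //.
have Md : 0 <= M / d by apply: divr_ge0 => //; exact: ltW.
set z := `|y| in yr; have z1 : 1 <= z by lra.
have z0 : 0 < z by lra.
have z4 : y ^+ 4 = z ^+ 4.
  by rewrite -[4%N]/(2 * 2)%N !exprM real_normK ?num_real.
have dz : d + M < d * z.
  have -> : d + M = d * (1 + M / d) by field; rewrite gt_eqF.
  by rewrite ltr_pM2l.
have z3 : 1 <= z ^+ 3 by rewrite exprn_ege1.
have z2 : z ^+ 2 <= z ^+ 3 by rewrite [leRHS]exprS ler_peMl// sqr_ge0.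
have z23 : z <= z ^+ 3.
  by rewrite -[leLHS]mulr1 exprS; apply: ler_wpM2l; [exact: ltW | rewrite exprn_ege1].
have h4 : (d + M) * z ^+ 3 < d * y ^+ 4.
  have -> : d * y ^+ 4 = (d * z) * z ^+ 3 by rewrite z4; ring.
  by rewrite ltr_pM2r// exprn_gt0.
have hd : 0 < d * z ^+ 3 by rewrite mulr_gt0// exprn_gt0.
have ha : `|a| <= `|a| * z ^+ 3 by rewrite ler_peMr.
have hK : `|K| <= `|K| * z ^+ 3 by rewrite ler_peMr.
have hb : `|b * y| <= `|b| * z ^+ 3 by rewrite normrM ler_wpM2l.
have hc : `|c / 2 * y ^+ 2| <= `|c| * z ^+ 3.
  rewrite normrM normrX normrM (ger0_norm (_ : 0 <= 2^-1 :> R))// -/z.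
  have : `|c| * z ^+ 2 <= `|c| * z ^+ 3 by rewrite ler_wpM2l.
  have := mulr_ge0 (normr_ge0 c) (sqr_ge0 z).
  by lra.
have := ler_norm (- a); have := ler_norm (- (b * y)); have := ler_norm K.
have := ler_norm (- (c / 2 * y ^+ 2)); rewrite !normrN /M in h4 *.
by lra.
Qed.

Context (D : R) (F : R -> R).
Hypothesis D0 : 0 <= D.
Hypothesis F_add : forall c e, 0 <= e -> F c <= F (c + e) /\ F (c + e) <= F c + D / 2 * e.

(** At time t - s, w lies below the Taylor quadratic of psi with curvature raised by theta, plus a
    quartic steep enough to dominate [K] off the ball where psi is controlled. The quartic bound
    carries this to time t: psi grows over [t - s, t] at most at the rate F (c + theta) + O(s), and
    a small s contradicts a larger time derivative. *)
Lemma quartic_visc_sub (w : R -> R -> R) (K : R) :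
  (forall t y, 0 <= t -> w t y <= K) ->
  (forall t s x a b c d, 0 <= t -> 0 <= s -> 0 < d ->
    (forall y, w t (x + y) <= a + b * y + c / 2 * y ^+ 2 + d * y ^+ 4) ->
    w (t + s) x <= a + F c * s + 3 * d * D ^+ 2 * s ^+ 2) ->
  visc_sub F w.
Proof.
move=> wK wq psi t x C t0 hmax.
set q := d_t psi t x; set c := d_yy psi t x.
rewrite leNgt; apply/negP => bad.
have [[dt _ _] [c0 _ c1 c2]] := C t x t0.
pose gap := q - F c; have gap0 : 0 < gap by rewrite subr_gt0.
pose theta := gap / (2 * (D + 1)).
have D1 : 0 < 2 * (D + 1) by rewrite mulr_gt0// ltr_wpDl.
have th0 : 0 < theta by rewrite divr_gt0.
have Dth : D / 2 * theta <= gap / 4.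
  have : theta * (2 * (D + 1)) = gap by rewrite /theta divfK// gt_eqF.
  by lra.
pose w0 := w t x - psi t x.
have near0 : \forall z \near ((t, x) : R * R),
  [/\ d_yy psi z.1 z.2 <= c + theta, `|psi t x - psi z.1 z.2| <= 1,
     `|d_y psi t x - d_y psi z.1 z.2| <= 1 & w z.1 z.2 - psi z.1 z.2 <= w0].
  near=> z; split.
  - near: z; apply: (cvgr_le c); [exact: c2 | by rewrite ltrDl].
  - by near: z; move/cvgrPdist_le : c0; apply.
  - by near: z; move/cvgrPdist_le : c1; apply.
  - by near: z.
have [rho rho0 hrho] : exists2 rho : R, 0 < rho & forall t' y', `|t - t'| < rho -> `|x - y'| < rho ->
  [/\ d_yy psi t' y' <= c + theta, `|psi t x - psi t' y'| <= 1,
     `|d_y psi t x - d_y psi t' y'| <= 1 & w t' y' - psi t' y' <= w0].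
  move/nbhs_ballP : near0 => [rho /= rho0 h]; exists rho => // t' y' h1 h2.
  by apply: (h (t', y')).
pose B := `|d_y psi t x| + 1.
(* For |y| >= [rho] the three quotients let d y^4 dominate the constant, linear and quadratic terms
   in turn. *)
pose d := (`|K| + `|w0| + `|psi t x| + 1) / rho ^+ 4 + B / rho ^+ 3
   + (`|c| + theta) / rho ^+ 2 + 1.
have d0 : 0 < d.
  rewrite /d ltr_wpDl// !addr_ge0//; apply: divr_ge0; rewrite ?exprn_ge0 ?(ltW rho0)//.
    by rewrite !addr_ge0.
  by rewrite addr_ge0// ltW.
have key s : 0 < s -> s < rho -> s < t ->
   psi t x - psi (t - s) x <= F (c + theta) * s + 3 * d * D ^+ 2 * s ^+ 2.
  move=> s0 sr st.
  have ts0 : 0 < t - s by rewrite subr_gt0.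
  have tsr : `|t - (t - s)| < rho by rewrite opprB addrC subrK gtr0_norm.
  have xx : `|x - x| < rho by rewrite subrr normr0.
  have [_ hp hb hw] := hrho _ _ tsr xx.
  have E : t - s + s = t by rewrite subrK.
  have := wq (t - s) s x (w0 + psi (t - s) x) (d_y psi (t - s) x) (c + theta) d (ltW ts0) (ltW s0) d0.
  rewrite E => H.
  suff : w t x <= w0 + psi (t - s) x + F (c + theta) * s + 3 * d * D ^+ 2 * s ^+ 2.
    by rewrite /w0; lra.
  apply: H => y.
  have [yr|yr] := ltP `|y| rho.
    have d1 z : is_derive z (1:R) (psi (t - s)) (d_y psi (t - s) z).
      have [[_ h _] _] := C (t - s) z ts0.
      by rewrite /d_y derive1E; exact: derivableP.
    have d2 z : is_derive z (1:R) (d_y psi (t - s)) (d_yy psi (t - s) z).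
      have [[_ _ h] _] := C (t - s) z ts0.
      by rewrite /d_yy derive1E; exact: derivableP.
    have hC z : `|z - x| < rho -> d_yy psi (t - s) z <= c + theta.
      by rewrite distrC => zr; have [] := hrho _ _ tsr zr.
    have T := taylor2_le d1 d2 hC yr.
    have xy : `|x - (x + y)| < rho by rewrite opprD addrA subrr add0r normrN.
    have [_ _ _] := hrho _ _ tsr xy.
    have dy : 0 <= d * y ^+ 4.
      by rewrite mulr_ge0 ?(ltW d0)// -[4%N]/(2 * 2)%N exprM sqr_ge0.
    by lra.
  apply: (le_trans (wK _ _ (ltW ts0))).
  have y4 : y ^+ 4 = `|y| ^+ 4.
    by rewrite -[4%N]/(2 * 2)%N !exprM real_normK ?num_real.
  have y2 : y ^+ 2 = `|y| ^+ 2 by rewrite real_normK ?num_real.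
  rewrite y4; set z := `|y| in yr y4 y2 *.
  have z0 : 0 < z by exact: lt_le_trans yr.
  have pw A k : 0 <= A -> (k <= 4)%N -> A * z ^+ (4 - k) <= A / rho ^+ k * z ^+ 4.
    move=> A0 k4; rewrite -mulrA ler_wpM2l// ler_pdivlMl ?exprn_gt0//.
    rewrite -[in leRHS](subnKC k4) exprD ler_wpM2r ?exprn_ge0 ?(ltW z0)//.
    by rewrite lerXn2r ?nnegrE ?(ltW rho0) ?(ltW z0).
  have p4 := pw (`|K| + `|w0| + `|psi t x| + 1) 4%N (_ : 0 <= _) isT.
  have p3 := pw B 3%N (_ : 0 <= _) isT.
  have p2 := pw (`|c| + theta) 2%N (_ : 0 <= _) isT.
  have {}p4 : `|K| + `|w0| + `|psi t x| + 1 <= (`|K| + `|w0| + `|psi t x| + 1) / rho ^+ 4 * z ^+ 4.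
    by rewrite -[leLHS]mulr1; apply: p4; rewrite !addr_ge0.
  have {}p3 : B * z <= B / rho ^+ 3 * z ^+ 4 by apply: p3; rewrite addr_ge0.
  have {}p2 : (`|c| + theta) * z ^+ 2 <= (`|c| + theta) / rho ^+ 2 * z ^+ 4.
    by apply: p2; rewrite addr_ge0// ltW.
  have hby : `|d_y psi (t - s) x * y| <= B * z.
    rewrite normrM ler_wpM2r// /B -[d_y psi (t - s) x](subrK (d_y psi t x)).
    by rewrite (le_trans (ler_normD _ _))// addrC lerD2l distrC.
  have hcy : `|(c + theta) / 2 * y ^+ 2| <= (`|c| + theta) * z ^+ 2.
    rewrite normrM normrX -/z ler_wpM2r ?sqr_ge0//.
    rewrite normrM (ger0_norm (_ : 0 <= 2^-1 :> R))//.
    have := ler_normD c theta; rewrite (gtr0_norm th0).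
    by have := normr_ge0 (c + theta); lra.
  have hpp : `|psi (t - s) x| <= `|psi t x| + 1.
    rewrite -[psi (t - s) x](subrK (psi t x)).
    by rewrite (le_trans (ler_normD _ _))// addrC lerD2l distrC.
  have z4 : 0 <= z ^+ 4 by rewrite exprn_ge0// ltW.
  have := ler_norm (- (d_y psi (t - s) x * y)).
  have := ler_norm (- ((c + theta) / 2 * y ^+ 2)).
  have := ler_norm (- psi (t - s) x); have := ler_norm K; have := ler_norm (- w0).
  by rewrite !normrN /d; lra.
have Fth : F (c + theta) <= F c + D / 2 * theta by have [] := F_add c (ltW th0).
have dq : (fun h => h^-1 *: (psi (h + t) x - psi t x)) @ 0^' --> q.
  have := dt; rewrite /derivable => /cvg_ex[l hl].
  have E : (fun h : R => h^-1 *: (psi (h *: 1 + t) x - psi t x)) =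
           (fun h => h^-1 *: (psi (h + t) x - psi t x)).
    by apply/funext => h; rewrite /GRing.scale/= mulr1.
  rewrite /= E in hl.
  suff -> : q = l by [].
  rewrite /q /d_t derive1E /derive/=; rewrite /= E.
  by apply: cvg_lim hl; exact: Rhausdorff.
have d3 : 0 <= 3 * d * D ^+ 2 by rewrite !mulr_ge0 ?sqr_ge0// ltW.
pose d' := 3 * d * D ^+ 2 + 1.
have d'0 : 0 < d' by rewrite ltr_wpDl.
have [h /= [h0 hh hr ht hd]] : exists h : R, [/\ 0 < h, q - gap / 4 <= (- h)^-1 *: (psi (- h + t) x - psi t x),
    h < rho, h < t & d' * h <= gap / 4].
  have : \forall h \near 0^'+, [/\ 0 < h, q - gap / 4 <= (- h)^-1 *: (psi (- h + t) x - psi t x),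
    h < rho, h < t & d' * h <= gap / 4].
    near=> h; split.
    - by near: h; exact: nbhs_right_gt.
    - near: h.
      have : (fun h => (- h)^-1 *: (psi (- h + t) x - psi t x)) @ 0^'+ --> q.
        apply: (@cvg_comp _ _ _ (fun h : R => - h) (fun h => h^-1 *: (psi (h + t) x - psi t x)) _ 0^') => //.
        move=> A; rewrite /nbhs/= /dnbhs /at_right /within /= => hA.
        have : \forall h \near (0:R), - h != 0 -> A (- h).
          have c0' : - h @[h --> (0:R)] --> (0:R).
            by rewrite -[X in _ --> X]oppr0; apply: cvgN; exact: cvg_id.
          exact: (c0' _ hA).
        by apply: filterS => h /= hA' h0; apply: hA'; rewrite oppr_eq0 gt_eqF.
      move=> /cvgr_ge; apply; by rewrite ltrBlDr ltrDl divr_gt0.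
    - by near: h; exact: nbhs_right_lt.
    - by near: h; exact: nbhs_right_lt.
    - by rewrite mulrC -ler_pdivlMr//; near: h; apply: nbhs_right_le; rewrite !divr_gt0.
  by move=> /filter_ex.
have := key h h0 hr ht.
have hE : (- h)^-1 *: (psi (- h + t) x - psi t x) * h = psi t x - psi (t - h) x.
  by rewrite /GRing.scale/= invrN (addrC (- h)); field; rewrite gt_eqF.
have : (q - gap / 4) * h <= (- h)^-1 *: (psi (- h + t) x - psi t x) * h by rewrite ler_pM2r.
rewrite hE => h1 h2.
have h3 : F (c + theta) * h <= (F c + gap / 4) * h by rewrite ler_pM2r//; lra.
have h4 : 3 * d * D ^+ 2 * h ^+ 2 <= gap / 4 * h.
  rewrite expr2 mulrA ler_pM2r// (le_trans _ hd)// ler_pM2r// /d' lerDl//.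
have h5 : 0 < gap / 4 * h by rewrite mulr_gt0// divr_gt0.
have h6 : q = gap + F c by rewrite /gap; lra.
by rewrite h6 in h1; lra.
Unshelve. all: by end_near. Qed.

End quartic_to_viscosity.

Definition grid_index (R : realType) (t : R) n : nat := Num.truncn (t * n.+1%:R).

Lemma grid_index_le (R : realType) (t : R) n : 0 <= t ->
  (grid_index t n)%:R * tstep R n <= t < (grid_index t n)%:R * tstep R n + tstep R n.
Proof.
move=> t0; have /andP[h1 h2] := truncn_itv (mulr_ge0 t0 (ler0n R n.+1)).
rewrite /tstep -/(grid_index t n) in h1 h2 *; apply/andP; split.
  by rewrite ler_pdivrMr.
by rewrite -[X in _ + X]mul1r -mulrDl natr1 ltr_pdivlMr.
Qed.

Lemma grid_index_cvg (R : realType) (t : R) : 0 <= t ->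
  (fun n => (grid_index t n)%:R * tstep R n) @ \oo --> t.
Proof.
move=> t0.
have hl : (fun n => t - tstep R n) @ \oo --> t.
  rewrite -[X in _ --> X]subr0; apply: cvgB; [exact: cvg_cst | exact: cvg_harmonic].
apply: (@squeeze_cvgr _ _ _ _ (fun n => t - tstep R n) (fun=> t)) => //; last exact: cvg_cst.
near=> n; have /andP[-> h] := grid_index_le n t0.
by rewrite andbT lerBlDr ltW.
Unshelve. all: by end_near. Qed.

Lemma grid_index_mono (R : realType) (s t : R) n : s <= t -> (grid_index s n <= grid_index t n)%N.
Proof. by move=> st; apply: le_truncn; rewrite ler_pM2r. Qed.

(** * Quartic bounds for the ultralimit of a monotone scheme *)

Section scheme_limit.
Context (R : realType) (D : R) (F : R -> R).
Implicit Types (t s x : R).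
(** Instantiated twice: by [step] with [G], and by its conjugate under negation with [Gc]. *)
Variable T : nat -> (R -> R) -> R -> R.
Hypothesis T_le : forall n f g, (forall x, f x <= g x) -> forall x, T n f x <= T n g x.
Hypothesis T_cst : forall n f c x, T n (fun y => f y + c) x = T n f x + c.
Hypothesis T_shift : forall n f z x, T n (fun y => f (y + z)) x = T n f (x + z).
Hypothesis T_hpoly : forall n a b c (d s : R) y, 0 <= d -> 0 <= s ->
  T n (hpoly a b c d (F c) D s) y <= hpoly a b c d (F c) D (s + tstep R n) y.
Variables (f : R -> R) (K L : R).

Definition approx n t x := iter (grid_index t n) (T n) f x.
Hypothesis v_bound : forall n t x, `|approx n t x| <= K.
Hypothesis v_lip : forall n t, lipf L (approx n t).

Lemma approx_bseq t x : bseq (fun n => approx n t x).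
Proof. by exists K. Qed.

Lemma iter_hpoly n i a b c d y : 0 <= d ->
  iter i (T n) (hpoly a b c d (F c) D 0) y <= hpoly a b c d (F c) D (i%:R * tstep R n) y.
Proof.
move=> d0; elim: i y => [|i IH] y; first by rewrite mul0r.
rewrite iterS; apply: (le_trans (T_le n IH y)).
rewrite -natr1 mulrDl mul1r; apply: T_hpoly => //.
by rewrite mulr_ge0// ltW// tstep_gt0.
Qed.

Lemma iter_cst n i g c x : iter i (T n) (fun y => g y + c) x = iter i (T n) g x + c.
Proof.
elim: i x => //= i IH x; rewrite -T_cst; congr (T _ _ x).
by apply/funext.
Qed.

Lemma iter_shift n i g z x : iter i (T n) (fun y => g (y + z)) x = iter i (T n) g (x + z).
Proof.
elim: i x => //= i IH x; rewrite -T_shift; congr (T _ _ x).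
by apply/funext.
Qed.

Lemma iter_le n i g h : (forall x, g x <= h x) -> forall x, iter i (T n) g x <= iter i (T n) h x.
Proof. by move=> gh; elim: i => //= i IH; exact: T_le. Qed.

(** A pointwise bound on the ultralimit becomes uniform in y: otherwise there are violating points
    for ultrafilter-many n, coercivity keeps them bounded, and at their ultralimit the common
    Lipschitz constant contradicts the bound. *)
Lemma ultra_below_quartic t x a b c d eta : 0 < d -> 0 < eta ->
  (forall y, ulim (fun n => approx n t (x + y)) <= a + b * y + c / 2 * y ^+ 2 + d * y ^+ 4) ->
  ultra [set n | forall y, approx n t (x + y) <=
    a + b * y + c / 2 * y ^+ 2 + d * y ^+ 4 + eta].
Proof.
move=> d0 e0 h; pose Q (y : R) := a + b * y + c / 2 * y ^+ 2 + d * y ^+ 4.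
have [//|H] := in_ultra_setVsetC [set n | forall y, approx n t (x + y) <= Q y + eta] ultra_ultra.
exfalso.
pose y n := if pselect (exists y, Q y + eta < approx n t (x + y)) is left e
  then sval (cid e) else 0.
have {}H : ultra [set n | Q (y n) + eta < approx n t (x + y n)].
  apply: filterS H => n /= H; rewrite /y; case: pselect => [e|ne].
    by case: cid.
  exfalso; apply: H => z; rewrite leNgt; apply/negP => hz.
  by apply: ne; exists z.
have yb : bseq y.
  exists (1 + (`|a| + `|b| + `|c| + `|K|) / d) => n; rewrite /y.
  case: pselect => [e|_]; last first.
    rewrite normr0; apply: addr_ge0 => //; apply: divr_ge0; last exact: ltW.
    by do 3! apply: addr_ge0 => //.
  case: cid => z /= hz; apply: quartic_coercive => //.
  apply: le_trans (_ : approx n t (x + z) <= _).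
    by apply: ltW; apply: le_lt_trans hz; rewrite lerDl ltW.
  by have := v_bound n t (x + z); rewrite ler_norml => /andP[].
have yc := ulimP yb; set ys := ulim y in yc.
have vc := ulimP (approx_bseq t (x + ys)).
have cz : y n - ys @[n --> ultra] --> 0.
  by rewrite -(subrr ys); apply: cvgB; [exact: yc | exact: cvg_cst].
have Qc : Q (y n) @[n --> ultra] --> Q ys.
  have jQ : {for ys, continuous Q}.
    have -> : Q = fun y => (a + b * y + c / 2 * (y * y)) + d * (y * y * (y * y)).
      by apply/funext => u; rewrite /Q; ring.
    have ci : (fun y : R => y) @ ys --> ys by exact: cvg_id.
    have c2 : (fun y : R => y * y) @ ys --> ys * ys by exact: cvgM.
    have c4 : (fun y : R => y * y * (y * y)) @ ys --> ys * ys * (ys * ys) by exact: cvgM.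
    apply: cvgD; last by apply: cvgM; [exact: cvg_cst | exact: c4].
    apply: cvgD; last by apply: cvgM; [exact: cvg_cst | exact: c2].
    apply: cvgD; [exact: cvg_cst | by apply: cvgM; [exact: cvg_cst | exact: ci]].
  by apply: continuous_cvg; [exact: jQ | exact: yc].
have c1 : Q (y n) + eta @[n --> ultra] --> Q ys + eta.
  by apply: cvgD; [exact: Qc | exact: cvg_cst].
have c2 : approx n t (x + ys) + L * `|y n - ys| @[n --> ultra] -->
    ulim (fun n => approx n t (x + ys)) + L * `|0 : R|.
  exact: (cvgD vc (cvgM (cvg_cst L) (cvg_norm cz))).
have := ler_cvg_to c1 c2; rewrite normr0 mulr0 addr0 => E.
suff : Q ys + eta <= ulim (fun n => approx n t (x + ys)).
  by have := h ys; rewrite -/(Q ys); lra.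
apply: E; apply: filterS H => n /= H; apply: ltW; apply: (lt_le_trans H).
have := v_lip n t (x + y n) (x + ys).
have -> : x + y n - (x + ys) = y n - ys by ring.
by rewrite ler_norml => /andP[_]; lra.
Qed.

(** Recentred at x, the quartic is evolved over the [i n] remaining grid steps by [iter_hpoly], and
    the grid time elapsed tends to s. *)
Lemma limit_quartic t s x a b c d : 0 <= t -> 0 <= s -> 0 < d ->
  (forall y, ulim (fun n => approx n t (x + y)) <= a + b * y + c / 2 * y ^+ 2 + d * y ^+ 4) ->
  ulim (fun n => approx n (t + s) x) <= a + F c * s + 3 * d * D ^+ 2 * s ^+ 2.
Proof.
move=> t0 s0 d0 h; apply/ler_addgt0Pr => eta e0.
have H := ultra_below_quartic d0 e0 h.
pose i n := (grid_index (t + s) n - grid_index t n)%N.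
have tts : t <= t + s by rewrite lerDl.
have ih : (i n)%:R * tstep R n @[n --> \oo] --> s.
  have -> : (fun n => (i n)%:R * tstep R n) = (fun n =>
    (grid_index (t + s) n)%:R * tstep R n - (grid_index t n)%:R * tstep R n).
    by apply/funext => n; rewrite /i natrB ?mulrBl// grid_index_mono.
  rewrite -[X in _ --> X](_ : t + s - t = s); last by ring.
  by apply: cvgB; apply: grid_index_cvg => //; rewrite addr_ge0.
have {}ih : (i n)%:R * tstep R n @[n --> ultra] --> s.
  by apply: cvg_trans ih => A; exact: near_ultra.
have rc : a + F c * ((i n)%:R * tstep R n) + 3 * d * D ^+ 2 * ((i n)%:R * tstep R n * ((i n)%:R * tstep R n)) + eta
   @[n --> ultra] --> a + F c * s + 3 * d * D ^+ 2 * (s * s) + eta.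
  exact: (cvgD (cvgD (cvgD (cvg_cst a) (cvgM (cvg_cst (F c)) ih)) (cvgM (cvg_cst (3 * d * D ^+ 2)) (cvgM ih ih))) (cvg_cst eta)).
rewrite expr2; apply: (ler_cvg_to (ulimP (approx_bseq (t + s) x)) rc).
apply: filterS H => n /= H.
have -> : approx n (t + s) x = iter (i n) (T n) (approx n t) x.
  by rewrite /approx -iterD /i subnK// grid_index_mono.
rewrite -[x in leLHS]add0r -iter_shift.
apply: (@le_trans _ _ (iter (i n) (T n) (fun y => hpoly a b c d (F c) D 0 y + eta) 0)).
  apply: iter_le => y; apply: le_trans (_ : _ <= _); last first.
    exact: lexx.
  by have := H y; rewrite addrC /hpoly; lra.
rewrite iter_cst lerD2r.
apply: (le_trans (iter_hpoly n (i n) a b c 0 (ltW d0))).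
by rewrite /hpoly !expr0n/=; lra.
Qed.

End scheme_limit.

(** * The semigroup of the G-heat equation *)

Section heat_semigroup.
Context (R : realType) (sl sh : R) (h0 : 0 <= sl) (hs : sl <= sh).
Implicit Types (f g : R -> R) (t s x : R).
Notation G := (G sl sh).
Notation Gc := (Gc sl sh).
Notation D := (sh ^+ 2).

Definition bddf f := exists M, forall x, `|f x| <= M.

(* Convergence of the scheme is not known beforehand: the limit along an ultrafilter
   exists, and the comparison argument shows that it is the viscosity solution. *)
Definition Sg (t : R) f x := ulim (fun n => scheme sl sh n (grid_index t n) f x).

Let ssl n j := scheme_sublinear sl sh n j.

Lemma scheme_bseq t f x : bddf f -> bseq (fun n => scheme sl sh n (grid_index t n) f x).
Proof. by move=> [M fM]; exists M => n; exact: sop_bound (ssl _ _) _. Qed.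

Lemma Sg_le t f g x : bddf f -> bddf g -> (forall y, f y <= g y) -> Sg t f x <= Sg t g x.
Proof.
move=> bf bg fg; apply: ulim_le; [exact: scheme_bseq | exact: scheme_bseq |].
by apply: filterE => n /=; exact: (sop_le (ssl _ _)).
Qed.

Lemma Sg_cst t f c x : bddf f -> Sg t (fun y => f y + c) x = Sg t f x + c.
Proof.
move=> bf; rewrite -{2}(ulim_cst c) /Sg -ulimD; [|exact: scheme_bseq|exact: bseq_cst].
by congr ulim; apply/funext => n; exact: (sop_cst (ssl _ _)).
Qed.

Lemma bddfD f g : bddf f -> bddf g -> bddf (fun x => f x + g x).
Proof.
move=> [M fM] [N gN]; exists (M + N) => x.
by rewrite (le_trans (ler_normD _ _))// lerD.
Qed.

Lemma Sg_sub t f g x : bddf f -> bddf g ->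
  Sg t (fun y => f y + g y) x <= Sg t f x + Sg t g x.
Proof.
move=> bf bg; rewrite -ulimD; [|exact: scheme_bseq|exact: scheme_bseq].
apply: ulim_le.
- by apply: scheme_bseq; exact: bddfD.
- by apply: bseqD; exact: scheme_bseq.
by apply: filterE => n /=; exact: (sop_sub (ssl _ _)).
Qed.

Lemma Sg_hom t f a x : bddf f -> 0 <= a -> Sg t (fun y => a * f y) x = a * Sg t f x.
Proof.
move=> bf a0; rewrite /Sg -ulimZ; last exact: scheme_bseq.
by congr ulim; apply/funext => n; exact: (sop_hom (ssl _ _)).
Qed.

Lemma Sg_shift t f z x : Sg t (fun y => f (y + z)) x = Sg t f (x + z).
Proof. by congr ulim; apply/funext => n; exact: (sop_shift (ssl _ _)). Qed.

Lemma Sg_const t c x : Sg t (fun=> c) x = c.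
Proof.
rewrite /Sg -[RHS]ulim_cst; congr ulim; apply/funext => n.
exact: sop_const (ssl _ _).
Qed.

Lemma Sg_bound t f M x : (forall y, `|f y| <= M) -> `|Sg t f x| <= M.
Proof. by move=> fM; apply: ulim_bound => n; exact: sop_bound (ssl _ _) _. Qed.

Lemma Sg_contract t f g e x : bddf f -> bddf g -> (forall y, f y <= g y + e) ->
  Sg t f x <= Sg t g x + e.
Proof.
move=> bf bg fg; rewrite -Sg_cst//; apply: Sg_le => //.
by apply: bddfD => //; exists `|e|.
Qed.

Lemma Sg_dist t f g e x : bddf f -> bddf g -> (forall y, `|f y - g y| <= e) ->
  `|Sg t f x - Sg t g x| <= e.
Proof.
move=> bf bg fg; rewrite ler_distl.
have h1 := @Sg_contract t f g e x bf bg; have h2 := @Sg_contract t g f e x bg bf.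
rewrite lerBlDr h1 ?h2// => y; have := fg y; rewrite ler_distl => /andP[? ?]; lra.
Qed.

Lemma Sg_lipf t f L : bddf f -> lipf L f -> lipf L (Sg t f).
Proof.
move=> bf lf x y; rewrite /Sg -ulimN; last exact: scheme_bseq.
have bN : bseq (fun n => - scheme sl sh n (grid_index t n) f y).
  by have [K hK] := scheme_bseq t y bf; exists K => n; rewrite normrN.
rewrite -ulimD//; last exact: scheme_bseq.
by apply: ulim_bound => n; exact: sop_lipf (ssl _ _) lf x y.
Qed.

Lemma Sg0 f x : Sg 0 f x = f x.
Proof.
rewrite /Sg -[RHS]ulim_cst; congr ulim; apply/funext => n.
by rewrite /grid_index mul0r truncn0.
Qed.

Lemma Sg_quartic f L : bddf f -> lipf L f -> quartic_bound sh G (fun t => Sg t f).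
Proof.
move=> [K fK] lf t s x a b c d.
apply: (@limit_quartic R D G (step sl sh) _ _ _ _ f K L).
- by move=> n g h gh y; exact: (sop_le (step_sublinear sl sh n)).
- by move=> n g e y; exact: (sop_cst (step_sublinear sl sh n)).
- by move=> n g z y; exact: (sop_shift (step_sublinear sl sh n)).
- by move=> n a' b' c' d' s' y; exact: step_hpoly.
- by move=> n t' y; exact: sop_bound (ssl _ _) fK.
- by move=> n t'; exact: sop_lipf (ssl _ _) lf.
Qed.

Lemma lipfN f L : lipf L f -> lipf L (fun x => - f x).
Proof. by move=> lf x y; rewrite -opprD normrN; exact: lf. Qed.

Lemma Sg_quarticN f L : bddf f -> lipf L f ->
  quartic_bound sh Gc (fun t x => - Sg t f x).
Proof.
move=> bf lf t s x a b c d t0 s0 d0.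
pose T n (g : R -> R) y := - step sl sh n (fun z => - g z) y.
have TE n j : iter j (T n) (fun y => - f y) = fun y => - scheme sl sh n j f y.
  elim: j => //= j ->; apply/funext => y; rewrite /T; congr (- step _ _ _ _ _).
  by apply/funext => z; rewrite opprK.
have E t' y : - Sg t' f y = ulim (fun n => approx T (fun y => - f y) n t' y).
  rewrite /Sg -ulimN; last exact: scheme_bseq.
  by congr ulim; apply/funext => n; rewrite /approx TE.
move=> h; rewrite E.
have [K fK] := bf.
apply: (@limit_quartic R D Gc T _ _ _ _ (fun y => - f y) K L _ _ _ _ _ a b c d) => //.
- move=> n g k gk y; rewrite /T lerN2; apply: (sop_le (step_sublinear sl sh n)) => z.
  by rewrite lerN2.
- move=> n g e y; rewrite /T.
  have -> : (fun z => - (g z + e)) = (fun z => - g z + - e).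
    by apply/funext => z; rewrite opprD.
  by rewrite (sop_cst (step_sublinear sl sh n)) opprD opprK.
- by move=> n g z y; rewrite /T -(sop_shift (step_sublinear sl sh n)).
- by move=> n a' b' c' d' s' y d'0 s'0; exact: stepN_hpoly.
- move=> n t' y; rewrite /approx TE normrN; exact: sop_bound (ssl _ _) fK.
- move=> n t'; rewrite /approx TE; apply: lipfN.
  exact: sop_lipf (ssl _ _) lf.
- by move=> y; rewrite -E; exact: h.
Qed.

(** From L |y| <= L theta + (L / theta) y^2 a Lipschitz function lies below a quartic centred at any
    point, so the quartic bound yields a one-sided modulus of continuity in time; negation gives the
    other side. *)
Lemma quartic_bound_time F (w : R -> R -> R) L :
  (forall c e, 0 <= e -> F c <= F (c + e) /\ F (c + e) <= F c + D / 2 * e) ->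
  F 0 = 0 -> quartic_bound sh F w -> (forall t, lipf L (w t)) -> 0 <= L ->
  forall eps, 0 < eps -> exists2 delta, 0 < delta &
  forall t s x, 0 <= t -> 0 <= s -> s < delta -> w (t + s) x <= w t x + eps.
Proof.
move=> Fa F0 wq wl L0 eps e0; have D0 : 0 <= D := sqr_ge0 _.
pose theta := eps / (4 * (L + 1)).
have L1 : 0 < 4 * (L + 1) by rewrite mulr_gt0// ltr_wpDl.
have th0 : 0 < theta by rewrite divr_gt0.
have Lth : L * theta <= eps / 4.
  have : theta * (4 * (L + 1)) = eps by rewrite divfK// gt_eqF.
  by lra.
pose c := 2 * (L / theta).
have c0 : 0 <= c by rewrite mulr_ge0// divr_ge0// ltW.
pose M := D * c + 3 * D ^+ 2 + 1.
have M0 : 0 < M.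
  by apply: ltr_wpDl => //; apply: addr_ge0; apply: mulr_ge0 => //; exact: sqr_ge0.
exists (Num.min 1 (eps / (2 * M))).
  by rewrite lt_min ltr01 divr_gt0// mulr_gt0.
move=> t s x t0 s0; rewrite lt_min => /andP[s1 sM].
have := wq t s x (w t x + L * theta) 0 c 1 t0 s0 ltr01 => H.
have {}H : w (t + s) x <= w t x + L * theta + F c * s + 3 * 1 * D ^+ 2 * s ^+ 2.
  apply: H => y; have := wl t (x + y) x; rewrite addrAC subrr add0r ler_norml => /andP[_ hy].
  have y4 : 0 <= y ^+ 4 by rewrite -[4%N]/(2 * 2)%N exprM sqr_ge0.
  have y2 : y ^+ 2 = `|y| ^+ 2 by rewrite real_normK ?num_real.
  have hh : `|y| <= theta + y ^+ 2 / theta.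
    rewrite -(ler_pM2l th0).
    have -> : theta * (theta + y ^+ 2 / theta) = theta ^+ 2 + y ^+ 2.
      by field; rewrite gt_eqF.
    rewrite y2.
    have := sqr_ge0 (theta - `|y|); have := mulr_ge0 (ltW th0) (normr_ge0 y).
    by lra.
  have : L * `|y| <= L * (theta + y ^+ 2 / theta) by rewrite ler_wpM2l.
  have -> : c / 2 * y ^+ 2 = L * (y ^+ 2 / theta) by rewrite /c; field; rewrite gt_eqF.
  by lra.
have Fc : F c <= D / 2 * c by have [_] := Fa 0 c c0; rewrite add0r F0 add0r.
have Fcs : F c * s <= D / 2 * c * s by rewrite ler_wpM2r.
have ss : s ^+ 2 <= s by rewrite expr2 ler_piMl// ltW.
have D2s : D ^+ 2 * s ^+ 2 <= D ^+ 2 * s by rewrite ler_wpM2l// sqr_ge0.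
have Ms : M * s <= eps / 2.
  have -> : eps / 2 = M * (eps / (2 * M)) by field; rewrite gt_eqF.
  by rewrite ler_pM2l// ltW.
have Dcs : 0 <= D * c * s by do 2! apply: mulr_ge0 => //.
rewrite /M in Ms.
by lra.
Qed.

Lemma G0 : G 0 = 0.
Proof. by rewrite /Defs.G oppr0 !maxxx !mulr0 subrr mulr0. Qed.

Lemma Gc0 : Gc 0 = 0.
Proof. by rewrite /Gc oppr0 G0 oppr0. Qed.

Lemma Sg_time f L : bddf f -> lipf L f -> 0 <= L ->
  forall eps, 0 < eps -> exists2 delta, 0 < delta &
  forall t s x, 0 <= t -> 0 <= s -> `|t - s| < delta -> `|Sg t f x - Sg s f x| <= eps.
Proof.
move=> bf lf L0 eps e0.
have [d1 d10 h1] := @quartic_bound_time G (fun t => Sg t f) L (G_add h0 hs) G0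
  (Sg_quartic bf lf) (fun t => Sg_lipf t bf lf) L0 eps e0.
have lN t : lipf L (fun x => - Sg t f x).
  by apply: lipfN; exact: Sg_lipf.
have [d2 d20 h2] := @quartic_bound_time Gc (fun t x => - Sg t f x) L (Gc_add h0 hs) Gc0
  (Sg_quarticN bf lf) lN L0 eps e0.
exists (Num.min d1 d2); first by rewrite lt_min d10.
have main t s x : 0 <= t -> t <= s -> `|t - s| < Num.min d1 d2 ->
    `|Sg t f x - Sg s f x| <= eps.
  move=> t0 ts; rewrite lt_min distrC ger0_norm ?subr_ge0// => /andP[sd1 sd2].
  have st0 : 0 <= s - t by rewrite subr_ge0.
  have := h1 t (s - t) x t0 st0 sd1; have := h2 t (s - t) x t0 st0 sd2.
  rewrite addrC subrK => ? ?; rewrite ler_norml; apply/andP; split; lra.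
move=> t s x t0 s0 d; have [ts|/ltW st] := leP t s; first exact: main.
by rewrite distrC; apply: main => //; rewrite distrC.
Qed.

Lemma Sg_continuous f L : bddf f -> lipf L f -> 0 <= L ->
  {within [set z : R * R | 0 <= z.1], continuous (fun z => Sg z.1 f z.2)}.
Proof.
move=> bf lf L0; apply/subspace_continuousP => -[t x] /= t0.
apply/cvgrPdist_le => eps e0.
have e2 : 0 < eps / 2 by rewrite divr_gt0.
have [d d0 hd] := Sg_time bf lf L0 e2.
have L1 : 0 < L + 1 by rewrite ltr_wpDl.
rewrite near_withinE; near=> z => z0.
have zd : `|t - z.1| < d.
  near: z; apply: (@cvgr_dist_lt _ _ _ (nbhs (t, x)) _ (fun z : R * R => z.1) t) => //.
  exact: cvg_fst.
have zx : `|x - z.2| < eps / (2 * (L + 1)).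
  near: z; apply: (@cvgr_dist_lt _ _ _ (nbhs (t, x)) _ (fun z : R * R => z.2) x).
    exact: cvg_snd.
  by rewrite divr_gt0// mulr_gt0.
have -> : Sg t f x - Sg z.1 f z.2 = (Sg t f x - Sg z.1 f x) + (Sg z.1 f x - Sg z.1 f z.2) by ring.
apply: (le_trans (ler_normD _ _)).
have a1 := hd t z.1 x t0 z0 zd.
have a2 := Sg_lipf z.1 bf lf x z.2.
have a3 : L * `|x - z.2| <= eps / 2.
  apply: (@le_trans _ _ ((L + 1) * (eps / (2 * (L + 1))))).
    by apply: ler_pM => //; [rewrite lerDl|exact: ltW].
  by rewrite le_eqVlt; apply/orP; left; apply/eqP; field; rewrite gt_eqF.
by lra.
Unshelve. all: by end_near. Qed.

(** The derivatives are known to exist for t > 0 only, so joint continuity is transferred through a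
    neighbourhood of a point with positive time. *)
Lemma C12N psi : C12 psi -> [/\ C12 (fun t x => - psi t x),
  (forall t x, 0 < t -> d_t (fun t x => - psi t x) t x = - d_t psi t x)
  & (forall t x, 0 < t -> d_yy (fun t x => - psi t x) t x = - d_yy psi t x)].
Proof.
move=> C; pose psi' t x := - psi t x.
have tE t x : 0 < t -> d_t psi' t x = - d_t psi t x.
  by move=> t0; have [[h _ _] _] := C t x t0; rewrite /d_t -derive1N.
have yE t x : 0 < t -> d_y psi' t x = - d_y psi t x.
  by move=> t0; have [[_ h _] _] := C t x t0; rewrite /d_y -derive1N.
have yE' t : 0 < t -> d_y psi' t = - d_y psi t.
  by move=> t0; apply/funext => x; exact: yE.
have yyE t x : 0 < t -> d_yy psi' t x = - d_yy psi t x.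
  by move=> t0; have [[_ _ h] _] := C t x t0; rewrite /d_yy yE'// derive1N.
suff C' : C12 psi' by split; [exact: C'|exact: tE|exact: yyE].
move=> t x t0.
have [[h1 h2 h3] [c1 c2 c3 c4]] := C t x t0.
have jN (f g : R -> R -> R) : (forall t x, 0 < t -> g t x = - f t x) ->
    jointly_continuous_at f t x -> jointly_continuous_at g t x.
  move=> fg cf; rewrite /jointly_continuous_at /prop_for /continuous_at /= fg//.
  apply: (cvg_trans _ (cvgN cf)); apply: near_eq_cvg.
  near=> z; rewrite fg//=; near: z.
  by apply: (cvgr_gt t) => //; exact: cvg_fst.
split; split.
- exact: derivableN.
- exact: derivableN.
- rewrite (_ : d_y psi' t = - d_y psi t); last exact: yE'.
  exact: derivableN.
- exact: (jN psi).
- exact: (jN (d_t psi)).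
- exact: (jN (d_y psi)).
- exact: (jN (d_yy psi)).
Unshelve. all: by end_near. Qed.

Lemma visc_superP w : viscosity_supersolution sl sh w <-> visc_sub Gc (fun t x => - w t x).
Proof.
split=> vw psi t x C t0 h.
  have [C' tE yyE] := C12N C; have := vw _ t x C' t0; rewrite tE// yyE//.
  rewrite /Gc lerNr; apply; apply: filterS h => z /=; lra.
have [C' tE yyE] := C12N C.
have : - d_t psi t x <= Gc (- d_yy psi t x).
  by rewrite -tE// -yyE//; apply: vw => //; apply: filterS h => z /=; lra.
by rewrite /Gc opprK lerN2.
Qed.

Lemma Sg_visc f L : bddf f -> lipf L f -> 0 <= L ->
  viscosity_solution sl sh f (fun t => Sg t f).
Proof.
move=> bf lf L0; have [K fK] := bf; split.
- exact: Sg_continuous bf lf L0.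
- by exists K => t y _; exact: Sg_bound.
- by move=> y; rewrite Sg0.
- apply: (@quartic_visc_sub R D G (sqr_ge0 _) (G_add h0 hs) _ K).
    by move=> t y _; have := Sg_bound t y fK; rewrite ler_norml => /andP[].
  exact: Sg_quartic bf lf.
- apply/visc_superP; apply: (@quartic_visc_sub R D Gc (sqr_ge0 _) (Gc_add h0 hs) _ K).
    by move=> t y _; have := Sg_bound t y fK; rewrite ler_norml => /andP[? ?]; lra.
  exact: Sg_quarticN bf lf.
Qed.

(** [scheme_upper] and [scheme_lower] squeeze the scheme onto [w] at the grid times, so the scheme
    truly converges; the last hypothesis leads from the grid times below t to t. *)
Lemma Sg_unique f L w t x : lipf L f -> 0 <= L -> 0 <= t ->
  quartic_bound sh G w -> quartic_bound sh Gc (fun t x => - w t x) ->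
  (forall x, w 0 x = f x) ->
  (fun n => w ((grid_index t n)%:R * tstep R n) x) @ \oo --> w t x ->
  w t x = Sg t f x.
Proof.
move=> lf L0 t0 wq wq' wf cw; apply/esym; apply: ulim_cvg_oo.
have wf1 y : w 0 y <= f y by rewrite wf.
have wf2 y : f y <= w 0 y by rewrite wf.
apply/cvgrPdist_le => eps e0; have e2 : 0 < eps / 2 by rewrite divr_gt0.
have hu := scheme_upper h0 hs L0 lf wq wf1 t0 e2.
have hl := scheme_lower h0 hs L0 lf wq' wf2 t0 e2.
move/cvgrPdist_le : cw => /(_ _ e2) cw.
apply: filterS (filterI (filterI hu hl) cw) => n /= [[hu' hl'] h3].
have /andP[nt _] := grid_index_le n t0.
have h1 := hu' _ nt x; have h2 := hl' _ nt x.
by move: h3; rewrite !ler_distl => /andP[? ?]; apply/andP; split; lra.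
Qed.

Lemma visc_unique f L w t x : lipf L f -> 0 <= L -> 0 <= t ->
  viscosity_solution sl sh f w -> w t x = Sg t f x.
Proof.
move=> lf L0 t0 [cw [K wK] w0 wsub /visc_superP wsup].
have D0 : 0 <= D := sqr_ge0 _.
apply: (Sg_unique lf) => //.
- move=> t' s x' a b c d; apply: (@visc_sub_quartic R D G D0 (G_add h0 hs) w K) => //.
  by move=> u y u0; have := wK u y u0; rewrite ler_norml => /andP[].
- move=> t' s x' a b c d.
  apply: (@visc_sub_quartic R D Gc D0 (Gc_add h0 hs) (fun t x => - w t x) K) => //.
    by move=> z; exact: (cvgN (cw z)).
  by move=> u y u0; have := wK u y u0; rewrite ler_norml => /andP[? ?]; lra.
move/subspace_continuousP : cw => /(_ (t, x) t0) cw.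
apply: (@cvg_comp _ _ _ (fun n => ((grid_index t n)%:R * tstep R n, x)) (fun z : R * R => w z.1 z.2) _ (within [set z | 0 <= z.1] (nbhs (t, x)))) => // A.
rewrite /within /nbhs /= => hA.
have cc : ((grid_index t n)%:R * tstep R n, x) @[n --> \oo] --> (t, x).
  exact: (cvg_pair (grid_index_cvg t0) (cvg_cst x)).
have := cc _ hA; rewrite /nbhs/=; apply: filterS => n /=; apply.
by rewrite mulr_ge0// ltW// tstep_gt0.
Qed.

(** s |-> [Sg (t + s) f] satisfies both quartic bounds and starts from [Sg t f], so it is the
    solution with that initial value. *)
Lemma Sg_semigroup f L s t x : bddf f -> lipf L f -> 0 <= L -> 0 <= s -> 0 <= t ->
  Sg (t + s) f x = Sg s (Sg t f) x.
Proof.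
move=> bf lf L0 s0 t0.
apply: (@Sg_unique (Sg t f) L (fun s => Sg (t + s) f)) => //.
- exact: Sg_lipf.
- move=> t' s' x' a b c d t'0 s'0 d0 h; rewrite addrA.
  by apply: (Sg_quartic bf lf) h => //; rewrite addr_ge0.
- move=> t' s' x' a b c d t'0 s'0 d0 h; rewrite addrA.
  by apply: (Sg_quarticN bf lf) h => //; rewrite addr_ge0.
- by move=> y; rewrite addr0.
apply/cvgrPdist_le => eps e0; have [d d0 hd] := Sg_time bf lf L0 e0.
have := grid_index_cvg s0 => /cvgrPdist_lt/(_ _ d0).
apply: filterS => n hn; apply: hd.
- by rewrite addr_ge0.
- by rewrite addr_ge0// mulr_ge0// ltW// tstep_gt0.
- by rewrite opprD addrACA subrr add0r.
Qed.

(** The quartic bound with [a], [b] and [c] zero: the fourth-moment estimate of increments, stated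
    for bounded Lipschitz functions. *)
Lemma Sg_fourth f L t lam : bddf f -> lipf L f -> 0 <= t -> 0 < lam ->
  (forall y, f y <= lam * y ^+ 4) -> Sg t f 0 <= 3 * lam * D ^+ 2 * t ^+ 2.
Proof.
move=> bf lf t0 l0 fy.
have H : Sg (0 + t) f 0 <= 0 + G 0 * t + 3 * lam * D ^+ 2 * t ^+ 2.
  apply: (Sg_quartic bf lf (b := 0)) => // y; rewrite Sg0 add0r.
  by have := fy y; lra.
by rewrite G0 mul0r !add0r in H.
Qed.

End heat_semigroup.

(** * Conditional G-expectation of cylinder functions *)

Section paths.
Context (R : realType).
Implicit Types (w : Omega R) (q r s t y : R).

Lemma path_ext w w' : (forall t, B t w = B t w') -> w = w'.
Proof.
case: w w' => [f cf f0] [g cg g0] /= fg.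
have e : f = g by apply/funext => t; exact: fg.
by subst g; congr CPath; exact: Prop_irrelevance.
Qed.

Lemma B_le0 t w : t <= 0 -> B t w = 0.
Proof. exact: path_nonpos. Qed.

(** The maximum of r with 0 and the absolute value make the ramp vanish on the negative half-line
    and stay continuous for all r and r', so that [glue] is total. *)
Definition ramp r r' t : R := Num.max 0 (Num.min 1 ((t - Num.max r 0) / `|r' - r|)).

Lemma ramp_itv r r' t : 0 <= ramp r r' t <= 1.
Proof. by rewrite /ramp le_max lexx/= ge_max ler01 ge_min lexx. Qed.

Lemma ramp0 r r' t : 0 <= r -> t <= r -> ramp r r' t = 0.
Proof.
move=> r0 tr; rewrite /ramp (max_idPl r0).
suff h : (t - r) / `|r' - r| <= 0 by apply/max_idPl; rewrite ge_min h orbT.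
by rewrite mulr_le0_ge0 ?invr_ge0// subr_le0.
Qed.

Lemma ramp1 r r' t : 0 <= r -> r < r' -> r' <= t -> ramp r r' t = 1.
Proof.
move=> r0 rr' tr; rewrite /ramp (max_idPl r0).
rewrite (min_idPl _); first by apply/max_idPr.
rewrite ger0_norm ?subr_ge0 ?(ltW rr')// ler_pdivlMr ?subr_gt0//.
by rewrite mul1r lerD2r.
Qed.

Lemma ramp_continuous r r' : continuous (ramp r r').
Proof.
have c1 : continuous (fun t : R => (t - Num.max r 0) / `|r' - r|).
  by move=> s; apply: cvgM; [apply: cvgB; [exact: cvg_id | exact: cvg_cst] | exact: cvg_cst].
move=> s; have c2 (c : R) : {for s, continuous (cst c)} by exact: cvg_cst.
exact: (continuous_max (c2 0) (continuous_min (c2 1) (c1 s))).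
Qed.

(** A function without observation times strictly between r and r' sees [y] as the increment over
    [r, r']. *)
Definition glue_fun r r' w y t : R := B (Num.min t r) w + y * ramp r r' t.

Lemma glue_continuous r r' w y : continuous (glue_fun r r' w y).
Proof.
move=> t; apply: cvgD; first exact: (@stop_continuous R r w t).
apply: cvgM; first exact: cvg_cst.
exact: ramp_continuous.
Qed.

Lemma glue_nonpos r r' w y t : t <= 0 -> glue_fun r r' w y t = 0.
Proof.
move=> t0; rewrite /glue_fun B_le0 ?ge_min ?t0// add0r.
suff -> : ramp r r' t = 0 by rewrite mulr0.
suff h : (t - Num.max r 0) / `|r' - r| <= 0 by apply/max_idPl; rewrite ge_min h orbT.
by rewrite mulr_le0_ge0 ?invr_ge0// subr_le0 le_max t0 orbT.
Qed.

Definition glue r r' w y : Omega R :=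
  CPath (@glue_continuous r r' w y) (@glue_nonpos r r' w y).

Lemma B_glue q r r' w y : B q (glue r r' w y) = B (Num.min q r) w + y * ramp r r' q.
Proof. by []. Qed.

Lemma B_glue_le q r r' w y : 0 <= r -> q <= r -> B q (glue r r' w y) = B q w.
Proof. by move=> r0 qr; rewrite B_glue ramp0// mulr0 addr0 (min_idPl qr). Qed.

Lemma B_glue_ge q r r' w y : 0 <= r -> r < r' -> r' <= q ->
  B q (glue r r' w y) = B r w + y.
Proof.
move=> r0 rr' qr; rewrite B_glue ramp1// mulr1 (min_idPr _)//.
exact: le_trans (ltW rr') qr.
Qed.

Implicit Types (F : seq R) (X Y Z : Omega R -> R) (K M : R).

(* Bounded Lipschitz functions of the values of the path at the times in [F]. *)
Definition cyl F K M X := [/\ 0 <= K, (forall w, `|X w| <= M)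
  & forall w w', `|X w - X w'| <= K * \sum_(q <- F) `|B q w - B q w'|].

Lemma cyl_eq F K M X w w' : cyl F K M X -> (forall q, q \in F -> B q w = B q w') ->
  X w = X w'.
Proof.
move=> [_ _ h] e; apply/eqP; rewrite -subr_eq0 -normr_le0.
apply: (le_trans (h w w')); rewrite big_seq big1 ?mulr0// => q qF.
by rewrite e// subrr normr0.
Qed.

Lemma cyl_glue_lipf F K M X r r' w : cyl F K M X ->
  lipf (K * (size F)%:R) (fun y => X (glue r r' w y)).
Proof.
move=> [K0 _ h] y y'; apply: (le_trans (h _ _)).
rewrite -mulrA ler_wpM2l//.
apply: (@le_trans _ _ (\sum_(q <- F) `|y - y'|)); last first.
  by rewrite big_const_seq count_predT iter_addr addr0 mulr_natl.
apply: ler_sum => q _; rewrite !B_glue opprD addrACA subrr add0r -mulrBl normrM.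
by have /andP[p0 p1] := ramp_itv r r' q; rewrite (ger0_norm p0) ler_piMr.
Qed.

Definition bddO X := exists M, forall w, `|X w| <= M.

Lemma cyl_bddO F K M X : cyl F K M X -> bddO X.
Proof. by move=> [_ h _]; exists M. Qed.

Lemma bddO_glue X r r' w : bddO X -> bddf (fun y => X (glue r r' w y)).
Proof. by move=> [M h]; exists M. Qed.

Lemma cyl_catl F F' K M X : cyl F K M X -> cyl (F ++ F') K M X.
Proof.
move=> [K0 h1 h2]; split => // w w'; apply: (le_trans (h2 _ _)).
by rewrite ler_wpM2l// big_cat lerDl sumr_ge0.
Qed.

Lemma cyl_catr F F' K M X : cyl F' K M X -> cyl (F ++ F') K M X.
Proof.
move=> [K0 h1 h2]; split => // w w'; apply: (le_trans (h2 _ _)).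
by rewrite ler_wpM2l// big_cat lerDr sumr_ge0.
Qed.

End paths.

(** * Backward operators on cylinder functions *)

Section G_expectation_cyl.
Context (R : realType) (sl sh : R) (h0 : 0 <= sl) (hs : sl <= sh).
Implicit Types (w : Omega R) (q r s t y : R).
Implicit Types (F l : seq R) (X Y Z : Omega R -> R) (K M : R).
Notation Sg := (Sg sl sh).

(** One step of the backward recursion, on path space instead of vectors of increments, so that time
    grids can change without a renumbering of variables. *)
Definition Op r r' X w : R := Sg (r' - r) (fun y => X (glue r r' w y)) 0.

Fixpoint EL r l X w : R := if l is r' :: l' then Op r r' (EL r' l' X) w else X w.

Lemma Op_bound r r' X M w : (forall w, `|X w| <= M) -> `|Op r r' X w| <= M.
Proof. by move=> h; exact: Sg_bound. Qed.

Lemma EL_bound r l X M w : (forall w, `|X w| <= M) -> `|EL r l X w| <= M.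
Proof. by move=> h; elim: l r w => //= r' l IH r w; exact: Op_bound. Qed.

Lemma EL_bddO r l X : bddO X -> bddO (EL r l X).
Proof. by move=> [M h]; exists M => w; exact: EL_bound. Qed.

Lemma EL_le r l X Y : bddO X -> bddO Y -> (forall w, X w <= Y w) ->
  forall w, EL r l X w <= EL r l Y w.
Proof.
move=> bX bY XY; elim: l r => //= r' l IH r w.
by apply: Sg_le => //; apply: bddO_glue; exact: EL_bddO.
Qed.

Lemma bddOD X Y : bddO X -> bddO Y -> bddO (fun w => X w + Y w).
Proof.
move=> [M fM] [N gN]; exists (M + N) => x.
by rewrite (le_trans (ler_normD _ _))// lerD.
Qed.

Lemma EL_sub r l X Y : bddO X -> bddO Y ->
  forall w, EL r l (fun w => X w + Y w) w <= EL r l X w + EL r l Y w.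
Proof.
move=> bX bY; elim: l r => //= r' l IH r w.
apply: (@le_trans _ _ (Op r r' (fun w => EL r' l X w + EL r' l Y w) w)).
  apply: Sg_le => [||y]; last exact: IH.
    by apply: bddO_glue; apply: EL_bddO; exact: bddOD.
  exact: (bddO_glue (X := fun w => EL r' l X w + EL r' l Y w) _ _ _ (bddOD (EL_bddO _ _ bX) (EL_bddO _ _ bY))).
by apply: Sg_sub; apply: bddO_glue; exact: EL_bddO.
Qed.

Definition past r X := forall w w', (forall q, q <= r -> B q w = B q w') -> X w = X w'.

Lemma past_glue r r1 r' X w y : past r X -> 0 <= r1 -> r <= r1 -> X (glue r1 r' w y) = X w.
Proof.
move=> pX r0 rr1; apply: pX => q qr; apply: B_glue_le => //.
exact: le_trans rr1.
Qed.

Lemma past_le r r' X : past r X -> r <= r' -> past r' X.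
Proof.
move=> pX rr' w w' e; apply: pX => q qr; apply: e; exact: le_trans rr'.
Qed.

Lemma EL_past_add r l X Y : 0 <= r -> path <%R r l -> bddO X -> past r Y ->
  EL r l (fun w => X w + Y w) = fun w => EL r l X w + Y w.
Proof.
move=> r0; elim: l r r0 => //= r' l IH r r0 /andP[rr' pl] bX pY.
apply/funext => w; rewrite /Op IH//; last first.
- exact: past_le (ltW rr').
- exact: le_trans (ltW rr').
rewrite -Sg_cst; last by apply: bddO_glue; exact: EL_bddO.
congr (Sg _ _ 0); apply/funext => y.
by rewrite (past_glue _ _ _ pY).
Qed.

Lemma EL_past_mul r l X Y : 0 <= r -> path <%R r l -> bddO X -> past r Y ->
  (forall w, 0 <= Y w) ->
  EL r l (fun w => Y w * X w) = fun w => Y w * EL r l X w.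
Proof.
move=> r0; elim: l r r0 => //= r' l IH r r0 /andP[rr' pl] bX pY Y0.
apply/funext => w; rewrite /Op IH//; last first.
- exact: past_le (ltW rr').
- exact: le_trans (ltW rr').
rewrite -Sg_hom//; last by apply: bddO_glue; exact: EL_bddO.
congr (Sg _ _ 0); apply/funext => y.
by rewrite (past_glue _ _ _ pY).
Qed.

Lemma cyl_past r F K M X : cyl F K M X -> {in F, forall q, q <= r} -> past r X.
Proof. by move=> cX Fr w w' e; apply: (cyl_eq cX) => q /Fr; exact: e. Qed.

Lemma EL_past r l X : 0 <= r -> path <%R r l -> past r X -> EL r l X = X.
Proof.
move=> r0; elim: l r r0 => //= r' l IH r r0 /andP[rr' pl] pX.
apply/funext => w; rewrite /Op IH//; last first.
- exact: past_le (ltW rr').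
- exact: le_trans (ltW rr').
rewrite (_ : (fun y => _) = fun=> X w) ?Sg_const//.
by apply/funext => y; rewrite (past_glue _ _ _ pX).
Qed.

Lemma Op_cyl r r' F K M X : cyl F K M X ->
  cyl (map (Num.min^~ r) F) K M (Op r r' X).
Proof.
move=> cX; have [K0 h1 h2] := cX; split => //.
  by move=> w; exact: Op_bound.
move=> w w'; apply: Sg_dist.
- exact/bddO_glue/cyl_bddO/cX.
- exact/bddO_glue/cyl_bddO/cX.
move=> y; apply: (le_trans (h2 _ _)); rewrite ler_wpM2l// big_map.
by apply: ler_sum => q _; rewrite !B_glue opprD addrACA subrr addr0.
Qed.

(** Times after r move to r because the glued path is stopped there; neither the Lipschitz constant
    nor the bound deteriorates, as the semigroup is a contraction. *)
Lemma EL_cyl r l F K M X : path <%R r l -> {in F, forall q, q <= r \/ q \in l} ->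
  cyl F K M X -> cyl (map (Num.min^~ r) F) K M (EL r l X).
Proof.
case: l => [_ Fr cX|r' l pl Fl cX] /=.
  rewrite (_ : map _ F = F)//; rewrite -[RHS]map_id; apply/eq_in_map => q qF.
  by have [h|//] := Fr _ qF; exact/min_idPl.
have : forall r l, path <%R r l -> l != [::] -> cyl (map (Num.min^~ r) F) K M (EL r l X).
  clear r r' l pl Fl => r l; elim: l r => //= r' l IH r /andP[rr' pl] _.
  have [->|l0] := eqVneq l [::]; first exact: Op_cyl.
  have := Op_cyl r r' (IH _ pl l0); rewrite -map_comp.
  rewrite (_ : map _ F = map (Num.min^~ r) F)//; apply: eq_map => q /=.
  by rewrite -minA (min_idPr (ltW rr')).
by move=> H; exact: (H r (r' :: l)).
Qed.

(** No observation time lies strictly between t and r, so only the total increment is seen and the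
    semigroup property merges the two steps. *)
Lemma Op_semigroup t q r F K M Z w : 0 <= t -> t < q -> q < r -> cyl F K M Z ->
  {in F, forall p, p <= t \/ r <= p} -> Op t q (Op q r Z) w = Op t r Z w.
Proof.
move=> t0 tq qr cZ Fp.
have q0 : 0 <= q by exact: le_trans (ltW tq).
have tr : t < r by exact: lt_trans qr.
pose g y := Z (glue t r w y).
have bg : bddf g by exact/bddO_glue/cyl_bddO/cZ.
have [K0 _ _] := cZ.
have lg : lipf (K * (size F)%:R) g by exact: cyl_glue_lipf cZ.
rewrite /Op -/g.
have -> : (fun y => Sg (r - q) (fun z => Z (glue q r (glue t q w y) z)) 0) = Sg (r - q) g.
  apply/funext => y; rewrite -[y in RHS]add0r -Sg_shift; congr (Sg _ _ 0).
  apply/funext => z; rewrite /g; apply: (cyl_eq cZ) => p /Fp[pt|rp].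
    rewrite !B_glue_le//; first exact: le_trans (ltW tq).
  rewrite !B_glue_ge//; first by rewrite addrA addrAC.
rewrite -(@Sg_semigroup R sl sh h0 hs g (K * (size F)%:R)) ?subr_ge0 ?(ltW tq) ?(ltW qr)//.
  by congr (Sg _ _ _); ring.
by rewrite mulr_ge0.
Qed.

(** Once the later steps are integrated out, the observation times are at most the point before q or
    equal to the one after it, so [Op_semigroup] removes q; if q is the last point, the function is
    already known before it. *)
Lemma EL_insert t l1 q l2 F K M X : 0 <= t -> path <%R t (l1 ++ q :: l2) ->
  cyl F K M X -> {in F, forall p, p <= t \/ p \in l1 ++ l2} ->
  EL t (l1 ++ q :: l2) X = EL t (l1 ++ l2) X.
Proof.
move=> t0; elim: l1 t t0 => [|a l1 IH] t t0 /=.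
  case: l2 => [|r l2] /= /andP[tq].
    move=> _ cX Ft; have pX : past t X.
      by apply: (cyl_past cX) => p /Ft[].
    by apply: (EL_past (l := [:: q])) => //=; rewrite tq.
  move=> /andP[qr pl] cX Ft; apply/funext => w.
  have cE : cyl (map (Num.min^~ r) F) K M (EL r l2 X).
    apply: EL_cyl => // p /Ft[pt|].
      by left; apply: (le_trans pt); apply: ltW; exact: lt_trans qr.
    by rewrite inE => /orP[/eqP->|]; [left|right].
  apply: (Op_semigroup w t0 tq qr cE) => p /mapP[p' /Ft[p't|p'l] ->].
    by left; rewrite ge_min p't.
  right; rewrite le_min lexx andbT.
  move: p'l; rewrite inE => /orP[/eqP->//|p'l].
  by have /allP/(_ _ p'l)/ltW := order_path_min lt_trans pl.
move=> /andP[ta pl] cX Ft; apply/funext => w; congr (Sg _ _ 0).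
have a0 : 0 <= a by exact: le_trans (ltW ta).
rewrite IH//; move=> p /Ft[pt|]; first by left; exact: le_trans (ltW ta).
by rewrite inE => /orP[/eqP->|]; [left|right].
Qed.

Lemma EL_subseq t l l' F K M X : 0 <= t -> path <%R t l' -> subseq l l' ->
  cyl F K M X -> {in F, forall p, p <= t \/ p \in l} -> EL t l' X = EL t l X.
Proof.
move=> t0 pl sl' cX Fl.
suff H l1 : path <%R t (l1 ++ l') -> {in F, forall p, p <= t \/ p \in l1 ++ l} ->
    EL t (l1 ++ l') X = EL t (l1 ++ l) X by exact: (H [::]).
elim: l' l l1 {pl Fl} sl' => [|a l' IH] l l1.
  by rewrite subseq0 => /eqP ->.
case: l => [|b l] /=.
  move=> _ pl Fl; rewrite (EL_insert t0 pl cX).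
    apply: IH => //; first by rewrite sub0seq.
    by apply: (subseq_path lt_trans _ pl); apply: cat_subseq => //; exact: subseq_cons.
  by move=> p /Fl[|]; [left|rewrite cats0 mem_cat; right; apply/orP; left].
case: eqP => [->|ba] sll pl Fl.
  by rewrite -!cat_rcons; apply: IH => //; rewrite cat_rcons.
rewrite (EL_insert t0 pl cX).
  apply: IH => //.
  by apply: (subseq_path lt_trans _ pl); apply: cat_subseq => //; exact: subseq_cons.
move=> p /Fl[|]; [by left|rewrite !mem_cat => /orP[->|pb]; right => //].
by apply/orP; right; exact: (mem_subseq sll).
Qed.

Definition grid t F := sort <=%R (undup [seq q <- F | t < q]).

Lemma mem_grid t F q : (q \in grid t F) = (t < q) && (q \in F).
Proof. by rewrite mem_sort mem_undup mem_filter. Qed.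

Lemma grid_path t F : path <%R t (grid t F).
Proof.
rewrite path_min_sorted; first by rewrite sort_lt_sorted undup_uniq.
by apply/allP => q; rewrite mem_grid => /andP[].
Qed.

Lemma grid_cover t F q : q \in F -> q <= t \/ q \in grid t F.
Proof.
by move=> qF; have [qt|tq] := leP q t; [left|right; rewrite mem_grid tq].
Qed.

Lemma sorted_subseq t l u : path <%R t l -> path <%R t u -> {subset l <= u} ->
  subseq l u.
Proof.
move=> pl pu lu; suff -> : l = [seq q <- u | q \in l] by exact: filter_subseq.
apply: lt_sorted_eq; first exact: path_sorted pl.
  by apply: sorted_filter; [exact: lt_trans | exact: path_sorted pu].
move=> q; rewrite mem_filter; apply/idP/idP => [ql|/andP[]//].
by rewrite ql lu.
Qed.

Lemma path_gt t l q : path <%R t l -> q \in l -> t < q.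
Proof. by move=> pl ql; have /allP := order_path_min lt_trans pl; apply. Qed.

Lemma path_rcons_lt s l t q : path <%R s (rcons l t) -> q \in l -> q < t.
Proof.
elim: l s => //= a l IH s /andP[_ pl]; rewrite inE => /orP[/eqP ->|]; last exact: IH pl.
by apply: path_gt pl _; rewrite mem_rcons inE eqxx.
Qed.

Definition is_cyl X := exists F K M, cyl F K M X.

(** A choice of observation times; by [EopE] the operator built from it depends on the function
    alone. *)
Definition times X : seq R :=
  if pselect (is_cyl X) is left h then sval (cid h) else [::].

Lemma timesP X : is_cyl X -> exists K M, cyl (times X) K M X.
Proof. by move=> h; rewrite /times; case: pselect => // h'; case: cid. Qed.

Lemma is_cyl_bddO X : is_cyl X -> bddO X.
Proof. by move=> [F [K [M /cyl_bddO]]]. Qed.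

(* The conditional [G]-expectation at time [t]; [condE_Lip_Eop] compares it with [condE_Lip]. *)
Definition Eop t X : Omega R -> R := EL t (grid t (times X)) X.

(** Both grids are compared with a common refinement by [EL_subseq]. *)
Lemma EopE t l F K M X : 0 <= t -> path <%R t l -> cyl F K M X ->
  {in F, forall q, q <= t \/ q \in l} -> Eop t X = EL t l X.
Proof.
move=> t0 pl cX Fl; pose u := grid t (l ++ times X).
have pu : path <%R t u by exact: grid_path.
have [K' [M' cX']] : exists K M, cyl (times X) K M X by apply: timesP; exists F, K, M.
have sg : subseq (grid t (times X)) u.
  apply: (sorted_subseq (grid_path _ _) pu) => q.
  by rewrite !mem_grid mem_cat => /andP[-> ->]; rewrite orbT.
rewrite /Eop -(EL_subseq t0 pu sg cX'); last by move=> q; exact: grid_cover.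
apply: (EL_subseq t0 pu _ cX Fl); apply: (sorted_subseq pl pu) => q ql.
by rewrite mem_grid mem_cat ql (path_gt pl).
Qed.

Lemma Eop_common t X Y Z F K M : 0 <= t -> is_cyl X -> is_cyl Y -> cyl F K M Z ->
  {subset F <= times X ++ times Y} ->
  exists l, [/\ path <%R t l, Eop t X = EL t l X, Eop t Y = EL t l Y & Eop t Z = EL t l Z].
Proof.
move=> t0 cX cY cZ FXY; have [K1 [M1 hX]] := timesP cX; have [K' [M' hY]] := timesP cY.
have pg := grid_path t (times X ++ times Y).
exists (grid t (times X ++ times Y)); split => //.
- apply: (EopE t0 pg hX) => q qX; apply: grid_cover; by rewrite mem_cat qX.
- apply: (EopE t0 pg hY) => q qX; apply: grid_cover; by rewrite mem_cat qX orbT.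
- by apply: (EopE t0 pg cZ) => q /FXY; exact: grid_cover.
Qed.

Lemma cyl_cst c : cyl [::] 0 `|c| (fun _ : Omega R => c).
Proof. by split => // *; rewrite subrr normr0 mul0r. Qed.

Lemma is_cyl_cst c : is_cyl (fun _ : Omega R => c).
Proof. by exists [::], 0, `|c|; exact: cyl_cst. Qed.

Lemma cylD F K M X F' K' M' Y : cyl F K M X -> cyl F' K' M' Y ->
  cyl (F ++ F') (K + K') (M + M') (fun w => X w + Y w).
Proof.
move=> /(cyl_catl F')[K0 h1 h2] /(cyl_catr F)[K'0 h1' h2']; split.
- exact: addr_ge0.
- by move=> w; rewrite (le_trans (ler_normD _ _))// lerD.
move=> w w'; rewrite opprD addrACA (le_trans (ler_normD _ _))//.
by rewrite mulrDl lerD.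
Qed.

Lemma cylM F K M X F' K' M' Y : cyl F K M X -> cyl F' K' M' Y ->
  cyl (F ++ F') (K * M' + M * K') (M * M') (fun w => X w * Y w).
Proof.
move=> /(cyl_catl F')[K0 h1 h2] /(cyl_catr F)[K'0 h1' h2'].
have M0 : 0 <= M by exact: le_trans (h1 (zero_path R)).
have M'0 : 0 <= M' by exact: le_trans (h1' (zero_path R)).
split.
- by rewrite addr_ge0// mulr_ge0.
- by move=> w; rewrite normrM ler_pM.
move=> w w'; have -> : X w * Y w - X w' * Y w' = (X w - X w') * Y w + X w' * (Y w - Y w') by ring.
rewrite (le_trans (ler_normD _ _))// !normrM mulrDl.
by apply: lerD; [rewrite mulrAC; apply: ler_pM | rewrite -mulrA; apply: ler_pM].
Qed.

Lemma cyl_comp F K M X (g : R -> R) L N : 0 <= L -> lipf L g -> (forall x, `|x| <= M -> `|g x| <= N) ->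
  cyl F K M X -> cyl F (L * K) N (fun w => g (X w)).
Proof.
move=> L0 lg gN [K0 h1 h2]; split; [exact: mulr_ge0 | by move=> w; exact: gN|].
by move=> w w'; rewrite (le_trans (lg _ _))// -mulrA ler_wpM2l.
Qed.

Lemma is_cylD X Y : is_cyl X -> is_cyl Y -> is_cyl (fun w => X w + Y w).
Proof. by move=> [F [K [M c]]] [F' [K' [M' c']]]; eexists _, _, _; exact: cylD c c'. Qed.

Lemma is_cylM X Y : is_cyl X -> is_cyl Y -> is_cyl (fun w => X w * Y w).
Proof. by move=> [F [K [M c]]] [F' [K' [M' c']]]; eexists _, _, _; exact: cylM c c'. Qed.

Lemma is_cylZ a X : is_cyl X -> is_cyl (fun w => a * X w).
Proof. exact/is_cylM/is_cyl_cst. Qed.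

Lemma Eop_bound t X M w : (forall w, `|X w| <= M) -> `|Eop t X w| <= M.
Proof. exact: EL_bound. Qed.

Lemma Eop_le t X Y : 0 <= t -> is_cyl X -> is_cyl Y -> (forall w, X w <= Y w) ->
  forall w, Eop t X w <= Eop t Y w.
Proof.
move=> t0 cX cY XY; have s0 : {subset [::] <= times X ++ times Y} by [].
have [l [_ -> -> _]] := Eop_common t0 cX cY (cyl_cst 0) s0.
by apply: EL_le => //; exact: is_cyl_bddO.
Qed.

Lemma Eop_sub t X Y : 0 <= t -> is_cyl X -> is_cyl Y ->
  forall w, Eop t (fun w => X w + Y w) w <= Eop t X w + Eop t Y w.
Proof.
move=> t0 cX cY; have [K [M hX]] := timesP cX; have [K' [M' hY]] := timesP cY.
have [//|l [_ -> -> ->]] := Eop_common t0 cX cY (cylD hX hY).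
by apply: EL_sub; exact: is_cyl_bddO.
Qed.

Lemma Eop_past_add t X Y : 0 <= t -> is_cyl X -> is_cyl Y -> past t Y ->
  Eop t (fun w => X w + Y w) = fun w => Eop t X w + Y w.
Proof.
move=> t0 cX cY pY; have [K [M hX]] := timesP cX; have [K' [M' hY]] := timesP cY.
have [//|l [pl -> _ ->]] := Eop_common t0 cX cY (cylD hX hY).
by apply: EL_past_add => //; exact: is_cyl_bddO.
Qed.

Lemma Eop_past_mul t X Y : 0 <= t -> is_cyl X -> is_cyl Y -> past t Y ->
  (forall w, 0 <= Y w) -> Eop t (fun w => Y w * X w) = fun w => Y w * Eop t X w.
Proof.
move=> t0 cX cY pY Y0; have [K [M hX]] := timesP cX; have [K' [M' hY]] := timesP cY.
have [//|l [pl _ -> ->]] := Eop_common t0 cY cX (cylM hY hX).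
by apply: EL_past_mul => //; exact: is_cyl_bddO.
Qed.

Lemma Eop_hom t a X : 0 <= t -> is_cyl X -> 0 <= a ->
  Eop t (fun w => a * X w) = fun w => a * Eop t X w.
Proof. by move=> t0 cX a0; apply: Eop_past_mul => //; exact: is_cyl_cst. Qed.

Lemma Eop_past t X : 0 <= t -> past t X -> Eop t X = X.
Proof. by move=> t0 pX; apply: EL_past => //; exact: grid_path. Qed.

Lemma Eop_cyl t F K M X : 0 <= t -> cyl F K M X ->
  cyl (map (Num.min^~ t) F) K M (Eop t X).
Proof.
move=> t0 cX; rewrite (EopE t0 (grid_path t F) cX); last by move=> q; exact: grid_cover.
by apply: EL_cyl => //; [exact: grid_path | move=> q; exact: grid_cover].
Qed.

Lemma Eop_is_cyl t X : 0 <= t -> is_cyl X -> is_cyl (Eop t X).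
Proof. by move=> t0 [F [K [M c]]]; exists (map (Num.min^~ t) F), K, M; exact: Eop_cyl. Qed.

Lemma past_Eop t X : 0 <= t -> is_cyl X -> past t (Eop t X).
Proof.
move=> t0 [F [K [M c]]]; apply: (cyl_past (Eop_cyl t0 c)) => q /mapP[p _ ->].
by rewrite ge_min lexx orbT.
Qed.

Lemma EL_cat s l1 t l2 X : EL s (l1 ++ t :: l2) X = EL s (rcons l1 t) (EL t l2 X).
Proof. by elim: l1 s => //= a l1 IH s; rewrite IH. Qed.

(** The time t is added to the grid starting at s and the grid is split there; its later part
    computes [Eop t X]. *)
Lemma Eop_tower s t X : 0 <= s -> s <= t -> is_cyl X -> Eop s (Eop t X) = Eop s X.
Proof.
move=> s0; rewrite le_eqVlt => /orP[/eqP <-|st] cX.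
  by rewrite (Eop_past s0)//; exact: past_Eop.
have t0 : 0 <= t by exact: le_trans (ltW st).
have [K [M hX]] := timesP cX; pose u := grid s (t :: times X).
have pu : path <%R s u by exact: grid_path.
have tu : t \in u by rewrite mem_grid st inE eqxx.
have Fu q : q \in times X -> q <= s \/ q \in u.
  by move=> qX; apply: grid_cover; rewrite inE qX orbT.
rewrite (EopE s0 pu hX Fu).
case/splitPr: tu pu Fu => l1 l2 pu Fu; rewrite EL_cat.
move: (pu); rewrite cat_path /= => /and3P[p1 lt1 p2].
have l1t q : q \in l1 -> q < t.
  move=> ql; move: pu; rewrite -cat1s catA cat_path => /andP[+ _].
  by rewrite cats1 => h; exact: path_rcons_lt h ql.
have prc : path <%R s (rcons l1 t) by rewrite rcons_path p1.
have E2 : Eop t X = EL t l2 X.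
  apply: (EopE t0 p2 hX) => q /Fu[qs|]; first by left; exact: le_trans (ltW st).
  rewrite mem_cat inE => /or3P[/l1t/ltW|/eqP ->|]; [by left|by left|by right].
rewrite -E2; apply: (EopE s0 prc (Eop_cyl t0 hX)) => _ /mapP[q /Fu qq ->].
rewrite mem_rcons inE; case: qq => [qs|]; first by left; rewrite ge_min qs.
rewrite mem_cat inE => /or3P[ql|/eqP ->|ql].
- by right; rewrite (min_idPl (ltW (l1t _ ql))) ql orbT.
- by right; rewrite minxx eqxx.
- by right; rewrite (min_idPr (ltW (path_gt p2 ql))) eqxx.
Qed.

Lemma past0 X w w' : past 0 X -> X w = X w'.
Proof. by move=> pX; apply: pX => q q0; rewrite !B_le0. Qed.

Lemma is_cyl_incr s t f L M : 0 <= L -> lipf L f -> (forall x, `|f x| <= M) ->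
  cyl [:: s; t] L M (fun w => f (B t w - B s w)).
Proof.
move=> L0 lf fM; split => // w w'; apply: (le_trans (lf _ _)).
rewrite ler_wpM2l// !big_cons big_nil addr0.
have -> : B t w - B s w - (B t w' - B s w') = (B t w - B t w') - (B s w - B s w') by ring.
by rewrite (le_trans (ler_normB _ _))// addrC.
Qed.

Lemma Eop_incr s t f L M w : 0 <= s -> s < t -> 0 <= L -> lipf L f -> (forall x, `|f x| <= M) ->
  Eop 0 (fun w => f (B t w - B s w)) w = Sg (t - s) f 0.
Proof.
move=> s0 st L0 lf fM; have cX := is_cyl_incr s t L0 lf fM.
rewrite -(Eop_tower (lexx 0) s0); last by eexists _, _, _; exact: cX.
have -> : Eop s (fun w => f (B t w - B s w)) = fun=> Sg (t - s) f 0.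
  rewrite (@EopE s [:: t] _ _ _ _ s0 _ cX)/= ?st//.
    apply/funext => {}w; rewrite /Op; congr (Sg _ _ 0); apply/funext => y.
    by rewrite B_glue_ge// B_glue_le// addrAC subrr add0r.
  by move=> q; rewrite !inE => /orP[/eqP ->|->]; [left|right].
by rewrite Eop_past.
Qed.

End G_expectation_cyl.

(** * Agreement with the definition through increments *)

Section lip.
Context (R : realType) (sl sh : R) (h0 : 0 <= sl) (hs : sl <= sh).
Implicit Types (w : Omega R) (q r s t y : R).
Implicit Types (F l : seq R) (X Y Z : Omega R -> R) (K M : R).

Lemma rV_norm_sum m (x : 'rV[R]_m) : `|x| <= \sum_(i < m) `|x 0 i|.
Proof.
rewrite [leLHS]mx_normrE; apply: bigmax_le; first exact: sumr_ge0.
move=> [i j] _ /=; rewrite (ord1 i) (bigD1 j)//= lerDl.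
exact: sumr_ge0.
Qed.

Lemma rV_coord_norm m (x : 'rV[R]_m) i : `|x 0 i| <= `|x|.
Proof.
rewrite [leRHS]mx_normrE; exact: (@le_bigmax _ _ _ 0 (fun ij : 'I_1 * 'I_m => `|x ij.1 ij.2|) (ord0, i)).
Qed.

Lemma bounded_lipschitzP m (phi : 'rV[R]_m -> R) : bounded_lipschitz phi <->
  (exists M, forall x, `|phi x| <= M) /\
  (exists2 L, 0 <= L & forall x y : 'rV[R]_m, `|phi x - phi y| <= L * `|x - y|).
Proof.
split=> [[[M [Mr hM]] hL]|[[M hM] [L L0 hL]]].
  split; first by exists (M + 1) => x; apply: (hM (M + 1)) => //; rewrite ltrDl.
  case: hL => L [Lr h]; exists (`|L| + 1); first by rewrite addr_ge0.
  move=> x y; apply: (h (`|L| + 1) _ (x, y)) => //.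
  by rewrite (le_lt_trans (ler_norm _))// ltrDl.
split.
  exists M; split; first exact: num_real.
  by move=> x Mx y _; apply: le_trans (hM y) (ltW Mx).
exists L; split; first exact: num_real.
move=> K LK [x y] _ /=; apply: (le_trans (hL x y)).
by rewrite ler_wpM2r// ltW.
Qed.

Definition cylT (T : \bar R) X :=
  exists F K M, cyl F K M X /\ {in F, forall q, 0 <= q /\ (q%:E <= T)%E}.

Lemma cylT_cyl T X : cylT T X -> is_cyl X.
Proof. by move=> [F [K [M [c _]]]]; exists F, K, M. Qed.

(** For the converse, X is extended from observed vectors to all vectors by McShane's formula inf_w
    (X w + K dist), which is bounded below only and hence cut off at M. *)
Lemma LipP (T : \bar R) X : (0 <= T)%E -> Lip T X <-> cylT T X.
Proof.
move=> T0; split=> [[m [s [phi [m0 sT /bounded_lipschitzP[[M hM] [L L0 hL]] ->]]]]|].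
  exists [seq s i | i <- enum 'I_m], L, M; split; last by move=> q /mapP[i _ ->].
  split => // w w'; apply: (le_trans (hL _ _)); rewrite ler_wpM2l//.
  apply: (le_trans (rV_norm_sum _)); rewrite big_map big_enum /=.
  by apply: ler_sum => i _; rewrite !mxE.
move=> [F [K [M [cX FT]]]].
(* [Lip] asks for at least one time; an empty list is replaced by time 0. *)
wlog F0 : F cX FT / (0 < size F)%N.
  move=> H; case: F cX FT => [|q F] cX FT; last exact: (H (q :: F)).
  apply: (H [:: 0]) => //; first exact: (cyl_catr [:: 0] cX).
  by move=> q; rewrite inE => /eqP ->; rewrite lexx.
have [K0 XM XK] := cX.
pose m := size F; pose s (i : 'I_m) := nth 0 F i.
pose Bs w : 'rV[R]_m := \row_i B (s i) w.
pose dist (x : 'rV[R]_m) w := \sum_(i < m) `|x 0 i - B (s i) w|.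
pose A x := [set X w + K * dist x w | w in setT].
have distB w w' : dist (Bs w) w' = \sum_(q <- F) `|B q w - B q w'|.
  rewrite (big_nth 0) big_mkord; apply: eq_bigr => i _; by rewrite mxE.
have A_lb x : has_lbound (A x).
  exists (- M) => _ [w _ <-]; rewrite -[- M]addr0 lerD//.
    by have := XM w; rewrite ler_norml => /andP[].
  by rewrite mulr_ge0// sumr_ge0.
have A0 x : A x !=set0 by exists (X (zero_path R) + K * dist x (zero_path R)), (zero_path R).
pose psi x := inf (A x).
have psiB w : psi (Bs w) = X w.
  apply/eqP; rewrite eq_le; apply/andP; split.
    apply: ge_inf => //; exists w => //.
    by rewrite distB big1 ?mulr0 ?addr0// => q _; rewrite subrr normr0.
  apply: lb_le_inf => // _ [w' _ <-]; rewrite distB.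
  by have := XK w w'; rewrite ler_norml => /andP[_ ?]; lra.
have M0 : 0 <= M by exact: le_trans (XM (zero_path R)).
have psi_lb x : - M <= psi x.
  apply: lb_le_inf => // _ [w _ <-]; rewrite -[- M]addr0 lerD//.
    by have := XM w; rewrite ler_norml => /andP[].
  by rewrite mulr_ge0// sumr_ge0.
have psi_le (x y : 'rV[R]_m) : psi x <= psi y + K * m%:R * `|x - y|.
  rewrite -lerBlDr; apply: lb_le_inf => // _ [w _ <-]; rewrite lerBlDr.
  apply: (@le_trans _ _ (X w + K * dist x w)); first by apply: ge_inf => //; exists w.
  rewrite -addrA lerD2l -mulrA -mulrDr ler_wpM2l//.
  apply: (@le_trans _ _ (\sum_(i < m) (`|y 0 i - B (s i) w| + `|x - y|))).
    apply: ler_sum => i _.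
    have -> : x 0 i - B (s i) w = (x - y) 0 i + (y 0 i - B (s i) w).
      by rewrite !mxE; ring.
    rewrite (le_trans (ler_normD _ _))// [leRHS]addrC lerD2r.
    exact: rV_coord_norm.
  by rewrite big_split /= sumr_const card_ord mulr_natl.
exists m, s, (fun x => Num.min M (psi x)); split => //.
- by move=> i; apply: FT; exact: mem_nth.
- apply/bounded_lipschitzP; split.
    exists M => x; rewrite ler_norml le_min psi_lb ge_min lexx !andbT.
    by lra.
  exists (K * m%:R); first by rewrite mulr_ge0.
  move=> x y; have h1 := psi_le x y; have h2 := psi_le y x; rewrite distrC in h2.
  have h3 : 0 <= K * m%:R * `|x - y| by rewrite !mulr_ge0.
  by rewrite ler_norml; case: (leP M (psi x)) => ?; case: (leP M (psi y)) => ?; apply/andP; split; lra.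
apply/funext => w; rewrite -/(Bs w) psiB; apply/esym/min_idPr.
by have := XM w; rewrite ler_norml => /andP[].
Qed.

Lemma is_cylT X : is_cyl X -> cylT +oo X.
Proof.
move=> [F [K [M [K0 h1 h2]]]]; exists [seq q <- F | 0 <= q], K, M; split.
  split => // w w'; rewrite big_filter.
  apply: (le_trans (h2 w w')); rewrite ler_wpM2l// [leLHS](bigID (fun q => 0 <= q))/=.
  rewrite [X in _ + X]big1 ?addr0// => q; rewrite -ltNge => /ltW q0.
  by rewrite !B_le0// subrr normr0.
by move=> q; rewrite mem_filter => /andP[-> _]; rewrite leey.
Qed.

Lemma cylT_Eop t X : 0 <= t -> is_cyl X -> cylT t%:E (Eop sl sh t X).
Proof.
move=> t0 /is_cylT[F [K [M [cX FT]]]].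
exists (map (Num.min^~ t) F), K, M; split; first exact: Eop_cyl.
move=> _ /mapP[q /FT[q0 _] ->]; rewrite le_min q0 t0; split => //.
by rewrite lee_fin ge_min lexx orbT.
Qed.

Lemma cylT_past t X : cylT t%:E X -> past t X.
Proof.
move=> [F [K [M [cX FT]]]]; apply: (cyl_past cX) => q /FT[_].
by rewrite lee_fin.
Qed.

Lemma snoc_last i (x : 'rV[R]_i) y : snoc x y 0 ord_max = y.
Proof. by rewrite mxE unlift_none. Qed.

Lemma snoc_widen i (x : 'rV[R]_i) y (k : 'I_i) : snoc x y 0 (lift ord_max k) = x 0 k.
Proof. by rewrite mxE liftK. Qed.

Section grid_of_times.
Variables (m : nat) (s : nat -> R).
Hypothesis s0 : s 0%N = 0.
Hypothesis s_inc : forall i, (i < m)%N -> s i < s i.+1.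

Lemma s_ltn i j : (i < j)%N -> (j <= m)%N -> s i < s j.
Proof.
elim: j => // j IH; rewrite ltnS leq_eqVlt => /orP[/eqP ->|ij] jm.
  exact: s_inc.
by apply: lt_trans (IH ij (ltnW jm)) (s_inc jm).
Qed.

Lemma s_le i j : (i <= j)%N -> (j <= m)%N -> s i <= s j.
Proof. by rewrite leq_eqVlt => /orP[/eqP -> //|ij jm]; exact/ltW/s_ltn. Qed.

Lemma s_ge0 i : (i <= m)%N -> 0 <= s i.
Proof. by case: i => [|i] im; [rewrite s0|rewrite -s0; apply/ltW/s_ltn]. Qed.

Lemma increments_eq i w w' : increments s i w = increments s i w' <->
  forall k, (k <= i)%N -> B (s k) w = B (s k) w'.
Proof.
split=> [e|e]; last first.
  by apply/rowP => k; rewrite !mxE !e//; exact: ltnW.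
elim=> [|k IH] ki; first by rewrite s0 !B_le0.
have := congr1 (fun x : 'rV_i => x 0 (Ordinal ki)) e; rewrite !mxE/= IH ?(ltnW ki)//.
by move=> h; lra.
Qed.

Lemma increments_glue i w y : (i < m)%N ->
  increments s i.+1 (glue (s i) (s i.+1) w y) = snoc (increments s i w) y.
Proof.
move=> im; have si := s_ge0 (ltnW im).
apply/rowP => k; case: (unliftP ord_max k) => [k' ->|->].
  rewrite snoc_widen !mxE lift_max !B_glue_le//.
    by apply: s_le; [exact: ltnW (ltn_ord k')|exact: ltnW].
  by apply: s_le; [exact: ltn_ord|exact: ltnW].
have E w' (j : 'I_i.+1) : increments s i.+1 w' 0 j = B (s j.+1) w' - B (s j) w' by rewrite mxE.
rewrite snoc_last E (B_glue_ge _ _ si (s_inc im))// (B_glue_le _ _ _ si)//=.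
by rewrite addrAC subrr add0r.
Qed.

(** Successive gluing realises any increments, so a function on vectors can be read off from one on
    paths. *)
Lemma increments_surj i (x : 'rV[R]_i) : (i <= m)%N -> exists w, increments s i w = x.
Proof.
elim: i x => [|i IH] x im; first by exists (zero_path R); apply/rowP => -[].
pose x' : 'rV[R]_i := \row_(k < i) x 0 (lift ord_max k).
have [w hw] := IH x' (ltnW im).
exists (glue (s i) (s i.+1) w (x 0 ord_max)); rewrite increments_glue// hw.
apply/rowP => k; case: (unliftP ord_max k) => [k' ->|->].
  by rewrite snoc_widen mxE.
by rewrite snoc_last.
Qed.

Definition stimes i := [seq s k | k <- iota i.+1 (m - i)].

Lemma stimesE i : (i < m)%N -> stimes i = s i.+1 :: stimes i.+1.
Proof. by move=> im; rewrite /stimes -(subnSK im). Qed.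

Lemma stimes_m : stimes m = [::]. Proof. by rewrite /stimes subnn. Qed.

Lemma stimes_path i : (i <= m)%N -> path <%R (s i) (stimes i).
Proof.
move=> im; rewrite -(subKn im); elim: (m - i)%N (leq_subr i m) => [|k IH] km.
  by rewrite subn0 stimes_m.
have km' : (m - k.+1 < m)%N by rewrite ltn_subrL (leq_trans _ km).
rewrite stimesE//= s_inc// subnSK//; exact: IH (ltnW km).
Qed.

Lemma mem_stimes i k : (i < k <= m)%N -> s k \in stimes i.
Proof.
move=> /andP[ik km]; apply/mapP; exists k => //.
by rewrite mem_iota ik /= addSn subnKC ?ltnS// ltnW// (leq_trans ik).
Qed.

Variables (X : Omega R -> R) (F : seq R) (K M : R).
Hypothesis cX : cyl F K M X.
Hypothesis FX : {in F, forall q, exists2 k, (k <= m)%N & q = s k}.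

Lemma stimes_cover i : (i <= m)%N -> {in F, forall q, q <= s i \/ q \in stimes i}.
Proof.
move=> im q /FX[k km ->]; have [ki|ik] := leqP k i.
  by left; move: ki; rewrite leq_eqVlt => /orP[/eqP ->//|ki]; exact/ltW/s_ltn.
by right; apply: mem_stimes; rewrite ik.
Qed.

Lemma Eop_stimes i : (i <= m)%N -> Eop sl sh (s i) X = EL sl sh (s i) (stimes i) X.
Proof.
move=> im; apply: (EopE h0 hs _ _ cX); [exact: s_ge0|exact: stimes_path|exact: stimes_cover].
Qed.

Lemma EL_stimes_inc i w w' : (i <= m)%N -> increments s i w = increments s i w' ->
  EL sl sh (s i) (stimes i) X w = EL sl sh (s i) (stimes i) X w'.
Proof.
move=> im /increments_eq e.
have c := EL_cyl sl sh (stimes_path im) (stimes_cover im) cX.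
apply: (cyl_eq c) => _ /mapP[q /FX[k km ->] ->].
have [ki|ik] := leqP k i.
  rewrite (min_idPl _); first exact: e.
  by move: ki; rewrite leq_eqVlt => /orP[/eqP ->//|ki]; exact/ltW/s_ltn.
by rewrite (min_idPr _); [exact: e|apply/ltW/s_ltn].
Qed.

End grid_of_times.

(** Downward induction from m: once [Phi i.+1] is known to be the backward operator, the next
    initial value is Lipschitz by [EL_cyl], so its viscosity solution is given by the semigroup. *)
Lemma condE_Lip_Eop t X Y : condE_Lip sl sh t X Y -> is_cyl X /\ Y = Eop sl sh t X.
Proof.
move=> [m [j [s [Phi [[s0 sinc jm st /bounded_lipschitzP[[M hM] [L L0 hL]]] [-> -> rec]]]]]].
pose F := [seq s k | k <- iota 0 m.+1].
(* Each of the m increments is a difference of two observed values, hence 2 L m. *)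
have cX : cyl F (2 * L * m%:R) M (fun w => Phi m (increments s m w)).
  split => [||w w'] //; first by rewrite !mulr_ge0.
  apply: (le_trans (hL _ _)); rewrite mulrAC -mulrA [2 * _]mulrC -!mulrA ler_wpM2l//.
  apply: (le_trans (rV_norm_sum _)).
  have hF k : (k <= m)%N -> `|B (s k) w - B (s k) w'| <= \sum_(q <- F) `|B q w - B q w'|.
    move=> km; rewrite big_map (bigD1_seq k) ?iota_uniq ?mem_iota ?ltnS//= lerDl.
    exact: sumr_ge0.
  apply: (@le_trans _ _ (\sum_(i < m) (2 * \sum_(q <- F) `|B q w - B q w'|))).
    apply: ler_sum => i _; rewrite !mxE.
    have -> : B (s i.+1) w - B (s i) w - (B (s i.+1) w' - B (s i) w') =
      (B (s i.+1) w - B (s i.+1) w') - (B (s i) w - B (s i) w') by ring.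
    rewrite (le_trans (ler_normB _ _))// mulrDl mul1r lerD// hF//.
    exact: ltnW.
  by rewrite sumr_const card_ord [leRHS]mulrA [leRHS]mulr_natr.
split; first by exists F, (2 * L * m%:R), M.
have FX : {in F, forall q, exists2 k, (k <= m)%N & q = s k}.
  by move=> q /mapP[k]; rewrite mem_iota /= ltnS => km ->; exists k.
set X' := fun w => _ in cX *.
rewrite -st (Eop_stimes s0 sinc cX FX jm).
have main d : (d <= m - j)%N -> forall w, Phi (m - d)%N (increments s (m - d) w) =
    EL sl sh (s (m - d)%N) (stimes m s (m - d)) X' w.
  elim: d => [|d IH] dm w; first by rewrite subn0 stimes_m.
  set i := (m - d.+1)%N.
  have im : (i < m)%N by rewrite /i ltn_subrL /= (leq_trans _ (leq_trans dm (leq_subr _ _))).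
  have iS : (m - d)%N = i.+1.
    by rewrite /i subnSK// (leq_trans dm)// leq_subr.
  have ji : (j <= i)%N.
    by rewrite -(subKn jm) leq_sub2l.
  rewrite stimesE//=.
  have [|u uv ->] := rec i _ (increments s i w); first by rewrite ji.
  have IH' y : Phi i.+1 (snoc (increments s i w) y) =
      EL sl sh (s i.+1) (stimes m s i.+1) X' (glue (s i) (s i.+1) w y).
    by rewrite -(increments_glue s0 sinc)// -iS IH// (ltnW dm).
  have c := EL_cyl sl sh (stimes_path sinc im) (stimes_cover sinc FX im) cX.
  have lf : lipf (2 * L * m%:R * (size [seq Num.min x (s i.+1) | x <- F])%:R)
      (fun y => Phi i.+1 (snoc (increments s i w) y)).
    move: (cyl_glue_lipf (s i) (s i.+1) w c) => H.
    by move=> y y'; rewrite !IH'; exact: H.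
  have K0 : 0 <= 2 * L * m%:R * (size [seq Num.min x (s i.+1) | x <- F])%:R.
    by apply: mulr_ge0 => //; case: cX.
  have si0 : 0 <= s i.+1 - s i by rewrite subr_ge0 ltW// sinc.
  rewrite (visc_unique h0 hs _ lf K0 si0 uv).
  by rewrite /Op; congr (Sg _ _ _ _ 0); apply/funext => y; exact: IH'.
apply/funext => w; have := main (m - j)%N (leqnn _) w.
by rewrite subKn.
Qed.

(** [Phi i] evaluates the backward operator at a chosen path with the given increments, which
    determine the value by [EL_stimes_inc]; t is put into the grid. *)
Lemma condE_Lip_exists t X : 0 <= t -> is_cyl X -> condE_Lip sl sh t X (Eop sl sh t X).
Proof.
move=> t0 /is_cylT[F [K [M [cX FT]]]].
pose l0 := grid 0 (t :: F); pose s k := nth 0 (0 :: l0) k; pose m := size l0.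
have s0 : s 0%N = 0 by [].
have pl0 : path <%R 0 l0 by exact: grid_path.
have sinc i : (i < m)%N -> s i < s i.+1.
  by move=> im; have /(pathP 0) := pl0; apply.
have mem_s q : q \in t :: F -> 0 <= q -> exists2 k, (k <= m)%N & q = s k.
  move=> qF; rewrite le_eqVlt => /orP[/eqP <-|q0]; first by exists 0%N.
  have : q \in l0 by rewrite mem_grid q0.
  by move=> /(nthP 0)[k km <-]; exists k.+1.
have FX : {in F, forall q, exists2 k, (k <= m)%N & q = s k}.
  by move=> q qF; apply: mem_s; [rewrite inE qF orbT|have [] := FT q qF].
have [j jm tj] := mem_s t (mem_head _ _) t0.
pose pathof i (x : 'rV[R]_i) : Omega R := xget (zero_path R) [set w | increments s i w = x].
have pathofK i x : (i <= m)%N -> increments s i (pathof i x) = x.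
  move=> im; rewrite /pathof; case: xgetP => // h.
  by have [w hw] := increments_surj s0 sinc x im; case: (h w).
pose Phi i (x : 'rV[R]_i) := EL sl sh (s i) (stimes m s i) X (pathof i x).
have PhiE i w : (i <= m)%N -> Phi i (increments s i w) = EL sl sh (s i) (stimes m s i) X w.
  move=> im; apply: (EL_stimes_inc s0 sinc cX FX im).
  exact: pathofK.
have [K0 XM XK] := cX.
exists m, j, s, Phi; split; split => //.
- apply/bounded_lipschitzP; split.
    by exists M => x; exact: EL_bound.
  exists (K * (size F)%:R * m%:R); first by rewrite !mulr_ge0.
  move=> x y; rewrite /Phi stimes_m /=; apply: (le_trans (XK _ _)).
  rewrite -!mulrA ler_wpM2l//.
  have hb k : (k <= m)%N -> `|B (s k) (pathof m x) - B (s k) (pathof m y)| <= m%:R * `|x - y|.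
    move=> km; apply: (@le_trans _ _ (k%:R * `|x - y|)); last by rewrite ler_wpM2r// ler_nat.
    elim: k km => [|k IH] km; first by rewrite s0 !B_le0// subrr normr0 mul0r.
    have E z : B (s k.+1) (pathof m z) = B (s k) (pathof m z) + z 0 (Ordinal km).
      have := congr1 (fun v : 'rV_m => v 0 (Ordinal km)) (pathofK m z (leqnn m)).
      by rewrite mxE /= => <-; ring.
    rewrite !E opprD addrACA (le_trans (ler_normD _ _))// -natr1 mulrDl mul1r.
    rewrite lerD ?IH ?(ltnW km)//.
    by have := rV_coord_norm (x - y) (Ordinal km); rewrite !mxE.
  apply: (@le_trans _ _ (\sum_(q <- F) (m%:R * `|x - y|))).
    rewrite big_seq [leRHS]big_seq; apply: ler_sum => q /FX[k km ->]; exact: hb.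
  by rewrite big_const_seq count_predT iter_addr addr0 [leRHS]mulr_natl.
- by apply/funext => w; rewrite PhiE// stimes_m.
- apply/funext => w; rewrite PhiE// tj.
  by rewrite (Eop_stimes s0 sinc cX FX jm).
move=> i /andP[ji im] x.
have E y : Phi i.+1 (snoc x y) = EL sl sh (s i.+1) (stimes m s i.+1) X (glue (s i) (s i.+1) (pathof i x) y).
  by rewrite -{1}(pathofK i x (ltnW im)) -(increments_glue s0 sinc)// PhiE.
have c := EL_cyl sl sh (stimes_path sinc im) (stimes_cover sinc FX im) cX.
have -> : (fun y => Phi i.+1 (snoc x y)) = (fun y => EL sl sh (s i.+1) (stimes m s i.+1) X (glue (s i) (s i.+1) (pathof i x) y)).
  exact/funext.
exists (fun t => Sg sl sh t (fun y => EL sl sh (s i.+1) (stimes m s i.+1) X (glue (s i) (s i.+1) (pathof i x) y))).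
  apply: (Sg_visc h0 hs (bddO_glue _ _ _ (cyl_bddO c)) (cyl_glue_lipf _ _ _ c)).
  by rewrite mulr_ge0.
by rewrite /Phi stimesE.
Qed.

End lip.

(** * Representing measures *)

Section borel.
Context (R : realType).
Implicit Types (w : Omega R) (q r s t y : R).

(** The tubes around w0 form a filter converging to it in the compact-open topology, because compact
    sets of times are bounded and w0 is continuous; hence one tube lies in [O]. *)
Lemma compact_open_tube w0 (O : set {compact-open, R -> R}) : open O ->
  O (path_fun (w0 : cpath R)) -> exists n : nat, forall w : cpath R,
  (forall t, `|t| <= n%:R -> `|path_fun w t - path_fun (w0 : cpath R) t| < n.+1%:R^-1) ->
  O (path_fun w).
Proof.
move=> oO Ow0; set f0 := path_fun (w0 : cpath R) in Ow0 *.
pose tube n := [set g : R -> R | forall t, `|t| <= n%:R -> `|g t - f0 t| < n.+1%:R^-1].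
pose Fil : set_system {compact-open, R -> R} := filter_from setT tube.
have tube_sub n m : (n <= m)%N -> tube m `<=` tube n.
  move=> nm g h t tn; apply: (@lt_le_trans _ _ m.+1%:R^-1).
    by apply: h; apply: (le_trans tn); rewrite ler_nat.
  by rewrite lef_pV2 ?posrE// ler_nat.
have FF : ProperFilter Fil.
  apply: filter_from_proper; last by move=> n _; exists f0 => t _; rewrite subrr normr0.
  apply: filter_from_filter; first by exists 0%N.
  move=> i j _ _; exists (maxn i j) => // g h; split; apply: tube_sub h.
    exact: leq_maxl.
  exact: leq_maxr.
have cF : Fil --> (f0 : {compact-open, R -> R}).
  apply/compact_open_cvgP => K O' cK oO' fKO.
  have [M KM] : exists M : nat, forall t, K t -> `|t| <= M%:R.
    have /compact_bounded[M [Mr hM]] := cK.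
    exists (Num.truncn (`|M| + 1)).+1 => t Kt.
    apply: (@le_trans _ _ (`|M| + 1)); last exact/ltW/truncnS_gt.
    by apply: hM => //; rewrite (le_lt_trans (ler_norm _))// ltrDl.
  have : \forall n \near \oo, K `<=` [set x | forall y, `|y - f0 x| < n.+1%:R^-1 -> O' y].
    move/compact_near_coveringP : cK; apply => x Kx.
    have : nbhs (f0 x) O' by apply: open_nbhs_nbhs; split => //; apply: fKO; exists x.
    move/nbhs_ballP => [rho /= rho0 hrho].
    have rho2 : 0 < rho / 2 by rewrite divr_gt0.
    have c1 : \forall x' \near x, `|f0 x - f0 x'| < rho / 2.
      by have /cvgrPdist_lt := @path_continuous R w0 x; apply.
    have c2 : \forall n \near \oo, n.+1%:R^-1 < rho / 2.
      have : (fun n => n.+1%:R^-1 : R) @ \oo --> (0 : R) by exact: cvg_harmonic.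
      by move/cvgr_lt; apply.
    exists ([set x' | `|f0 x - f0 x'| < rho / 2], [set n | n.+1%:R^-1 < rho / 2]) => //.
    move=> [x' n] [/= h1 h2] y h3; apply: hrho; rewrite /ball/=.
    have -> : f0 x - y = (f0 x - f0 x') - (y - f0 x') by ring.
    apply: (le_lt_trans (ler_normB _ _)); rewrite [rho]splitr; apply: ltrD => //.
    exact: (lt_trans h3).
  move=> [n _ hn]; exists (maxn n M) => // g hg y [t Kt <-].
  apply: (hn (maxn n M)); [exact: leq_maxl|exact: Kt|].
  by apply: hg; apply: (le_trans (KM t Kt)); rewrite ler_nat leq_maxr.
have [n _ hn] := cF O (open_nbhs_nbhs (conj oO Ow0)).
by exists n => w h; apply: hn.
Qed.

Lemma path_uniform w0 (n : nat) eps : 0 < eps -> exists m : nat, forall t t',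
  0 <= t <= n%:R -> `|t - t'| <= m.+1%:R^-1 -> `|B t w0 - B t' w0| < eps.
Proof.
move=> e0; have e2 : 0 < eps / 2 by rewrite divr_gt0.
have : \forall m \near \oo, `[0, n%:R]%classic `<=`
    [set t | forall t', `|t - t'| <= m.+1%:R^-1 -> `|B t w0 - B t' w0| < eps].
  have /compact_near_coveringP := @segment_compact R 0 n%:R; apply => x _.
  have /cvgrPdist_lt/(_ _ e2)/nbhs_ballP[rho /= rho0 hrho] := @path_continuous R w0 x.
  have rho2 : 0 < rho / 2 by rewrite divr_gt0.
  have c1 : \forall x' \near x, `|x - x'| < rho / 2.
    by apply: (@cvgr_dist_lt _ _ _ (nbhs x) _ id x) => //; exact: cvg_id.
  have c2 : \forall n \near \oo, n.+1%:R^-1 < rho / 2.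
    have : (fun n => n.+1%:R^-1 : R) @ \oo --> (0 : R) by exact: cvg_harmonic.
    by move/cvgr_lt; apply.
  exists ([set x' | `|x - x'| < rho / 2], [set n | n.+1%:R^-1 < rho / 2]) => //.
  move=> [x' m] [/= h1 h2] y h3.
  have xy : ball x rho y.
    rewrite /ball/=; have -> : x - y = (x - x') + (x' - y) by ring.
    apply: (le_lt_trans (ler_normD _ _)); rewrite [rho]splitr; apply: ltrD => //.
    exact: (le_lt_trans h3).
  have xx' : ball x rho x'.
    by rewrite /ball/=; apply: (lt_trans h1); rewrite ltr_pdivrMr// ltr_pMr// ltr1n.
  have := hrho _ xy; have := hrho _ xx'; rewrite /= -/(B x w0) -/(B y w0) -/(B x' w0).
  have -> : B x' w0 - B y w0 = (B x w0 - B y w0) - (B x w0 - B x' w0) by ring.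
  move=> b1 b2; apply: (le_lt_trans (ler_normB _ _)); rewrite [eps]splitr; exact: ltrD.
move=> [m _ hm]; exists m => t t' tn; apply: (hm m) => //=.
Qed.

(** There are countably many such boxes, and each involves countably many coordinates; an open set
    is a countable union of finite intersections of them. *)
Definition rat_box (e : rat * rat * rat * rat) : set (Omega R) :=
  [set w | forall q : rat, e.1.1.1 <= q <= e.1.1.2 -> ratr e.1.2 <= B (ratr q) w <= ratr e.2].

Lemma rat_box_real e w t : e.1.1.1 < e.1.1.2 -> rat_box e w ->
  ratr e.1.1.1 <= t <= ratr e.1.1.2 -> ratr e.1.2 <= B t w <= ratr e.2.
Proof.
move: e => [[[a b] c] d] /= ab h /andP[at_ tb].
have ab' : ratr a < ratr b :> R by rewrite ltr_rat.
have main (P : R -> Prop) : (\forall y \near B t w, P y) -> exists q : rat,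
    [/\ a <= q <= b & P (B (ratr q) w)].
  move=> /(@path_continuous R w t)/nbhs_ballP[rho /= rho0 hrho].
  have lt1 : Num.max (ratr a) (t - rho) < Num.min (ratr b) (t + rho).
    have ? : ratr a < t + rho by lra.
    have ? : t - rho < ratr b by lra.
    have ? : t - rho < t + rho by lra.
    by rewrite gt_max !lt_min; apply/andP; split; apply/andP; split.
  have [q] := rat_in_itvoo lt1; rewrite in_itv/= gt_max lt_min => /andP[/andP[q1 q2] /andP[q3 q4]].
  exists q; split; first by rewrite -(ler_rat R) (ltW q1) -(ler_rat R) ltW.
  by apply: hrho; rewrite /ball/= ltr_distl; apply/andP; split; lra.
apply/andP; split; rewrite leNgt; apply/negP => bad.
  have [|q [qab]] := main (fun y => y < ratr c).
    exact: lt_nbhsl.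
  by have /andP[+ _] := h q qab; rewrite leNgt => /negP.
have [|q [qab]] := main (fun y => ratr d < y).
  exact: lt_nbhsr.
by have /andP[_] := h q qab; rewrite leNgt => /negP.
Qed.

Lemma open_rat_box (O : set (cpath R)) w0 : open O -> O w0 ->
  exists2 l : seq (rat * rat * rat * rat), (forall e, e \in l -> rat_box e w0) &
  forall w, (forall e, e \in l -> rat_box e w) -> O w.
Proof.
case=> U oU UE Ow0; subst O; move: Ow0 => /= Ow0.
have [n hn] := compact_open_tube oU Ow0.
set eps : R := n.+1%:R^-1 in hn; have e0 : 0 < eps by rewrite invr_gt0.
have e4 : 0 < eps / 4 by rewrite divr_gt0.
have [m hm] := path_uniform w0 n.+1 e4.
have hq x : {q : rat | x < ratr q < x + eps / 4}.
  apply: cid; have [|q] := @rat_in_itvoo R x (x + eps / 4); first by rewrite ltrDl.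
  by rewrite in_itv/= => qx; exists q.
pose q x := sval (hq x).
have qP x : x < ratr (q x) < x + eps / 4 by exact: svalP (hq x).
pose tt (i : nat) : rat := i%:R / m.+1%:R.
have ttE i : ratr (tt i) = i%:R / m.+1%:R :> R by rewrite /tt fmorph_div/= !ratr_nat.
have m0 : 0 < m.+1%:R :> R by [].
(* Over a mesh interval w0 varies by less than eps / 4, and the rational bounds are between eps / 4
   and eps / 2 away from its left value: they contain w0 and keep other paths within eps of it. *)
pose e i := (tt i, tt i.+1, q (B (ratr (tt i)) w0 - eps / 2), q (B (ratr (tt i)) w0 + eps / 4)).
have inn i t : (i < n.+1 * m.+1)%N -> ratr (tt i) <= t <= ratr (tt i.+1) ->
    `|B (ratr (tt i)) w0 - B t w0| < eps / 4.
  move=> im /andP[t1 t2]; apply: hm.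
    rewrite ttE divr_ge0//= ler_pdivrMr// -natrM ler_nat; exact: ltnW.
  have : ratr (tt i.+1) = ratr (tt i) + m.+1%:R^-1 :> R.
    by rewrite !ttE -natr1 mulrDl mul1r.
  move=> E; rewrite E in t2; rewrite distrC ger0_norm ?subr_ge0//.
  by rewrite lerBlDl.
exists [seq e i | i <- iota 0 (n.+1 * m.+1)].
  move=> _ /mapP[i + ->]; rewrite mem_iota /= add0n => im p /= /andP[p1 p2].
  have := inn i (ratr p) im; rewrite !ler_rat p1 p2 => /(_ isT); rewrite ltr_norml => /andP[? ?].
  have /andP[? ?] := qP (B (ratr (tt i)) w0 - eps / 2).
  have /andP[? ?] := qP (B (ratr (tt i)) w0 + eps / 4).
  by apply/andP; split; lra.
move=> w hw; apply: hn => t tn.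
have [t0|t0] := leP t 0.
  by rewrite !path_nonpos// subrr normr0.
pose i := Num.truncn (t * m.+1%:R).
have tm0 : 0 <= t * m.+1%:R by rewrite mulr_ge0// ltW.
have /andP[i1 i2] := truncn_itv tm0; rewrite -/i in i1 i2.
have tn' : t <= n%:R by rewrite (le_trans (ler_norm _)).
have im : (i < n.+1 * m.+1)%N.
  rewrite -(ltr_nat R); apply: (le_lt_trans i1); rewrite natrM ltr_pM2r//.
  by apply: (le_lt_trans tn'); rewrite ltr_nat.
have ti : ratr (tt i) <= t <= ratr (tt i.+1).
  by rewrite !ttE ler_pdivrMr// i1 ler_pdivlMr// ltW.
have := inn i t im ti.
have ei : e i \in [seq e i | i <- iota 0 (n.+1 * m.+1)].
  by apply/mapP; exists i => //; rewrite mem_iota.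
have := rat_box_real (_ : (e i).1.1.1 < (e i).1.1.2) (hw _ ei) ti.
have -> : (e i).1.1.1 < (e i).1.1.2.
  by rewrite /e/= /tt ltr_pM2r ?invr_gt0// ltr_nat.
move=> /(_ isT) /= /andP[? ?].
have /andP[? ?] := qP (B (ratr (tt i)) w0 - eps / 2).
have /andP[? ?] := qP (B (ratr (tt i)) w0 + eps / 4).
rewrite -/(B t w) -/(B t w0) !ltr_norml => /andP[? ?]; apply/andP; split; lra.
Qed.

Lemma borel_generated (D : set (set (Omega R))) : sigma_algebra setT D ->
  (forall q a, D [set w | a < B q w]) -> measurable `<=` D.
Proof.
move=> sD Dq; have sD' := sD; apply: smallest_sub => // O oO.
have DC A : D A -> D (~` A) by move=> DA; rewrite -setTD; have [_ hDC _] := sD; exact: hDC.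
have Dle q a : D [set w | B q w <= a].
  have -> : [set w | B q w <= a] = ~` [set w | a < B q w].
    by apply/seteqP; split => w /=; rewrite leNgt => /negP.
  exact: DC.
have Dcap (I : countType) (A : I -> set (Omega R)) : (forall i, D (A i)) -> D (\bigcap_i A i).
  move=> DA; rewrite -[X in D X]setCK setC_bigcap; apply: (DC).
  have [_ _ hDcup] := sD.
  pose A' n := if unpickle n is Some i then ~` (A i) else set0.
  have -> : \bigcup_i ~` (A i) = \bigcup_n A' n.
    apply/seteqP; split => w [i _ Aw].
      by exists (pickle i) => //; rewrite /A' pickleK.
    by move: Aw; rewrite /A'; case: unpickle => // j; exists j.
  apply: hDcup => n; rewrite /A'; case: unpickle => [i|]; first exact/DC/DA.
  by case: sD.
have Dcup (I : countType) (A : I -> set (Omega R)) : (forall i, D (A i)) -> D (\bigcup_i A i).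
  move=> DA; rewrite -[X in D X]setCK setC_bigcup; apply: (DC); apply: (Dcap) => i.
  exact/DC/DA.
have DT : D setT by rewrite -setC0; apply: (DC); case: sD.
have D0 : D set0 by case: sD.
have Dge q a : D [set w | a <= B q w].
  have -> : [set w | a <= B q w] = \bigcap_(n : nat) [set w | a - n.+1%:R^-1 < B q w].
    apply/seteqP; split => w /= h.
      by move=> n _ /=; apply: lt_le_trans h; rewrite ltrBlDr ltrDl invr_gt0.
    rewrite leNgt; apply/negP => bad.
    have d0 : 0 < a - B q w by rewrite subr_gt0.
    have [n _ hn] : \forall n \near \oo, n.+1%:R^-1 < a - B q w.
      have : (fun n => n.+1%:R^-1 : R) @ \oo --> (0 : R) by exact: cvg_harmonic.
      by move/cvgr_lt; apply.
    have hn' : n.+1%:R^-1 < a - B q w by exact: (hn n (leqnn n)).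
    by have := h n I; rewrite /= ltrBlDr -ltrBlDl => h'; have := lt_trans hn' h'; rewrite ltxx.
  by apply: (Dcap) => n; exact: Dq.
have Dbox e : D (rat_box e).
  have -> : rat_box e = \bigcap_(q : rat) [set w | e.1.1.1 <= q <= e.1.1.2 -> ratr e.1.2 <= B (ratr q) w <= ratr e.2].
    by apply/seteqP; split => w /= h q; [move=> _; exact: h|exact: h].
  apply: (Dcap) => q.
  case: (boolP (e.1.1.1 <= q <= e.1.1.2)) => qe.
    have -> : [set w : Omega R | true -> ratr e.1.2 <= B (ratr q) w <= ratr e.2] =
      \bigcap_(b : bool) (if b then [set w : Omega R | ratr e.1.2 <= B (ratr q) w] else [set w | B (ratr q) w <= ratr e.2]).
      apply/seteqP; split => w /=.
        by move=> /(_ isT)/andP[h1 h2] [] _.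
      by move=> h _; rewrite (h true I) (h false I).
    by apply: (Dcap) => -[].
  by rewrite (_ : [set w | _] = setT)//; apply/seteqP; split.
have Dbigbox (l : seq (rat * rat * rat * rat)) : D [set w | forall e, e \in l -> rat_box e w].
  elim: l => [|e l IH].
    by rewrite (_ : [set w | _] = setT)//; apply/seteqP; split.
  have -> : [set w | forall e', e' \in e :: l -> rat_box e' w] =
     \bigcap_(b : bool) (if b then rat_box e else [set w | forall e, e \in l -> rat_box e w]).
    apply/seteqP; split => w /= h.
      move=> [] _; first by apply: h; rewrite mem_head.
      by move=> e' e'l; apply: h; rewrite inE e'l orbT.
    move=> e'; rewrite inE => /orP[/eqP ->|e'l]; first exact: (h true I).
    exact: (h false I).
  by apply: (Dcap) => -[].
have -> : O = \bigcup_(l : seq (rat * rat * rat * rat))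
   (if `[< [set w | forall e, e \in l -> rat_box e w] `<=` O >] then
   [set w | forall e, e \in l -> rat_box e w] else set0).
  apply/seteqP; split => w.
    move=> Ow; have [l h1 h2] := open_rat_box oO Ow; exists l => //.
    by case: asboolP => // h; exfalso; apply: h => w'; exact: h2.
  by move=> [l _]; case: asboolP => // h; exact: h.
by apply: Dcup => l; case: asboolP => // _.
Qed.

End borel.

(** * The Hahn-Banach theorem *)

Section hahn_banach.
Context (R : realType) (V : lmodType R) (D : set V).
Hypothesis DD : forall x y, D x -> D y -> D (x + y).
Hypothesis DZ : forall a x, D x -> D (a *: x).
Implicit Types (p q : V -> R) (x y z : V) (a b c : R).

Definition sublin q := (forall x y, D x -> D y -> q (x + y) <= q x + q y) /\
  (forall a x, 0 <= a -> D x -> q (a *: x) <= a * q x).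

Let DN x : D x -> D (- x). Proof. by rewrite -scaleN1r; exact: DZ. Qed.

Lemma sublin_ge0 q x : sublin q -> D x -> 0 <= q x + q (- x).
Proof.
move=> [qD qZ] Dx; apply: le_trans (qD _ _ Dx (DN Dx)); rewrite subrr.
have D0 : D 0 by rewrite -(scale0r x); exact: DZ.
by have := qD _ _ D0 D0; rewrite addr0 -subr_ge0 addrK.
Qed.

Lemma sublin_Z q a x : sublin q -> 0 <= a -> D x -> q (a *: x) = a * q x.
Proof.
move=> sq; have [qD qZ] := sq; rewrite le_eqVlt => /orP[/eqP <-|a0] Dx.
  apply/eqP; rewrite eq_le qZ//= scale0r mul0r.
  have D0 : D 0 by rewrite -(scale0r x); exact: DZ.
  by have := qD _ _ D0 D0; rewrite addr0 -subr_ge0 addrK.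
apply/eqP; rewrite eq_le qZ//=; last exact: ltW.
rewrite mulrC -ler_pdivlMr// mulrC.
have -> : q x = q (a^-1 *: (a *: x)) by rewrite scalerA mulVf ?scale1r// gt_eqF.
by apply: qZ; [rewrite invr_ge0 ltW|exact: DZ].
Qed.

Lemma inf_leD (S1 S2 : set R) c : S1 !=set0 -> S2 !=set0 ->
  (forall s t, S1 s -> S2 t -> c <= s + t) -> c <= inf S1 + inf S2.
Proof.
move=> S10 S20 h; rewrite -lerBlDl; apply: lb_le_inf => // t S2t.
by rewrite lerBlDl -lerBlDr; apply: lb_le_inf => // s S1s; rewrite lerBlDr h.
Qed.

Lemma inf_leM (S : set R) a c : S !=set0 -> 0 <= a -> (forall s, S s -> c <= a * s) ->
  c <= a * inf S.
Proof.
move=> S0; rewrite le_eqVlt => /orP[/eqP <-|a0] h.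
  by have [s Ss] := S0; have := h s Ss; rewrite !mul0r.
by rewrite mulrC -ler_pdivrMr//; apply: lb_le_inf => // s Ss; rewrite ler_pdivrMr// mulrC h.
Qed.

(* The largest sublinear functional below [q] that is additive along [z], so that a
   minimal sublinear functional is linear. *)
Definition slope q z x := inf [set q (x + a *: z) - a * q z | a in [set a | 0 <= a]].

Lemma slope_lb q z x a : sublin q -> D x -> D z -> 0 <= a ->
  - q (- x) <= q (x + a *: z) - a * q z.
Proof.
move=> sq Dx Dz a0; rewrite -(sublin_Z sq a0 Dz) lerBrDr addrC lerBlDr.
have [qD _] := sq; apply: le_trans (qD _ _ _ _); [|exact: (DD Dx (DZ _ Dz))|exact: DN].
by rewrite addrAC subrr add0r.
Qed.

Lemma slope_le q z x a : sublin q -> D x -> D z -> 0 <= a ->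
  slope q z x <= q (x + a *: z) - a * q z.
Proof.
move=> sq Dx Dz a0; apply: ge_inf; last by exists a.
by exists (- q (- x)) => _ [b b0 <-]; exact: slope_lb.
Qed.

Lemma slope_sublin q z : sublin q -> D z -> sublin (slope q z).
Proof.
move=> sq Dz; have [qD qZ] := sq.
have S0 x : [set q (x + a *: z) - a * q z | a in [set a | 0 <= a]] !=set0.
  by exists (q (x + 0 *: z) - 0 * q z); exists 0 => //=.
split=> [x y Dx Dy|b x b0 Dx].
  apply: inf_leD => // _ _ [a /= a0 <-] [b /= b0 <-].
  apply: (le_trans (slope_le sq (DD Dx Dy) Dz (addr_ge0 a0 b0))).
  rewrite mulrDl opprD addrACA; apply: lerD => //.
  by rewrite scalerDl addrACA; apply: qD; apply: DD => //; exact: DZ.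
apply: inf_leM => // _ [a /= a0 <-].
apply: (le_trans (slope_le sq (DZ b Dx) Dz (mulr_ge0 b0 a0))).
rewrite mulrBr mulrA lerB// -scalerA -scalerDr.
by apply: qZ => //; apply: DD => //; exact: DZ.
Qed.

Lemma slope_le0 q z x : sublin q -> D x -> D z -> slope q z x <= q x.
Proof.
by move=> sq Dx Dz; have := slope_le sq Dx Dz (lexx 0); rewrite scale0r addr0 mul0r subr0.
Qed.

Definition minorant p := {q : V -> R | sublin q /\ forall x, D x -> q x <= p x}.

Lemma minimal_sublin p : sublin p -> exists2 q, sublin q &
  (forall x, D x -> q x <= p x) /\
  forall r, sublin r -> (forall x, D x -> r x <= q x) -> forall x, D x -> q x <= r x.
Proof.
move=> sp; pose rl (q r : minorant p) := `[< forall x, D x -> sval r x <= sval q x >].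
have p0 : minorant p by exists p.
have [||A Atot|[q [sq qp]] qmin] := @ZL_preorder _ p0 rl.
- by move=> q; apply/asboolP.
- move=> q r s /asboolP h1 /asboolP h2; apply/asboolP => x Dx.
  exact: le_trans (h2 x Dx) (h1 x Dx).
- have [[q0 Aq0]|A0] := pselect (A !=set0); last first.
    by exists p0 => s As; exfalso; apply: A0; exists s.
  pose qi x := inf [set sval r x | r in A].
  have lbA x : D x -> has_lbound [set sval r x | r in A].
    move=> Dx; exists (- p (- x)) => _ [[r [sr rp]] Ar <-] /=.
    have := sublin_ge0 sr Dx; have := rp _ (DN Dx) => h1 h2.
    by rewrite lerNl -subr_ge0; lra.
  have neA x : [set sval r x | r in A] !=set0 by exists (sval q0 x); exists q0.
  have qi_le x r : D x -> A r -> qi x <= sval r x.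
    by move=> Dx Ar; apply: ge_inf; [exact: lbA|exists r].
  have sqi : sublin qi.
    split=> [x y Dx Dy|a x a0 Dx].
      apply: inf_leD => // _ _ [r Ar <-] [s As <-].
      have [/asboolP rs|/asboolP sr] := Atot _ _ Ar As.
        apply: (le_trans (qi_le _ s (DD Dx Dy) As)).
        have [h _] := proj1 (svalP s); apply: (le_trans (h _ _ Dx Dy)).
        by rewrite lerD2r rs.
      apply: (le_trans (qi_le _ r (DD Dx Dy) Ar)).
      have [h _] := proj1 (svalP r); apply: (le_trans (h _ _ Dx Dy)).
      by rewrite lerD2l sr.
    apply: inf_leM => // _ [r Ar <-].
    apply: (le_trans (qi_le _ r (DZ a Dx) Ar)).
    by have [_ h] := proj1 (svalP r); exact: h.
  have qip x : D x -> qi x <= p x.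
    by move=> Dx; apply: (le_trans (qi_le x q0 Dx Aq0)); exact: (proj2 (svalP q0)).
  exists (exist _ qi (conj sqi qip)) => r Ar; apply/asboolP => x Dx /=.
  exact: qi_le.
exists q => //; split => // r sr rq.
have rp x : D x -> r x <= p x by move=> Dx; exact: le_trans (rq x Dx) (qp x Dx).
have := qmin (exist _ r (conj sr rp)).
by move=> h; move: (h ltac:(by apply/asboolP)) => /asboolP.
Qed.

Definition linear_on (L : V -> R) := (forall x y, D x -> D y -> L (x + y) = L x + L y) /\
  (forall a x, D x -> L (a *: x) = a * L x).

(** A minimal functional lies below its own slopes and is therefore additive. Starting from
    [slope p z] forces L (- z) <= - p z, that is, L z = p z. *)
Lemma hahn_banach p z : sublin p -> D z -> exists L, [/\ linear_on L,
  (forall x, D x -> L x <= p x) & L z = p z].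
Proof.
move=> sp Dz; have sp' := slope_sublin sp Dz.
have [L sL [Lp Lmin]] := minimal_sublin sp'.
have [LD LZ] := sL.
have Lsup x y : D x -> D y -> L x + L y <= L (x + y).
  move=> Dx Dy; rewrite -lerBrDr.
  have := Lmin _ (slope_sublin sL Dy) (fun u Du => slope_le0 sL Du Dy) x Dx.
  move=> /le_trans; apply; have := slope_le sL Dx Dy ler01.
  by rewrite scale1r mul1r.
have LDe x y : D x -> D y -> L (x + y) = L x + L y.
  by move=> Dx Dy; apply/eqP; rewrite eq_le LD// Lsup.
have D0 : D 0 by rewrite -(scale0r z); exact: DZ.
have L0 : L 0 = 0 by have /eqP := LDe 0 0 D0 D0; rewrite addr0 -subr_eq subrr eq_sym => /eqP.
have LN x : D x -> L (- x) = - L x.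
  by move=> Dx; apply/eqP; rewrite -addr_eq0 -LDe// ?addNr ?L0//; exact: DN.
exists L; split.
- split => // a x Dx; have [a0|a0] := leP 0 a; first exact: sublin_Z.
  rewrite -[a]opprK scaleNr LN; last exact: DZ.
  by rewrite (sublin_Z sL)// ?mulNr// oppr_ge0 ltW.
- by move=> x Dx; exact: le_trans (Lp x Dx) (slope_le0 sp Dx Dz).
apply/eqP; rewrite eq_le (le_trans (Lp z Dz) (slope_le0 sp Dz Dz))/=.
have := Lp _ (DN Dz); rewrite LN// lerNl => /(le_trans _); apply.
have := slope_le sp (DN Dz) Dz ler01; rewrite scale1r addNr mul1r.
have := sublin_Z sp (lexx 0) D0; rewrite scaler0 mul0r => ->.
by rewrite sub0r lerNr.
Qed.

End hahn_banach.

(** * Measurability and lattice operations of cylinder functions *)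

Section cylinder_measurable.
Context (R : realType).
Implicit Types (w : Omega R) (X Y : Omega R -> R).

Lemma open_B_preimage (q : R) (O : set R) : open O -> open ((fun w : cpath R => path_fun w q) @^-1` O).
Proof.
move=> oO; exists [set g | [set g x | x in [set q]] `<=` O].
  by apply: compact_open_open => //; exact: compact_set1.
apply/seteqP; split => w /= h; first by apply: h; exists q.
by move=> _ [_ -> <-].
Qed.

Lemma open_B_tube (F : seq R) w0 rho :
  open [set w : cpath R | forall q, q \in F -> `|path_fun w q - B q w0| < rho].
Proof.
elim: F => [|q F IH].
  by rewrite (_ : [set w | _] = setT); [exact: openT|apply/seteqP; split].
rewrite (_ : [set w | _] = [set w | `|path_fun w q - B q w0| < rho] `&`
    [set w : cpath R | forall q, q \in F -> `|path_fun w q - B q w0| < rho]).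
  apply: openI => //; have := @open_B_preimage q (ball (B q w0) rho) (ball_open _ _).
  by congr open; apply/seteqP; split => w; rewrite /ball/= distrC.
apply/seteqP; split => w /=.
  by move=> h; split => [|q' q'F]; apply: h; rewrite inE ?eqxx// q'F orbT.
by move=> [h1 h2] q'; rewrite inE => /orP[/eqP ->//|]; exact: h2.
Qed.

Lemma is_cyl_measurable X : is_cyl X -> measurable_fun setT X.
Proof.
move=> [F [K [M [K0 _ hX]]]].
apply: (measurability _ (RGenOInfty.measurableE R)) => _ [_ [a ->] <-]; rewrite setTI.
apply: sub_sigma_algebra; rewrite openE => w0 /=; rewrite in_itv/= andbT => aX.
have c0 : 0 < K * (size F)%:R + 1 by rewrite ltr_wpDl// mulr_ge0.
pose rho := (X w0 - a) / (K * (size F)%:R + 1).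
have rho0 : 0 < rho by rewrite divr_gt0// subr_gt0.
apply: (filterS _ (open_nbhs_nbhs (conj (open_B_tube F w0 rho) _))); last first.
  by move=> q _; rewrite subrr normr0.
move=> w /= hw; rewrite in_itv/= andbT.
have h1 : `|X w0 - X w| <= K * (size F)%:R * rho.
  apply: (le_trans (hX _ _)); rewrite -mulrA ler_wpM2l//.
  rewrite mulr_natl -(count_predT F) -iter_addr_0 -big_const_seq.
  rewrite big_seq [leRHS]big_seq; apply: ler_sum => q qF; rewrite distrC.
  exact/ltW/hw.
have h2 : K * (size F)%:R * rho < X w0 - a.
  by rewrite /rho mulrA ltr_pdivrMr// mulrC ltr_pM2l ?subr_gt0// ltrDl.
have := ler_norm (X w0 - X w); lra.
Qed.

Lemma is_cyl_abs X : is_cyl X -> is_cyl (fun w => `|X w|).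
Proof.
move=> [F [K [M c]]]; exists F, (1 * K), M; apply: (cyl_comp _ _ _ c) => //.
  by move=> x y; rewrite mul1r; exact: ler_dist_dist.
by move=> x xM; rewrite normr_id.
Qed.

Lemma is_cylN X : is_cyl X -> is_cyl (fun w => - X w).
Proof.
move=> cX; rewrite (_ : (fun w => _) = (fun w => -1 * X w)); last first.
  by apply/funext => w; rewrite mulN1r.
exact: is_cylZ.
Qed.

Lemma is_cylB X Y : is_cyl X -> is_cyl Y -> is_cyl (fun w => X w - Y w).
Proof. by move=> cX cY; apply: is_cylD => //; exact: is_cylN. Qed.

Lemma is_cyl_max X Y : is_cyl X -> is_cyl Y -> is_cyl (fun w => Num.max (X w) (Y w)).
Proof.
move=> cX cY; rewrite (_ : (fun w => _) = (fun w => 2^-1 * (X w + Y w + `|X w - Y w|))).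
  by apply: is_cylZ; apply: is_cylD; [exact: is_cylD|exact/is_cyl_abs/is_cylB].
apply/funext => w; have [h|h] := leP (X w) (Y w).
  by rewrite ler0_norm ?subr_le0//; field.
by rewrite gtr0_norm ?subr_gt0//; field.
Qed.

Lemma is_cyl_min X Y : is_cyl X -> is_cyl Y -> is_cyl (fun w => Num.min (X w) (Y w)).
Proof.
move=> cX cY; rewrite (_ : (fun w => _) = (fun w => - Num.max (- X w) (- Y w))).
  by apply: is_cylN; apply: is_cyl_max; exact: is_cylN.
by apply/funext => w; rewrite oppr_max !opprK.
Qed.

Lemma is_cyl_sum (I : Type) (r : seq I) (X : I -> Omega R -> R) :
  (forall i, is_cyl (X i)) -> is_cyl (fun w => \sum_(i <- r) X i w).
Proof.
move=> cX; elim: r => [|i r IH].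
  by under eq_fun do rewrite big_nil; exact: is_cyl_cst.
by under eq_fun do rewrite big_cons; exact: is_cylD.
Qed.

End cylinder_measurable.

(** * Daniell's construction of a measure from a functional *)

Section daniell.
Context (R : realType) (L : (Omega R -> R) -> R).
Implicit Types (w : Omega R) (X Y Z : Omega R -> R) (A : set (Omega R)).

Definition daniell :=
  [/\ (forall X Y, is_cyl X -> is_cyl Y -> L (fun w => X w + Y w) = L X + L Y),
      (forall a X, is_cyl X -> L (fun w => a * X w) = a * L X),
      (forall X, is_cyl X -> (forall w, 0 <= X w) -> 0 <= L X),
      L (fun=> 1) = 1
    & forall X : nat -> Omega R -> R, (forall n, is_cyl (X n)) ->
        (forall n w, 0 <= X n w) -> (forall n w, X n.+1 w <= X n w) ->
        (forall w, X n w @[n --> \oo] --> 0) -> L (X n) @[n --> \oo] --> 0].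

Hypothesis dL : daniell.

Let LD X Y : is_cyl X -> is_cyl Y -> L (fun w => X w + Y w) = L X + L Y.
Proof. by case: dL => h _ _ _ _; exact: h. Qed.
Let LZ a X : is_cyl X -> L (fun w => a * X w) = a * L X.
Proof. by case: dL => _ h _ _ _; exact: h. Qed.
Let L_ge0 X : is_cyl X -> (forall w, 0 <= X w) -> 0 <= L X.
Proof. by case: dL => _ _ h _ _; exact: h. Qed.
Let L1 : L (fun=> 1) = 1. Proof. by case: dL. Qed.
Let LB X Y : is_cyl X -> is_cyl Y -> L (fun w => X w - Y w) = L X - L Y.
Proof.
move=> cX cY; rewrite (_ : (fun w => _) = (fun w => X w + -1 * Y w)).
  by rewrite LD ?LZ ?mulN1r//; exact: is_cylZ.
by apply/funext => w; rewrite mulN1r.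
Qed.
Let L_le X Y : is_cyl X -> is_cyl Y -> (forall w, X w <= Y w) -> L X <= L Y.
Proof.
move=> cX cY XY; rewrite -subr_ge0 -LB//; apply: L_ge0; first exact: is_cylB.
by move=> w; rewrite subr_ge0.
Qed.
Let Lcst a : L (fun=> a) = a.
Proof.
rewrite (_ : (fun=> a) = (fun w : Omega R => a * 1)); last by apply/funext => w; rewrite mulr1.
by rewrite LZ ?L1 ?mulr1//; exact: is_cyl_cst.
Qed.

(** The supremum of the sequence is a function that is at least 1 on A; the condition with a < 1
    avoids naming it, as it is in general no cylinder function. *)
Definition cover A c (X : nat -> Omega R -> R) :=
  [/\ (forall n, is_cyl (X n)), (forall n w, 0 <= X n w),
      (forall n w, X n w <= X n.+1 w),
      (forall w, A w -> forall a, a < 1 -> exists n, a < X n w)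
    & forall n, L (X n) <= c].

Let cover_mono A c (X : nat -> Omega R -> R) w : cover A c X -> {homo (fun n => X n w) : m n / (m <= n)%N >-> m <= n}.
Proof. by move=> [_ _ h _ _]; apply: homo_leq => //; exact: le_trans. Qed.

Definition outer A : R := inf [set c | exists X : nat -> Omega R -> R, cover A c X].

Let cover1 A : cover A 1 (fun _ => fun=> 1).
Proof.
split => //; first by move=> _; exact: is_cyl_cst.
  by move=> w _ a a1; exists 0%N.
by move=> _; rewrite L1.
Qed.

Let outer_has_inf A : has_inf [set c | exists X : nat -> Omega R -> R, cover A c X].
Proof.
split; first by exists 1; exists (fun _ => fun=> 1); exact: cover1.
by exists 0 => c [X [cX X0 _ _ Xc]]; apply: le_trans (Xc 0%N); exact: L_ge0.
Qed.

Let outer_ge0 A : 0 <= outer A.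
Proof.
apply: lb_le_inf; first by have [] := outer_has_inf A.
by move=> c [X [cX X0 _ _ Xc]]; apply: le_trans (Xc 0%N); exact: L_ge0.
Qed.

Let outer_le A c (X : nat -> Omega R -> R) : cover A c X -> outer A <= c.
Proof. by move=> h; apply: ge_inf; [have [] := outer_has_inf A|exists X]. Qed.

Let outer_lt A c : outer A < c -> exists X : nat -> Omega R -> R, cover A c X.
Proof.
move=> Ac; have e0 : 0 < c - outer A by rewrite subr_gt0.
have [d [X [h1 h2 h3 h4 h5]]] := inf_adherent e0 (outer_has_inf A).
rewrite addrCA subrr addr0 => dc.
by exists X; split => // n; exact: le_trans (ltW dc).
Qed.

Let outer_mono A A' : A `<=` A' -> outer A <= outer A'.
Proof.
move=> AA'; apply: lb_le_inf; first by have [] := outer_has_inf A'.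
move=> c [X [h1 h2 h3 h4 h5]]; apply: (@outer_le _ _ X); split => // w Aw.
exact/h4/AA'.
Qed.

Let outer_upper A Z : is_cyl Z -> (forall w, 0 <= Z w) -> (forall w, A w -> 1 <= Z w) ->
  outer A <= L Z.
Proof.
move=> cZ Z0 Z1; apply: (@outer_le _ _ (fun _ => Z)); split => // w Aw a a1; exists 0%N.
exact: lt_le_trans (Z1 w Aw).
Qed.

(** Daniell's condition enters here: for a cover X of A the positive parts of Z - X n decrease to
    0. *)
Let outer_lower A Z : is_cyl Z -> (forall w, Z w <= 1) -> (forall w, ~ A w -> Z w <= 0) ->
  L Z <= outer A.
Proof.
move=> cZ Z1 Z0; apply: lb_le_inf; first by have [] := outer_has_inf A.
move=> c [X hX]; have [cX X0 Xinc Xsup Xc] := hX.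
pose Y n w := Num.max 0 (Z w - X n w).
have cY n : is_cyl (Y n) by apply: is_cyl_max; [exact: is_cyl_cst|exact: is_cylB].
have Y0 : L (Y n) @[n --> \oo] --> 0.
  case: dL => _ _ _ _; apply => //.
  - by move=> n w; rewrite le_max lexx.
  - move=> n w; rewrite /Y ge_max !le_max lexx /=.
    by apply/orP; right; have := Xinc n w; lra.
  move=> w; apply/cvgrPdist_le => eps e0.
  have [n hn] : exists n, Y n w <= eps.
    have [Aw|/Z0 Zw] := pselect (A w); last first.
      exists 0%N; rewrite /Y ge_max ltW//=; have := X0 0%N w; lra.
    have [|n hn] := Xsup w Aw (1 - eps); first lra.
    exists n; rewrite /Y ge_max ltW//=; have := Z1 w; lra.
  exists n => // m /= nm; rewrite sub0r normrN ger0_norm ?le_max ?lexx//.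
  apply: le_trans hn; rewrite /Y ge_max !le_max lexx /=; apply/orP; right.
  by have := cover_mono w hX nm; rewrite /=; lra.
have : L Z - c <= 0.
  apply: (@ler_cvg_to _ _ _ _ (fun _ => L Z - c) (fun n => L (Y n)) _ _ (cvg_cst _) Y0).
  apply: nearW => n; rewrite lerBlDr; apply: (@le_trans _ _ (L (fun w => Y n w + X n w))).
    apply: L_le => //; first exact: is_cylD.
    by move=> w; rewrite -lerBlDr le_max lexx orbT.
  by rewrite LD// lerD2l.
by rewrite subr_le0.
Qed.

Definition outer_mu A : \bar R := (outer A)%:E.

Local Notation mu := outer_mu.

Let mu_set0 : mu set0 = 0%E.
Proof.
congr EFin; apply/eqP; rewrite eq_le outer_ge0 andbT -(Lcst 0).
by apply: outer_upper => //; exact: is_cyl_cst.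
Qed.

Let mu_ge0 A : (0 <= mu A)%E.
Proof. by rewrite lee_fin. Qed.

Let mu_le : {homo mu : A A' / A `<=` A' >-> (A <= A')%E}.
Proof. by move=> A A' AA'; rewrite lee_fin; exact: outer_mono. Qed.

Let mu_sub : sigma_subadditive mu.
Proof.
move=> F; set S := (X in (_ <= X)%E).
have S0 : (0 <= S)%E by apply: nneseries_ge0.
have [Soo|Sfin] := eqVneq S +oo%E; first by rewrite Soo leey.
have Sf : S \is a fin_num by rewrite ge0_fin_numE// ltey.
rewrite -(fineK Sf) lee_fin; apply/ler_addgt0Pr => eps e0.
have hk k : exists X : nat -> Omega R -> R, cover (F k) (outer (F k) + eps / 2 ^+ k.+1) X.
  by apply: outer_lt; rewrite ltrDl divr_gt0// exprn_gt0.
have [X hX] := choice hk.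
have cX k n : is_cyl (X k n) by case: (hX k).
have X0 k n w : 0 <= X k n w by case: (hX k).
(* A diagonal sum: m + 1 covers at stage m, increasing in m and still a finite sum of cylinder
   functions. *)
pose Y m w := \sum_(0 <= k < m.+1) X k m w.
have partial m : \sum_(0 <= k < m) (outer (F k) + eps / 2 ^+ k.+1) <= fine S + eps.
  rewrite big_split/=; apply: lerD.
    rewrite -lee_fin -sumEFin fineK//.
    exact: (@nneseries_lim_ge R (fun k => mu (F k)) xpredT 0 m).
  suff -> : \sum_(0 <= k < m) eps / 2 ^+ k.+1 = eps - eps / 2 ^+ m.
    by rewrite gerBl divr_ge0 ?exprn_ge0// ltW.
  elim: m => [|m IH]; first by rewrite big_nil expr0 divr1 subrr.
  rewrite big_nat_recr//= IH exprS; field.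
  by rewrite expf_neq0.
apply: (@outer_le _ _ Y); split.
- by move=> m; exact: is_cyl_sum.
- by move=> m w; apply: sumr_ge0.
- move=> m w; rewrite [leRHS]big_nat_recr//= ler_wpDr//.
  by apply: ler_sum => k _; case: (hX k).
- move=> w [k _ Fw] a a1; have [_ _ _ h _] := hX k; have [n hn] := h w Fw a a1.
  exists (maxn k n); apply: (lt_le_trans hn).
  apply: (@le_trans _ _ (X k (maxn k n) w)).
    exact: (cover_mono w (hX k) (leq_maxr _ _)).
  rewrite /Y (bigD1_seq k) ?iota_uniq//=; last first.
    by rewrite mem_index_iota/= ltnS leq_maxl.
  by rewrite lerDl sumr_ge0.
- move=> m; apply: le_trans (partial m.+1); rewrite /Y.
  set M := m.+1; have := leqnn M; rewrite {1}/M; move: M => M _; elim: M => [|j IH].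
    by under eq_fun do rewrite big_nil; rewrite Lcst big_nil.
  rewrite big_nat_recr//=; under eq_fun do rewrite big_nat_recr//=.
  rewrite LD//; last by apply: is_cyl_sum.
  by apply: lerD => //; case: (hX j).
Qed.

HB.instance Definition _ := isOuterMeasure.Build R (Omega R) mu mu_set0 mu_ge0 mu_le mu_sub.

(** Increases with k to the indicator of a < Z. *)
Let phi k Z (a : R) w := Num.min 1 (k%:R * Num.max 0 (Z w - a)).

Let phi_cyl k Z a : is_cyl Z -> is_cyl (phi k Z a).
Proof.
move=> cZ; apply: is_cyl_min; first exact: is_cyl_cst.
by apply: is_cylZ; apply: is_cyl_max; [exact: is_cyl_cst|apply: is_cylB => //; exact: is_cyl_cst].
Qed.

Let phi01 k Z a w : 0 <= phi k Z a w <= 1.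
Proof. by rewrite /phi le_min ler01 ge_min lexx mulr_ge0// le_max lexx. Qed.

Let phi_mono k m Z a w : (k <= m)%N -> phi k Z a w <= phi m Z a w.
Proof.
move=> km; rewrite /phi le_min !ge_min lexx /=; apply/orP; right.
by apply: ler_wpM2r; rewrite ?le_max ?lexx// ler_nat.
Qed.

(** A cover X of A is split into X phi_k and X (1 - phi_k). The diagonal products cover the part of
    A in a < Z; on the rest k is frozen where the diagonal functional comes within eps / 2 of its
    supremum, since 1 - phi_k decreases in k. *)
Let caratheodory_cyl Z a : is_cyl Z -> mu.-caratheodory [set w | a < Z w].
Proof.
move=> cZ; apply: le_caratheodory_measurable => A.
rewrite -EFinD lee_fin; apply/ler_addgt0Pr => eps e0.
have e2 : 0 < eps / 2 by rewrite divr_gt0.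
have [|X hX] := @outer_lt A (outer A + eps / 2); first by rewrite ltrDl.
have [cX X0 Xinc Xsup Xc] := hX.
pose W k n w := X n w * phi k Z a w.
have cW k n : is_cyl (W k n) by apply: is_cylM => //; exact: phi_cyl.
have W0 k n w : 0 <= W k n w by apply: mulr_ge0 => //; case/andP: (phi01 k Z a w).
have Wle k k' n n' w : (k <= k')%N -> (n <= n')%N -> W k n w <= W k' n' w.
  move=> kk nn; apply: ler_pM => //; [by case/andP: (phi01 k Z a w)| |exact: phi_mono].
  exact: (cover_mono w hX nn).
have WX k n w : W k n w <= X n w.
  by rewrite ler_piMr//; case/andP: (phi01 k Z a w).
pose s := sup [set L (W n n) | n in setT].
have hs : has_sup [set L (W n n) | n in setT].
  split; first by exists (L (W 0%N 0%N)), 0%N.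
  by exists (outer A + eps / 2) => _ [n _ <-]; apply: le_trans (Xc n); exact: L_le.
have s1 : outer (A `&` [set w | a < Z w]) <= s.
  apply: (@outer_le _ _ (fun n => W n n)); split => //.
  - by move=> n w; exact: Wle.
  - move=> w [Aw /= aZ] b b1.
    have [b0|b0] := ltP b 0; first by exists 0%N; exact: lt_le_trans (W0 _ _ _).
    have [n hn] := Xsup w Aw b b1.
    pose m := (Num.truncn (Z w - a)^-1).+1.
    exists (maxn n m); apply: (lt_le_trans hn).
    have -> : W (maxn n m) (maxn n m) w = X (maxn n m) w.
      rewrite /W (_ : phi _ _ _ _ = 1) ?mulr1//; apply: min_idPl.
      have Za : 0 < Z w - a by rewrite subr_gt0.
      rewrite (max_idPr _); last exact: ltW.
      rewrite -ler_pdivrMr// div1r; apply: (@le_trans _ _ m%:R).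
        exact/ltW/truncnS_gt.
      by rewrite ler_nat leq_maxr.
    exact: (cover_mono w hX (leq_maxl _ _)).
  - by move=> n; apply: ub_le_sup; [have [] := hs|exists n].
have [_ [k _ <-] sk] := sup_adherent e2 hs; rewrite -/s in sk.
have VE n w : X n w - W k n w = X n w * (1 - phi k Z a w) by rewrite mulrBr mulr1.
have Vinc m n w : (m <= n)%N -> X m w - W k m w <= X n w - W k n w.
  move=> mn; rewrite !VE; apply: ler_wpM2r; last exact: (cover_mono w hX mn).
  by rewrite subr_ge0; case/andP: (phi01 k Z a w).
have s2 : outer (A `&` ~` [set w | a < Z w]) <= outer A + eps / 2 - (s - eps / 2).
  apply: (@outer_le _ _ (fun n w => X n w - W k n w)); split.
  - by move=> n; exact: is_cylB.
  - by move=> n w; rewrite subr_ge0.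
  - by move=> n w; apply: Vinc.
  - move=> w [Aw /= aZ] b b1; have [n hn] := Xsup w Aw b b1; exists n.
    rewrite /W (_ : phi _ _ _ _ = 0) ?mulr0 ?subr0//.
    rewrite /phi (max_idPl _) ?mulr0; last by rewrite subr_le0 leNgt; apply/negP.
    by apply: min_idPr.
  move=> n; apply: (@le_trans _ _ (L (fun w => X (maxn k n) w - W k (maxn k n) w))).
    by apply: L_le => [||w]; [exact: is_cylB|exact: is_cylB|apply: Vinc; exact: leq_maxr].
  rewrite LB//; have := Xc (maxn k n).
  have : L (W k k) <= L (W k (maxn k n)).
    by apply: L_le => // w; apply: Wle => //; exact: leq_maxl.
  lra.
by apply: (le_trans (lerD s1 s2)); lra.
Qed.
(** Coordinates are unbounded, hence not cylinder functions; cutting near a leaves the event that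
    they exceed a unchanged. *)
Let clip (a y : R) := Num.min (Num.max y (a - 1)) (a + 1).

Let clip_cyl q a : is_cyl (fun w => clip a (B q w - B 0 w)).
Proof.
eexists _, 1, (`|a| + 1); apply: is_cyl_incr => //.
  move=> x y; rewrite mul1r /clip.
  by have [?|?] := leP x (a - 1); have [?|?] := leP y (a - 1);
    rewrite ?minEle ?maxEle; do ?case: ifP; rewrite ?ler_norml; try (move=> *; apply/andP; split);
    have := ler_norm (x - y); have := ler_norm (y - x); rewrite (distrC y x); lra.
move=> x; rewrite /clip ler_norml; have := ler_norm a; have := ler_norm (- a); rewrite normrN => *.
by apply/andP; split; rewrite ?le_min ?le_max ?ge_min; [apply/andP; split; [apply/orP; right|]|apply/orP; right]; lra.
Qed.

Let borel_caratheodory : @measurable _ (Omega R) `<=` mu.-caratheodory.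
Proof.
apply: borel_generated => [|q a].
  split; first exact: caratheodory_measurable_set0.
    by move=> A; rewrite setTD; exact: caratheodory_measurable_setC.
  by move=> A hA; exact: caratheodory_measurable_bigcup.
have := caratheodory_cyl a (clip_cyl q a); congr caratheodory_measurable.
apply/seteqP; split => w /=; rewrite (@B_le0 _ 0)// subr0 /clip.
  by rewrite lt_min lt_max => /andP[/orP[//|]]; lra.
by move=> aB; rewrite lt_min lt_max aB/=; lra.
Qed.

Let mu_sigma_additive : semi_sigma_additive (mu : set (Omega R) -> _).
Proof.
move=> A mA tA mU; apply: caratheodory_measure_sigma_additive => //.
  by move=> i; exact: borel_caratheodory.
exact: borel_caratheodory.
Qed.

HB.instance Definition _ := isMeasure.Build _ (Omega R) R mu mu_set0 mu_ge0 mu_sigma_additive.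

Let mu_setT : mu [set: Omega R] = 1%E.
Proof.
congr EFin; apply/eqP; rewrite eq_le; apply/andP; split.
  rewrite -[leRHS]L1; apply: outer_upper => //; exact: is_cyl_cst.
rewrite -[leLHS]L1; apply: outer_lower => //; first exact: is_cyl_cst.
by move=> w h; exfalso; exact: h.
Qed.

HB.instance Definition _ := Measure_isProbability.Build _ (Omega R) R mu mu_setT.

(** The slice of Z between two consecutive levels, divided by h, is at most 1 and vanishes where Z
    does not exceed the lower level. *)
Let mu_layer Z h i : is_cyl Z -> 0 < h ->
  L (fun w => Num.min (Num.max (Z w) 0) (i.+1%:R * h)) -
  L (fun w => Num.min (Num.max (Z w) 0) (i%:R * h)) <= h * outer [set w | i%:R * h < Z w].
Proof.
move=> cZ h0; have cS k : is_cyl (fun w => Num.min (Num.max (Z w) 0) (k%:R * h)).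
  by apply: is_cyl_min; [apply: is_cyl_max => //|]; exact: is_cyl_cst.
have ih0 : 0 <= i%:R * h by rewrite mulr_ge0// ltW.
have ih : i.+1%:R * h = i%:R * h + h by rewrite -natr1 mulrDl mul1r.
rewrite -LB// -ler_pdivrMl// -LZ; last exact: is_cylB.
apply: outer_lower; first by apply: is_cylZ; exact: is_cylB.
  move=> w; rewrite ler_pdivrMl// mulr1 ih !minEle !maxEle.
  by do !case: ifP; lra.
move=> w /= /negP; rewrite -leNgt => Zw.
rewrite mulrC mulr_le0_ge0 ?invr_ge0 ?(ltW h0)// ih !minEle !maxEle.
by do !case: ifP; lra.
Qed.

Lemma is_cyl_integrable (P : probability (Omega R) R) A X : measurable A -> is_cyl X ->
  P.-integrable A (EFin \o X).
Proof.
move=> mA cX; have [M XM] := is_cyl_bddO cX.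
apply: measurable_bounded_integrable => //.
- by rewrite (le_lt_trans (probability_le1 P mA))// ltry.
- by apply: measurable_funTS; exact: is_cyl_measurable.
exists M; split; first exact: num_real.
by move=> y My w _; exact: le_trans (XM w) (ltW My).
Qed.

(** Summing slices of height h bounds L Z by h times the measures of the level sets; the same sum
    shifted by one level lies below the integral, and the shift costs at most h. *)
Lemma daniell_le01 Z : is_cyl Z -> (forall w, 0 <= Z w <= 1) ->
  L Z <= \int[mu]_w Z w.
Proof.
move=> cZ Z01; apply/ler_addgt0Pr => eps e0.
pose N := (Num.truncn eps^-1).+1; pose h : R := N%:R^-1.
have h0 : 0 < h by rewrite invr_gt0.
have he : h <= eps.
  by rewrite /h -[eps]invrK lef_pV2 ?posrE ?invr_gt0//; exact/ltW/truncnS_gt.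
have Nh : N%:R * h = 1 by rewrite mulfV// pnatr_eq0.
pose S k w := Num.min (Num.max (Z w) 0) (k%:R * h).
pose A k : set (Omega R) := [set w | k%:R * h < Z w].
have mA k : measurable (A k).
  rewrite (_ : A k = Z @^-1` `]k%:R * h, +oo[).
    by rewrite -[X in measurable X]setTI; apply: is_cyl_measurable.
  by apply/seteqP; split => w /=; rewrite in_itv/= andbT.
have up k : L (S k) <= \sum_(i < k) h * outer (A i).
  elim: k => [|k IH].
    rewrite big_ord0 /S mul0r (_ : (fun w => _) = fun=> 0) ?Lcst//.
    by apply/funext => w; rewrite (min_idPr _)// le_max lexx orbT.
  by rewrite big_ord_recr/=; have := mu_layer k cZ h0; rewrite -/(S k) -/(S k.+1) -/(A k); lra.
have SN : S N = Z.
  apply/funext => w; rewrite /S Nh; have /andP[? ?] := Z01 w.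
  by rewrite (max_idPl _)// (min_idPl _).
have sum_le k w : \sum_(i < k) h * \1_(A i.+1) w <= S k w.
  elim: k => [|k IH].
    by rewrite big_ord0 /S mul0r le_min lexx le_max lexx orbT.
  have ih : k.+1%:R * h = k%:R * h + h by rewrite -natr1 mulrDl mul1r.
  rewrite big_ord_recr/= indicE; case: (boolP (w \in A k.+1)) => [|_].
    rewrite inE /A/= => kZ; apply: (@le_trans _ _ (S k w + h * 1)); first by rewrite lerD2r.
    by move: kZ; rewrite mulr1 /S ih; rewrite !minEle !maxEle; do !case: ifP; lra.
  rewrite mulr0 addr0; apply: (le_trans IH); rewrite /S ih.
  by rewrite !minEle !maxEle; do !case: ifP; lra.
have low k : \sum_(i < k) h * outer (A i.+1) <= \int[mu]_w S k w.
  have cS : is_cyl (S k).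
    by apply: is_cyl_min; [apply: is_cyl_max => //|]; exact: is_cyl_cst.
  rewrite -lee_fin /Rintegral fineK; last first.
    have := integral_fune_fin_num measurableT (is_cyl_integrable _ measurableT cS).
    exact.
  rewrite -sumEFin.
  have -> : (\sum_(i < k) (h * outer (A i.+1))%:E =
      \int[mu]_w (\sum_(i < k) (h * \1_(A i.+1) w)%:E))%E.
    rewrite ge0_integral_sum//.
    - apply: eq_bigr => i _; under eq_integral do rewrite EFinM.
      rewrite ge0_integralZl_EFin//; last exact: ltW.
        by rewrite integral_indic// setIT -EFinM.
      exact/measurable_EFinP/measurable_indic.
    - move=> i; apply/measurable_EFinP; apply: measurable_funM => //.
    - by move=> i w _; rewrite lee_fin mulr_ge0// ltW.
  apply: ge0_le_integral => //.
  - by move=> w _; apply: sume_ge0 => i _; rewrite lee_fin mulr_ge0// ltW.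
  - by apply: emeasurable_sum => i; apply/measurable_EFinP; apply: measurable_funM.
  - by apply/measurable_EFinP; exact: is_cyl_measurable.
  - by move=> w _; rewrite sumEFin lee_fin.
have o1 i : outer (A i) <= 1.
  by rewrite -[leRHS]L1; apply: outer_upper => //; exact: is_cyl_cst.
have := up N; have := low N; rewrite SN => h1 h2.
apply: (le_trans h2); apply: (@le_trans _ _ (h + \sum_(i < N) h * outer (A i.+1))); last first.
  by rewrite addrC; exact: lerD.
have tel k : \sum_(i < k) h * outer (A i) =
    h * outer (A 0%N) + \sum_(i < k) h * outer (A i.+1) - h * outer (A k).
  elim: k => [|k IH]; first by rewrite !big_ord0; ring.
  by rewrite !big_ord_recr/= IH; ring.
have g1 : h * outer (A 0%N) <= h by rewrite ler_piMr// ltW.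
have g2 : 0 <= h * outer (A N) by rewrite mulr_ge0// ltW.
rewrite tel; lra.
Qed.

(** The inequality is applied to two affine images of Z in [0, 1], with slopes of opposite signs. *)
Lemma daniell_integral Z : is_cyl Z -> \int[mu]_w Z w = L Z.
Proof.
move=> cZ; have [M ZM] := is_cyl_bddO cZ.
have M0 : 0 <= M by exact: le_trans (ZM (zero_path R)).
pose c := 2 * (M + 1); have c0 : 0 < c by rewrite /c; lra.
have cst_cyl a := is_cyl_cst (R := R) a.
have E a b : \int[mu]_w (a * Z w + b) = a * (\int[mu]_w Z w) + b.
  rewrite RintegralD//; last 2 first.
  - by apply: is_cyl_integrable => //; exact: is_cylZ.
  - by apply: is_cyl_integrable.
  rewrite RintegralZl//; last exact: is_cyl_integrable.
  have o1 : outer setT = 1 by case: mu_setT.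
  by rewrite Rintegral_cst//= o1 mulr1.
have H a b : (forall w, 0 <= a * Z w + b <= 1) -> a * L Z <= a * \int[mu]_w Z w.
  move=> h; have := daniell_le01 (is_cylD (is_cylZ a cZ) (cst_cyl b)) h.
  by rewrite LD ?LZ ?Lcst ?E ?lerD2r//; exact: is_cylZ.
have Zb w : - (1 / 2) <= c^-1 * Z w <= 1 / 2.
  have /andP[h1 h2] : - M <= Z w <= M by rewrite -ler_norml.
  by rewrite ler_pdivrMl// ler_pdivlMl// /c; apply/andP; split; lra.
apply/eqP; rewrite eq_le; apply/andP; split.
  rewrite -(ler_pM2l (x := c^-1)) ?invr_gt0// -lerN2 -!mulNr; apply: (H _ (1/2)) => w.
  by have /andP[h1 h2] := Zb w; rewrite mulNr; apply/andP; split; lra.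
rewrite -(ler_pM2l (x := c^-1)) ?invr_gt0//; apply: (H _ (1/2)) => w.
by have /andP[h1 h2] := Zb w; apply/andP; split; lra.
Qed.

End daniell.

Lemma daniell_representation (R : realType) (L : (Omega R -> R) -> R) : daniell L ->
  exists P : probability (Omega R) R, forall X, is_cyl X -> \int[P]_w X w = L X.
Proof. by move=> dL; eexists => X cX; exact: (daniell_integral dL cX). Qed.

(* A sequence of paths with increments at dyadic-like mesh [256 ^- i] bounded by
   [lam i] up to time [2 ^ i] has a limit path along an ultrafilter. *)
Section limit_path.
Context (R : realType).
Implicit Types (i j k l n : nat) (s t : R).
Variables (m : nat) (lam : nat -> R) (w : nat -> Omega R).
Hypothesis m0 : (0 < m)%N.
Hypothesis lam0 : forall i, 0 <= lam i.
Hypothesis lamS : forall i, lam i = 2 * lam i.+1.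

Definition gridpt i l : R := l%:R / m%:R ^+ i.
Definition fl i t : R := gridpt i (Num.truncn (t * m%:R ^+ i)).

Definition regular i (x : Omega R) := forall j, (j < (2 * m) ^ i)%N ->
  `|B (gridpt i j.+1) x - B (gridpt i j) x| <= lam i.

Hypothesis wreg : forall n i, (i <= n)%N -> regular i (w n).

Let pm i : 0 < m%:R ^+ i :> R. Proof. by rewrite exprn_gt0// ltr0n. Qed.

Lemma lam_cvg (C eps a : R) : 0 <= C -> 0 < eps ->
  exists i0, forall i, (i0 <= i)%N -> C * lam i < eps /\ a < 2 ^+ i.
Proof.
move=> C0 e0; have lamE i : lam i = lam 0%N / 2 ^+ i.
  elim: i => [|i IH]; first by rewrite expr0 divr1.
  have h : 2 ^+ i != 0 :> R by rewrite expf_neq0.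
  rewrite exprS; apply: (mulfI (_ : 2 != 0 :> R)) => //.
  by rewrite -lamS IH; field.
have i2 i : i%:R <= 2 ^+ i :> R by rewrite -natrX ler_nat ltnW// ltn_expl.
pose b := Num.max `|a| (C * lam 0%N / eps).
have b0 : 0 <= b by rewrite le_max normr_ge0.
exists (Num.truncn b).+1 => i bi.
have bi' : b < 2 ^+ i.
  by apply: lt_le_trans (i2 i); apply: (lt_le_trans (truncnS_gt b)); rewrite ler_nat.
move: bi'; rewrite gt_max => /andP[h1 h2]; split; last exact: le_lt_trans (ler_norm _) h1.
by rewrite lamE mulrA ltr_pdivrMr ?exprn_gt0// -ltr_pdivrMl// mulrC.
Qed.

Lemma bseq_eventually (x : nat -> R) N (K : R) : (forall n, (N <= n)%N -> `|x n| <= K) -> bseq x.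
Proof.
move=> h; exists (`|K| + \sum_(0 <= n < N) `|x n|) => n.
have [Nn|nN] := leqP N n.
  apply: (le_trans (h n Nn)); apply: (le_trans (ler_norm K)).
  by rewrite lerDl sumr_ge0.
rewrite (bigD1_seq n) ?iota_uniq//=; last by rewrite mem_index_iota.
by rewrite addrCA lerDl addr_ge0// sumr_ge0.
Qed.

Let trunc_nonpos (t : R) : t <= 0 -> Num.truncn t = 0%N.
Proof. by move=> t0; apply/truncn0Pn; rewrite -ltNge (le_lt_trans t0). Qed.

Let trunc_succ (t : R) : (Num.truncn (t + 1) <= (Num.truncn t).+1)%N.
Proof.
have [t0|t0] := ltP t 0; last first.
  by rewrite -ltnS truncn_lt_nat ?addr_ge0// -[ltRHS]natr1 ltrD2r truncnS_gt.
have /truncn0Pn -> // : ~~ (1 <= t + 1).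
by rewrite -ltNge gtrDr.
Qed.

Lemma truncn_fl_lt i t : t < 2 ^+ i -> (Num.truncn (t * m%:R ^+ i) < (2 * m) ^ i)%N.
Proof.
move=> ti; have [t0|t0] := leP 0 t; last first.
  by rewrite trunc_nonpos ?expn_gt0 ?muln_gt0 ?m0// mulr_le0_ge0// ltW.
rewrite -(ltr_nat R) natrX; apply: (@le_lt_trans _ _ (t * m%:R ^+ i)).
  by rewrite truncn_le// mulr_ge0// ltW.
by rewrite natrM exprMn ltr_pM2r.
Qed.

Lemma regular_chain i x a k : regular i x -> (a + k <= (2 * m) ^ i)%N ->
  `|B (gridpt i (a + k)) x - B (gridpt i a) x| <= k%:R * lam i.
Proof.
move=> rx; elim: k => [|k IH] ak; first by rewrite addn0 subrr normr0 mul0r.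
rewrite addnS in ak *; rewrite -natr1 mulrDl mul1r.
rewrite -[X in `|X - _|](subrK (B (gridpt i (a + k)) x)) -addrA.
by apply: (le_trans (ler_normD _ _)); rewrite [leRHS]addrC; apply: lerD; [exact: rx|apply: IH; exact: ltnW].
Qed.

Let trunc_refine i t : (m * Num.truncn (t * m%:R ^+ i) <= Num.truncn (t * m%:R ^+ i.+1)
  <= m * Num.truncn (t * m%:R ^+ i) + m)%N.
Proof.
have [t0|t0] := leP t 0; first by rewrite !trunc_nonpos ?mulr_le0_ge0// ?ltW// muln0.
have t1 j : 0 <= t * m%:R ^+ j by rewrite mulr_ge0// ltW.
have /andP[h1 h2] := truncn_itv (t1 i).
have e : t * m%:R ^+ i.+1 = m%:R * (t * m%:R ^+ i) by rewrite exprS mulrCA.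
rewrite truncn_ge_nat// e natrM ler_wpM2l//=; apply: ltnW.
rewrite truncn_lt_nat; last by rewrite -e.
by rewrite addnC -mulnS natrM ltr_pM2l ?ltr0n.
Qed.

(** Refinement moves the mesh point below t by at most m steps; writing [lam i.+1] as
    [lam i - lam i.+1] makes the bounds telescope in [fl_dist]. *)
Lemma fl_succ i t x : regular i.+1 x -> t < 2 ^+ i ->
  `|B (fl i.+1 t) x - B (fl i t) x| <= m%:R * (lam i - lam i.+1).
Proof.
move=> rx ti; have ti' : t < 2 ^+ i.+1.
  by apply: (lt_le_trans ti); rewrite exprS ler_peMl// ?exprn_ge0// ler1n.
have /andP[h1 h2] := trunc_refine i t.
rewrite /fl -[in gridpt i.+1 _](subnKC h1).
have -> : gridpt i (Num.truncn (t * m%:R ^+ i)) = gridpt i.+1 (m * Num.truncn (t * m%:R ^+ i)).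
  rewrite /gridpt natrM exprS; have p := pm i; field.
  by rewrite gt_eqF//= pnatr_eq0 -lt0n.
apply: (le_trans (regular_chain rx _)).
  by rewrite subnKC//; apply: ltnW; exact: truncn_fl_lt.
have -> : lam i - lam i.+1 = lam i.+1 by rewrite lamS; ring.
apply: ler_wpM2r; first exact: lam0.
rewrite ler_nat leq_subLR; exact: h2.
Qed.

Lemma fl_dist i k t x : (i <= k)%N -> (forall j, (j <= k)%N -> regular j x) -> t < 2 ^+ i ->
  `|B (fl k t) x - B (fl i t) x| <= m%:R * (lam i - lam k).
Proof.
move=> ik rx ti; rewrite -(subnKC ik) in rx *; move: (k - i)%N rx => d.
elim: d => [|d IH] rx; first by rewrite addn0 !subrr normr0 mulr0.
rewrite addnS; rewrite -[X in `|X - _|](subrK (B (fl (i + d) t) x)) -addrA.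
apply: (le_trans (ler_normD _ _)).
have -> : m%:R * (lam i - lam (i + d).+1) =
  m%:R * (lam (i + d)%N - lam (i + d).+1) + m%:R * (lam i - lam (i + d)%N) by ring.
apply: lerD.
  apply: fl_succ; first by apply: rx; rewrite addnS.
  apply: (lt_le_trans ti); rewrite ler_eXn2l ?ltr1n// ?leq_addr//.
by apply: IH => j jd; apply: rx; rewrite addnS ltnW.
Qed.

Definition glim (s : R) := ulim (fun n => B s (w n)).

Lemma fl_bseq i t : t < 2 ^+ i -> bseq (fun n => B (fl i t) (w n)).
Proof.
move=> ti; apply: (@bseq_eventually _ i ((Num.truncn (t * m%:R ^+ i))%:R * lam i)) => n ni.
have := @regular_chain i (w n) 0 (Num.truncn (t * m%:R ^+ i)) (wreg ni).
rewrite add0n; have -> : gridpt i 0 = 0 by rewrite /gridpt mul0r.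
by rewrite (@B_le0 _ 0)// subr0; apply; apply: ltnW; exact: truncn_fl_lt.
Qed.

Lemma ulim_dist (x y : nat -> R) (K : R) : bseq x -> bseq y ->
  (\forall n \near \oo, `|x n - y n| <= K) -> `|ulim x - ulim y| <= K.
Proof.
move=> bx bY h; rewrite -ulimN -?ulimD//; last by have := bseqZ (-1) bY; under eq_fun do rewrite mulN1r.
have bxy : bseq (fun n => x n - y n).
  by apply: bseqD => //; have := bseqZ (-1) bY; under eq_fun do rewrite mulN1r.
rewrite ler_norml; apply/andP; split.
  apply: ulim_ge_cst => //; apply: near_ultra; apply: filterS h => n.
  by rewrite ler_norml => /andP[].
apply: ulim_le_cst => //; apply: near_ultra; apply: filterS h => n.
by rewrite ler_norml => /andP[].
Qed.

Lemma glim_dist i k t : (i <= k)%N -> t < 2 ^+ i ->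
  `|glim (fl k t) - glim (fl i t)| <= m%:R * lam i.
Proof.
move=> ik ti; have tk : t < 2 ^+ k.
  by apply: (lt_le_trans ti); rewrite ler_eXn2l ?ltr1n.
apply: ulim_dist; [exact: fl_bseq|exact: fl_bseq|].
exists k => // n /= kn; apply: le_trans (fl_dist ik _ ti) _ => [j jk|].
  by apply: wreg; exact: leq_trans kn.
by rewrite ler_wpM2l// gerBl.
Qed.

(** The limit over n is taken first at mesh points, where the increments are controlled, and then
    along the mesh points below t. *)
Definition lim_path_fun t := ulim (fun k => glim (fl k t)).

Lemma glim_bseq t : bseq (fun k => glim (fl k t)).
Proof.
have [i0 hi0] := lam_cvg t (lexx 0) ltr01; have [_ ti] := hi0 i0 (leqnn _).
apply: (@bseq_eventually _ i0 (`|glim (fl i0 t)| + m%:R * lam i0)) => k ik.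
rewrite -[X in `|X|](subrK (glim (fl i0 t))) addrC; apply: (le_trans (ler_normD _ _)).
by rewrite lerD2l glim_dist.
Qed.

Lemma lim_path_dist i t : t < 2 ^+ i -> `|lim_path_fun t - glim (fl i t)| <= m%:R * lam i.
Proof.
move=> ti; rewrite -(ulim_cst (glim (fl i t))); apply: ulim_dist.
- exact: glim_bseq.
- exact: bseq_cst.
by exists i => // k /= ik; exact: glim_dist.
Qed.

Lemma fl_adj i s t : `|s - t| <= (m%:R ^+ i)^-1 -> s < 2 ^+ i -> t < 2 ^+ i ->
  `|glim (fl i s) - glim (fl i t)| <= lam i.
Proof.
move=> st si ti; apply: ulim_dist; [exact: fl_bseq|exact: fl_bseq|].
exists i => // n /= ni; have rn := wreg ni.
wlog sT : s t st si ti / (Num.truncn (s * m%:R ^+ i) <= Num.truncn (t * m%:R ^+ i))%N.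
  move=> h; have [?|/ltnW ?] := leqP (Num.truncn (s * m%:R ^+ i)) (Num.truncn (t * m%:R ^+ i)).
    exact: h.
  by rewrite distrC; apply: h => //; rewrite distrC.
have : (Num.truncn (t * m%:R ^+ i) <= (Num.truncn (s * m%:R ^+ i)).+1)%N.
  apply: leq_trans (trunc_succ _); apply: le_truncn.
  have : t - s <= (m%:R ^+ i)^-1 by apply: le_trans st; rewrite distrC ler_norm.
  by rewrite -[X in _ <= X]mul1r ler_pdivlMr// mulrBl lerBlDl.
rewrite leq_eqVlt ltnS => /orP[/eqP e|e].
  by rewrite distrC /fl e; apply: rn; exact: truncn_fl_lt.
have -> : fl i s = fl i t by rewrite /fl; congr gridpt; apply/eqP; rewrite eqn_leq sT.
by rewrite subrr normr0.
Qed.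

Lemma lim_path_continuous : continuous lim_path_fun.
Proof.
move=> t; apply/cvgrPdist_lt => eps e0.
have [i0 hi0] := @lam_cvg (2 * m%:R + 1) eps (`|t| + 1) ltac:(by rewrite addr_ge0// mulr_ge0) e0.
have [li ti] := hi0 i0 (leqnn _).
have p0 : 0 < (m%:R ^+ i0)^-1 :> R by rewrite invr_gt0.
near=> s.
have ts : `|t - s| <= (m%:R ^+ i0)^-1 by near: s; apply: cvgr_dist_le => //; exact: cvg_id.
have tl : t < 2 ^+ i0 by apply: le_lt_trans ti; have := ler_norm t; lra.
have sl : s < 2 ^+ i0.
  apply: le_lt_trans ti.
  have : (m%:R ^+ i0)^-1 <= 1 :> R by rewrite invf_le1// exprn_ege1// ler1n.
  have := ler_norm t; have := ler_norm (s - t); rewrite distrC in ts; lra.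
apply: le_lt_trans li.
have -> : lim_path_fun t - lim_path_fun s = (lim_path_fun t - glim (fl i0 t)) +
  (glim (fl i0 t) - glim (fl i0 s)) - (lim_path_fun s - glim (fl i0 s)) by ring.
apply: (le_trans (ler_normB _ _)).
apply: (@le_trans _ _ (m%:R * lam i0 + lam i0 + m%:R * lam i0)); last by lra.
apply: lerD; last exact: lim_path_dist.
apply: (le_trans (ler_normD _ _)); apply: lerD; first exact: lim_path_dist.
exact: fl_adj.
Unshelve. all: by end_near. Qed.

Lemma lim_path_nonpos t : t <= 0 -> lim_path_fun t = 0.
Proof.
move=> t0; rewrite /lim_path_fun -[RHS]ulim_cst; congr ulim; apply/funext => k.
rewrite /glim -[RHS]ulim_cst; congr ulim; apply/funext => n.
by rewrite /fl trunc_nonpos ?mulr_le0_ge0// ?ltW// /gridpt mul0r B_le0.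
Qed.

Definition lim_path : Omega R := CPath lim_path_continuous lim_path_nonpos.

(** Regularity says nothing between mesh points, so at a general q the hypothesis ties the paths to
    the mesh point below. *)
Lemma lim_path_cvg q i0 : (forall n i, (i0 <= i <= n)%N -> `|B q (w n) - B (fl i q) (w n)| <= lam i) ->
  B q (w n) @[n --> ultra] --> B q lim_path.
Proof.
move=> hq; have hgl i : (i0 <= i)%N -> q < 2 ^+ i ->
    bseq (fun n => B q (w n)) /\ `|glim q - glim (fl i q)| <= lam i.
  move=> ii qi; have bq : bseq (fun n => B q (w n)).
    have [K hK] := fl_bseq qi.
    apply: (@bseq_eventually _ i (K + lam i)) => n ni.
    rewrite -[X in `|X|](subrK (B (fl i q) (w n))) addrC; apply: (le_trans (ler_normD _ _)).
    by apply: lerD => //; apply: hq; rewrite ii.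
  split => //; apply: ulim_dist => //; first exact: fl_bseq.
  by exists i => // n /= ni; apply: hq; rewrite ii.
have [i1 hi1] := lam_cvg q (lexx 0) ltr01.
have bq : bseq (fun n => B q (w n)).
  have [_ qi] := hi1 (maxn i0 i1) (leq_maxr _ _).
  by have [] := hgl (maxn i0 i1) (leq_maxl _ _) qi.
suff -> : B q lim_path = glim q by exact: ulimP.
apply/eqP; rewrite -subr_eq0 -normr_le0; apply/ler_addgt0Pr => eps e0; rewrite add0r.
have [i2 hi2] := @lam_cvg (m%:R + 1) eps q ltac:(by rewrite addr_ge0) e0.
have [li qi] := hi2 (maxn i0 i2) (leq_maxr _ _).
have [_ h1] := hgl (maxn i0 i2) (leq_maxl _ _) qi.
have h2 := lim_path_dist qi.
apply: le_trans (ltW li); rewrite -/(lim_path_fun q).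
have -> : B q lim_path - glim q = (lim_path_fun q - glim (fl (maxn i0 i2) q)) -
   (glim q - glim (fl (maxn i0 i2) q)) by rewrite /B/=; ring.
by apply: (le_trans (ler_normB _ _)); lra.
Qed.

End limit_path.

(** * Daniell's condition from fourth moments *)

Section sigma_continuity.
Context (R : realType) (sl sh : R).
Hypotheses (h0 : 0 <= sl) (hs : sl <= sh).
Implicit Types (X Y : Omega R -> R) (w : Omega R) (s t q : R).

Definition E0 X : R := Eop sl sh 0 X (zero_path R).

(** A bounded Lipschitz majorant of the indicator of |y| > [lam], itself below (y / lam)^4:
    Chebyshev's inequality within cylinder functions. *)
Definition bump4 (lam y : R) : R := (Num.min 1 `|y / lam|) ^+ 4.

Lemma bump4_lipf lam : 0 < lam -> lipf (4 / lam) (bump4 lam).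
Proof.
move=> l0 x y; rewrite /bump4.
have min_lip (a b : R) : `|Num.min 1 a - Num.min 1 b| <= `|a - b|.
  have := ler_norm (a - b); have := ler_norm (b - a); rewrite distrC => h1 h2.
  by rewrite !minEle ler_norml; apply/andP; split; do !case: ifP; lra.
set a := Num.min 1 `|x / lam|; set b := Num.min 1 `|y / lam|.
have itv (z : R) : 0 <= Num.min 1 `|z| <= 1 by rewrite le_min ler01 normr_ge0 ge_min lexx.
have /andP[a0 a1] : 0 <= a <= 1 by exact: itv.
have /andP[b0 b1] : 0 <= b <= 1 by exact: itv.
have -> : a ^+ 4 - b ^+ 4 = (a - b) * ((a + b) * (a ^+ 2 + b ^+ 2)) by ring.
rewrite normrM mulrAC -mulrA mulrC; apply: ler_pM => //.
  rewrite ger0_norm; last by rewrite mulr_ge0// addr_ge0// sqr_ge0.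
  have -> : 4 = 2 * 2 :> R by ring.
  have a2 : a ^+ 2 <= 1 by rewrite exprn_ile1.
  have b2 : b ^+ 2 <= 1 by rewrite exprn_ile1.
  apply: ler_pM; [exact: addr_ge0|by rewrite addr_ge0// sqr_ge0|lra|lra].
apply: (le_trans (min_lip _ _)); apply: (le_trans (ler_dist_dist _ _)).
by rewrite -mulrBl normrM normfV (gtr0_norm l0).
Qed.

Lemma bump4_ge0 lam y : 0 <= bump4 lam y.
Proof. by rewrite exprn_ge0// le_min ler01 normr_ge0. Qed.

Lemma bump4_le1 lam y : bump4 lam y <= 1.
Proof. by rewrite exprn_ile1// ?ge_min ?lexx// le_min ler01 normr_ge0. Qed.

Lemma bump4_lt1 lam y : 0 < lam -> bump4 lam y < 1 -> `|y| <= lam.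
Proof.
move=> l0 h; rewrite leNgt; apply/negP => ly; move: h; rewrite /bump4.
rewrite (min_idPl _) ?expr1n ?ltxx// normrM normfV (gtr0_norm l0) ler_pdivlMr// mul1r.
exact: ltW.
Qed.

Lemma bump4_le lam y : 0 < lam -> bump4 lam y <= lam ^- 4 * y ^+ 4.
Proof.
move=> l0; apply: (@le_trans _ _ (`|y / lam| ^+ 4)).
  by rewrite lerXn2r// ?nnegrE// ?le_min ?ler01 ?normr_ge0// ge_min lexx orbT.
by rewrite -normrX ger0_norm ?exprn_even_ge0// exprMn exprVn mulrC.
Qed.

Lemma is_cyl_bump lam s t : 0 < lam -> is_cyl (fun w => bump4 lam (B t w - B s w)).
Proof.
move=> l0; eexists _, _, _; apply: (@is_cyl_incr R s t _ (4 / lam) 1).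
- by rewrite divr_ge0// ltW.
- exact: bump4_lipf.
- by move=> x; rewrite ger0_norm ?bump4_ge0// bump4_le1.
Qed.

(** The second alternative serves a prescribed time t <= 0, whose mesh point is 0 and may exceed
    it. *)
Lemma E0_bump lam s t d : 0 < lam -> 0 <= s -> s <= t \/ (s = 0 /\ t <= 0) -> t - s <= d ->
  E0 (fun w => bump4 lam (B t w - B s w)) <= 3 * lam ^- 4 * sh ^+ 4 * d ^+ 2.
Proof.
move=> l0 s0 st td.
have b4 : 0 <= 3 * lam ^- 4 * sh ^+ 4.
  apply: mulr_ge0; last by rewrite exprn_ge0// (le_trans h0).
  by rewrite mulr_ge0// invr_ge0 exprn_ge0// ltW.
have [lt_st|le_ts] := ltP s t; last first.
  apply: (@le_trans _ _ 0); last by rewrite mulr_ge0// sqr_ge0.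
  rewrite /E0 (_ : (fun w => _) = fun=> 0).
    by rewrite (le_trans (ler_norm _))//; apply: Eop_bound => w; rewrite normr0.
  apply/funext => w; have -> : B t w = B s w.
    case: st => [st|[-> t0]]; first by congr (B _ w); apply/eqP; rewrite eq_le le_ts.
    by rewrite !B_le0.
  by rewrite subrr /bump4 mul0r normr0 (min_idPr ler01) expr0n.
have l4 : 0 <= 4 / lam by rewrite divr_ge0// ltW.
have b1 x : `|bump4 lam x| <= 1 by rewrite ger0_norm ?bump4_ge0// bump4_le1.
rewrite /E0 (Eop_incr h0 hs _ s0 lt_st l4 (bump4_lipf l0) b1).
have ts0 : 0 <= t - s by rewrite subr_ge0 ltW.
apply: (le_trans (@Sg_fourth _ _ _ h0 hs _ _ _ (lam ^- 4) _ (bump4_lipf l0) ts0 _ _)).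
- by exists 1.
- by rewrite invr_gt0 exprn_gt0.
- by move=> y; exact: bump4_le.
rewrite -exprM; apply: ler_wpM2l => //.
by rewrite lerXn2r// ?nnegrE// (le_trans ts0).
Qed.

Variable L : (Omega R -> R) -> R.
Hypothesis LD : forall X Y, is_cyl X -> is_cyl Y -> L (fun w => X w + Y w) = L X + L Y.
Hypothesis LZ : forall a X, is_cyl X -> L (fun w => a * X w) = a * L X.
Hypothesis LE : forall X, is_cyl X -> L X <= E0 X.

Let L_ge0 X : is_cyl X -> (forall w, 0 <= X w) -> 0 <= L X.
Proof.
move=> cX X0; rewrite -oppr_le0 -mulN1r -LZ//; apply: (le_trans (LE (is_cylZ _ cX))).
have c0 : is_cyl (fun _ : Omega R => (0 : R)) by exact: is_cyl_cst.
apply: (le_trans (Eop_le h0 hs (lexx 0) (is_cylZ (-1) cX) c0 _ _)).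
  by move=> w; rewrite mulN1r oppr_le0.
by rewrite (le_trans (ler_norm _))//; apply: Eop_bound => w; rewrite normr0.
Qed.

Let L_le_cst X c : is_cyl X -> (forall w, X w <= c) -> L X <= c.
Proof.
move=> cX Xc; apply: (le_trans (LE cX)).
apply: (le_trans (Eop_le h0 hs (lexx 0) cX (is_cyl_cst c) Xc _)).
by rewrite Eop_past.
Qed.

Let LB X Y : is_cyl X -> is_cyl Y -> L (fun w => X w - Y w) = L X - L Y.
Proof.
move=> cX cY; rewrite (_ : (fun w => _) = (fun w => X w + -1 * Y w)).
  by rewrite LD ?LZ ?mulN1r//; exact: is_cylZ.
by apply/funext => w; rewrite mulN1r.
Qed.

Let L_le X Y : is_cyl X -> is_cyl Y -> (forall w, X w <= Y w) -> L X <= L Y.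
Proof.
move=> cX cY XY; rewrite -subr_ge0 -LB//; apply: L_ge0; first exact: is_cylB.
by move=> w; rewrite subr_ge0.
Qed.

Let L_sum (I : Type) (r : seq I) (X : I -> Omega R -> R) : (forall i, is_cyl (X i)) ->
  L (fun w => \sum_(i <- r) X i w) = \sum_(i <- r) L (X i).
Proof.
move=> cX; elim: r => [|i r IH].
  under eq_fun do rewrite big_nil; rewrite big_nil -[RHS](mul0r (L (fun=> 0))) -LZ; last exact: is_cyl_cst.
  by congr L; apply/funext => w; rewrite mul0r.
under eq_fun do rewrite big_cons; rewrite big_cons LD ?IH//; exact: is_cyl_sum.
Qed.

(** Up to time 2^i the mesh has 2^i m^i points, and an increment passes Lam 2^(-i) with weight of
    order 2^(4 i) m^(-2 i); with m = 2^6 the total is of order 2^(-i), which is summable. *)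
Let m := 64%N.
Let m0 : (0 < m)%N. Proof. by []. Qed.

Section bad_event.
Variables (Lam : R) (q : nat -> R).
Hypothesis Lam0 : 0 < Lam.

Let lam i : R := Lam / 2 ^+ i.

Let lam_gt0 i : 0 < lam i.
Proof. by rewrite divr_gt0// exprn_gt0. Qed.

(** Besides the mesh increments, the first (2 m)^i prescribed times are tied to the mesh points
    below them. *)
Let bad i w := \sum_(j < (2 * m) ^ i)
  (bump4 (lam i) (B (gridpt R m i j.+1) w - B (gridpt R m i j) w) +
   bump4 (lam i) (B (q j) w - B (fl m i (q j)) w)).

Let bad_cyl i : is_cyl (bad i).
Proof. by apply: is_cyl_sum => j; apply: is_cylD; exact: is_cyl_bump. Qed.

Let bad_ge0 i w : 0 <= bad i w.
Proof. by apply: sumr_ge0 => j _; apply: addr_ge0; exact: bump4_ge0. Qed.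

Let pm i : 0 < m%:R ^+ i :> R. Proof. by rewrite exprn_gt0// ltr0n. Qed.

Let L_bad i : L (bad i) <= 6 * sh ^+ 4 / Lam ^+ 4 * 2 ^- i.
Proof.
rewrite L_sum; last by move=> j; apply: is_cylD; exact: is_cyl_bump.
have gp j : 0 <= gridpt R m i j by rewrite divr_ge0// ltW.
pose c := 3 * lam i ^- 4 * sh ^+ 4 * (m%:R ^- i) ^+ 2.
apply: (@le_trans _ _ (\sum_(j < (2 * m) ^ i) (c + c))).
  apply: ler_sum => j _; rewrite LD; [|exact: is_cyl_bump|exact: is_cyl_bump].
  apply: lerD; apply: (le_trans (LE (is_cyl_bump _ _ (lam_gt0 i)))); apply: E0_bump => //.
  - by left; rewrite ler_pM2r ?invr_gt0// ler_nat.
  - by rewrite -mulrBl -natr1 addrAC subrr add0r mul1r.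
  - by rewrite divr_ge0// ltW.
  - have [q0|q0] := leP (q j) 0.
      right; split=> //; rewrite /fl /gridpt.
      have /truncn0Pn -> : ~~ (1 <= q j * m%:R ^+ i); last by rewrite mul0r.
      by rewrite -ltNge (@le_lt_trans _ _ 0)// mulr_le0_ge0// ltW.
    by left; rewrite /fl /gridpt ler_pdivrMr// truncn_le mulr_ge0// ltW.
  have h : q j * m%:R ^+ i < (Num.truncn (q j * m%:R ^+ i))%:R + 1.
    by rewrite natr1 truncnS_gt.
  rewrite lerBlDl /fl /gridpt -[X in _ + X]mul1r -mulrDl ler_pdivlMr//.
  exact: ltW.
rewrite sumr_const card_ord -[leLHS]mulr_natl natrX natrM exprMn.
have l2 : 2 ^+ i != 0 :> R by rewrite expf_neq0.
have lm : m%:R ^+ i != 0 :> R by rewrite gt_eqF.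
have m6 : m%:R = 2 ^+ 6 :> R by rewrite -(natrX R 2 6).
have m2 : m%:R ^+ i = (2 ^+ i) ^+ 6 :> R by rewrite m6 -!exprM mulnC.
rewrite le_eqVlt; apply/orP; left; apply/eqP; rewrite /c /lam m2; field.
by rewrite l2 gt_eqF.
Qed.

Let geom k : \sum_(i < k) 2 ^- i <= 2 - 2 ^- k * 2 :> R.
Proof.
elim: k => [|k IH]; first by rewrite big_ord0 expr0 invr1 mul1r subrr.
rewrite big_ord_recr/=; have e : 2 ^- k = 2 ^- k.+1 * 2 :> R.
  by rewrite exprS; field; rewrite expf_neq0.
by move: IH; rewrite e; lra.
Qed.

Let L_bads k : L (fun w => \sum_(i < k) bad i w) <= 12 * sh ^+ 4 / Lam ^+ 4.
Proof.
rewrite L_sum; last by move=> i; exact: bad_cyl.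
apply: (@le_trans _ _ (\sum_(i < k) (6 * sh ^+ 4 / Lam ^+ 4 * 2 ^- i))).
  by apply: ler_sum => i _; exact: L_bad.
rewrite -mulr_sumr; have -> : 12 * sh ^+ 4 / Lam ^+ 4 = 6 * sh ^+ 4 / Lam ^+ 4 * 2 by ring.
apply: ler_wpM2l.
  by rewrite mulr_ge0 ?invr_ge0 ?exprn_ge0 ?(ltW Lam0)// mulr_ge0// exprn_ge0// (le_trans h0).
by apply: (le_trans (geom k)); rewrite gerBl mulr_ge0// invr_ge0 exprn_ge0.
Qed.

(** L of X minus M times all bumps is at least delta / 2, so some path gives it a value above delta
    / 4. As X <= M, the bumps there sum to less than 1, and no increment passes its threshold. *)
Lemma good_path X (M delta : R) k : is_cyl X -> 0 < M -> (forall w, X w <= M) ->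
  delta <= L X -> M * (12 * sh ^+ 4 / Lam ^+ 4) <= delta / 2 -> 0 < delta ->
  exists w, [/\ delta / 4 < X w, (forall i, (i < k)%N -> regular m lam i w) &
    forall i j, (i < k)%N -> (j < (2 * m) ^ i)%N -> `|B (q j) w - B (fl m i (q j)) w| <= lam i].
Proof.
move=> cX M0 XM dX hM d0.
have cb : is_cyl (fun w => \sum_(i < k) bad i w) by exact: is_cyl_sum.
have [w hw] : exists w, delta / 4 < X w - M * \sum_(i < k) bad i w.
  apply: contrapT => /forallNP h.
  have : L (fun w => X w - M * \sum_(i < k) bad i w) <= delta / 4.
    apply: L_le_cst; first by apply: is_cylB => //; exact: is_cylZ.
    by move=> w; rewrite leNgt; apply/negP; exact: h.
  rewrite LB ?LZ//; last exact: is_cylZ.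
  have := ler_wpM2l (ltW M0) (L_bads k); lra.
have s0 : 0 <= \sum_(i < k) bad i w by apply: sumr_ge0.
have s1 : \sum_(i < k) bad i w < 1.
  rewrite -(ltr_pM2l M0) mulr1; have := XM w; lra.
have bad1 i : (i < k)%N -> bad i w < 1.
  move=> ik; apply: le_lt_trans s1; rewrite (bigD1 (Ordinal ik))//= lerDl; exact: sumr_ge0.
have term i j : (i < k)%N -> (j < (2 * m) ^ i)%N ->
   bump4 (lam i) (B (gridpt R m i j.+1) w - B (gridpt R m i j) w) +
   bump4 (lam i) (B (q j) w - B (fl m i (q j)) w) < 1.
  move=> ik ji; apply: le_lt_trans (bad1 i ik).
  rewrite /bad (bigD1 (Ordinal ji))//= lerDl; apply: sumr_ge0 => j' _.
  by apply: addr_ge0; exact: bump4_ge0.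
exists w; split.
- have := mulr_ge0 (ltW M0) s0; lra.
- move=> i ik j ji; apply: bump4_lt1 => //; apply: le_lt_trans (term i j ik ji).
  by rewrite lerDl bump4_ge0.
move=> i j ik ji; apply: bump4_lt1 => //; apply: le_lt_trans (term i j ik ji).
by rewrite lerDr bump4_ge0.
Qed.

End bad_event.

(** If L (X n) stayed above eps, there would be paths w_n with controlled increments and X_k w_n >
    eps / 4 for k <= n; a limit path v then has X_k v >= eps / 4 for every k, against pointwise
    convergence. This replaces tightness, as no measure is available yet. *)
Lemma dominated_daniell : daniell L.
Proof.
split => //.
  apply/eqP; rewrite eq_le L_le_cst//=; last exact: is_cyl_cst.
  have : L (fun w => -1 * 1) <= -1 by apply: L_le_cst; [exact: is_cyl_cst|move=> w; rewrite mulr1].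
  by rewrite LZ ?mulN1r ?lerN2//; exact: is_cyl_cst.
move=> X cX X0 Xdec Xcvg.
have LX0 n : 0 <= L (X n) by exact: L_ge0.
have Xmono w : {homo (fun n => X n w) : i j / (i <= j)%N >-> j <= i}.
  by apply: homo_leq => [//|x y z xy yz|n]; [exact: le_trans yz xy|exact: Xdec].
apply/cvgrPdist_le => eps e0.
have [[n hn]|hX] := pselect (exists n, L (X n) <= eps).
  exists n => // k /= nk; rewrite sub0r normrN ger0_norm//; apply: le_trans hn.
  by apply: L_le => // w; exact: Xmono.
exfalso; have eX n : eps <= L (X n).
  by rewrite leNgt; apply/negP => /ltW ?; apply: hX; exists n.
have [M0 hM0] := is_cyl_bddO (cX 0%N).
pose M := `|M0| + 1; have Mp : 0 < M by rewrite ltr_wpDl.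
have XM n w : X n w <= M.
  apply: (le_trans (Xmono w _ _ (leq0n n))); apply: (le_trans (ler_norm _)).
  by apply: (le_trans (hM0 w)); apply: (le_trans (ler_norm _)); rewrite lerDl.
have sh4 : 0 <= sh ^+ 4 by rewrite exprn_ge0// (le_trans h0).
(* As Lam^4 >= Lam >= a, M times the bound on all bumps is at most eps / 2. *)
pose a := 24 * M * sh ^+ 4 / eps.
have a0 : 0 <= a by rewrite divr_ge0 ?(ltW e0)// mulr_ge0// mulr_ge0// ltW.
pose Lam := 1 + a; have Lam1 : 1 <= Lam by rewrite lerDl.
have Lam0 : 0 < Lam by exact: lt_le_trans Lam1.
have hLam : M * (12 * sh ^+ 4 / Lam ^+ 4) <= eps / 2.
  rewrite !mulrA ler_pdivrMr ?exprn_gt0//.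
  apply: (@le_trans _ _ (eps / 2 * a)).
    by rewrite /a le_eqVlt; apply/orP; left; apply/eqP; field; rewrite gt_eqF.
  apply: ler_wpM2l; first by rewrite divr_ge0// ltW.
  apply: (@le_trans _ _ Lam); first by rewrite lerDr.
  by rewrite -{1}[Lam]expr1 ler_weXn2l.
have cX' n : exists F, exists K M, cyl F K M (X n) by exact: cX.
have [F hF] := choice cX'.
(* One enumeration of the observation times of all [X n], padded with 0. *)
pose q j := if (unpickle j : option (nat * nat)) is Some (n, k) then nth 0 (F n) k else 0.
have hw n := good_path q Lam0 n.+1 (cX n) Mp (XM n) (eX n) hLam e0.
have [w hw'] := choice hw.
pose lam i := Lam / 2 ^+ i.
have lam0 i : 0 <= lam i by rewrite divr_ge0 ?exprn_ge0// ltW.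
have lamS i : lam i = 2 * lam i.+1.
  by rewrite /lam exprS; field; rewrite expf_neq0.
have wreg n i : (i <= n)%N -> regular m lam i (w n).
  by move=> ni; have [_ h _] := hw' n; apply: h; rewrite ltnS.
pose v := lim_path m0 lam0 lamS wreg.
have cvgq n t : t \in F n -> B t (w k) @[k --> ultra] --> B t v.
  move=> tF; pose j := pickle (n, index t (F n)).
  have qj : q j = t by rewrite /q pickleK nth_index.
  apply: (@lim_path_cvg _ _ _ _ m0 lam0 lamS wreg t j) => k i /andP[ji ik].
  have [_ _ h] := hw' k; rewrite -qj; apply: h; first by rewrite ltnS.
  apply: (leq_ltn_trans ji); apply: ltn_expl.
  by [].
have Xv n : eps / 4 <= X n v.
  have [K [M' [K0 _ hK]]] := hF n.
  have c : (K * \sum_(t <- F n) `|B t (w k) - B t v|) @[k --> ultra] --> 0.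
    suff : \sum_(t <- F n) `|B t (w k) - B t v| @[k --> ultra] --> (0 : R).
      move=> h; have h2 : K * \sum_(t <- F n) `|B t (w k) - B t v| @[k --> ultra] --> K * 0.
        by apply: cvgM => //; exact: cvg_cst.
      by rewrite mulr0 in h2.
    have : forall G : seq R, {subset G <= F n} ->
        \sum_(t <- G) `|B t (w k) - B t v| @[k --> ultra] --> 0.
      elim=> [|t G IH] GF.
        by under eq_cvg do rewrite big_nil; exact: cvg_cst.
      under eq_cvg do rewrite big_cons.
      have c1 : `|B t (w k) - B t v| @[k --> ultra] --> (0 : R).
        have c0 : (B t (w k) - B t v) @[k --> ultra] --> B t v - B t v.
          by apply: cvgB; [apply: (cvgq n); apply: GF; exact: mem_head|exact: cvg_cst].
        by move: c0; rewrite subrr => /cvg_norm; rewrite normr0.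
      have c2 : \sum_(s <- G) `|B s (w k) - B s v| @[k --> ultra] --> (0 : R).
        by apply: IH => s sG; apply: GF; rewrite inE sG orbT.
      have c3 : (`|B t (w k) - B t v| + \sum_(s <- G) `|B s (w k) - B s v|) @[k --> ultra] --> (0 : R) + 0.
        by apply: cvgD.
      by rewrite addr0 in c3.
    by apply.
  have c' : (X n v + K * \sum_(t <- F n) `|B t (w k) - B t v|) @[k --> ultra] --> X n v + 0.
    by apply: cvgD => //; exact: cvg_cst.
  rewrite -[leRHS]addr0; apply: (ler_cvg_to (cvg_cst (eps / 4)) c').
  apply: near_ultra; exists n => // k /= nk.
  have [h _ _] := hw' k; apply: (le_trans (ltW h)).
  apply: (le_trans (Xmono (w k) _ _ nk)).
  by rewrite -lerBlDl; exact: le_trans (ler_norm _) (hK (w k) v).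
have : eps / 4 <= 0.
  by apply: (ler_cvg_to (cvg_cst (eps / 4)) (Xcvg v)); exact: nearW.
by rewrite leNgt divr_gt0.
Qed.

End sigma_continuity.

(** * Integrals of real functions under one probability *)

Section real_integrals.
Context d (T : measurableType d) (R : realType) (P : probability T R).
Implicit Types (f g : T -> R) (A : set T).

Definition ig f := P.-integrable setT (EFin \o f).

Lemma prob1 : P [set: T] = 1%E. Proof. exact: probability_setT. Qed.

Lemma ig_measurable f : ig f -> measurable_fun setT f.
Proof. by move=> /integrableP[/measurable_EFinP]. Qed.

Lemma igD f g : ig f -> ig g -> ig (fun x => f x + g x).
Proof. by move=> hf hg; apply: eq_integrable (integrableD measurableT hf hg). Qed.

Lemma igZ a f : ig f -> ig (fun x => a * f x).
Proof. by move=> hf; apply: eq_integrable (integrableZl measurableT a hf). Qed.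

Lemma igN f : ig f -> ig (fun x => - f x).
Proof. by move=> /(igZ (-1)); rewrite (_ : (fun x => _) = fun x => - f x)//; apply/funext => x; rewrite mulN1r. Qed.

Lemma igB f g : ig f -> ig g -> ig (fun x => f x - g x).
Proof. by move=> hf hg; apply: igD => //; exact: igN. Qed.

Lemma ig_abs f : ig f -> ig (fun x => `|f x|).
Proof. exact: integrable_norm. Qed.

Lemma ig_cst a : ig (fun=> a).
Proof. exact: finite_measure_integrable_cst. Qed.

Lemma ig_le f g : measurable_fun setT f -> ig g -> (forall x, `|f x| <= g x) -> ig f.
Proof.
move=> mf hg fg; apply: le_integrable hg => //; first exact/measurable_EFinP.
by move=> x _; rewrite /= lee_fin (le_trans (fg x))// ler_norm.
Qed.

Lemma ig_max f g : ig f -> ig g -> ig (fun x => Num.max (f x) (g x)).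
Proof.
move=> hf hg; apply: (ig_le _ (igD (ig_abs hf) (ig_abs hg))).
  by apply: measurable_maxr; exact: ig_measurable.
by move=> x; rewrite maxEle; case: ifP => _; rewrite ?lerDl ?lerDr.
Qed.

Lemma igS A f : measurable A -> ig f -> P.-integrable A (EFin \o f).
Proof. by move=> mA; exact: integrableS. Qed.

Lemma intD A f g : measurable A -> ig f -> ig g ->
  \int[P]_(x in A) (f x + g x) = \int[P]_(x in A) f x + \int[P]_(x in A) g x.
Proof. by move=> mA hf hg; apply: RintegralD => //; exact: igS. Qed.

Lemma intB A f g : measurable A -> ig f -> ig g ->
  \int[P]_(x in A) (f x - g x) = \int[P]_(x in A) f x - \int[P]_(x in A) g x.
Proof. by move=> mA hf hg; apply: RintegralB => //; exact: igS. Qed.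

Lemma intZ A a f : measurable A -> ig f ->
  \int[P]_(x in A) (a * f x) = a * \int[P]_(x in A) f x.
Proof. by move=> mA hf; apply: RintegralZl => //; exact: igS. Qed.

Lemma int_cst a : \int[P]_x a = a.
Proof.
transitivity (a * fine (P setT)); first exact: Rintegral_cst.
by rewrite prob1 mulr1.
Qed.

Lemma int_ae_eq A f g : measurable A -> ig f -> ig g -> {ae P, forall x, f x = g x} ->
  \int[P]_(x in A) f x = \int[P]_(x in A) g x.
Proof.
move=> mA hf hg fg; congr fine; apply: ae_eq_integral => //.
- by have /integrableP[] := igS mA hf.
- by have /integrableP[] := igS mA hg.
by apply: filterS fg => x /= -> _.
Qed.

Lemma int_ae_le A f g : measurable A -> ig f -> ig g -> {ae P, forall x, f x <= g x} ->
  \int[P]_(x in A) f x <= \int[P]_(x in A) g x.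
Proof.
move=> mA hf hg fg; have hm := ig_max hf hg.
rewrite -(int_ae_eq mA hm hg); last by apply: filterS fg => x /= fg; exact/max_idPr.
by apply: le_Rintegral => //; [exact: igS|exact: igS|move=> x _; rewrite le_max lexx].
Qed.

Lemma int_split A f : measurable A -> ig f ->
  \int[P]_x f x = \int[P]_(x in A) f x + \int[P]_(x in ~` A) f x.
Proof.
move=> mA hf; rewrite -[in LHS](setUv A) Rintegral_setU ?setUv//; first exact: measurableC.
by apply/disj_set2P; rewrite setICr.
Qed.

Lemma int_abs_le A f : measurable A -> ig f -> `|\int[P]_(x in A) f x| <= \int[P]_x `|f x|.
Proof.
move=> mA hf; apply: (le_trans (le_normr_Rintegral mA (igS mA hf))).
by rewrite (int_split mA (ig_abs hf)) lerDl; apply: Rintegral_ge0.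
Qed.

Lemma dct A (f_ : nat -> T -> R) f g : measurable A -> (forall n, measurable_fun setT (f_ n)) ->
  measurable_fun setT f -> ig g ->
  {ae P, forall x, f_ n x @[n --> \oo] --> (f x : R)} ->
  {ae P, forall x, forall n, `|f_ n x| <= g x} ->
  ig f /\ (\int[P]_(x in A) f_ n x) @[n --> \oo] --> \int[P]_(x in A) f x.
Proof.
move=> mA mf_ mf ig_g cf bf.
have H B : measurable B -> P.-integrable B (EFin \o f) /\
    ((\int[P]_(x in B) (f_ n x)%:E)%E @[n --> \oo] --> (\int[P]_(x in B) (f x)%:E)%E).
  move=> mB; have [|||||h1 _ h3] := @dominated_convergence _ _ _ P B mB
     (fun n => EFin \o f_ n) (EFin \o f) (EFin \o g).
  - by move=> n; apply/measurable_EFinP; exact: measurable_funTS.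
  - by apply/measurable_EFinP; exact: measurable_funTS.
  - apply: filterS cf => x /= cfx _; apply/fine_cvgP; split => //.
    by apply: nearW.
  - exact: igS.
  - by apply: filterS bf => x /= bfx n _; rewrite lee_fin.
  by split.
have [i1 _] := H _ measurableT; have [i2 c] := H _ mA.
split => //; apply: fine_cvg; rewrite /Rintegral fineK//.
exact: integrable_fin_num.
Qed.

End real_integrals.

(** * Stopped paths and prior events *)

Section stopping_paths.
Context (R : realType).
Implicit Types (w : Omega R) (t q : R) (A : set (Omega R)).

Lemma B_stop t q w : B q (stop t w) = B (Num.min q t) w.
Proof. by []. Qed.

Lemma stop_stop t t' w : t <= t' -> stop t (stop t' w) = stop t w.
Proof.
by move=> tt'; apply: path_ext => q; rewrite !B_stop -minA (min_idPl tt').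
Qed.

Lemma measurable_B q : measurable_fun setT (B q : Omega R -> R).
Proof.
apply: (measurability _ (RGenOInfty.measurableE R)) => _ [_ [a ->] <-]; rewrite setTI.
by apply: sub_sigma_algebra; apply: (@open_B_preimage R q); exact: interval_open.
Qed.

Lemma measurable_B_gt q a : measurable [set w : Omega R | a < B q w].
Proof.
rewrite (_ : [set w | _] = B q @^-1` `]a, +oo[).
  by rewrite -[X in measurable X]setTI; exact: measurable_B.
by apply/seteqP; split => w /=; rewrite in_itv/= andbT.
Qed.

Lemma measurable_stop t : measurable_fun setT (stop t : Omega R -> Omega R).
Proof.
move=> _ C mC; rewrite setTI.
suff : measurable `<=` [set C : set (Omega R) | measurable (stop t @^-1` C)] by apply.
apply: borel_generated => [|q a]; last exact: (measurable_B_gt (Num.min q t) a).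
split; first by rewrite /= preimage_set0.
  by move=> A mA; rewrite /= setTD preimage_setC; exact: measurableC.
by move=> F mF; rewrite /= preimage_bigcup; exact: bigcupT_measurable.
Qed.

Definition stp (T : \bar R) w : Omega R := if T is t%:E then stop t w else w.

(** Stopping is idempotent, so the events prior to t are the Borel sets invariant under it; [stp]
    treats finite and infinite horizons alike. *)
Lemma FiltP T A : Filt T A <-> measurable A /\ stp T @^-1` A = A.
Proof.
case: T => [t| |]; [|by split => [|[]]..]; split => [[C mC <-]|[mA sA]].
  rewrite setTI; split; first by rewrite -[X in measurable X]setTI; exact: measurable_stop.
  by apply/seteqP; split => w /=; rewrite stop_stop.
by exists A => //; rewrite setTI.
Qed.

Lemma past_stop t (X : Omega R -> R) : past t X <-> (forall w, X (stop t w) = X w).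
Proof.
split=> [pX w|h w w' e].
  by apply: pX => q qt; rewrite B_stop (min_idPl qt).
rewrite -h -[RHS]h; congr X; apply: path_ext => q; rewrite !B_stop; apply: e.
by rewrite ge_min lexx orbT.
Qed.

End stopping_paths.

(** * Laws representing the sublinear expectation *)

Section representing_measures.
Context (R : realType) (sl sh : R).
Hypotheses (h0 : 0 <= sl) (hs : sl <= sh).
Local Notation Omega := (Omega R).
Local Notation Prob := (probability Omega R).
Local Notation PP := (PP sl sh).
Local Notation Eop := (Eop sl sh).
Local Notation E0 := (E0 sl sh).
Implicit Types (X Y Z : Omega -> R) (w : Omega) (s t : R) (P Q : Prob) (A : set Omega).

Lemma Eop0_cst X : is_cyl X -> Eop 0 X = cst (E0 X).
Proof. by move=> cX; apply/funext => w; apply: past0; exact: past_Eop. Qed.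

Lemma EFin_integral P X : is_cyl X -> (\int[P]_w (X w)%:E)%E = (\int[P]_w X w)%:E.
Proof.
move=> cX; rewrite /Rintegral fineK//.
exact: (integral_fune_fin_num measurableT (is_cyl_integrable P measurableT cX)).
Qed.

Lemma PPP P : PP P <-> forall X, is_cyl X -> \int[P]_w X w <= E0 X.
Proof.
split=> [PP_P X cX|h X c].
  rewrite -lee_fin -EFin_integral//; apply: PP_P.
  by rewrite -(Eop0_cst cX); exact: condE_Lip_exists.
move=> /(condE_Lip_Eop h0 hs)[cX e]; rewrite EFin_integral// lee_fin.
by apply: (le_trans (h X cX)); rewrite /E0 -e.
Qed.

Lemma integral_cylD P A X Y : measurable A -> is_cyl X -> is_cyl Y ->
  \int[P]_(w in A) (X w + Y w) = \int[P]_(w in A) X w + \int[P]_(w in A) Y w.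
Proof. by move=> mA cX cY; rewrite RintegralD//; exact: is_cyl_integrable. Qed.

Lemma integral_cylZ P A X a : measurable A -> is_cyl X ->
  \int[P]_(w in A) (a * X w) = a * \int[P]_(w in A) X w.
Proof. by move=> mA cX; rewrite RintegralZl//; exact: is_cyl_integrable. Qed.

Lemma integral_cyl_le P A X Y : measurable A -> is_cyl X -> is_cyl Y ->
  (forall w, X w <= Y w) -> \int[P]_(w in A) X w <= \int[P]_(w in A) Y w.
Proof. by move=> mA cX cY XY; apply: le_Rintegral => //; exact: is_cyl_integrable. Qed.

Lemma integral_cst P c : \int[P]_w c = c.
Proof. exact: int_cst. Qed.

(** The source of the laws constructed by domination: [PP] is nonempty, and conditional expectations
    are attained, by suitable choices of [p]. *)
Lemma sublin_prob (p : (Omega -> R) -> R) X0 :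
  (forall X Y, is_cyl X -> is_cyl Y -> p (fun w => X w + Y w) <= p X + p Y) ->
  (forall a X, 0 <= a -> is_cyl X -> p (fun w => a * X w) <= a * p X) ->
  (forall X, is_cyl X -> p X <= E0 X) -> is_cyl X0 ->
  exists P, (forall X, is_cyl X -> \int[P]_w X w <= p X) /\ \int[P]_w X0 w = p X0.
Proof.
move=> pD pZ pE cX0.
pose V : lmodType R := (Omega -> R^o)%type.
have sp : @sublin R V (@is_cyl R) p.
  by split => [x y cx cy|a x a0 cx]; [exact: pD|exact: pZ].
have [L [[LD LZ] Lp LX0]] := @hahn_banach R V (@is_cyl R)
  (fun x y cx cy => is_cylD cx cy) (fun a x cx => is_cylZ a cx) p X0 sp cX0.
have dL : daniell L.
  apply: (dominated_daniell h0 hs) => [X Y cX cY|a X cX|X cX]; [exact: LD|exact: LZ|].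
  exact: le_trans (Lp X cX) (pE X cX).
have [P hP] := daniell_representation dL.
by exists P; split => [X cX|]; rewrite hP// Lp.
Qed.

(* The laws that agree with [P] up to time [t]. *)
Definition QQ t P : set Prob :=
  [set Q | forall X, is_cyl X -> \int[Q]_w X w <= \int[P]_w Eop t X w].

Lemma PP_nonempty : exists P, PP P.
Proof.
have [||//||P [hP _]] := @sublin_prob E0 (fun=> 0); last by exists P; apply/PPP.
- by move=> X Y cX cY; exact: Eop_sub.
- by move=> a X a0 cX; rewrite /E0 Eop_hom.
- exact: is_cyl_cst.
Qed.

Lemma QQ_PP t P Q : 0 <= t -> PP P -> QQ t P Q -> PP Q.
Proof.
move=> t0 /PPP hP hQ; apply/PPP => X cX; apply: (le_trans (hQ X cX)).
apply: (le_trans (hP _ (Eop_is_cyl h0 hs t0 cX))).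
by rewrite /E0 (Eop_tower h0 hs (lexx 0) t0 cX).
Qed.

(** X - [Eop t X] has conditional expectation 0 at t, so by the tower property its integral under P
    is at most 0. *)
Lemma QQ_refl t P : 0 <= t -> PP P -> QQ t P P.
Proof.
move=> t0 /PPP hP X cX; have cE := Eop_is_cyl h0 hs t0 cX.
have cN := is_cylZ (-1) cE.
have := hP _ (is_cylD cX cN); rewrite integral_cylD// integral_cylZ//.
rewrite /E0 -(Eop_tower h0 hs (lexx 0) t0); last exact: is_cylD.
rewrite (Eop_past_add h0 hs t0 cX cN); last first.
  by move=> w w' e; congr (_ * _); apply: past_Eop.
rewrite (_ : (fun w => Eop t X w + -1 * Eop t X w) = fun=> 0); last first.
  by apply/funext => w; rewrite mulN1r subrr.
by rewrite [Eop 0 _]Eop_past// mulN1r subr_le0.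
Qed.

Lemma QQ_trans s t P Q Q' : 0 <= s -> s <= t -> PP P -> QQ s P Q -> QQ t Q Q' -> QQ s P Q'.
Proof.
move=> s0 st PP_P hQ hQ' X cX; have t0 := le_trans s0 st.
apply: (le_trans (hQ' X cX)); apply: (le_trans (hQ _ (Eop_is_cyl h0 hs t0 cX))).
by rewrite (Eop_tower h0 hs s0 st cX).
Qed.

Lemma QQ_attained t P X : 0 <= t -> PP P -> is_cyl X ->
  exists2 Q, QQ t P Q & \int[Q]_w X w = \int[P]_w Eop t X w.
Proof.
move=> t0 /PPP hP cX.
have cE Y : is_cyl Y -> is_cyl (Eop t Y) by exact: Eop_is_cyl.
have [|||//|Q [hQ e]] := @sublin_prob (fun Y => \int[P]_w Eop t Y w) X.
- move=> Y Z cY cZ; rewrite -integral_cylD//; [|exact: cE|exact: cE].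
  apply: integral_cyl_le => //; [exact/cE/is_cylD|by apply: is_cylD; exact: cE|].
  exact: Eop_sub.
- by move=> a Y a0 cY; rewrite Eop_hom// integral_cylZ//; exact: cE.
- move=> Y cY; apply: (le_trans (hP _ (cE _ cY))).
  by rewrite /E0 (Eop_tower h0 hs (lexx 0) t0 cY).
by exists Q.
Qed.

(** The ultralimit of the integrals is linear and dominated by [E0], hence a probability by
    Daniell's theorem; the inequalities defining [QQ] pass to the limit. *)
Lemma QQ_compact t P (Qn : nat -> Prob) : 0 <= t -> PP P -> (forall n, QQ t P (Qn n)) ->
  exists2 Q, QQ t P Q & forall X, is_cyl X -> \int[Q]_w X w = ulim (fun n => \int[Qn n]_w X w).
Proof.
move=> t0 PP_P hQ.
have bQ X : is_cyl X -> bseq (fun n => \int[Qn n]_w X w).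
  move=> cX; have [M XM] := is_cyl_bddO cX; exists M => n.
  apply: (le_trans (le_normr_Rintegral measurableT (is_cyl_integrable (Qn n) measurableT cX))).
  rewrite -[leRHS](integral_cst (Qn n)); apply: integral_cyl_le => //.
    exact: is_cyl_abs.
  exact: is_cyl_cst.
have dL : daniell (fun X => ulim (fun n => \int[Qn n]_w X w)).
  apply: (dominated_daniell h0 hs) => [X Y cX cY|a X cX|X cX].
  - rewrite -ulimD; [|exact: bQ|exact: bQ]; congr ulim; apply/funext => n.
    by rewrite integral_cylD.
  - rewrite -ulimZ; last exact: bQ.
    by congr ulim; apply/funext => n; rewrite integral_cylZ.
  apply: ulim_le_cst; first exact: bQ.
  apply: near_ultra; apply: nearW => n.
  by have /PPP := QQ_PP t0 PP_P (hQ n); apply.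
have [Q e] := daniell_representation dL; exists Q => // X cX; rewrite e//.
apply: ulim_le_cst; first exact: bQ.
by apply: near_ultra; apply: nearW => n; exact: hQ.
Qed.

(** One cylinder function serves both laws, and being known at t it can leave the conditional
    expectation. *)
Definition event_approx t P Q A := forall eps, 0 < eps -> exists phi,
  [/\ is_cyl phi, past t phi, (forall w, 0 <= phi w <= 1),
   \int[P]_w `|phi w - \1_A w| <= eps & \int[Q]_w `|phi w - \1_A w| <= eps].

Let integrable_diff P phi A : is_cyl phi -> measurable A ->
  P.-integrable setT (EFin \o (fun w => `|phi w - \1_A w|)).
Proof.
move=> cp mA; have [M hM] := is_cyl_bddO cp.
have mphi : measurable_fun setT (fun w => `|phi w - \1_A w|).
  apply: measurableT_comp => //; apply: measurable_funB; first exact: is_cyl_measurable.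
  exact: measurable_indic.
apply: (ig_le mphi (ig_cst P (M + 1))) => w; rewrite normr_id.
apply: (le_trans (ler_normB _ _)); apply: lerD => //.
by rewrite indicE; case: (_ \in _); rewrite ?normr1 ?normr0.
Qed.

Let approx0 t P Q : event_approx t P Q set0.
Proof.
move=> eps e0; exists (fun=> 0); split => //; first exact: is_cyl_cst.
- by move=> w; rewrite lexx ler01.
- rewrite (_ : (fun w => `|0 - \1_set0 w|) = fun=> 0) ?int_cst ?ltW//.
  by apply/funext => w; rewrite indic0 subr0 normr0.
rewrite (_ : (fun w => `|0 - \1_set0 w|) = fun=> 0) ?int_cst ?ltW//.
by apply/funext => w; rewrite indic0 subr0 normr0.
Qed.

Let compl_dist (A : set Omega) (x : R) w : `|1 - x - \1_(~` A) w| = `|x - \1_A w|.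
Proof.
rewrite !indicE in_setC; case: (w \in A) => /=; first by rewrite subr0 distrC.
by rewrite subr0 addrAC subrr add0r normrN.
Qed.

Lemma approxC t P Q A : measurable A -> event_approx t P Q A -> event_approx t P Q (~` A).
Proof.
move=> mA hA eps e0; have [phi [cp pp p01 h1 h2]] := hA eps e0.
exists (fun w => 1 - phi w); split.
- by apply: is_cylB => //; exact: is_cyl_cst.
- by move=> w w' e; congr (_ - _); exact: pp.
- by move=> w; have /andP[? ?] := p01 w; rewrite subr_ge0 lerBlDr lerDl; apply/andP.
- by under eq_Rintegral do rewrite compl_dist.
by under eq_Rintegral do rewrite compl_dist.
Qed.

Let dist_setU (a b : R) (phi psi : R) : `|Num.max phi psi - Num.max a b| <= `|phi - a| + `|psi - b|.
Proof.
have := ler_norm (phi - a); have := ler_norm (a - phi).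
have := ler_norm (psi - b); have := ler_norm (b - psi).
rewrite (distrC b) (distrC a) => h1 h2 h3 h4.
by rewrite !maxEle ler_norml; apply/andP; split; do !case: ifP; lra.
Qed.

Lemma approxU t P Q A A' : measurable A -> measurable A' ->
  event_approx t P Q A -> event_approx t P Q A' -> event_approx t P Q (A `|` A').
Proof.
move=> mA mA' hA hA' eps e0; have e2 : 0 < eps / 2 by rewrite divr_gt0.
have [phi [cp pp p01 h1 h2]] := hA _ e2; have [psi [cq pq q01 g1 g2]] := hA' _ e2.
have cm : is_cyl (fun w => Num.max (phi w) (psi w)) by exact: is_cyl_max.
have main (S : Prob) : \int[S]_w `|phi w - \1_A w| <= eps / 2 ->
    \int[S]_w `|psi w - \1_A' w| <= eps / 2 ->
    \int[S]_w `|Num.max (phi w) (psi w) - \1_(A `|` A') w| <= eps.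
  move=> k1 k2; rewrite [eps]splitr; apply: le_trans (lerD k1 k2).
  rewrite -RintegralD//; [|exact: integrable_diff|exact: integrable_diff].
  apply: le_Rintegral => //.
  - by apply: integrable_diff => //; exact: measurableU.
  - by apply: igD; exact: integrable_diff.
  move=> w _; have -> : \1_(A `|` A') w = Num.max (\1_A w) (\1_A' w) :> R.
    rewrite !indicE in_setU; do 2!case: (_ \in _) => /=;
      by rewrite ?maxxx// ?(max_idPl ler01)// ?(max_idPr ler01).
  exact: dist_setU.
exists (fun w => Num.max (phi w) (psi w)); split => //; [|move=> w|exact: main|exact: main].
  by move=> w w' e; rewrite (pp _ _ e) (pq _ _ e).
have /andP[? ?] := p01 w; have /andP[? ?] := q01 w.
by rewrite le_max ge_max; apply/andP; split; [apply/orP; left|apply/andP].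
Qed.

Let approx_lim t P Q A (phi : nat -> Omega -> R) : measurable A ->
  (forall n, is_cyl (phi n)) -> (forall n, past t (phi n)) -> (forall n w, 0 <= phi n w <= 1) ->
  (forall w, phi n w @[n --> \oo] --> (\1_A w : R)) -> event_approx t P Q A.
Proof.
move=> mA cp pp p01 pA eps e0.
have main (S : Prob) : (\int[S]_w `|phi n w - \1_A w|) @[n --> \oo] --> 0.
  have [||||||_] := @dct _ _ _ S setT (fun n w => `|phi n w - \1_A w|) (fun=> 0) (fun=> 1).
  - exact: measurableT.
  - by move=> n; have /ig_measurable := integrable_diff S (cp n) mA.
  - exact: measurable_cst.
  - exact: ig_cst.
  - apply: aeW => w; have : (phi n w - \1_A w) @[n --> \oo] --> (\1_A w - \1_A w : R).
      by apply: cvgB => //; exact: cvg_cst.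
    by rewrite subrr => /cvg_norm; rewrite normr0.
  - apply: aeW => w n; rewrite normr_id indicE; have /andP[? ?] := p01 n w.
    by case: (_ \in _); rewrite /= ler_norml; apply/andP; split; lra.
  by rewrite int_cst.
have [n1 _ H1] : \forall n \near \oo, \int[P]_w `|phi n w - \1_A w| <= eps.
  by have /cvgr_le := main P; apply.
have [n2 _ H2] : \forall n \near \oo, \int[Q]_w `|phi n w - \1_A w| <= eps.
  by have /cvgr_le := main Q; apply.
exists (phi (maxn n1 n2)); split => //; [apply: H1; exact: leq_maxl|apply: H2; exact: leq_maxr].
Qed.

Lemma approx_close t P Q A : measurable A -> (forall eps, 0 < eps -> exists A',
   [/\ measurable A', event_approx t P Q A', \int[P]_w `|\1_A' w - \1_A w| <= eps &
    \int[Q]_w `|\1_A' w - \1_A w| <= eps]) -> event_approx t P Q A.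
Proof.
move=> mA h eps e0; have e2 : 0 < eps / 2 by rewrite divr_gt0.
have [A' [mA' hA' d1 d2]] := h _ e2; have [phi [cp pp p01 p1 p2]] := hA' _ e2.
have main (S : Prob) : \int[S]_w `|phi w - \1_A' w| <= eps / 2 ->
    \int[S]_w `|\1_A' w - \1_A w| <= eps / 2 -> \int[S]_w `|phi w - \1_A w| <= eps.
  move=> k1 k2; rewrite [eps]splitr; apply: le_trans (lerD k1 k2).
  have i1 : ig S (fun w => `|phi w - \1_A' w|) by exact: integrable_diff.
  have i2 : ig S (fun w => `|\1_A' w - \1_A w : R|).
    by apply: ig_abs; apply: igB; (apply: (ig_le _ (ig_cst S 1)); [exact: measurable_indic|move=> w;
      rewrite indicE ger0_norm//; case: (_ \in _)]).
  rewrite -intD//; apply: le_Rintegral => //; first exact: integrable_diff.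
    exact: igD.
  move=> w _; apply: le_trans (ler_normD _ _).
  by rewrite addrA subrK.
by exists phi; split => //; exact: main.
Qed.

(** The Borel sets whose preimage under stopping can be approximated form a sigma-field containing
    the coordinate events. *)
Lemma approx_Filt t P Q A : 0 <= t -> Filt t%:E A -> event_approx t P Q A.
Proof.
move=> t0 [C mC <-]; rewrite setTI.
suff : measurable `<=` [set C : set Omega | measurable C /\ event_approx t P Q (stop t @^-1` C)].
  by move=> /(_ _ mC)[].
have mpre (C' : set Omega) : measurable C' -> measurable (stop t @^-1` C').
  by move=> mC'; rewrite -[X in measurable X]setTI; exact: measurable_stop.
have DC (A' : set Omega) : measurable A' /\ event_approx t P Q (stop t @^-1` A') ->
    measurable (~` A') /\ event_approx t P Q (stop t @^-1` (~` A')).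
  move=> [mA' hA']; split; first exact: measurableC.
  by rewrite preimage_setC; apply: approxC => //; exact: mpre.
apply: borel_generated => [|q a].
  split => [|A' hA'|F hF].
  - by split => //; rewrite preimage_set0; exact: approx0.
  - by rewrite setTD; exact: DC.
  have mF n : measurable (F n) by case: (hF n).
  have mU : measurable (\bigcup_n F n) by exact: bigcupT_measurable.
  split => //; rewrite preimage_bigcup.
  pose A_ n := \big[setU/set0]_(i < n) (stop t @^-1` F i).
  have hA_ n : measurable (A_ n) /\ event_approx t P Q (A_ n).
    elim: n => [|n [IH1 IH2]]; rewrite /A_ ?big_ord0 ?big_ord_recr/=.
      by split => //; exact: approx0.
    split; first by apply: measurableU => //; exact: mpre.
    by apply: approxU => //; [exact: mpre|case: (hF n)].
  have mUp : measurable (\bigcup_n (stop t @^-1` F n)).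
    by apply: bigcupT_measurable => n; exact: mpre.
  apply: approx_close => // eps e0.
  have main (S : Prob) : (\int[S]_w `|\1_(A_ n) w - \1_(\bigcup_n (stop t @^-1` F n)) w|) @[n --> \oo] --> (0 : R).
    have [||||||_] := @dct _ _ _ S setT (fun n w => `|\1_(A_ n) w - \1_(\bigcup_n (stop t @^-1` F n)) w|)
      (fun=> 0) (fun=> 1).
    - exact: measurableT.
    - move=> n; apply: measurableT_comp => //.
      by apply: measurable_funB; apply: measurable_indic => //; case: (hA_ n).
    - exact: measurable_cst.
    - exact: ig_cst.
    - apply: aeW => w; apply: cvg_near_cst.
      have [[k _ Fk]|nU] := pselect ((\bigcup_n (stop t @^-1` F n)) w).
        exists k.+1 => // n /= kn; rewrite !indicE !mem_set ?subrr ?normr0//; first by exists k.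
        by rewrite /A_ -(bigcup_mkord _ (fun i => stop t @^-1` F i)); exists k.
      apply: nearW => n; rewrite !indicE !memNset ?subrr ?normr0//.
      by rewrite /A_ -(bigcup_mkord _ (fun i => stop t @^-1` F i)) => -[k _ Fk]; apply: nU; exists k.
    - apply: aeW => w n; rewrite normr_id !indicE.
      by do 2!case: (_ \in _); rewrite /= ?subrr ?subr0 ?sub0r ?normrN ?normr0 ?normr1.
    by rewrite int_cst.
  have [n1 _ H1] : \forall n \near \oo, \int[P]_w `|\1_(A_ n) w - \1_(\bigcup_n (stop t @^-1` F n)) w| <= eps.
    by have /cvgr_le := main P; apply.
  have [n2 _ H2] : \forall n \near \oo, \int[Q]_w `|\1_(A_ n) w - \1_(\bigcup_n (stop t @^-1` F n)) w| <= eps.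
    by have /cvgr_le := main Q; apply.
  have [m1 a1] := hA_ (maxn n1 n2).
  exists (A_ (maxn n1 n2)); split => //; [apply: H1; exact: leq_maxl|apply: H2; exact: leq_maxr].
split; first exact: measurable_B_gt.
pose r := Num.min q t.
have -> : stop t @^-1` [set w | a < B q w] = [set w | a < B r w] by [].
pose f (k : nat) (y : R) := Num.min 1 (k%:R * Num.max 0 (y - a)).
have f01 k y : 0 <= f k y <= 1.
  by rewrite /f le_min ler01 ge_min lexx mulr_ge0// le_max lexx.
apply: (@approx_lim _ _ _ _ (fun k w => f k (B r w - B 0 w))).
- exact: measurable_B_gt.
- move=> k; eexists _, _, _; apply: (@is_cyl_incr R 0 r (f k) k%:R 1) => //.
    move=> x y; have h1 := ler_norm (x - y); have h2 := ler_norm (y - x); rewrite distrC in h2.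
    apply: (@le_trans _ _ `|k%:R * Num.max 0 (x - a) - k%:R * Num.max 0 (y - a)|).
      set u := k%:R * _; set v := k%:R * _.
      have := ler_norm (u - v); have := ler_norm (v - u); rewrite (distrC v) => ? ?.
      by rewrite /f -/u -/v !minEle ler_norml; apply/andP; split; do !case: ifP; lra.
    rewrite -mulrBr normrM ger0_norm//; apply: ler_wpM2l => //.
    by rewrite !maxEle ler_norml; apply/andP; split; do !case: ifP; lra.
  by move=> x; have /andP[? ?] := f01 k x; rewrite ger0_norm.
- move=> k w w' e; rewrite (e r) ?(e 0)//; by rewrite ge_min lexx orbT.
- by move=> k w; exact: f01.
move=> w; rewrite (@B_le0 _ 0)// subr0 indicE; case: (boolP (w \in _)) => [|].
  rewrite inE /= => aB; apply: cvg_near_cst.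
  have b0 : 0 < B r w - a by rewrite subr_gt0.
  exists (Num.truncn (B r w - a)^-1).+1 => // k /= hk.
  rewrite /f (max_idPr (ltW b0)); apply: min_idPl.
  rewrite -ler_pdivrMr// div1r; apply: (le_trans (ltW (truncnS_gt _))).
  by rewrite ler_nat.
rewrite notin_setE /= => /negP; rewrite -leNgt => Ba.
rewrite (_ : (fun k => _) = fun=> 0); first exact: cvg_cst.
apply/funext => k; rewrite /f (max_idPl _) ?subr_le0// mulr0; exact: min_idPr.
Qed.

End representing_measures.

(** * Conditional expectation as an essential supremum *)

Section real_conditional_expectation.
Context (R : realType) (sl sh : R).
Hypotheses (h0 : 0 <= sl) (hs : sl <= sh).
Local Notation Omega := (Omega R).
Local Notation Prob := (probability Omega R).
Local Notation PP := (PP sl sh).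
Local Notation QQ := (QQ sl sh).
Local Notation Eop := (Eop sl sh).
Implicit Types (x y z : Omega -> R) (w : Omega) (s t K : R) (P Q : Prob) (A : set Omega).

Lemma int_indic P A x : measurable A -> ig P x ->
  ig P (fun w => \1_A w * x w) /\ \int[P]_(w in A) x w = \int[P]_w (\1_A w * x w).
Proof.
move=> mA ix; split.
  apply: (ig_le _ (ig_abs ix)).
    by apply: measurable_funM; [exact: measurable_indic|exact: ig_measurable ix].
  move=> w; rewrite normrM indicE; case: (_ \in _); first by rewrite normr1 mul1r.
  by rewrite normr0 mul0r.
rewrite Rintegral_mkcond; congr fine; congr integral; apply/funext => w /=.
by rewrite patchE indicE; case: (_ \in _); rewrite ?mul1r ?mul0r.
Qed.

(** The norm of the sublinear expectation is at most [K], without suprema or extended values. *)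
Definition nb x K := forall P, PP P -> ig P x /\ \int[P]_w `|x w| <= K.

Definition L1 x := exists K, nb x K.

Lemma nb_measurable x K : nb x K -> measurable_fun setT x.
Proof. by have [P PP_P] := PP_nonempty h0 hs; move=> /(_ P PP_P)[/ig_measurable]. Qed.

Lemma L1_measurable x : L1 x -> measurable_fun setT x.
Proof. by move=> [K /nb_measurable]. Qed.

Lemma L1_ig P x : L1 x -> PP P -> ig P x.
Proof. by move=> [K h] /h[]. Qed.

Lemma nb_ae_le x y K : measurable_fun setT y -> nb x K ->
  (forall P, PP P -> {ae P, forall w, `|y w| <= `|x w|}) -> nb y K.
Proof.
move=> my nx h P PP_P; have [ix xK] := nx P PP_P.
have iy : ig P y.
  apply/integrableP; split; first exact/measurable_EFinP.
  have /integrableP[_] := ig_abs ix; apply: le_lt_trans.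
  apply: ae_ge0_le_integral => //.
  - by apply: measurableT_comp => //; exact/measurable_EFinP.
  - apply: measurableT_comp => //; apply/measurable_EFinP; apply: measurableT_comp => //.
    exact: nb_measurable nx.
  - by apply: filterS (h P PP_P) => w /= hw _; rewrite !lee_fin normr_id.
split => //; apply: le_trans xK.
by apply: int_ae_le => //; [exact: ig_abs|exact: ig_abs|exact: h].
Qed.

Lemma nb_le x y K : measurable_fun setT y -> nb x K -> (forall w, `|y w| <= `|x w|) -> nb y K.
Proof. by move=> my nx h; apply: (nb_ae_le my nx) => P _; apply: aeW => w; exact: h. Qed.

Lemma nb_leK x K K' : nb x K -> K <= K' -> nb x K'.
Proof. by move=> h KK' P /h[? ?]; split => //; exact: le_trans KK'. Qed.

Lemma nbD x y K K' : nb x K -> nb y K' -> nb (fun w => x w + y w) (K + K').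
Proof.
move=> hx hy P PP_P; have [ix xK] := hx P PP_P; have [iy yK] := hy P PP_P.
split; first exact: igD.
apply: le_trans (lerD xK yK); rewrite -intD//; [|exact: ig_abs|exact: ig_abs].
apply: int_ae_le => //; [exact/ig_abs/igD|by apply: igD; exact: ig_abs|].
by apply: aeW => w; exact: ler_normD.
Qed.

Lemma nbN x K : nb x K -> nb (fun w => - x w) K.
Proof.
move=> nx; apply: (nb_le _ nx); last by move=> w; rewrite normrN.
by apply: measurableT_comp => //; exact: nb_measurable nx.
Qed.

Lemma nbB x y K K' : nb x K -> nb y K' -> nb (fun w => x w - y w) (K + K').
Proof. by move=> hx hy; apply: nbD => //; exact: nbN. Qed.

Lemma nbC x y K : nb (fun w => x w - y w) K -> nb (fun w => y w - x w) K.
Proof. by move=> /nbN; under eq_fun do rewrite opprB. Qed.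

Lemma nb_tri x y z K K' : nb (fun w => x w - y w) K -> nb (fun w => y w - z w) K' ->
  nb (fun w => x w - z w) (K + K').
Proof.
move=> h1 h2; have := nbD h1 h2; congr nb.
by apply/funext => w; rewrite addrA subrK.
Qed.

Lemma nb_bound x K : measurable_fun setT x -> (forall w, `|x w| <= K) -> nb x K.
Proof.
move=> mx xK P PP_P; have ix : ig P x by exact: (ig_le mx (ig_cst P K)).
split => //; rewrite -[leRHS](int_cst P); apply: int_ae_le => //; [exact: ig_abs|exact: ig_cst|].
exact: aeW.
Qed.

Lemma L1D x y : L1 x -> L1 y -> L1 (fun w => x w + y w).
Proof. by move=> [K hx] [K' hy]; exists (K + K'); exact: nbD. Qed.

Lemma L1N x : L1 x -> L1 (fun w => - x w).
Proof. by move=> [K hx]; exists K; exact: nbN. Qed.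

Lemma L1B x y : L1 x -> L1 y -> L1 (fun w => x w - y w).
Proof. by move=> hx hy; apply: L1D => //; exact: L1N. Qed.

Lemma L1_le x y : measurable_fun setT y -> L1 x -> (forall w, `|y w| <= `|x w|) -> L1 y.
Proof. by move=> my [K hx] h; exists K; exact: nb_le hx h. Qed.

Lemma L1_cyl x : is_cyl x -> L1 x.
Proof. by move=> cx; have [K h] := is_cyl_bddO cx; exists K; apply: nb_bound => //; exact: is_cyl_measurable. Qed.

Lemma L1_mulI A x : measurable A -> L1 x -> L1 (fun w => \1_A w * x w).
Proof.
move=> mA hx; apply: (L1_le _ hx).
  by apply: measurable_funM; [exact: measurable_indic|exact: L1_measurable].
move=> w; rewrite normrM indicE; case: (_ \in _); rewrite ?normr1 ?normr0 ?mul1r ?mul0r//.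
Qed.

Definition adapted t y := forall w, y (stop t w) = y w.

(* The conditional expectation of [x] at time [t] under [P] is the essential supremum
   of [E^Q[x | F_t]] over [Q] in [QQ t P]; the second part, for [Omega] alone, implies
   it for all events prior to [t]. *)
Definition ce t x y := [/\ L1 x, L1 y, adapted t y & forall P, PP P ->
  (forall Q A, QQ t P Q -> Filt t%:E A -> \int[Q]_(w in A) x w <= \int[P]_(w in A) y w) /\
  (forall eps, 0 < eps -> exists2 Q, QQ t P Q & \int[P]_w y w <= \int[Q]_w x w + eps)].

Lemma Filt_stop t A : Filt t%:E A <-> measurable A /\ stop t @^-1` A = A.
Proof. exact: FiltP. Qed.

Lemma FiltC t A : Filt t%:E A -> Filt t%:E (~` A).
Proof.
move=> /Filt_stop[mA sA]; apply/Filt_stop; split; first exact: measurableC.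
by rewrite preimage_setC; congr setC; exact: sA.
Qed.

Lemma FiltI t A A' : Filt t%:E A -> Filt t%:E A' -> Filt t%:E (A `&` A').
Proof.
move=> /Filt_stop[mA sA] /Filt_stop[mA' sA']; apply/Filt_stop.
by split; [exact: measurableI|rewrite preimage_setI sA sA'].
Qed.

Lemma Filt_measurable t A : Filt t%:E A -> measurable A.
Proof. by move=> /FiltP[]. Qed.

Lemma Filt_le s t A : s <= t -> Filt s%:E A -> Filt t%:E A.
Proof.
move=> st /Filt_stop[mA sA]; apply/Filt_stop; split => //.
by rewrite -[in LHS]sA -[RHS]sA; apply/seteqP; split => w /=; rewrite stop_stop.
Qed.

Lemma Filt_gt t y y' : measurable_fun setT y -> measurable_fun setT y' ->
  adapted t y -> adapted t y' -> Filt t%:E [set w | y' w < y w].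
Proof.
move=> my my' ay ay'; apply/FiltP; split; last first.
  by apply/seteqP; split => w /=; rewrite ay ay'.
rewrite (_ : [set w | _] = (fun w => y w - y' w) @^-1` `]0, +oo[).
  by rewrite -[X in measurable X]setTI; exact: measurable_funB.
by apply/seteqP; split => w /=; rewrite in_itv/= andbT subr_gt0.
Qed.

(** The indicator of A is approximated under both laws by a nonnegative cylinder function known at
    t, for which the defining inequality of [QQ] can be localised. *)
Lemma QQ_Filt t P Q A x : 0 <= t -> PP P -> QQ t P Q -> Filt t%:E A -> is_cyl x ->
  \int[Q]_(w in A) x w <= \int[P]_(w in A) Eop t x w.
Proof.
move=> t0 PP_P hQ FA cx; have mA := Filt_measurable FA.
have cE := Eop_is_cyl h0 hs t0 cx; have [M xM] := is_cyl_bddO cx.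
have EM w : `|Eop t x w| <= M by exact: Eop_bound.
have M0 : 0 <= M by exact: le_trans (xM (zero_path R)).
apply/ler_addgt0Pr => eps e0.
have d0 : 0 < eps / (2 * (M + 1)) by rewrite divr_gt0// mulr_gt0// ltr_wpDl.
have [phi [cp pp p01 h1 h2]] := approx_Filt P Q t0 FA d0.
have main (S : Prob) u : is_cyl u -> (forall w, `|u w| <= M) ->
    \int[S]_w `|phi w - \1_A w| <= eps / (2 * (M + 1)) ->
    `|\int[S]_w (phi w * u w) - \int[S]_(w in A) u w| <= eps / 2.
  move=> cu uM hS; have iu : ig S u by exact: is_cyl_integrable.
  have [i1 ->] := int_indic mA iu.
  have i2 : ig S (fun w => phi w * u w) by apply: is_cyl_integrable => //; exact: is_cylM.
  rewrite -intB//; apply: (le_trans (int_abs_le measurableT (igB i2 i1))).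
  have iphi : ig S phi by exact: is_cyl_integrable.
  have i3 : ig S (fun w => `|phi w - \1_A w : R|).
    apply/ig_abs/igB => //; apply: (ig_le _ (ig_cst S 1)); first exact: measurable_indic.
    by move=> w; rewrite indicE; case: (_ \in _); rewrite ?normr1 ?normr0.
  apply: (@le_trans _ _ (\int[S]_w ((M + 1) * `|phi w - \1_A w|))).
    apply: int_ae_le => //; [exact/ig_abs/igB|exact: igZ|].
    apply: aeW => w; rewrite -mulrBl normrM mulrC; apply: ler_wpM2r => //.
    by apply: (le_trans (uM w)); rewrite lerDl.
  rewrite intZ//; have -> : eps / 2 = (M + 1) * (eps / (2 * (M + 1))).
    by field; rewrite gt_eqF// ltr_wpDl.
  by apply: ler_wpM2l => //; apply: addr_ge0.
have g1 := main P _ cE EM h1; have g2 := main Q _ cx xM h2.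
have cpx : is_cyl (fun w => phi w * x w) by exact: is_cylM.
have := hQ _ cpx; rewrite (Eop_past_mul h0 hs t0 cx cp pp); last by move=> w; case/andP: (p01 w).
by move: g1 g2; rewrite !ler_distl => /andP[? ?] /andP[? ?] ?; lra.
Qed.

Lemma ce_cyl t x : 0 <= t -> is_cyl x -> ce t x (Eop t x).
Proof.
move=> t0 cx; split.
- exact: L1_cyl.
- exact/L1_cyl/Eop_is_cyl.
- by apply/past_stop; exact: past_Eop.
move=> P PP_P; split => [Q A hQ FA|eps e0]; first exact: QQ_Filt.
by have [Q hQ <-] := QQ_attained h0 hs t0 PP_P cx; exists Q => //; rewrite lerDl ltW.
Qed.

(** The constant 1 gives one inequality, and the complement of A the other. *)
Lemma QQ_prob t P Q A : 0 <= t -> PP P -> QQ t P Q -> Filt t%:E A -> Q A = P A.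
Proof.
move=> t0 PP_P hQ FA.
have main A' : Filt t%:E A' -> fine (Q A') <= fine (P A').
  move=> FA'; have mA := Filt_measurable FA'.
  have := QQ_Filt t0 PP_P hQ FA' (is_cyl_cst 1).
  by rewrite Eop_past// !Rintegral_cst// !mul1r.
have mA := Filt_measurable FA.
have fQ : Q A \is a fin_num by exact: fin_num_measure.
have fP : P A \is a fin_num by exact: fin_num_measure.
rewrite -(fineK fQ) -(fineK fP); congr EFin; apply/eqP; rewrite eq_le main//=.
have := main _ (FiltC FA); rewrite !probability_setC// !fineB//= .
by rewrite lerD2l lerN2.
Qed.

(** An adapted function is integrated against the law of the stopped path, which is common to P and
    Q. *)
Lemma QQ_int t P Q A x : 0 <= t -> PP P -> QQ t P Q -> Filt t%:E A -> adapted t x -> L1 x ->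
  \int[Q]_(w in A) x w = \int[P]_(w in A) x w.
Proof.
move=> t0 PP_P hQ FA ax hx; have /Filt_stop[mA sA] := FA.
have xs : (EFin \o x) \o stop t = EFin \o x by apply/funext => w /=; rewrite ax.
have H (S : Prob) : PP S -> (\int[S]_(w in A) (EFin \o x) w =
    \int[pushforward S (stop t)]_(w in A) (EFin \o x) w)%E.
  move=> PP_S; rewrite (integral_pushforward (measurable_stop t))//.
  - by rewrite sA xs.
  - by apply/measurable_EFinP; exact: L1_measurable.
  - by rewrite sA xs; apply: igS => //; exact: L1_ig.
rewrite /Rintegral (H P PP_P) (H Q (QQ_PP h0 hs t0 PP_P hQ)); congr fine.
have := @eq_measure_integral _ _ R A (pushforward P (stop t)) (pushforward Q (stop t)) (EFin \o x).
move=> /(_ (measurable_stop t) (measurable_stop t)); apply => A' mA' _; rewrite /pushforward.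
by apply: (QQ_prob t0 PP_P hQ); exists A' => //; rewrite setTI.
Qed.

Lemma int_le0_null P A x : measurable A -> ig P x -> (forall w, A w -> 0 < x w) ->
  \int[P]_(w in A) x w <= 0 -> P A = 0%E.
Proof.
move=> mA ix x0 hx.
have iA := igS mA ix; have /integrableP[mx _] := iA.
have e : (\int[P]_(w in A) `|(EFin \o x) w| = 0)%E.
  have -> : (\int[P]_(w in A) `|(EFin \o x) w| = (\int[P]_(w in A) x w)%:E)%E.
    rewrite /Rintegral fineK; last exact: integrable_fin_num.
    by apply: eq_integral => w; rewrite inE => Aw /=; rewrite ger0_norm// ltW// x0.
  congr EFin; apply/eqP; rewrite eq_le hx/=; apply: Rintegral_ge0 => w Aw.
  exact/ltW/x0.
have /(ae_eq_integral_abs _ mA mx)[N [mN N0 hN]] := e.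
apply/eqP; rewrite eq_le measure_ge0 andbT -N0; apply: le_measure; rewrite ?inE//.
by move=> w Aw; apply: hN => /= /(_ Aw) /= [xw]; have := x0 w Aw; rewrite xw ltxx.
Qed.

(** A law that is nearly optimal on the whole space is so on each prior event, since on the
    complement it cannot exceed the integral of y. *)
Lemma ce_near t x y P eps : 0 <= t -> ce t x y -> PP P -> 0 < eps -> exists2 Q, QQ t P Q &
  forall A, Filt t%:E A -> \int[P]_(w in A) y w <= \int[Q]_(w in A) x w + eps.
Proof.
move=> t0 [hx hy _ /(_ P) H] PP_P e0; have [h1 /(_ _ e0)[Q hQ h2]] := H PP_P.
exists Q => // A FA; have mA := Filt_measurable FA.
have PP_Q := QQ_PP h0 hs t0 PP_P hQ.
have := h1 Q _ hQ (FiltC FA).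
move: h2; rewrite (int_split mA (L1_ig hy PP_P)) (int_split mA (L1_ig hx PP_Q)).
move: (\int[P]_(w in A) y w) (\int[P]_(w in ~` A) y w) (\int[Q]_(w in A) x w)
  (\int[Q]_(w in ~` A) x w) => a b c d; lra.
Qed.

Lemma nb_int_dist P A x x' K : nb (fun w => x w - x' w) K -> PP P -> measurable A ->
  ig P x -> ig P x' -> \int[P]_(w in A) x w <= \int[P]_(w in A) x' w + K.
Proof.
move=> nK PP_P mA ix ix'; have [id hK] := nK P PP_P.
rewrite -lerBlDl -intB//; apply: le_trans hK.
exact: le_trans (ler_norm _) (int_abs_le mA id).
Qed.

Lemma ce_dist t x y x' y' K P A : 0 <= t -> ce t x y -> ce t x' y' ->
  nb (fun w => x w - x' w) K -> PP P -> Filt t%:E A ->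
  \int[P]_(w in A) y w <= \int[P]_(w in A) y' w + K.
Proof.
move=> t0 hc hc' nK PP_P FA; have mA := Filt_measurable FA.
apply/ler_addgt0Pr => eps e0; have [Q hQ h1] := ce_near t0 hc PP_P e0.
have PP_Q := QQ_PP h0 hs t0 PP_P hQ.
have [hx hy _ _] := hc; have [hx' hy' _ /(_ P PP_P)[h2 _]] := hc'.
have := h1 A FA; have := h2 Q A hQ FA.
have := nb_int_dist nK PP_Q mA (L1_ig hx PP_Q) (L1_ig hx' PP_Q).
move: (\int[P]_(w in A) y w) (\int[P]_(w in A) y' w) (\int[Q]_(w in A) x w)
  (\int[Q]_(w in A) x' w) => a b c d; lra.
Qed.

(** Tested on the prior event y' < y, which must be null. Comparing integrals over prior events, and
    not x with x' pointwise, is what [CE_super] requires. *)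
Lemma ce_mono_int t x y x' y' : 0 <= t -> ce t x y -> ce t x' y' ->
  (forall Q A, PP Q -> Filt t%:E A -> \int[Q]_(w in A) x w <= \int[Q]_(w in A) x' w) ->
  forall P, PP P -> {ae P, forall w, y w <= y' w}.
Proof.
move=> t0 hc hc' xx' P PP_P; have [hx hy ay _] := hc.
have [hx' hy' ay' /(_ P PP_P)[h2 _]] := hc'.
pose A := [set w | y' w < y w].
have FA : Filt t%:E A by apply: Filt_gt => //; exact: L1_measurable.
have mA := Filt_measurable FA.
have iy := L1_ig hy PP_P; have iy' := L1_ig hy' PP_P.
exists A; split => //; last by move=> w /= /negP; rewrite -ltNge.
apply: (@int_le0_null P A (fun w => y w - y' w) mA (igB iy iy')).
  by move=> w /= yy; rewrite subr_gt0.
rewrite intB// subr_le0; apply/ler_addgt0Pr => eps e0.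
have [Q hQ h1] := ce_near t0 hc PP_P e0; have PP_Q := QQ_PP h0 hs t0 PP_P hQ.
apply: (le_trans (h1 A FA)); rewrite lerD2r; apply: le_trans (h2 Q A hQ FA).
exact: xx'.
Qed.

Lemma ce_mono t x y x' y' : 0 <= t -> ce t x y -> ce t x' y' ->
  (forall P, PP P -> {ae P, forall w, x w <= x' w}) ->
  forall P, PP P -> {ae P, forall w, y w <= y' w}.
Proof.
move=> t0 hc hc' xx'; apply: (ce_mono_int t0 hc hc') => Q A PP_Q FA.
have [hx _ _ _] := hc; have [hx' _ _ _] := hc'.
apply: int_ae_le; [exact: Filt_measurable FA|exact: L1_ig|exact: L1_ig|exact: xx'].
Qed.

(** The factor 2 arises from bounding y - y' on the event y' < y and y' - y on its complement, each
    by K. *)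
Lemma ce_contract t x y x' y' K : 0 <= t -> ce t x y -> ce t x' y' ->
  nb (fun w => x w - x' w) K -> nb (fun w => y w - y' w) (2 * K).
Proof.
move=> t0 hc hc' nK P PP_P; have [hx hy ay _] := hc; have [hx' hy' ay' _] := hc'.
have iy := L1_ig hy PP_P; have iy' := L1_ig hy' PP_P.
split; first exact: igB.
pose A := [set w | y' w < y w].
have FA : Filt t%:E A by apply: Filt_gt => //; exact: L1_measurable.
have mA := Filt_measurable FA.
have e1 := ce_dist t0 hc hc' nK PP_P FA.
have e2 := ce_dist t0 hc' hc (nbC nK) PP_P (FiltC FA).
rewrite (int_split mA (ig_abs (igB iy iy'))).
have -> : \int[P]_(w in A) `|y w - y' w| = \int[P]_(w in A) (y w - y' w).
  by apply: eq_Rintegral => w; rewrite inE /A/= => h; rewrite gtr0_norm// subr_gt0.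
have -> : \int[P]_(w in ~` A) `|y w - y' w| = \int[P]_(w in ~` A) (y' w - y w).
  apply: eq_Rintegral => w; rewrite inE /A/= => /negP; rewrite -leNgt => h.
  by rewrite ler0_norm ?subr_le0// opprB.
rewrite !intB//; last exact: measurableC.
move: e1 e2; move: (\int[P]_(w in A) y w) (\int[P]_(w in A) y' w) (\int[P]_(w in ~` A) y w)
  (\int[P]_(w in ~` A) y' w) => a b c d; lra.
Qed.

Lemma ce_self t x : 0 <= t -> L1 x -> adapted t x -> ce t x x.
Proof.
move=> t0 hx ax; split => // P PP_P; split => [Q A hQ FA|eps e0].
  by rewrite (QQ_int t0 PP_P hQ FA ax hx).
by exists P; [exact: QQ_refl|rewrite lerDl ltW].
Qed.

(** For near-attainment, a law nearly optimal for y is modified after t into one nearly optimal for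
    x; by [QQ_trans] it still agrees with P up to s. *)
Lemma ce_tower s t x y z : 0 <= s -> s <= t -> ce t x y -> ce s y z -> ce s x z.
Proof.
move=> s0 st hc hc'; have t0 := le_trans s0 st.
have [hx hy ay H] := hc; have [_ hz az H'] := hc'; split => // P PP_P.
have [h1' h2'] := H' P PP_P; split => [Q A hQ FA|eps e0].
  apply: le_trans (h1' Q A hQ FA); have PP_Q := QQ_PP h0 hs s0 PP_P hQ.
  have [h1 _] := H Q PP_Q; apply: h1; first exact: QQ_refl.
  exact: Filt_le FA.
have e2 : 0 < eps / 2 by rewrite divr_gt0.
have [Q1 hQ1 k1] := h2' _ e2; have PP_Q1 := QQ_PP h0 hs s0 PP_P hQ1.
have [_ /(_ _ e2)[Q2 hQ2 k2]] := H Q1 PP_Q1.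
exists Q2; first exact: (QQ_trans h0 hs s0 st PP_P hQ1 hQ2).
move: k1 k2; move: (\int[P]_w z w) (\int[Q1]_w y w) (\int[Q2]_w x w) => a b c; lra.
Qed.

(** Off A the variable is known at t, and all laws agreeing up to t integrate it alike. *)
Lemma ce_local t x y z A : 0 <= t -> ce t x y -> L1 z -> adapted t z -> Filt t%:E A ->
  ce t (fun w => \1_A w * x w + \1_(~` A) w * z w)
       (fun w => \1_A w * y w + \1_(~` A) w * z w).
Proof.
move=> t0 hc hz az FA; have [hx hy ay H] := hc; have mA := Filt_measurable FA.
have mAC := measurableC mA; have /Filt_stop[_ sA] := FA.
have hI u : L1 u -> L1 (fun w => \1_A w * u w + \1_(~` A) w * z w).
  by move=> hu; apply: L1D; exact: L1_mulI.
have ind_stop C w : Filt t%:E C -> \1_C (stop t w) = \1_C w :> R.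
  move=> /Filt_stop[_ sC]; have e : C (stop t w) = C w := congr1 (fun C => C w) sC.
  rewrite !indicE (_ : (stop t w \in C) = (w \in C))//.
  by apply/idP/idP; rewrite !inE e.
have split_int (S : Prob) u A' : PP S -> L1 u -> Filt t%:E A' ->
    \int[S]_(w in A') (\1_A w * u w + \1_(~` A) w * z w) =
    \int[S]_(w in A' `&` A) u w + \int[S]_(w in A' `&` ~` A) z w.
  move=> PP_S hu FA'; have mA' := Filt_measurable FA'.
  have iu := L1_ig hu PP_S; have iz := L1_ig hz PP_S.
  have [i1 _] := int_indic mA iu; have [i2 _] := int_indic mAC iz.
  rewrite intD//; congr (_ + _).
    have [_ ->] := int_indic mA' i1; have [_ ->] := int_indic (measurableI _ _ mA' mA) iu.
    by congr fine; congr integral; apply/funext => w; rewrite indicI mulrA.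
  have [_ ->] := int_indic mA' i2; have [_ ->] := int_indic (measurableI _ _ mA' mAC) iz.
  by congr fine; congr integral; apply/funext => w; rewrite indicI mulrA.
split; [exact: hI|exact: hI|by move=> w; rewrite !ind_stop ?ay ?az//; exact: FiltC|].
move=> P PP_P; have [h1 _] := H P PP_P; split => [Q A' hQ FA'|eps e0].
  have PP_Q := QQ_PP h0 hs t0 PP_P hQ.
  rewrite split_int// split_int//; apply: lerD.
    by apply: h1 => //; exact: FiltI.
  by rewrite (QQ_int t0 PP_P hQ _ az hz)//; apply: FiltI => //; exact: FiltC.
have [Q hQ k1] := ce_near t0 hc PP_P e0; have PP_Q := QQ_PP h0 hs t0 PP_P hQ.
have FT : Filt t%:E setT by apply/Filt_stop; split => //; rewrite preimage_setT.
exists Q => //; rewrite split_int// split_int// !setTI addrAC; apply: lerD; first exact: k1.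
by rewrite (QQ_int t0 PP_P hQ _ az hz)//; exact: FiltC.
Qed.

Lemma ce_norm_lim t x y : 0 <= t -> L1 x -> L1 y -> adapted t y ->
  (forall eps, 0 < eps -> exists x' y', [/\ ce t x' y', nb (fun w => x w - x' w) eps &
     nb (fun w => y w - y' w) eps]) -> ce t x y.
Proof.
move=> t0 hx hy ay H; split => // P PP_P; split => [Q A hQ FA|eps e0].
  apply/ler_addgt0Pr => eps e0; have e2 : 0 < eps / 2 by rewrite divr_gt0.
  have [x' [y' [[hx' hy' _ /(_ P PP_P)[h1 _]] nx ny]]] := H _ e2.
  have PP_Q := QQ_PP h0 hs t0 PP_P hQ; have mA := Filt_measurable FA.
  have := nb_int_dist nx PP_Q mA (L1_ig hx PP_Q) (L1_ig hx' PP_Q).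
  have := nb_int_dist (nbC ny) PP_P mA (L1_ig hy' PP_P) (L1_ig hy PP_P).
  have := h1 Q A hQ FA.
  move: (\int[P]_(w in A) y w) (\int[P]_(w in A) y' w) (\int[Q]_(w in A) x w)
    (\int[Q]_(w in A) x' w) => a b c d; lra.
have e3 : 0 < eps / 3 by rewrite divr_gt0.
have [x' [y' [[hx' hy' _ /(_ P PP_P)[_ /(_ _ e3)[Q hQ h2]]] nx ny]]] := H _ e3.
exists Q => //; have PP_Q := QQ_PP h0 hs t0 PP_P hQ.
have := nb_int_dist (nbC nx) PP_Q measurableT (L1_ig hx' PP_Q) (L1_ig hx PP_Q).
have := nb_int_dist ny PP_P measurableT (L1_ig hy PP_P) (L1_ig hy' PP_P).
move: h2; move: (\int[P]_w y w) (\int[P]_w y' w) (\int[Q]_w x w) (\int[Q]_w x' w) => a b c d; lra.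
Qed.

Definition ae_incr (xn : nat -> Omega -> R) x := forall P, PP P ->
  {ae P, forall w, (forall n, xn n w <= xn n.+1 w) /\ xn n w @[n --> \oo] --> (x w : R)}.

Definition ae_decr (xn : nat -> Omega -> R) x := forall P, PP P ->
  {ae P, forall w, (forall n, xn n.+1 w <= xn n w) /\ xn n w @[n --> \oo] --> (x w : R)}.

Lemma ae_incr_le (xn : nat -> Omega -> R) x n : ae_incr xn x ->
  forall P, PP P -> {ae P, forall w, xn n w <= x w}.
Proof.
move=> h P PP_P; apply: filterS (h P PP_P) => w [hm hl].
have hm' : {homo (fun n => xn n w) : i j / (i <= j)%N >-> i <= j}.
  by apply: homo_leq => //; exact: le_trans.
apply: (ler_cvg_to (cvg_cst (xn n w)) hl); exists n => // k /= nk; exact: hm'.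
Qed.

Lemma ae_decr_ge (xn : nat -> Omega -> R) x n : ae_decr xn x ->
  forall P, PP P -> {ae P, forall w, x w <= xn n w}.
Proof.
move=> h P PP_P; apply: filterS (h P PP_P) => w [hm hl].
have hm' : {homo (fun n => xn n w) : i j / (i <= j)%N >-> j <= i}.
  by apply: homo_leq => [//|a b c ab bc|k]; [exact: le_trans bc ab|exact: hm].
apply: (ler_cvg_to hl (cvg_cst (xn n w))); exists n => // k /= nk; exact: hm'.
Qed.

Lemma ae_incr_int (xn : nat -> Omega -> R) x P A : (forall n, L1 (xn n)) -> L1 x ->
  ae_incr xn x -> PP P -> measurable A ->
  (\int[P]_(w in A) xn n w) @[n --> \oo] --> \int[P]_(w in A) x w.
Proof.
move=> hxn hx h PP_P mA.
have [|||||_] := @dct _ _ _ P A xn x (fun w => `|xn 0%N w| + `|x w|) mA; last exact.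
- by move=> n; exact: L1_measurable.
- exact: L1_measurable.
- by apply: igD; apply: ig_abs; exact: L1_ig.
- by apply: filterS (h P PP_P) => w [].
apply: filterS (h P PP_P) => w [hm hl] n.
have hm' : {homo (fun n => xn n w) : i j / (i <= j)%N >-> i <= j}.
  by apply: homo_leq => //; exact: le_trans.
have xnx : xn n w <= x w.
  by apply: (ler_cvg_to (cvg_cst (xn n w)) hl); exists n => // k /= nk; exact: hm'.
have x0n := hm' _ _ (leq0n n).
have := ler_norm (x w); have := ler_norm (- xn 0%N w); rewrite normrN.
have := normr_ge0 (x w); have := normr_ge0 (xn 0%N w).
by rewrite ler_norml => *; apply/andP; split; lra.
Qed.

Lemma ae_decrN (xn : nat -> Omega -> R) x : ae_decr xn x ->
  ae_incr (fun n w => - xn n w) (fun w => - x w).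
Proof.
move=> h P PP_P; apply: filterS (h P PP_P) => w [hm hl]; split.
  by move=> n; rewrite lerN2.
exact: cvgN.
Qed.

Lemma ae_decr_int (xn : nat -> Omega -> R) x P A : (forall n, L1 (xn n)) -> L1 x ->
  ae_decr xn x -> PP P -> measurable A ->
  (\int[P]_(w in A) xn n w) @[n --> \oo] --> \int[P]_(w in A) x w.
Proof.
move=> hxn hx h PP_P mA.
have := ae_incr_int (fun n => L1N (hxn n)) (L1N hx) (ae_decrN h) PP_P mA.
have E u : L1 u -> \int[P]_(w in A) (- u w) = - \int[P]_(w in A) u w.
  move=> hu; rewrite -mulN1r -intZ//; last exact: L1_ig.
  by apply: eq_Rintegral => w _; rewrite mulN1r.
rewrite E// => /cvgN; rewrite opprK.
rewrite (_ : (fun n => \int[P]_(w in A) xn n w) = - (fun n => \int[P]_(w in A) - xn n w))//.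
by apply/funext => n; rewrite fctE E// opprK.
Qed.

Lemma ce_incr_lim t (xn yn : nat -> Omega -> R) x y : 0 <= t -> (forall n, ce t (xn n) (yn n)) ->
  L1 x -> L1 y -> adapted t y -> ae_incr xn x -> ae_incr yn y -> ce t x y.
Proof.
move=> t0 hc hx hy ay xx yy; split => // P PP_P; split => [Q A hQ FA|eps e0].
  have PP_Q := QQ_PP h0 hs t0 PP_P hQ; have mA := Filt_measurable FA.
  have c1 := ae_incr_int (fun n => let: And4 h _ _ _ := hc n in h) hx xx PP_Q mA.
  have c2 := ae_incr_int (fun n => let: And4 _ h _ _ := hc n in h) hy yy PP_P mA.
  apply: (ler_cvg_to c1 c2); apply: nearW => n.
  by have [_ _ _ /(_ P PP_P)[h1 _]] := hc n; exact: h1.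
have e2 : 0 < eps / 2 by rewrite divr_gt0.
have c2 := ae_incr_int (fun n => let: And4 _ h _ _ := hc n in h) hy yy PP_P measurableT.
have [n _ hn] : \forall n \near \oo, \int[P]_w y w - eps / 2 <= \int[P]_w yn n w.
  by have /cvgr_ge := c2; apply; rewrite ltrBlDr ltrDl.
have [hxn hyn _ /(_ P PP_P)[_ /(_ _ e2)[Q hQ h2]]] := hc n.
have PP_Q := QQ_PP h0 hs t0 PP_P hQ; exists Q => //.
have := hn n (leqnn n); have := ae_incr_le n xx PP_Q => /(int_ae_le measurableT (L1_ig hxn PP_Q) (L1_ig hx PP_Q)).
move: h2; move: (\int[P]_w y w) (\int[P]_w yn n w) (\int[Q]_w x w) (\int[Q]_w xn n w) => a b c d /=; lra.
Qed.

(** A law nearly optimal for x_n need not be so for the smaller x, so a limit Q of such laws is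
    used. For k >= n the k-th law gives x_k at most the integral of x_n, and x_n is close to a
    cylinder function, whose integrals converge to the one under Q. *)
Lemma ce_decr_lim t (xn yn : nat -> Omega -> R) x y : 0 <= t -> (forall n, ce t (xn n) (yn n)) ->
  (forall n eps, 0 < eps -> exists2 z, is_cyl z & nb (fun w => xn n w - z w) eps) ->
  L1 x -> L1 y -> adapted t y -> ae_decr xn x -> ae_decr yn y -> ce t x y.
Proof.
move=> t0 hc hcyl hx hy ay xx yy; split => // P PP_P; split => [Q A hQ FA|eps e0].
  have PP_Q := QQ_PP h0 hs t0 PP_P hQ; have mA := Filt_measurable FA.
  have c1 := ae_decr_int (fun n => let: And4 h _ _ _ := hc n in h) hx xx PP_Q mA.
  have c2 := ae_decr_int (fun n => let: And4 _ h _ _ := hc n in h) hy yy PP_P mA.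
  apply: (ler_cvg_to c1 c2); apply: nearW => n.
  by have [_ _ _ /(_ P PP_P)[h1 _]] := hc n; exact: h1.
have e4 : 0 < eps / 4 by rewrite divr_gt0.
have hQn n : exists Q, QQ t P Q /\ \int[P]_w yn n w <= \int[Q]_w xn n w + eps / 4.
  by have [_ _ _ /(_ P PP_P)[_ /(_ _ e4)[Q hQ h2]]] := hc n; exists Q.
have [Qn hQn'] := choice hQn.
have hQ1 n : QQ t P (Qn n) by case: (hQn' n).
have PP_Qn n := QQ_PP h0 hs t0 PP_P (hQ1 n).
have [Q hQ Qlim] := QQ_compact h0 hs t0 PP_P hQ1; exists Q => //.
have PP_Q := QQ_PP h0 hs t0 PP_P hQ.
have Lxn n : L1 (xn n) by case: (hc n).
have Lyn n : L1 (yn n) by case: (hc n).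
have main n : \int[P]_w y w <= \int[Q]_w xn n w + (eps / 4 + eps / 4 + eps / 4).
  have [z cz nz] := hcyl n _ e4.
  have zQ : \int[P]_w y w - (eps / 4 + eps / 4) <= \int[Q]_w z w.
    rewrite Qlim//; have [M zM] := is_cyl_bddO cz.
    apply: ulim_ge_cst.
      exists M => k; apply: (le_trans (int_abs_le measurableT (L1_ig (L1_cyl cz) (PP_Qn k)))).
      by have [] := nb_bound (L1_measurable (L1_cyl cz)) zM (PP_Qn k).
    apply: near_ultra; exists n => // k /= nk.
    have k1 : \int[P]_w y w <= \int[P]_w yn k w.
      apply: int_ae_le => //; [exact: L1_ig|exact: L1_ig|exact: ae_decr_ge].
    have [_ k2] := hQn' k.
    have k3 : \int[Qn k]_w xn k w <= \int[Qn k]_w xn n w.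
      apply: int_ae_le => //; [exact: L1_ig|exact: L1_ig|].
      apply: filterS (xx _ (PP_Qn k)) => w [hm _].
      have hm' : {homo (fun n => xn n w) : i j / (i <= j)%N >-> j <= i}.
        by apply: homo_leq => [//|a b c ab bc|i]; [exact: le_trans bc ab|exact: hm].
      exact: hm'.
    have := nb_int_dist nz (PP_Qn k) measurableT (L1_ig (Lxn n) (PP_Qn k)) (L1_ig (L1_cyl cz) (PP_Qn k)).
    move: k1 k2 k3; move: (\int[P]_w y w) (\int[P]_w yn k w) (\int[Qn k]_w xn n w) (\int[Qn k]_w xn k w) (\int[Qn k]_w z w) => a b c d e; lra.
  have := nb_int_dist (nbC nz) PP_Q measurableT (L1_ig (L1_cyl cz) PP_Q) (L1_ig (Lxn n) PP_Q).
  move: zQ; move: (\int[P]_w y w) (\int[Q]_w xn n w) (\int[Q]_w z w) => a b c; lra.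
have c1 := ae_decr_int Lxn hx xx PP_Q measurableT.
have c2 : (\int[Q]_w xn n w + (eps / 4 + eps / 4 + eps / 4)) @[n --> \oo] --> \int[Q]_w x w + (eps / 4 + eps / 4 + eps / 4).
  by apply: cvgD => //; exact: cvg_cst.
have : \int[P]_w y w <= \int[Q]_w x w + (eps / 4 + eps / 4 + eps / 4).
  by apply: (ler_cvg_to (cvg_cst _) c2); exact: nearW.
move: (\int[P]_w y w) (\int[Q]_w x w) => a b; lra.
Qed.

End real_conditional_expectation.

(** * Quasi-sure calculus, real versions and completeness *)

Section quasi_sure.
Context (R : realType) (sl sh : R).
Hypotheses (h0 : 0 <= sl) (hs : sl <= sh).
Local Notation Omega := (Omega R).
Local Notation Prob := (probability Omega R).
Local Notation PP := (PP sl sh).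
Local Notation qs := (qs sl sh).
Local Notation qs_eq := (qs_eq sl sh).
Local Notation qs_le := (qs_le sl sh).
Local Notation Ehat := (Ehat sl sh).
Local Notation nb := (nb sl sh).
Local Notation L1 := (L1 sl sh).
Implicit Types (x y z : Omega -> R) (w : Omega) (K : R) (P : Prob) (A S : set Omega)
  (X Y Z : Omega -> \bar R) (T : \bar R).

(** The existence of a representing law makes the supremum in the capacity 0 and not minus
    infinity. *)
Lemma qsP S : qs S <-> exists A, [/\ measurable A, (forall P, PP P -> P A = 0%E) & ~` S `<=` A].
Proof.
have [P0 PP_P0] := PP_nonempty h0 hs.
split=> [[A [mA cA SA]]|[A [mA cA SA]]]; exists A; split => //.
  move=> P PP_P; apply/eqP; rewrite eq_le measure_ge0 andbT -cA.
  by apply: ereal_sup_ubound; exists P.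
apply/eqP; rewrite eq_le; apply/andP; split.
  by apply: ge_ereal_sup => _ [P PP_P <-]; rewrite cA.
by rewrite -(cA P0 PP_P0); apply: ereal_sup_ubound; exists P0.
Qed.

Lemma qs_ae S P : qs S -> PP P -> {ae P, forall w, S w}.
Proof. by move=> /qsP[A [mA cA SA]] PP_P; exists A; split => //; exact: cA. Qed.

Lemma qs_meas S : measurable S -> (forall P, PP P -> {ae P, forall w, S w}) -> qs S.
Proof.
move=> mS h; apply/qsP; exists (~` S); split => //; first exact: measurableC.
move=> P PP_P; have [A [mA A0 SA]] := h P PP_P.
by apply/eqP; rewrite eq_le measure_ge0 andbT -A0; apply: le_measure; rewrite ?inE//; exact: measurableC.
Qed.

Lemma qs_sub S S' : S `<=` S' -> qs S -> qs S'.
Proof.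
move=> SS' /qsP[A [mA cA SA]]; apply/qsP; exists A; split => // w nS.
by apply: SA => Sw; apply: nS; exact: SS'.
Qed.

Lemma qs_T S : (forall w, S w) -> qs S.
Proof.
move=> h; apply/qsP; exists set0; split => //.
by move=> w /(_ (h w)).
Qed.

Lemma qs_all (S : nat -> set Omega) : (forall n, qs (S n)) -> qs [set w | forall n, S n w].
Proof.
move=> h; have /choice[A hA] : forall n, exists A, [/\ measurable A, (forall P, PP P -> P A = 0%E) & ~` S n `<=` A].
  by move=> n; exact/qsP.
apply/qsP; exists (\bigcup_n A n); split.
- by apply: bigcupT_measurable => n; case: (hA n).
- move=> P PP_P; apply/measure_negligible.
    by apply: bigcupT_measurable => n; case: (hA n).
  apply: negligible_bigcup => n; have [mA cA _] := hA n.
  by apply/negligibleP => //; exact: cA.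
move=> w /existsNP[n nS]; exists n => //; have [_ _ h3] := hA n; exact: h3.
Qed.

Lemma qs_and S S' : qs S -> qs S' -> qs (S `&` S').
Proof.
move=> hS hS'; pose F n := if n is 0%N then S else S'.
apply: (@qs_sub [set w | forall n, F n w]); last by apply: qs_all; case.
by move=> w h; split; [exact: (h 0%N)|exact: (h 1%N)].
Qed.

Lemma qs_eq_sym X Y : qs_eq X Y -> qs_eq Y X.
Proof. by apply: qs_sub => w /= ->. Qed.

Lemma qs_eq_refl X : qs_eq X X.
Proof. exact: qs_T. Qed.

(* [L^1] elements are quasi-surely finite: [x] is a real-valued version of [X]. *)
Definition ver X x := qs_eq X (EFin \o x).

Lemma ver_refl x : ver (EFin \o x) x.
Proof. exact: qs_eq_refl. Qed.

Lemma ver_uniq X x y : ver X x -> ver X y -> qs [set w | x w = y w].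
Proof. by move=> h1 h2; apply: qs_sub (qs_and h1 h2) => w [/= -> [->]]. Qed.

Lemma qs_measurable_eq x y : measurable_fun setT x -> measurable_fun setT y ->
  (forall P, PP P -> {ae P, forall w, x w = y w}) -> qs [set w | x w = y w].
Proof.
move=> mx my h; apply: qs_meas => //.
rewrite (_ : [set w | _] = (fun w => x w - y w) @^-1` [set 0]).
  by rewrite -[X in measurable X]setTI; exact: measurable_funB.
by apply/seteqP; split => w /= => [->|/eqP]; rewrite ?subrr// subr_eq0 => /eqP.
Qed.

Lemma qs_measurable_le x y : measurable_fun setT x -> measurable_fun setT y ->
  (forall P, PP P -> {ae P, forall w, x w <= y w}) -> qs [set w | x w <= y w].
Proof.
move=> mx my h; apply: qs_meas => //.
rewrite (_ : [set w | _] = (fun w => y w - x w) @^-1` `[0, +oo[).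
  by rewrite -[X in measurable X]setTI; exact: measurable_funB.
by apply/seteqP; split => w /=; rewrite in_itv/= andbT subr_ge0.
Qed.

Lemma nb0_eq x y : measurable_fun setT x -> measurable_fun setT y ->
  (forall eps, 0 < eps -> nb (fun w => x w - y w) eps) -> qs [set w | x w = y w].
Proof.
move=> mx my h; apply: qs_measurable_eq => // P PP_P.
pose d w := x w - y w.
have [id _] : ig P d /\ _ := h 1 ltr01 P PP_P.
have e : (\int[P]_(w in setT) `|(EFin \o d) w| = 0)%E.
  have -> : (\int[P]_(w in setT) `|(EFin \o d) w| = (\int[P]_w `|d w|%R)%:E)%E.
    by rewrite /Rintegral fineK//; apply: integrable_fin_num => //; exact: (ig_abs id).
  congr EFin; apply/eqP; rewrite eq_le; apply/andP; split; last exact: Rintegral_ge0.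
  by apply/ler_addgt0Pr => eps e0; rewrite add0r; have [] := h _ e0 P PP_P.
have /integrableP[md _] := id.
have /(ae_eq_integral_abs _ measurableT md) := e.
apply: filterS => w /(_ I) /= [/eqP]; by rewrite subr_eq0 => /eqP.
Qed.

Lemma Ehat_ge0 X : (forall w, (0 <= X w)%E) -> (0 <= Ehat X)%E.
Proof.
have [P PP_P] := PP_nonempty h0 hs; move=> X0.
apply: (@le_trans _ _ (\int[P]_w X w)%E); first exact: integral_ge0.
by apply: ereal_sup_ubound; exists P.
Qed.

Lemma Ehat_nb Z z K : measurable_fun setT Z -> measurable_fun setT z -> ver Z z ->
  (Ehat (fun w => `|Z w|) <= K%:E)%E <-> nb z K.
Proof.
move=> mZ mz Zz.
have e P : PP P -> (\int[P]_w `|Z w| = \int[P]_w `|z w|%:E)%E.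
  move=> PP_P; apply: ae_eq_integral => //.
  - exact: measurableT_comp.
  - by apply/measurable_EFinP; exact: measurableT_comp.
  by apply: filterS (qs_ae Zz PP_P) => w /= -> _.
split=> [h P PP_P|h].
  have hP : (\int[P]_w `|z w|%:E <= K%:E)%E.
    by rewrite -e//; apply: le_trans h; apply: ereal_sup_ubound; exists P.
  have iz : ig P z.
    apply/integrableP; split; first exact/measurable_EFinP.
    by apply: (le_lt_trans hP); rewrite ltry.
  split => //; rewrite -lee_fin /Rintegral fineK//.
  by apply: integrable_fin_num => //; exact: ig_abs.
apply: ge_ereal_sup => _ [P PP_P <-]; rewrite e//.
have [iz zK] := h P PP_P; move: zK; rewrite -lee_fin /Rintegral fineK//.
by apply: integrable_fin_num => //; exact: ig_abs.
Qed.

Lemma measurable_cpre x (S : set R) : measurable_fun setT x -> measurable S -> measurable (x @^-1` S).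
Proof. by move=> mx mS; rewrite -[X in measurable X]setTI; exact: mx. Qed.

Definition inv T x := forall w, x (stp T w) = x w.

(** A finite norm makes X quasi-surely finite, so [fine] of its exactly measurable version is a real
    version, still invariant under stopping. *)
Lemma LL1P T X : LL1 sl sh T X <->
  measurable_fun setT X /\ exists x, [/\ L1 x, inv T x & ver X x].
Proof.
split=> [[[mX [Y aY XY]] EX]|[mX [x [hx ix Xx]]]].
  split => //; have mY : measurable_fun setT Y.
    by move=> _ C mC; rewrite setTI; have /FiltP[] := aY C mC.
  have iY w : Y (stp T w) = Y w.
    have /FiltP[_ h] := aY _ (emeasurable_set1 (Y w)).
    by have : (stp T @^-1` (Y @^-1` [set Y w])) w by rewrite h.
  pose x := fine \o Y.
  have mx : measurable_fun setT x.
    by apply: measurableT_comp mY => //; exact: fine_measurable.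
  have E0 : (0 <= Ehat (fun w => `|X w|))%E by apply: Ehat_ge0 => w; exact: abse_ge0.
  have Ef : (Ehat (fun w => `|X w|) \is a fin_num)%E by rewrite ge0_fin_numE.
  have Xx : ver X x.
    have h : qs [set w | Y w \is a fin_num].
      apply: qs_meas; first by rewrite -[X in measurable X]setTI; exact: emeasurable_fin_num.
      move=> P PP_P; have : P.-integrable setT X.
        apply/integrableP; split => //; apply: le_lt_trans EX.
        by apply: ereal_sup_ubound; exists P.
      move=> /(integrable_ae measurableT) h1; have h2 := qs_ae XY PP_P.
      by apply: filterS2 h1 h2 => w /= /(_ I) + <-.
    by apply: qs_sub (qs_and XY h) => w [/= -> Yf]; rewrite /x/= fineK.
  exists x; split => //; last by move=> w; rewrite /x /= iY.
  exists (fine (Ehat (fun w => `|X w|%E))); apply/(Ehat_nb _ mX mx Xx).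
  by rewrite fineK.
split.
  split => //; exists (EFin \o x) => // A mA; apply/FiltP; split.
    have : measurable_fun setT (EFin \o x) by apply/measurable_EFinP; exact: L1_measurable hx.
    by move=> m; rewrite -[X in measurable X]setTI; exact: m.
  by apply/seteqP; split => w /=; rewrite ix.
have [K hK] := hx; apply: (@le_lt_trans _ _ K%:E); last by rewrite ltry.
by apply/(Ehat_nb _ mX _ Xx) => //; exact: L1_measurable hx.
Qed.

Definition nbcvg (xn : nat -> Omega -> R) x := forall eps, 0 < eps ->
  exists N, forall n, (N <= n)%N -> nb (fun w => xn n w - x w) eps.

Lemma norm_cvgP (Xn : nat -> Omega -> \bar R) X : norm_cvg sl sh Xn X <-> forall eps, 0 < eps ->
  exists N, forall n, (N <= n)%N -> (Ehat (fun w => `|Xn n w - X w|) <= eps%:E)%E.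
Proof.
have E0 n : (0 <= Ehat (fun w => `|Xn n w - X w|))%E by apply: Ehat_ge0 => w; exact: abse_ge0.
split=> [/fine_cvgP[h1 h2] eps e0|h].
  have h3 := h2; move/cvgr_le : h3 => /(_ eps e0) h3.
  have [N _ hN] := filterI h1 h3; exists N => n /hN[/= f1 f2].
  by rewrite -(fineK f1) lee_fin.
apply/fine_cvgP; split.
  have [N hN] := h 1 ltr01; exists N => // n /= /hN hn.
  by rewrite ge0_fin_numE//; apply: (le_lt_trans hn); rewrite ltry.
apply/cvgrPdist_le => eps e0; have [N hN] := h eps e0; exists N => // n /= /hN hn.
rewrite sub0r normrN ger0_norm ?fine_ge0//.
have f : Ehat (fun w => `|Xn n w - X w|)%E \is a fin_num.
  by rewrite ge0_fin_numE//; apply: (le_lt_trans hn); rewrite ltry.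
by rewrite -lee_fin fineK.
Qed.

Lemma verB X Y x y : ver X x -> ver Y y -> ver (fun w => X w - Y w)%E (fun w => x w - y w).
Proof. by move=> h1 h2; apply: qs_sub (qs_and h1 h2) => w [/= -> ->]. Qed.

Lemma norm_cvg_nb (Xn : nat -> Omega -> \bar R) X (xn : nat -> Omega -> R) x :
  (forall n, measurable_fun setT (Xn n)) -> measurable_fun setT X ->
  (forall n, L1 (xn n)) -> L1 x -> (forall n, ver (Xn n) (xn n)) -> ver X x ->
  norm_cvg sl sh Xn X <-> nbcvg xn x.
Proof.
move=> mXn mX hxn hx Xxn Xx.
have H n eps := @Ehat_nb (fun w => Xn n w - X w)%E (fun w => xn n w - x w) eps
  (emeasurable_funB (mXn n) mX)
  (measurable_funB (L1_measurable h0 hs (hxn n)) (L1_measurable h0 hs hx)) (verB (Xxn n) Xx).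
split=> [/norm_cvgP h eps e0|h].
  by have [N hN] := h eps e0; exists N => n /hN /H.
by apply/norm_cvgP => eps e0; have [N hN] := h eps e0; exists N => n /hN /H.
Qed.

Lemma norm_cvg_ver (Xn : nat -> Omega -> \bar R) X (xn : nat -> Omega -> R) :
  (forall n, measurable_fun setT (Xn n)) -> measurable_fun setT X ->
  (forall n, L1 (xn n)) -> (forall n, ver (Xn n) (xn n)) ->
  norm_cvg sl sh Xn X -> exists2 x, L1 x & ver X x.
Proof.
move=> mXn mX hxn Xxn /norm_cvgP/(_ _ ltr01)[N /(_ N (leqnn _)) hN].
pose x := fine \o X.
have mx : measurable_fun setT x.
  by apply: measurableT_comp mX => //; exact: fine_measurable.
have mD : measurable_fun setT (fun w => Xn N w - X w)%E by exact: emeasurable_funB.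
have Xx : ver X x.
  have h : qs [set w | X w \is a fin_num].
    apply: qs_meas; first by rewrite -[X in measurable X]setTI; exact: emeasurable_fin_num.
    move=> P PP_P; have : P.-integrable setT (fun w => Xn N w - X w)%E.
      apply/integrableP; split => //; apply: (@le_lt_trans _ _ 1%:E); last by rewrite ltry.
      by apply: le_trans hN; apply: ereal_sup_ubound; exists P.
    move=> /(integrable_ae measurableT) h1; have h2 := qs_ae (Xxn N) PP_P.
    apply: filterS2 h1 h2 => w /= /(_ I) + e; rewrite e.
    by case: (X w).
  by apply: qs_sub h => w /= Xf; rewrite /x/= fineK.
exists x => //.
have h : nb (fun w => xn N w - x w) 1.
  apply/(Ehat_nb _ mD _ (verB (Xxn N) Xx)) => //.
  by apply: measurable_funB => //; exact: L1_measurable (hxn N).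
have [K hK] := hxn N; exists (K + 1); have := nbB h0 hs hK h.
congr nb; apply/funext => w; by rewrite opprB addrC subrK.
Qed.

Lemma nbcvg_uniq (xn : nat -> Omega -> R) x y : (forall n, L1 (xn n)) -> L1 x -> L1 y ->
  nbcvg xn x -> nbcvg xn y -> qs [set w | x w = y w].
Proof.
move=> hxn hx hy cx cy; apply: nb0_eq; [exact: L1_measurable hx|exact: L1_measurable hy|].
move=> eps e0; have e2 : 0 < eps / 2 by rewrite divr_gt0.
have [N1 H1] := cx _ e2; have [N2 H2] := cy _ e2.
have k1 := H1 (maxn N1 N2) (leq_maxl _ _); have k2 := H2 (maxn N1 N2) (leq_maxr _ _).
by have := nb_tri (nbC h0 hs k1) k2; rewrite -splitr.
Qed.

(** The limit must be invariant at every path. So the increments are multiplied by the indicator of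
    the invariant set [S] where the whole sequence increases, and the limit is taken as an upper
    limit, quasi-surely finite by monotone convergence. *)
Lemma incr_lim T (un : nat -> Omega -> R) K : (forall n, L1 (un n)) -> (forall n, inv T (un n)) ->
  (forall n P, PP P -> {ae P, forall w, un n w <= un n.+1 w}) ->
  (forall n P, PP P -> \int[P]_w un n w <= K) ->
  exists u, [/\ L1 u, inv T u &
    qs [set w | (forall n, un n w <= un n.+1 w) /\ un n w @[n --> \oo] --> (u w : R)]].
Proof.
move=> hun iun incu boundu.
have mun n : measurable_fun setT (un n) by exact: L1_measurable (hun n).
pose S := [set w | forall n, un n w <= un n.+1 w].
have mS : measurable S.
  rewrite (_ : S = \bigcap_n [set w | un n w <= un n.+1 w]); last first.
    by apply/seteqP; split => w h n; [move=> _; exact: h|exact: (h n I)].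
  apply: bigcapT_measurable => n.
  rewrite (_ : [set w | _] = (fun w => un n.+1 w - un n w) @^-1` `[0, +oo[).
    by apply: measurable_cpre => //; exact: measurable_funB.
  by apply/seteqP; split => w /=; rewrite in_itv/= andbT subr_ge0.
have iS w : (stp T w \in S) = (w \in S).
  by apply/idP/idP; rewrite !inE /S /= => h n; have := h n; rewrite !iun.
pose v n w : R := \1_S w * (un n w - un 0%N w).
have mv n : measurable_fun setT (v n).
  by apply: measurable_funM; [exact: measurable_indic|exact: measurable_funB].
have vmono w : {homo (fun n => v n w) : i j / (i <= j)%N >-> i <= j}.
  apply: homo_leq => [//|a b c|n]; first exact: le_trans.
  rewrite /v indicE; case: (boolP (w \in S)) => [|_]; last by rewrite !mul0r.
  by rewrite inE => /(_ n) h; rewrite !mul1r lerD2r.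
have v0 n w : 0 <= v n w.
  by apply: le_trans (vmono w _ _ (leq0n n)); rewrite /v subrr mulr0.
pose G w : \bar R := limn_esup (fun n => (v n w)%:E).
have Gcvg w : (v n w)%:E @[n --> \oo] --> G w.
  have h : cvgn (fun n => (v n w)%:E).
    by apply: ereal_nondecreasing_is_cvgn => i j ij; rewrite lee_fin; exact: vmono.
  by rewrite /G is_cvg_limn_esupE.
have mG : measurable_fun setT G.
  by apply: measurable_fun_limn_esup => n; exact/measurable_EFinP.
have G0 w : (0 <= G w)%E.
  rewrite -(cvg_lim (@ereal_hausdorff R) (Gcvg w)); apply: lime_ge; first exact: cvgP (Gcvg w).
  by apply: nearW => n; rewrite lee_fin.
have [K0 hK0] := hun 0%N.
have intG P : PP P -> (\int[P]_w G w <= (K + K0)%:E)%E.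
  move=> PP_P; have c : (\int[P]_w (v n w)%:E)%E @[n --> \oo] --> (\int[P]_w limn (fun n => (v n w)%:E))%E.
    apply: cvg_monotone_convergence => //.
    - by move=> n; exact/measurable_EFinP.
    - by move=> n w _; rewrite lee_fin.
    - by move=> w _ i j ij; rewrite lee_fin; exact: vmono.
  rewrite (eq_integral (fun w => limn (fun n => (v n w)%:E))); last first.
    by move=> w _; apply/esym/cvg_lim => //; exact: Gcvg.
  rewrite -(cvg_lim (@ereal_hausdorff R) c); apply: lime_le; first exact: cvgP c.
  apply: nearW => n.
  have i0 := L1_ig (hun 0%N) PP_P; have in' := L1_ig (hun n) PP_P.
  have [iv e] := int_indic mS (igB in' i0).
  have -> : (\int[P]_w (v n w)%:E = (\int[P]_w v n w)%:E)%E.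
    by rewrite /Rintegral fineK//; exact: integrable_fin_num.
  rewrite lee_fin; apply: (@le_trans _ _ (\int[P]_w (un n w - un 0%N w))).
    apply: int_ae_le => //; first exact: igB.
    have := qs_ae (qs_all (S := fun n => [set w | un n w <= un n.+1 w]) _) PP_P.
    move=> h; apply: filterS (h _).
      by move=> w /= Sw; rewrite /v indicE mem_set ?mul1r.
    move=> k; apply: qs_measurable_le => // P' PP_P'; exact: incu.
  rewrite intB//; apply: lerD; first exact: boundu.
  have [_] := hK0 P PP_P; apply: le_trans.
  by apply: le_trans (int_abs_le measurableT i0); rewrite -normrN ler_norm.
pose g := fine \o G.
have mg : measurable_fun setT g.
  by apply: measurableT_comp mG => //; exact: fine_measurable.
have Lg : L1 g.
  exists (K + K0) => P PP_P.
  have le_gG : (\int[P]_w `|g w|%:E <= (K + K0)%:E)%E.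
    apply: le_trans (intG P PP_P); apply: ge0_le_integral => //.
    - by apply/measurable_EFinP; exact: measurableT_comp.
    - by move=> w _; rewrite /g /=; have := G0 w; case: (G w) => [r| |]//=;
        rewrite ?lee_fin ?normr0// => r0; rewrite ger0_norm.
  have ig_g : ig P g.
    apply/integrableP; split; first exact/measurable_EFinP.
    by apply: (le_lt_trans le_gG); rewrite ltry.
  split => //; rewrite -lee_fin /Rintegral fineK//.
  by apply: integrable_fin_num => //; exact: (ig_abs ig_g).
exists (fun w => un 0%N w + g w); split.
- exact: L1D.
- by move=> w; rewrite iun /g /= /G; congr (_ + fine (limn_esup _)); apply/funext => n;
    rewrite /v !indicE iS !iun.
have h1 : qs S.
  apply: qs_sub (qs_all (S := fun n => [set w | un n w <= un n.+1 w]) _); first by [].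
  by move=> k; apply: qs_measurable_le => // P' PP_P'; exact: incu.
have h2 : qs [set w | G w \is a fin_num].
  apply: qs_meas; first by rewrite -[X in measurable X]setTI; exact: emeasurable_fin_num.
  move=> P PP_P; have iG : P.-integrable setT G.
    apply/integrableP; split => //; rewrite (eq_integral G); last by move=> w _; rewrite gee0_abs.
    by apply: (le_lt_trans (intG P PP_P)); rewrite ltry.
  by apply: filterS (integrable_ae measurableT iG) => w /(_ I).
apply: qs_sub (qs_and h1 h2) => w [Sw /= Gf]; split => //.
have c1 : v n w @[n --> \oo] --> g w.
  by have := Gcvg w; rewrite -(fineK Gf) => /fine_cvg.
have c2 : (un 0%N w + v n w) @[n --> \oo] --> un 0%N w + g w by apply: cvgD => //; exact: cvg_cst.
rewrite (_ : (fun n => un n w) = (fun n => un 0%N w + v n w))//.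
by apply/funext => n; rewrite /v indicE mem_set// mul1r addrC subrK.
Qed.

(** Along a subsequence with distances below 2^(-k) the increments are absolutely summable, and
    their sum G dominates. The upper limit again keeps exact invariance. *)
Lemma complete T (yn : nat -> Omega -> R) : (forall n, L1 (yn n)) -> (forall n, inv T (yn n)) ->
  (forall eps, 0 < eps -> exists N, forall m n, (N <= m)%N -> (N <= n)%N ->
     nb (fun w => yn m w - yn n w) eps) ->
  exists y, [/\ L1 y, inv T y & nbcvg yn y].
Proof.
move=> hyn iyn cauchy.
have p2 k : 0 < 2 ^- k :> R by rewrite invr_gt0 exprn_gt0.
have /choice[N0 hN0] : forall k, exists N, forall m n, (N <= m)%N -> (N <= n)%N ->
    nb (fun w => yn m w - yn n w) (2 ^- k) by move=> k; exact: cauchy.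
(* The running maximum makes the indices nondecreasing in k. *)
pose N k := \max_(j < k.+1) N0 j.
have N_ge k : (N0 k <= N k)%N by rewrite /N; exact: (leq_bigmax (@ord_max k)).
have N_mono k : (N k <= N k.+1)%N by rewrite /N [X in (_ <= X)%N]big_ord_recr /= leq_maxl.
have N_homo : {homo N : i j / (i <= j)%N >-> (i <= j)%N}.
  by apply: homo_leq => //; exact: leq_trans.
pose u k := yn (N k).
have hu k : L1 (u k) by exact: hyn.
have mu k : measurable_fun setT (u k) by exact: L1_measurable (hu k).
have udist k m : (k <= m)%N -> nb (fun w => u m w - u k w) (2 ^- k).
  move=> km; apply: hN0; last exact: N_ge.
  exact: leq_trans (N_ge k) (N_homo _ _ km).
pose g k w := \sum_(0 <= j < k) `|u j.+1 w - u j w|.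
have Labs j : L1 (fun w => `|u j.+1 w - u j w|).
  have h := L1B h0 hs (hu j.+1) (hu j); apply: (L1_le h0 hs _ h).
    by apply: measurableT_comp => //; exact: measurable_funB.
  by move=> w; rewrite normr_id.
have gS k : g k.+1 = fun w => g k w + `|u k.+1 w - u k w|.
  by apply/funext => w; rewrite /g big_nat_recr.
have Lg k : L1 (g k).
  elim: k => [|k IH]; last by rewrite gS; exact: L1D.
  by rewrite (_ : g 0%N = fun=> 0); [exact/L1_cyl/is_cyl_cst|apply/funext => w; rewrite /g big_nil].
have gbound k P : PP P -> \int[P]_w g k w <= 2.
  move=> PP_P; apply: (@le_trans _ _ (2 - 2 ^- k * 2)); last by rewrite gerBl mulr_ge0// ltW.
  elim: k => [|k IH].
    by rewrite (_ : g 0%N = fun=> 0) ?int_cst ?expr0 ?invr1 ?mul1r ?subrr//; apply/funext => w; rewrite /g big_nil.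
  rewrite gS intD//; [|exact: L1_ig|exact: L1_ig].
  have [_ h] := udist k k.+1 (leqnSn k) P PP_P.
  have e : 2 ^- k = 2 ^- k.+1 * 2 :> R by rewrite exprS; field; rewrite expf_neq0.
  have aux (a b c d : R) : a <= 2 - c * 2 -> b <= c -> c = d * 2 -> a + b <= 2 - d * 2 by lra.
  exact: aux IH h e.
have ginv k : inv T (g k).
  by move=> w; rewrite /g; apply: eq_bigr => j _; rewrite /u !iyn.
have [G [LG iG hG]] : exists G, [/\ L1 G, inv T G &
    qs [set w | (forall n, g n w <= g n.+1 w) /\ g n w @[n --> \oo] --> (G w : R)]].
  apply: (@incr_lim T g 2) => // n P _; apply: aeW => w; rewrite gS lerDl.
  exact: normr_ge0.
pose y w := fine (limn_esup (fun n => (u n w)%:E)).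
have my : measurable_fun setT y.
  apply: (@measurableT_comp _ _ _ _ _ _ fine); first exact: fine_measurable.
  by apply: measurable_fun_limn_esup => n; exact/measurable_EFinP.
have ucvg w : g n w @[n --> \oo] --> (G w : R) -> u n w @[n --> \oo] --> (y w : R).
  move=> gG; have : cvgn (series (fun j => u j.+1 w - u j w)).
    by apply: normed_cvg; exact: (cvgP (G w)).
  rewrite (_ : series _ = fun n => u n w - u 0%N w); last first.
    by apply/funext => n; rewrite /series/= telescope_sumr.
  move=> /cvg_ex[l hl]; have h : u n w @[n --> \oo] --> l + u 0%N w.
    have : (u n w - u 0%N w + u 0%N w) @[n --> \oo] --> l + u 0%N w.
      by apply: cvgD => //; exact: cvg_cst.
    by rewrite (_ : (fun n => _) = (fun n => u n w))//; apply/funext => n; rewrite subrK.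
  suff -> : y w = l + u 0%N w by [].
  have h' : (u n w)%:E @[n --> \oo] --> (l + u 0%N w)%:E.
    by apply/fine_cvgP; split => //; exact: nearW.
  by rewrite /y (cvg_limn_einf_sup h').2.
have ubound n w : (forall n, g n w <= g n.+1 w) -> g n w @[n --> \oo] --> (G w : R) ->
    `|u n w - u 0%N w| <= G w.
  move=> gm gG; have gm' : {homo (fun n => g n w) : i j / (i <= j)%N >-> i <= j}.
    by apply: homo_leq => //; exact: le_trans.
  apply: (@le_trans _ _ (g n w)); last first.
    by apply: (ler_cvg_to (cvg_cst (g n w)) gG); exists n => // k /= nk; exact: gm'.
  by rewrite -(@telescope_sumr _ 0%N n (fun j => u j w))//; exact: ler_norm_sum.
have key k P : PP P -> ig P y /\ \int[P]_w `|u k w - y w| <= 2 ^- k.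
  move=> PP_P; have aeG := qs_ae hG PP_P.
  have iu j := L1_ig (hu j) PP_P; have iG' := L1_ig LG PP_P.
  have [iy _] : ig P y /\ (\int[P]_(w in setT) u n w) @[n --> \oo] --> \int[P]_(w in setT) y w.
    apply: (@dct _ _ _ P setT u y (fun w => `|u 0%N w| + G w)) => //.
    - by apply: igD => //; exact: ig_abs.
    - by apply: filterS aeG => w [_ /ucvg].
    apply: filterS aeG => w [gm gG] n; rewrite -[X in `|X|](subrK (u 0%N w)) addrC.
    by apply: (le_trans (ler_normD _ _)); rewrite lerD2l; exact: ubound.
  split => //.
  have [_ c] : ig P (fun w => `|u k w - y w|) /\ (\int[P]_(w in setT) `|u k w - u n w|) @[n --> \oo] -->
      \int[P]_(w in setT) `|u k w - y w|.
    apply: (@dct _ _ _ P setT (fun n w => `|u k w - u n w|) _ (fun w => G w + G w)) => //.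
    - by move=> n; apply: measurableT_comp => //; exact: measurable_funB.
    - by apply: measurableT_comp => //; exact: measurable_funB.
    - exact: igD.
    - apply: filterS aeG => w [_ /ucvg c]; apply: cvg_norm; apply: cvgB => //; exact: cvg_cst.
    apply: filterS aeG => w [gm gG] n; rewrite normr_id.
    have -> : u k w - u n w = (u k w - u 0%N w) - (u n w - u 0%N w) by ring.
    by apply: (le_trans (ler_normB _ _)); apply: lerD; exact: ubound.
  have c2 : (2 ^- k : R) @[n --> \oo] --> (2 ^- k : R) by exact: cvg_cst.
  apply: (ler_cvg_to c c2); exists k => // n /= kn.
  by have [_] := nbC h0 hs (udist k n kn) PP_P.
exists y; split.
- have [K hK] := hu 0%N; exists (K + 2 ^- 0) => P PP_P.
  have : nb (fun w => u 0%N w - y w) (2 ^- 0).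
    by move=> P' PP_P'; have [iy h] := key 0%N P' PP_P'; split => //; apply: igB => //; exact: L1_ig (hu 0%N) PP_P'.
  move=> h; have e : (fun w => u 0%N w - (u 0%N w - y w)) = y.
    by apply/funext => w; rewrite opprB addrC subrK.
  by have := nbB h0 hs hK h; rewrite e => /(_ P PP_P).
- by move=> w; rewrite /y; congr (fine (limn_esup _)); apply/funext => n; rewrite /u iyn.
move=> eps e0; have [k hk] : exists k, 2 ^- k <= eps / 2 :> R.
  exists (Num.truncn (eps / 2)^-1).+1; rewrite -[leRHS]invrK lef_pV2 ?posrE ?exprn_gt0 ?invr_gt0 ?divr_gt0//.
  apply: (le_trans (ltW (truncnS_gt _))); rewrite -natrX ler_nat; exact/ltnW/ltn_expl.
exists (N k) => n Nn.
have k1 : nb (fun w => yn n w - u k w) (eps / 2).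
  apply: nb_leK hk; apply: hN0; last exact: N_ge.
  exact: leq_trans (N_ge k) Nn.
have k2 : nb (fun w => u k w - y w) (eps / 2).
  move=> P PP_P; have [iy h] := key k P PP_P; split; last exact: le_trans hk.
  by apply: igB => //; exact: L1_ig (hu k) PP_P.
by have := nb_tri k1 k2; rewrite -splitr.
Qed.

End quasi_sure.

(** * The extended conditional expectation *)

Section extended_conditional_expectation.
Context (R : realType) (sl sh : R).
Hypotheses (h0 : 0 <= sl) (hs : sl <= sh).
Local Notation Omega := (Omega R).
Local Notation Prob := (probability Omega R).
Local Notation PP := (PP sl sh).
Local Notation QQ := (QQ sl sh).
Local Notation qs := (qs sl sh).
Local Notation qs_eq := (qs_eq sl sh).
Local Notation qs_le := (qs_le sl sh).
Local Notation qs_incr := (qs_incr sl sh).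
Local Notation qs_decr := (qs_decr sl sh).
Local Notation Ehat := (Ehat sl sh).
Local Notation norm_cvg := (norm_cvg sl sh).
Local Notation nb := (nb sl sh).
Local Notation L1 := (L1 sl sh).
Local Notation ver := (ver sl sh).
Local Notation ce := (ce sl sh).
Local Notation nbcvg := (nbcvg sl sh).
Local Notation LG1 := (LG1 sl sh).
Local Notation LG1s := (LG1s sl sh).
Local Notation LG1ss := (LG1ss sl sh).
Local Notation LGbar := (LGbar sl sh).
Local Notation Eop := (Eop sl sh).
Implicit Types (x y z : Omega -> R) (w : Omega) (s t K : R) (P : Prob) (A S : set Omega)
  (X Y Z : Omega -> \bar R) (T : \bar R).

Definition cyl_approx T x := forall eps, 0 < eps ->
  exists z, [/\ is_cyl z, inv T z & nb (fun w => x w - z w) eps].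

(* The classes [lg], [lgs] and, below, [lgd] consist of the real-valued [Omega_T]-measurable
   versions of the elements of [LG1 T], [LG1s T] and [LGs1 T]. *)
Definition lg T x := [/\ L1 x, inv T x & cyl_approx T x].

Lemma cylT_inv T x : (0 <= T)%E -> cylT T x <-> is_cyl x /\ inv T x.
Proof.
case: T => [t| |]//=.
  rewrite lee_fin => t0; split=> [cx|[cx ix]].
    by split; [exact: cylT_cyl cx|apply/past_stop; exact: cylT_past cx].
  have <- : Eop t x = x by apply: Eop_past => //; exact/past_stop.
  exact: cylT_Eop.
by move=> _; split=> [/cylT_cyl//|[/is_cylT]].
Qed.

Lemma LG1P T X : (0 <= T)%E -> LG1 T X <->
  measurable_fun setT X /\ exists2 x, lg T x & ver X x.
Proof.
move=> T0; split.
  move=> [/(LL1P h0 hs)[mX [x [hx ix Xx]]] [Xn LXn cX]]; split => //; exists x => //.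
  have cyln n : is_cyl (Xn n) /\ inv T (Xn n) by apply/cylT_inv => //; exact/LipP.
  have /(norm_cvg_nb h0 hs) h := cX.
  have {}h : nbcvg Xn x.
    apply: h => //; first by move=> n; apply/measurable_EFinP; apply: is_cyl_measurable; case: (cyln n).
    - by move=> n; apply: L1_cyl => //; case: (cyln n).
    - by move=> n; exact: ver_refl.
  split => // eps e0; have [N hN] := h eps e0; exists (Xn N).
  by have [c i] := cyln N; split => //; apply: nbC => //; exact: hN.
move=> [mX [x [hx ix cx] Xx]]; split.
  by apply/LL1P => //; split => //; exists x.
have /choice[z hz] : forall n : nat, exists z, [/\ is_cyl z, inv T z & nb (fun w => x w - z w) n.+1%:R^-1].
  by move=> n; apply: cx; rewrite invr_gt0.
exists z; first by move=> n; apply/LipP => //; apply/cylT_inv => //; have [] := hz n.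
apply/(norm_cvg_nb h0 hs (xn := z) (x := x)) => //.
- by move=> n; apply/measurable_EFinP; apply: is_cyl_measurable; case: (hz n).
- by move=> n; apply: L1_cyl => //; case: (hz n).
- by move=> n; exact: ver_refl.
move=> eps e0; exists (Num.truncn eps^-1).+1 => n Nn; have [_ _ h] := hz n.
apply: nbC => //; apply: nb_leK h _; rewrite -[leRHS]invrK lef_pV2 ?posrE ?invr_gt0//.
apply: (le_trans (ltW (truncnS_gt _))); rewrite ler_nat; exact: leqW.
Qed.

Lemma nbcvg_cauchy (xn : nat -> Omega -> R) x : nbcvg xn x -> forall eps, 0 < eps ->
  exists N, forall m n, (N <= m)%N -> (N <= n)%N -> nb (fun w => xn m w - xn n w) eps.
Proof.
move=> h eps e0; have e2 : 0 < eps / 2 by rewrite divr_gt0.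
have [N hN] := h _ e2; exists N => m n Nm Nn.
by have := nb_tri (hN m Nm) (nbC h0 hs (hN n Nn)); rewrite -splitr.
Qed.

(** The description that each stage of the extension satisfies and that determines Y
    quasi-surely. *)
Definition CE t X Y := exists x y, [/\ ver X x, ver Y y & ce t x y].

Lemma CE_mono t X Y X' Y' : 0 <= t -> CE t X Y -> CE t X' Y' -> qs_le X X' -> qs_le Y Y'.
Proof.
move=> t0 [x [y [Xx Yy c]]] [x' [y' [Xx' Yy' c']]] XX'.
have xx' : qs [set w | x w <= x' w].
  by apply: (qs_sub h0 hs) (qs_and h0 hs XX' (qs_and h0 hs Xx Xx')) => w [/= h [e1 e2]]; move: h; rewrite e1 e2 lee_fin.
have yy' : qs [set w | y w <= y' w].
  have [_ hy _ _] := c; have [_ hy' _ _] := c'.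
  apply: (qs_measurable_le h0 hs); [exact: L1_measurable hy|exact: L1_measurable hy'|].
  by apply: (ce_mono h0 hs t0 c c') => P PP_P; exact: qs_ae xx' PP_P.
by apply: (qs_sub h0 hs) (qs_and h0 hs yy' (qs_and h0 hs Yy Yy')) => w [/= h [e1 e2]]; rewrite e1 e2 lee_fin.
Qed.

Lemma qs_le_anti X Y : qs_le X Y -> qs_le Y X -> qs_eq X Y.
Proof.
move=> h1 h2; apply: (qs_sub h0 hs) (qs_and h0 hs h1 h2) => w [/= a b].
by apply/eqP; rewrite eq_le a.
Qed.

Lemma qs_eq_le X Y : qs_eq X Y -> qs_le X Y.
Proof. by apply: (qs_sub h0 hs) => w /= ->. Qed.

Lemma qs_le_trans X Y Z : qs_le X Y -> qs_le Y Z -> qs_le X Z.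
Proof.
by move=> h1 h2; apply: (qs_sub h0 hs) (qs_and h0 hs h1 h2) => w [/= a]; exact: le_trans.
Qed.

Lemma CE_uniq t X Y X' Y' : 0 <= t -> CE t X Y -> CE t X' Y' -> qs_eq X X' -> qs_eq Y Y'.
Proof.
move=> t0 c c' XX'; apply: qs_le_anti.
  by apply: (CE_mono t0 c c'); exact: qs_eq_le.
by apply: (CE_mono t0 c' c); apply: qs_eq_le; exact: qs_eq_sym.
Qed.

Lemma qs_incr_ver (Xn : nat -> Omega -> \bar R) X (xn : nat -> Omega -> R) x :
  (forall n, ver (Xn n) (xn n)) -> ver X x ->
  qs_incr Xn X <-> qs [set w | (forall n, xn n w <= xn n.+1 w) /\ xn n w @[n --> \oo] --> (x w : R)].
Proof.
move=> hn hx; have h := qs_and h0 hs (qs_all h0 hs hn) hx.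
split=> H; apply: (qs_sub h0 hs) (qs_and h0 hs h H) => w [[/= en e] [k1 k2]]; split.
- by move=> n; have := k1 n; rewrite !en lee_fin.
- by move: k2; rewrite e (_ : Xn^~ w = EFin \o (xn^~ w)) => [/fine_cvg//|]; apply/funext => n; rewrite en.
- by move=> n; rewrite !en lee_fin.
- rewrite e (_ : Xn^~ w = EFin \o (xn^~ w)); last by apply/funext => n; rewrite en.
  by apply/fine_cvgP; split => //; exact: nearW.
Qed.

Lemma qs_decr_ver (Xn : nat -> Omega -> \bar R) X (xn : nat -> Omega -> R) x :
  (forall n, ver (Xn n) (xn n)) -> ver X x ->
  qs_decr Xn X <-> qs [set w | (forall n, xn n.+1 w <= xn n w) /\ xn n w @[n --> \oo] --> (x w : R)].
Proof.
move=> hn hx; have h := qs_and h0 hs (qs_all h0 hs hn) hx.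
split=> H; apply: (qs_sub h0 hs) (qs_and h0 hs h H) => w [[/= en e] [k1 k2]]; split.
- by move=> n; have := k1 n; rewrite !en lee_fin.
- by move: k2; rewrite e (_ : Xn^~ w = EFin \o (xn^~ w)) => [/fine_cvg//|]; apply/funext => n; rewrite en.
- by move=> n; rewrite !en lee_fin.
- rewrite e (_ : Xn^~ w = EFin \o (xn^~ w)); last by apply/funext => n; rewrite en.
  by apply/fine_cvgP; split => //; exact: nearW.
Qed.

(** The y_n increase by monotonicity; their integrals stay bounded since each is attained up to 1 by
    an integral of x_n <= x. *)
Lemma ce_incr_exists t (xn yn : nat -> Omega -> R) x : 0 <= t ->
  (forall n, ce t (xn n) (yn n)) -> L1 x ->
  qs [set w | (forall n, xn n w <= xn n.+1 w) /\ xn n w @[n --> \oo] --> (x w : R)] ->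
  exists2 y, ce t x y &
  qs [set w | (forall n, yn n w <= yn n.+1 w) /\ yn n w @[n --> \oo] --> (y w : R)].
Proof.
move=> t0 hc hx xx.
have axx : ae_incr sl sh xn x by move=> P PP_P; exact: (qs_ae h0 hs xx PP_P).
have ync n P : PP P -> {ae P, forall w, yn n w <= yn n.+1 w}.
  apply: (ce_mono h0 hs t0 (hc n) (hc n.+1)) => P' PP_P'.
  by apply: filterS (axx P' PP_P') => w [].
have [K hK] := hx.
have bnd n P : PP P -> \int[P]_w yn n w <= K + 1.
  move=> PP_P; have [hxn hyn _ /(_ P PP_P)[_ /(_ 1 ltr01)[Q hQ]]] := hc n.
  move=> /le_trans; apply; rewrite lerD2r; have PP_Q := QQ_PP h0 hs t0 PP_P hQ.
  apply: (@le_trans _ _ (\int[Q]_w x w)).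
    apply: int_ae_le => //; [exact: L1_ig hxn PP_Q|exact: L1_ig hx PP_Q|exact: (ae_incr_le n axx PP_Q)].
  have [ix] := hK Q PP_Q; apply: le_trans.
  exact: le_trans (ler_norm _) (int_abs_le measurableT ix).
have [y [hy iy yy]] := @incr_lim _ _ _ h0 hs t%:E yn (K + 1)
  (fun n => let: And4 _ h _ _ := hc n in h) (fun n => let: And4 _ _ h _ := hc n in h) ync bnd.
exists y => //; apply: (ce_incr_lim h0 hs t0 hc hx hy iy axx).
by move=> P PP_P; exact: (qs_ae h0 hs yy PP_P).
Qed.

(** P itself is an admissible law, so the integrals of y_n are bounded below by that of x; negation
    leads back to an increasing sequence. *)
Lemma ce_decr_exists t (xn yn : nat -> Omega -> R) x : 0 <= t ->
  (forall n, ce t (xn n) (yn n)) -> (forall n, cyl_approx +oo (xn n)) -> L1 x ->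
  qs [set w | (forall n, xn n.+1 w <= xn n w) /\ xn n w @[n --> \oo] --> (x w : R)] ->
  exists2 y, ce t x y &
  qs [set w | (forall n, yn n.+1 w <= yn n w) /\ yn n w @[n --> \oo] --> (y w : R)].
Proof.
move=> t0 hc hcyl hx xx.
have axx : ae_decr sl sh xn x by move=> P PP_P; exact: (qs_ae h0 hs xx PP_P).
have hyn n : L1 (yn n) by case: (hc n).
have ync n P : PP P -> {ae P, forall w, - yn n w <= - yn n.+1 w}.
  move=> PP_P; have := ce_mono h0 hs t0 (hc n.+1) (hc n) _ PP_P; move=> h.
  apply: filterS (h _) => [w|P' PP_P']; first by rewrite lerN2.
  by apply: filterS (axx P' PP_P') => w [].
have [K hK] := hx.
have bnd n P : PP P -> \int[P]_w (- yn n w) <= K.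
  move=> PP_P; have [hxn _ ay /(_ P PP_P)[h _]] := hc n.
  have FT : Filt t%:E [set: Omega] by apply/Filt_stop; split => //; rewrite preimage_setT.
  have h1 := h P setT (QQ_refl h0 hs t0 PP_P) FT.
  have h2 : \int[P]_w x w <= \int[P]_w xn n w.
    by apply: int_ae_le => //; [exact: L1_ig hx PP_P|exact: L1_ig hxn PP_P|exact: (ae_decr_ge n axx PP_P)].
  have [ix hx'] := hK P PP_P.
  have h3 : - (\int[P]_w x w) <= K.
    have aux (a b : R) : `|a| <= b -> - a <= b.
      by move=> hab; apply: le_trans hab; rewrite -normrN ler_norm.
    exact: aux (le_trans (int_abs_le measurableT ix) hx').
  have -> : \int[P]_w (- yn n w) = - (\int[P]_w yn n w).
    rewrite -mulN1r -intZ//; last exact: L1_ig (hyn n) PP_P.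
    by apply: eq_Rintegral => w _; rewrite mulN1r.
  by apply: le_trans h3; rewrite lerN2; exact: le_trans h1.
have iN n : inv t%:E (fun w => - yn n w).
  by move=> w /=; have [_ _ a _] := hc n; rewrite a.
have [y [hy iy yy]] := @incr_lim _ _ _ h0 hs t%:E (fun n w => - yn n w) K
  (fun n => L1N h0 hs (hyn n)) iN ync bnd.
have yy' : qs [set w | (forall n, yn n.+1 w <= yn n w) /\ yn n w @[n --> \oo] --> (- y w : R)].
  apply: (qs_sub h0 hs) yy => w [k1 k2]; split; first by move=> n; rewrite -lerN2.
  rewrite (_ : (fun n => yn n w) = (fun n => - - yn n w)); first exact: cvgN k2.
  by apply/funext => n; rewrite opprK.
exists (fun w => - y w) => //.
apply: (ce_decr_lim h0 hs t0 hc _ hx (L1N h0 hs hy) _ axx).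
- by move=> n eps e0; have [z [cz _ hz]] := hcyl n eps e0; exists z.
- by move=> w; rewrite iy.
by move=> P PP_P; exact: (qs_ae h0 hs yy' PP_P).
Qed.

Lemma ce_norm_exists t (xn yn : nat -> Omega -> R) x : 0 <= t ->
  (forall n, ce t (xn n) (yn n)) -> L1 x -> nbcvg xn x ->
  exists2 y, ce t x y & nbcvg yn y.
Proof.
move=> t0 hc hx xx.
have [|y [hy iy yy]] := @complete _ _ _ h0 hs t%:E yn
  (fun n => let: And4 _ h _ _ := hc n in h) (fun n => let: And4 _ _ h _ := hc n in h).
  move=> eps e0; have e2 : 0 < eps / 2 by rewrite divr_gt0.
  have [N hN] := nbcvg_cauchy xx e2; exists N => m n Nm Nn.
  have := ce_contract h0 hs t0 (hc m) (hc n) (hN m n Nm Nn).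
  by rewrite mulrC divfK.
exists y => //; apply: (ce_norm_lim h0 hs) => // eps e0.
have [N1 H1] := xx eps e0; have [N2 H2] := yy eps e0.
exists (xn (maxn N1 N2)), (yn (maxn N1 N2)); split => //; apply: nbC => //.
  by apply: H1; exact: leq_maxl.
by apply: H2; exact: leq_maxr.
Qed.

(** Conditioning maps cylinder functions to cylinder functions known at t and contracts up to a
    constant, so the class of L_G^1 is stable, as the backward recursion requires. *)
Lemma lg_ce t x : 0 <= t -> L1 x -> cyl_approx +oo x -> exists2 y, ce t x y & lg t%:E y.
Proof.
move=> t0 hx cx.
have /choice[z hz] : forall n : nat, exists z, [/\ is_cyl z, inv +oo z & nb (fun w => x w - z w) n.+1%:R^-1].
  by move=> n; apply: cx; rewrite invr_gt0.
have cz n : is_cyl (z n) by case: (hz n).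
have zx : nbcvg z x.
  move=> eps e0; exists (Num.truncn eps^-1).+1 => n Nn; have [_ _ h] := hz n.
  apply: nbC => //; apply: nb_leK h _; rewrite -[leRHS]invrK lef_pV2 ?posrE ?invr_gt0//.
  apply: (le_trans (ltW (truncnS_gt _))); rewrite ler_nat; exact: leqW.
have [y hc yy] := ce_norm_exists t0 (fun n => ce_cyl h0 hs t0 (cz n)) hx zx.
exists y => //; have [_ hy ay _] := hc; split => // eps e0.
have [N hN] := yy eps e0; exists (Eop t (z N)); split.
- exact: Eop_is_cyl.
- by apply/past_stop; exact: past_Eop.
by apply: nbC => //; exact: hN.
Qed.

Lemma ver_exists (Xn : nat -> Omega -> \bar R) (Yn : nat -> Omega -> \bar R) t :
  (forall n, CE t (Xn n) (Yn n)) -> exists xn yn : nat -> Omega -> R,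
  [/\ forall n, ver (Xn n) (xn n), forall n, ver (Yn n) (yn n) & forall n, ce t (xn n) (yn n)].
Proof.
move=> h; have /choice[xn /choice[yn H]] : forall n, exists x, exists y, [/\ ver (Xn n) x, ver (Yn n) y & ce t x y].
  by move=> n; exact: h.
by exists xn, yn; split => n; have [] := H n.
Qed.

Lemma CE_norm_lim t (Xn Yn : nat -> Omega -> \bar R) X Y : 0 <= t ->
  (forall n, measurable_fun setT (Xn n)) -> (forall n, measurable_fun setT (Yn n)) ->
  measurable_fun setT X -> measurable_fun setT Y -> (forall n, CE t (Xn n) (Yn n)) ->
  norm_cvg Xn X -> norm_cvg Yn Y -> CE t X Y.
Proof.
move=> t0 mXn mYn mX mY /ver_exists[xn [yn [Xxn Yyn hc]]] cX cY.
have hxn n : L1 (xn n) by case: (hc n).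
have hyn n : L1 (yn n) by case: (hc n).
have [x hx Xx] := norm_cvg_ver h0 hs mXn mX hxn Xxn cX.
have [y' hy' Yy'] := norm_cvg_ver h0 hs mYn mY hyn Yyn cY.
have xx : nbcvg xn x by apply/(norm_cvg_nb h0 hs mXn mX hxn hx Xxn Xx).
have yy' : nbcvg yn y' by apply/(norm_cvg_nb h0 hs mYn mY hyn hy' Yyn Yy').
have [y hc' yy] := ce_norm_exists t0 hc hx xx.
exists x, y; split => //; have [_ hy _ _] := hc'.
have e := nbcvg_uniq h0 hs hyn hy' hy yy' yy.
by apply: (qs_sub h0 hs) (qs_and h0 hs Yy' e) => w [/= -> ->].
Qed.

Lemma CE_norm_exists t (Xn Yn : nat -> Omega -> \bar R) X : 0 <= t ->
  (forall n, measurable_fun setT (Xn n)) -> (forall n, measurable_fun setT (Yn n)) ->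
  measurable_fun setT X -> (forall n, CE t (Xn n) (Yn n)) -> norm_cvg Xn X ->
  exists2 Y, measurable_fun setT Y & norm_cvg Yn Y.
Proof.
move=> t0 mXn mYn mX /ver_exists[xn [yn [Xxn Yyn hc]]] cX.
have hxn n : L1 (xn n) by case: (hc n).
have hyn n : L1 (yn n) by case: (hc n).
have [x hx Xx] := norm_cvg_ver h0 hs mXn mX hxn Xxn cX.
have xx : nbcvg xn x by apply/(norm_cvg_nb h0 hs mXn mX hxn hx Xxn Xx).
have [y hc' yy] := ce_norm_exists t0 hc hx xx; have [_ hy _ _] := hc'.
have mY : measurable_fun setT (EFin \o y) by apply/measurable_EFinP; exact: L1_measurable hy.
exists (EFin \o y) => //; apply/(norm_cvg_nb h0 hs mYn mY hyn hy Yyn) => //.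
exact: ver_refl.
Qed.

Lemma LL1_ver T X : LL1 sl sh T X -> measurable_fun setT X /\ exists2 x, L1 x & ver X x.
Proof. by move=> /(LL1P h0 hs)[mX [x [hx _ Xx]]]; split => //; exists x. Qed.

Lemma condE_Lip_CE t (X Y : Omega -> R) : 0 <= t -> condE_Lip sl sh t X Y ->
  [/\ is_cyl X, is_cyl Y & CE t (EFin \o X) (EFin \o Y)].
Proof.
move=> t0 /(condE_Lip_Eop h0 hs)[cX ->]; split => //; first exact: Eop_is_cyl.
by exists X, (Eop t X); split; [exact: ver_refl|exact: ver_refl|exact: ce_cyl].
Qed.

Lemma condE_G1_CE t X Y : 0 <= t -> condE_G1 sl sh t X Y -> CE t X Y.
Proof.
move=> t0 [[/LL1_ver[mX _] _] mY [Xn [Yn [hc cX cY]]]].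
have H n := condE_Lip_CE t0 (hc n).
apply: (CE_norm_lim t0 _ _ mX mY _ cX cY).
- by move=> n; apply/measurable_EFinP; apply: is_cyl_measurable; case: (H n).
- by move=> n; apply/measurable_EFinP; apply: is_cyl_measurable; case: (H n).
by move=> n; case: (H n).
Qed.

Lemma condE_G1_exists t X : 0 <= t -> LG1 +oo X -> exists Y, condE_G1 sl sh t X Y.
Proof.
move=> t0 LX; have [/LL1_ver[mX _] [Xn LXn cX]] := LX.
have cXn n : is_cyl (Xn n) by have /(LipP _ le0y)/cylT_cyl := LXn n.
have hL n := condE_Lip_exists h0 hs t0 (cXn n).
have H n := condE_Lip_CE t0 (hL n).
have [|||Y mY cY] := @CE_norm_exists t (fun n => EFin \o Xn n) (fun n => EFin \o Eop t (Xn n)) X t0 _ _ mX _ cX.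
- by move=> n; apply/measurable_EFinP; exact: is_cyl_measurable.
- by move=> n; apply/measurable_EFinP; apply: is_cyl_measurable; exact: Eop_is_cyl.
- by move=> n; case: (H n).
by exists Y; split => //; exists Xn, (fun n => Eop t (Xn n)).
Qed.

Lemma CE_cyl_approx t (Xn Yn : nat -> Omega -> \bar R) (xn yn : nat -> Omega -> R) :
  (forall n, LG1 +oo (Xn n)) -> (forall n, ver (Xn n) (xn n)) -> (forall n, ce t (xn n) (yn n)) ->
  forall n, cyl_approx +oo (xn n).
Proof.
move=> LXn Xxn hc n eps e0; have /(LG1P _ le0y)[_ [x [hx _ /(_ _ e0)[z [cz iz hz]]] Xx]] := LXn n.
exists z; split => //; have hxn : L1 (xn n) by case: (hc n).
apply: (nb_ae_le h0 hs _ hz) => [|P PP_P].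
  by apply: measurable_funB; [exact: L1_measurable hxn|exact: is_cyl_measurable].
by apply: filterS (qs_ae h0 hs (ver_uniq h0 hs Xx (Xxn n)) PP_P) => w /= ->.
Qed.

(** The given Y and the limit built by [ce_decr_exists] are limits of the same sequence. *)
Lemma condE_G1s_CE t X Y : 0 <= t -> condE_G1s sl sh t X Y -> CE t X Y.
Proof.
move=> t0 [[/LL1_ver[_ [x hx Xx]] _] mY [Xn [Yn [hc cX cY]]]].
have [xn [yn [Xxn Yyn hc']]] := ver_exists (fun n => condE_G1_CE t0 (hc n)).
have apx := @CE_cyl_approx t Xn Yn xn yn (fun n => let: And3 h _ _ := hc n in h) Xxn hc'.
have /(qs_decr_ver Xxn Xx) xx := cX.
have [y c yy] := ce_decr_exists t0 hc' apx hx xx.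
exists x, y; split => //.
apply: (qs_sub h0 hs) (qs_and h0 hs (qs_all h0 hs Yyn) (qs_and h0 hs yy cY)) => w [/= en [[_ k1] [_ k2]]].
have k3 : Yn^~ w @ \oo --> (y w)%:E.
  rewrite (_ : Yn^~ w = EFin \o (yn^~ w)); last by apply/funext => n; rewrite en.
  by apply/fine_cvgP; split => //; exact: nearW.
exact: (cvg_unique (@ereal_hausdorff R) k2 k3).
Qed.

Lemma condE_G1s_exists t X : 0 <= t -> LG1s +oo X -> exists Y, condE_G1s sl sh t X Y.
Proof.
move=> t0 LX; have [/LL1_ver[_ [x hx Xx]] [Xn LXn cX]] := LX.
have /choice[Yn hc] : forall n, exists Y, condE_G1 sl sh t (Xn n) Y by move=> n; exact: condE_G1_exists.
have [xn [yn [Xxn Yyn hc']]] := ver_exists (fun n => condE_G1_CE t0 (hc n)).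
have apx := @CE_cyl_approx t Xn Yn xn yn (fun n => let: And3 h _ _ := hc n in h) Xxn hc'.
have /(qs_decr_ver Xxn Xx) xx := cX.
have [y c yy] := ce_decr_exists t0 hc' apx hx xx.
exists (EFin \o y); split => //.
  by apply/measurable_EFinP; have [_ hy _ _] := c; exact: L1_measurable hy.
by exists Xn, Yn; split => //; exact/(qs_decr_ver Yyn (ver_refl h0 hs y)).
Qed.

Lemma condE_G1ss_CE t X Y : 0 <= t -> condE_G1ss sl sh t X Y -> CE t X Y.
Proof.
move=> t0 [[/LL1_ver[_ [x hx Xx]] _] mY [Xn [Yn [hc cX cY]]]].
have [xn [yn [Xxn Yyn hc']]] := ver_exists (fun n => condE_G1s_CE t0 (hc n)).
have /(qs_incr_ver Xxn Xx) xx := cX.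
have [y c yy] := ce_incr_exists t0 hc' hx xx.
exists x, y; split => //.
apply: (qs_sub h0 hs) (qs_and h0 hs (qs_all h0 hs Yyn) (qs_and h0 hs yy cY)) => w [/= en [[_ k1] [_ k2]]].
have k3 : Yn^~ w @ \oo --> (y w)%:E.
  rewrite (_ : Yn^~ w = EFin \o (yn^~ w)); last by apply/funext => n; rewrite en.
  by apply/fine_cvgP; split => //; exact: nearW.
exact: (cvg_unique (@ereal_hausdorff R) k2 k3).
Qed.

Lemma condE_G1ss_exists t X : 0 <= t -> LG1ss +oo X -> exists Y, condE_G1ss sl sh t X Y.
Proof.
move=> t0 LX; have [/LL1_ver[_ [x hx Xx]] [Xn LXn cX]] := LX.
have /choice[Yn hc] : forall n, exists Y, condE_G1s sl sh t (Xn n) Y by move=> n; exact: condE_G1s_exists.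
have [xn [yn [Xxn Yyn hc']]] := ver_exists (fun n => condE_G1s_CE t0 (hc n)).
have /(qs_incr_ver Xxn Xx) xx := cX.
have [y c yy] := ce_incr_exists t0 hc' hx xx.
exists (EFin \o y); split => //.
  by apply/measurable_EFinP; have [_ hy _ _] := c; exact: L1_measurable hy.
by exists Xn, Yn; split => //; exact/(qs_incr_ver Yyn (ver_refl h0 hs y)).
Qed.

Lemma is_condE_CE t X Y : 0 <= t -> is_condE sl sh t X Y -> CE t X Y.
Proof.
move=> t0 [[/LL1_ver[mX _] _] mY [Xn [Yn [hc cX cY]]]].
apply: (CE_norm_lim t0 _ _ mX mY _ cX cY).
- by move=> n; have [[/LL1_ver[]]] := hc n.
- by move=> n; have [] := hc n.
by move=> n; exact: condE_G1ss_CE (hc n).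
Qed.

Lemma is_condE_exists t X : 0 <= t -> LGbar +oo X -> exists Y, is_condE sl sh t X Y.
Proof.
move=> t0 LX; have [/LL1_ver[mX _] [Xn LXn cX]] := LX.
have /choice[Yn hc] : forall n, exists Y, condE_G1ss sl sh t (Xn n) Y by move=> n; exact: condE_G1ss_exists.
have [|||Y mY cY] := @CE_norm_exists t Xn Yn X t0 _ _ mX _ cX.
- by move=> n; have [[/LL1_ver[]]] := hc n.
- by move=> n; have [] := hc n.
- by move=> n; exact: condE_G1ss_CE (hc n).
by exists Y; split => //; exists Xn, Yn.
Qed.

Lemma condEP t X : 0 <= t -> LGbar +oo X ->
  measurable_fun setT (condE sl sh t X) /\ CE t X (condE sl sh t X).
Proof.
move=> t0 LX; rewrite /condE; case: xgetP => [Y _ hY|h].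
  by split; [case: hY|exact: is_condE_CE].
by have [Y hY] := is_condE_exists t0 LX; case: (h Y).
Qed.

Lemma condE_eq t X Y : 0 <= t -> LGbar +oo X -> CE t X Y -> qs_eq (condE sl sh t X) Y.
Proof.
move=> t0 LX c; have [_ c'] := condEP t0 LX.
by apply: (CE_uniq t0 c' c); exact: qs_eq_refl.
Qed.

Lemma norm_cvg_cst X : (exists2 x, L1 x & ver X x) -> measurable_fun setT X -> norm_cvg (fun=> X) X.
Proof.
move=> [x hx Xx] mX; apply/(norm_cvg_nb h0 hs (xn := fun=> x) (x := x)) => //.
move=> eps e0; exists 0%N => n _; apply: (nb_leK (K := 0)); last exact: ltW.
under eq_fun do rewrite subrr; apply: nb_bound => //.
by move=> w; rewrite normr0.
Qed.

Lemma LG1_LG1s T X : LG1 T X -> LG1s T X.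
Proof.
move=> LX; have [h _] := LX; split => //; exists (fun=> X) => //.
by apply: qs_T => // w; split => //; exact: cvg_cst.
Qed.

Lemma LG1s_LG1ss T X : LG1s T X -> LG1ss T X.
Proof.
move=> LX; have [h _] := LX; split => //; exists (fun=> X) => //.
by apply: qs_T => // w; split => //; exact: cvg_cst.
Qed.

Lemma LG1ss_LGbar T X : LG1ss T X -> LGbar T X.
Proof.
move=> LX; have [h _] := LX; split => //; exists (fun=> X) => //.
by have [mX hx] := LL1_ver h; exact: norm_cvg_cst.
Qed.

Lemma LG1_LGbar T X : LG1 T X -> LGbar T X.
Proof. by move=> /LG1_LG1s/LG1s_LG1ss/LG1ss_LGbar. Qed.

Lemma inv_le T T' x : (T <= T')%E -> (0 <= T)%E -> inv T x -> inv T' x.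
Proof.
move=> TT' T0 ix; case: T' TT' => [t'| |] TT'//.
case: T T0 TT' ix => [t| |]//= t0; rewrite lee_fin => tt' ix w /=.
by have := ix (stop t' w); rewrite /= stop_stop// => <-; exact: ix.
Qed.

Lemma LL1_le T T' X : (T <= T')%E -> (0 <= T)%E -> LL1 sl sh T X -> LL1 sl sh T' X.
Proof.
move=> TT' T0 /(LL1P h0 hs)[mX [x [hx ix Xx]]]; apply/LL1P => //; split => //.
by exists x; split => //; exact: inv_le ix.
Qed.

Lemma LG1_le T T' X : (T <= T')%E -> (0 <= T)%E -> LG1 T X -> LG1 T' X.
Proof.
move=> TT' T0 /(LG1P _ T0)[mX [x [hx ix cx] Xx]]; have T0' := le_trans T0 TT'.
apply/LG1P => //; split => //; exists x => //; split => //; first exact: inv_le ix.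
move=> eps e0; have [z [cz iz hz]] := cx eps e0; exists z; split => //.
exact: inv_le iz.
Qed.

Lemma LG1s_le T T' X : (T <= T')%E -> (0 <= T)%E -> LG1s T X -> LG1s T' X.
Proof.
move=> TT' T0 [h [Xn LXn cX]]; split; first exact: LL1_le h.
by exists Xn => // n; exact: LG1_le (LXn n).
Qed.

Lemma LG1ss_le T T' X : (T <= T')%E -> (0 <= T)%E -> LG1ss T X -> LG1ss T' X.
Proof.
move=> TT' T0 [h [Xn LXn cX]]; split; first exact: LL1_le h.
by exists Xn => // n; exact: LG1s_le (LXn n).
Qed.

Lemma LGbar_le T T' X : (T <= T')%E -> (0 <= T)%E -> LGbar T X -> LGbar T' X.
Proof.
move=> TT' T0 [h [Xn LXn cX]]; split; first exact: LL1_le h.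
by exists Xn => // n; exact: LG1ss_le (LXn n).
Qed.

Lemma condE_LG1 t X : 0 <= t -> LG1 +oo X -> LG1 t%:E (condE sl sh t X).
Proof.
move=> t0 LX; have [mY c] := condEP t0 (LG1_LGbar LX).
have /(LG1P _ le0y)[_ [x [hx _ cx] Xx]] := LX.
have [y cy ly] := lg_ce t0 hx cx.
apply/LG1P; first by rewrite lee_fin.
split => //; exists y => //; apply: (condE_eq t0 (LG1_LGbar LX)).
by exists x, y; split => //; exact: ver_refl.
Qed.

Lemma CE_self t X : 0 <= t -> LL1 sl sh t%:E X -> CE t X X.
Proof.
move=> t0 /(LL1P h0 hs)[mX [x [hx ix Xx]]]; exists x, x; split => //.
exact: ce_self.
Qed.

(** The two relations may carry different real versions of Y; in the second one Y enters through
    integrals only, so the versions can be exchanged. *)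
Lemma CE_tower s t X Y Z : 0 <= s -> s <= t -> CE t X Y -> CE s Y Z -> CE s X Z.
Proof.
move=> s0 st [x [y [Xx Yy c]]] [y' [z [Yy' Zz c']]].
have [hx hy ay _] := c; have [hy' hz az _] := c'.
suff c2 : ce s y z by exists x, z; split => //; exact: (ce_tower h0 hs s0 st c c2).
have e := ver_uniq h0 hs Yy' Yy; split => // P PP_P; have [_ _ _ /(_ P PP_P)[k1 k2]] := c'.
have int_eq Q A : PP Q -> measurable A -> \int[Q]_(w in A) y w = \int[Q]_(w in A) y' w.
  move=> PP_Q mA; apply: int_ae_eq => //; [exact: L1_ig hy PP_Q|exact: L1_ig hy' PP_Q|].
  by apply: filterS (qs_ae h0 hs e PP_Q) => w /= ->.
split=> [Q A hQ FA|eps e0].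
  rewrite int_eq; [exact: k1|exact: QQ_PP hQ|exact: Filt_measurable FA].
have [Q hQ k3] := k2 eps e0; exists Q => //; rewrite int_eq//; exact: QQ_PP hQ.
Qed.

End extended_conditional_expectation.

(** * Stopping and the Snell envelope *)

Section first_contact_time.
Local Open Scope nat_scope.

Lemma bigminn_le N (Q : pred nat) (s : seq nat) k :
  (\big[minn/N]_(l <- s | Q l) l <= k) = (N <= k) || has (fun l => Q l && (l <= k)) s.
Proof.
elim: s => [|l s IH]; first by rewrite big_nil orbF.
rewrite big_cons /=; case: (Q l) => //=.
by rewrite geq_min IH; case: (l <= k); case: (N <= k).
Qed.

Variables (R : realType) (j N : nat) (X V : nat -> Omega R -> \bar R).
Hypotheses (jN : j <= N) (hVN : V N = X N).
Local Notation tau := (first_contact j N X V).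

(** Restricted to k < N because N is also the default value of the minimum. *)
Lemma first_contact_leP w k : k < N ->
  reflect (exists2 l, j <= l <= k & V l w = X l w) (tau w <= k).
Proof.
move=> kN; rewrite /first_contact bigminn_le leqNgt kN /=.
apply: (iffP hasP) => [[l]|[l /andP[jl lk] e]].
  by rewrite mem_index_iota => /andP[jl lN] /andP[/eqP e lk]; exists l => //; rewrite jl.
by exists l; rewrite ?mem_index_iota ?jl/= ?ltnS ?(leq_trans lk (ltnW kN))// e eqxx.
Qed.

Lemma first_contact_le w : tau w <= N.
Proof. by rewrite /first_contact bigminn_le leqnn. Qed.

Lemma first_contact_stop w : (j <= tau w) /\ V (tau w) w = X (tau w) w.
Proof.
have [tN|] := ltnP (tau w) N; last first.
  move=> Nt; have -> : tau w = N by apply/eqP; rewrite eqn_leq first_contact_le.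
  by rewrite hVN.
have /(first_contact_leP w tN)[l /andP[jl lt] e] := leqnn (tau w).
suff -> : tau w = l by [].
apply/eqP; rewrite eqn_leq lt andbT; apply/first_contact_leP; first exact: leq_ltn_trans lt tN.
by exists l => //; rewrite jl leqnn.
Qed.

Lemma first_contact_before w l : j <= l -> l < tau w -> V l w <> X l w.
Proof.
move=> jl lt e; have lN : l < N by exact: leq_trans lt (first_contact_le w).
suff : tau w <= l by rewrite leqNgt lt.
by apply/first_contact_leP => //; exists l; rewrite ?jl ?leqnn.
Qed.

End first_contact_time.

(** * Stability of the classes under algebraic operations *)

Section stopping.
Context (R : realType) (sl sh : R).
Hypotheses (h0 : 0 <= sl) (hs : sl <= sh).
Local Notation Omega := (Omega R).
Local Notation Prob := (probability Omega R).
Local Notation PP := (PP sl sh).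
Local Notation QQ := (QQ sl sh).
Local Notation qs := (qs sl sh).
Local Notation qs_eq := (qs_eq sl sh).
Local Notation qs_le := (qs_le sl sh).
Local Notation nb := (nb sl sh).
Local Notation L1 := (L1 sl sh).
Local Notation ver := (ver sl sh).
Local Notation ce := (ce sl sh).
Local Notation CE := (CE sl sh).
Local Notation lg := (lg sl sh).
Local Notation LG1 := (LG1 sl sh).
Local Notation LG1s := (LG1s sl sh).
Local Notation LG1ss := (LG1ss sl sh).
Local Notation LGs1 := (LGs1 sl sh).
Local Notation LGbar := (LGbar sl sh).
Local Notation condE := (condE sl sh).
Implicit Types (x y z : Omega -> R) (w : Omega) (s t K : R) (P : Prob) (A S : set Omega)
  (X Y Z : Omega -> \bar R) (T : \bar R).

Lemma indicP A w : (A w /\ \1_A w = 1 :> R) \/ (~ A w /\ \1_A w = 0 :> R).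
Proof.
rewrite indicE; case: (boolP (w \in A)) => h; [left|right]; split => //; first by rewrite inE in h.
by move/mem_set; rewrite (negPf h).
Qed.

Lemma nb_mul x (a : Omega -> R) K (M : R) : 0 <= M -> measurable_fun setT a -> (forall w, `|a w| <= M) -> nb x K ->
  nb (fun w => a w * x w) (M * K).
Proof.
move=> M0 ma aM hx P PP_P; have [ix hK] := hx P PP_P.
have mx := ig_measurable ix; have iM := igZ M (ig_abs ix).
have le w : `|a w * x w| <= M * `|x w| by rewrite normrM ler_wpM2r.
have i : ig P (fun w => a w * x w) by apply: ig_le iM le => //; exact: measurable_funM.
split => //; apply: (@le_trans _ _ (\int[P]_w (M * `|x w|))).
  by apply: int_ae_le => //; [exact: ig_abs|exact: aeW].
by rewrite intZ//; [exact: ler_wpM2l|exact: ig_abs].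
Qed.

Lemma lg_cst T c : lg T (fun=> c).
Proof.
split => //; first exact/L1_cyl/is_cyl_cst.
move=> eps e0; exists (fun=> c); split => //; first exact: is_cyl_cst.
by apply: nb_bound => // w; rewrite subrr normr0 ltW.
Qed.

Lemma nb_abs x K : nb x K -> nb (fun w => `|x w|) K.
Proof.
move=> hx; apply: (nb_le h0 hs _ hx) => [|w]; last by rewrite normr_id.
by apply: measurableT_comp => //; exact: (nb_measurable h0 hs hx).
Qed.

(** Treats sums and maxima at once; f 0 0 is subtracted so that the Lipschitz bound controls the
    norm. *)
Lemma lg_lipschitz T x y (f : R -> R -> R) : lg T x -> lg T y ->
  measurable_fun setT (fun w => f (x w) (y w)) ->
  (forall z z', is_cyl z -> is_cyl z' -> is_cyl (fun w => f (z w) (z' w))) ->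
  (forall a b c d, `|f a b - f c d| <= `|a - c| + `|b - d|) ->
  lg T (fun w => f (x w) (y w)).
Proof.
move=> [hx ix cx] [hy iy cy] mf fcyl fl.
have near (z z' : Omega -> R) eps eps' : measurable_fun setT (fun w => f (z w) (z' w)) ->
    nb (fun w => x w - z w) eps -> nb (fun w => y w - z' w) eps' ->
    nb (fun w => f (x w) (y w) - f (z w) (z' w)) (eps + eps').
  move=> mz h h'; have H := nbD (nb_abs h) (nb_abs h').
  apply: (nb_le h0 hs _ H) => [|w]; first exact: measurable_funB.
  by rewrite [leRHS]ger0_norm ?addr_ge0.
split; last 2 [by move=> w; rewrite ix iy].
- have [K hK] := hx; have [K' hK'] := hy.
  have H := near (fun=> 0) (fun=> 0) K K'; rewrite /= in H.
  rewrite (_ : (fun w => _) = (fun w => f (x w) (y w) - f 0 0 + f 0 0)).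
    apply: L1D; last exact/L1_cyl/is_cyl_cst.
    exists (K + K'); apply: H => //.
      by rewrite (_ : (fun w => _) = x)//; apply/funext => w; rewrite subr0.
    by rewrite (_ : (fun w => _) = y)//; apply/funext => w; rewrite subr0.
  by apply/funext => w; rewrite subrK.
move=> eps e0; have e2 : 0 < eps / 2 by rewrite divr_gt0.
have [z [cz iz nz]] := cx _ e2; have [z' [cz' iz' nz']] := cy _ e2.
have cf := fcyl _ _ cz cz'.
exists (fun w => f (z w) (z' w)); split => //; first by move=> w; rewrite iz iz'.
rewrite [eps]splitr; apply: near => //; exact: is_cyl_measurable.
Qed.

Lemma lgD T x y : lg T x -> lg T y -> lg T (fun w => x w + y w).
Proof.
move=> hx hy; have [/(L1_measurable h0 hs) mx _ _] := hx; have [/(L1_measurable h0 hs) my _ _] := hy.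
apply: (lg_lipschitz hx hy (f := +%R)); [exact: measurable_funD|by move=> *; exact: is_cylD|].
by move=> a b c d; rewrite opprD addrACA ler_normD.
Qed.

Lemma lg_max T x y : lg T x -> lg T y -> lg T (fun w => Num.max (x w) (y w)).
Proof.
move=> hx hy; have [/(L1_measurable h0 hs) mx _ _] := hx; have [/(L1_measurable h0 hs) my _ _] := hy.
apply: (lg_lipschitz hx hy (f := Num.max)); [exact: measurable_maxr|by move=> *; exact: is_cyl_max|].
move=> a b c d; rewrite !maxr_absE -mulrBl normrM (ger0_norm (x := 2^-1)) ?invr_ge0//.
rewrite ler_pdivrMr//; have -> : a + b + `|a - b| - (c + d + `|c - d|) =
  (a - c) + (b - d) + (`|a - b| - `|c - d|) by ring.
have h1 := ler_dist_dist (a - b) (c - d).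
rewrite (_ : (a - b) - (c - d) = (a - c) - (b - d)) in h1; last by ring.
have h2 := ler_normD (a - c) (b - d); have h3 := ler_normB (a - c) (b - d).
have h4 := ler_normD (a - c + (b - d)) (`|a - b| - `|c - d|); lra.
Qed.

(** y is approximated first; the bound of its approximation then fixes the accuracy for x. *)
Lemma lgM T x y M : lg T x -> lg T y -> (forall w, `|x w| <= M) -> lg T (fun w => x w * y w).
Proof.
move=> [hx ix cx] [hy iy cy] xM; have mx := L1_measurable h0 hs hx.
have M0 : 0 <= M by exact: le_trans (xM (zero_path R)).
split; last 2 [by move=> w; rewrite ix iy].
  by have [K hK] := hy; exists (M * K); exact: nb_mul.
move=> eps e0; have e2 : 0 < eps / 2 by rewrite divr_gt0.
have [|z' [cz' iz' nz']] := cy (eps / 2 / (M + 1)); first by rewrite divr_gt0// ltr_wpDl.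
have [C zC] := is_cyl_bddO cz'.
have C0 : 0 <= C by exact: le_trans (zC (zero_path R)).
have [|z [cz iz nz]] := cx (eps / 2 / (C + 1)); first by rewrite divr_gt0// ltr_wpDl.
exists (fun w => z w * z' w); split; [exact: is_cylM|by move=> w; rewrite iz iz'|].
have h1 := nb_mul M0 mx xM nz'; have h2 := nb_mul C0 (is_cyl_measurable cz') zC nz.
have := nbD h1 h2; rewrite (_ : (fun w => _) = (fun w => x w * y w - z w * z' w)); last first.
  by apply/funext => w; ring.
have le a : 0 <= a -> a * (eps / 2 / (a + 1)) <= eps / 2.
  by move=> a0; rewrite mulrA ler_pdivrMr ?ltr_wpDl// mulrC ler_wpM2l ?(ltW e2)// lerDl.
by move=> h; apply: nb_leK h _; rewrite [leRHS]splitr lerD// le.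
Qed.

Lemma lgZ T x a : lg T x -> lg T (fun w => a * x w).
Proof. by move=> hx; apply: (lgM (M := `|a|) (lg_cst T a) hx). Qed.

Lemma lgN T x : lg T x -> lg T (fun w => - x w).
Proof. by move=> /(lgZ (-1)); under eq_fun do rewrite mulN1r. Qed.

Lemma lgB T x y : lg T x -> lg T y -> lg T (fun w => x w - y w).
Proof. by move=> hx hy; apply: lgD => //; exact: lgN. Qed.

Lemma lg_abs T x : lg T x -> lg T (fun w => `|x w|).
Proof.
move=> hx; have := lg_max hx (lgN hx); rewrite (_ : (fun w => _) = (fun w => `|x w|))//.
apply/funext => w; case: (leP 0 (x w)) => [x0|/ltW x0].
  by rewrite ger0_norm//; apply/max_idPl; rewrite (le_trans _ x0)// oppr_le0.
by rewrite ler0_norm//; apply/max_idPr; rewrite (le_trans x0)// oppr_ge0.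
Qed.

Lemma lg_le T T' x : (T <= T')%E -> (0 <= T)%E -> lg T x -> lg T' x.
Proof.
move=> TT' T0 [hx ix cx]; split => //; first exact: inv_le ix.
by move=> eps e0; have [z [cz iz nz]] := cx eps e0; exists z; split => //; exact: inv_le iz.
Qed.

Definition decr_to (xn : nat -> Omega -> R) x :=
  qs [set w | (forall n, xn n.+1 w <= xn n w) /\ xn n w @[n --> \oo] --> (x w : R)].

Definition lgs T x := [/\ L1 x, inv T x & exists2 xn, (forall n, lg T (xn n)) & decr_to xn x].

Lemma lg_lgs T x : lg T x -> lgs T x.
Proof.
move=> hx; have [lx ix _] := hx; split => //; exists (fun=> x) => //.
by apply: qs_T => // w; split => //; exact: cvg_cst.
Qed.

Lemma lgs_le T T' x : (T <= T')%E -> (0 <= T)%E -> lgs T x -> lgs T' x.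
Proof.
move=> TT' T0 [hx ix [xn lxn cx]]; split => //; first exact: inv_le ix.
by exists xn => // n; exact: lg_le (lxn n).
Qed.

Lemma LG1sP T X : (0 <= T)%E -> LG1s T X <->
  measurable_fun setT X /\ exists2 x, lgs T x & ver X x.
Proof.
move=> T0; split=> [[/(LL1P h0 hs)[mX [x [hx ix Xx]]] [Xn LXn cX]]|[mX [x [hx ix [xn lxn cx]] Xx]]].
  split => //; have /choice[xn hxn] : forall n, exists x, lg T x /\ ver (Xn n) x.
    by move=> n; have /(LG1P h0 hs _ T0)[_ [z lz Xz]] := LXn n; exists z.
  have Xxn n : ver (Xn n) (xn n) by case: (hxn n).
  exists x => //; split => //; exists xn; first by move=> n; case: (hxn n).
  exact/(qs_decr_ver h0 hs Xxn Xx).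
split; first by apply/(LL1P h0 hs); split => //; exists x.
exists (fun n => EFin \o xn n); last exact/(qs_decr_ver h0 hs (fun n => ver_refl h0 hs (xn n)) Xx).
move=> n; apply/(LG1P h0 hs _ T0); split; last by exists (xn n) => //; exact: ver_refl.
by apply/measurable_EFinP; have [h _ _] := lxn n; exact: L1_measurable h.
Qed.

Lemma lgs_op T x y (f : R -> R -> R) (xn yn : nat -> Omega -> R) :
  L1 (fun w => f (x w) (y w)) -> inv T x -> inv T y ->
  decr_to xn x -> decr_to yn y -> (forall n, lg T (fun w => f (xn n w) (yn n w))) ->
  (forall n m n' m' w, xn n w <= xn m w -> yn n' w <= yn m' w ->
    f (xn n w) (yn n' w) <= f (xn m w) (yn m' w)) ->
  (forall (u v : nat -> R) (a b : R), u n @[n --> \oo] --> a -> v n @[n --> \oo] --> b ->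
    f (u n) (v n) @[n --> \oo] --> f a b) ->
  lgs T (fun w => f (x w) (y w)).
Proof.
move=> hf ix iy cx cy hxy fm fc; split => //; first by move=> w; rewrite ix iy.
exists (fun n w => f (xn n w) (yn n w)) => //.
apply: (qs_sub h0 hs) (qs_and h0 hs cx cy) => w [[m1 c1] [m2 c2]]; split; last exact: fc.
by move=> n; apply: fm.
Qed.

Lemma lgsD T x y : lgs T x -> lgs T y -> lgs T (fun w => x w + y w).
Proof.
move=> [hx ix [xn lx cx]] [hy iy [yn ly cy]].
apply: (lgs_op (f := +%R) (xn := xn) (yn := yn)) => //.
- exact: L1D.
- by move=> n; exact: lgD.
- by move=> *; exact: lerD.
by move=> u v a b; exact: cvgD.
Qed.

Lemma cvg_maxr (u v : nat -> R) (a b : R) : u n @[n --> \oo] --> a -> v n @[n --> \oo] --> b ->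
  Num.max (u n) (v n) @[n --> \oo] --> Num.max a b.
Proof.
move=> ua vb; rewrite maxr_absE (_ : (fun n => _) = (fun n => (u n + v n + `|u n - v n|) / 2)).
  by apply: cvgMl; apply: cvgD; [exact: cvgD|apply: cvg_norm; exact: cvgB].
by apply/funext => n; rewrite maxr_absE.
Qed.

Lemma lgs_max T x y : lgs T x -> lgs T y -> lgs T (fun w => Num.max (x w) (y w)).
Proof.
move=> [hx ix [xn lx cx]] [hy iy [yn ly cy]].
apply: (lgs_op (f := Num.max) (xn := xn) (yn := yn)) => //.
- have [K hK] := hx; have [K' hK'] := hy; exists (K + K').
  apply: (nb_le h0 hs _ (nbD (nb_abs hK) (nb_abs hK'))) => [|w].
    by apply: measurable_maxr; [exact: L1_measurable hx|exact: L1_measurable hy].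
  rewrite [leRHS]ger0_norm ?addr_ge0//; case: (leP (x w) (y w)) => _.
    by rewrite lerDr.
  by rewrite lerDl.
- by move=> n; exact: lg_max.
- move=> n m n' m' w h1 h2; rewrite ge_max !le_max h1 h2 orbT//.
exact: cvg_maxr.
Qed.

(** The sequence decreasing to i is cut to [0, 1], so that the products with v >= 0 decrease and
    [lgM] applies. *)
Lemma lgs_mul T i v : lgs T i -> (forall w, 0 <= i w <= 1) -> lg T v -> (forall w, 0 <= v w) ->
  lgs T (fun w => i w * v w).
Proof.
move=> [hi ii [xn lx cx]] i01 lv v0; have [hv iv _] := lv.
(* This is max (0, min (1, xn)), expressed through operations under which [lg] is known to be
   stable. *)
pose yn n w := Num.max 0 (- Num.max (- 1) (- xn n w)).
have ly n : lg T (yn n).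
  by apply: lg_max; [exact: lg_cst|apply: lgN; apply: lg_max; [exact: lg_cst|exact: lgN]].
have y01 n w : 0 <= yn n w <= 1.
  rewrite /yn le_max lexx ge_max ler01/= lerNl le_max lexx//.
have clip (a : R) : 0 <= a <= 1 -> a = Num.max 0 (- Num.max (- 1) (- a)).
  move=> /andP[a0 a1]; have -> : Num.max (- 1) (- a) = - a by apply/max_idPr; rewrite lerN2.
  by rewrite opprK; apply/esym/max_idPr.
have cy : decr_to yn i.
  apply: (qs_sub h0 hs) cx => w [m c]; split.
    move=> n; rewrite /yn ge_max le_max lexx/= le_max; apply/orP; right.
    by rewrite lerN2 ge_max !le_max lexx/=; apply/orP; right; rewrite lerN2.
  rewrite (clip _ (i01 w)); apply: cvg_maxr; first exact: cvg_cst.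
  apply: cvgN; apply: cvg_maxr; first exact: cvg_cst.
  exact: cvgN.
have cv : decr_to (fun=> v) v by apply: qs_T => // w; split => //; exact: cvg_cst.
apply: (lgs_op (f := *%R) (xn := yn) (yn := fun=> v)) => //.
- have [K hK] := hv; exists (1 * K); apply: nb_mul => //; first exact: L1_measurable hi.
  by move=> w; have /andP[a b] := i01 w; rewrite ger0_norm.
- move=> n; apply: (lgM (M := 1)) => // w.
  by have /andP[a b] := y01 n w; rewrite ger0_norm.
- by move=> n m n' m' w h1 h2; apply: ler_pM => //; have /andP[] := y01 n w.
by move=> u u' a b; exact: cvgM.
Qed.

Definition lgd T z := exists x y, [/\ lgs T x, lgs T y & z = fun w => x w - y w].

Lemma lgdD T z z' : lgd T z -> lgd T z' -> lgd T (fun w => z w + z' w).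
Proof.
move=> [x [y [hx hy ->]]] [x' [y' [hx' hy' ->]]].
exists (fun w => x w + x' w), (fun w => y w + y' w); split; [exact: lgsD|exact: lgsD|].
by apply/funext => w; ring.
Qed.

Lemma lgdN T z : lgd T z -> lgd T (fun w => - z w).
Proof.
by move=> [x [y [hx hy ->]]]; exists y, x; split => //; apply/funext => w; rewrite opprB.
Qed.

Lemma lgd_le T T' z : (T <= T')%E -> (0 <= T)%E -> lgd T z -> lgd T' z.
Proof.
by move=> TT' T0 [x [y [hx hy ->]]]; exists x, y; split => //; exact: lgs_le TT' _ _.
Qed.

Lemma lgs_lgd T x : lgs T x -> lgd T x.
Proof.
move=> hx; exists x, (fun=> 0); split => //; first exact/lg_lgs/lg_cst.
by apply/funext => w; rewrite subr0.
Qed.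

(** Positive and negative parts of v are multiplied separately, as [lgs_mul] needs a sign. *)
Lemma lgd_mul T i v : lgs T i -> (forall w, 0 <= i w <= 1) -> lg T v ->
  lgd T (fun w => i w * v w).
Proof.
move=> hi i01 hv.
exists (fun w => i w * Num.max 0 (v w)), (fun w => i w * Num.max 0 (- v w)); split.
- apply: lgs_mul => //; last by move=> w; rewrite le_max lexx.
  by apply: lg_max => //; exact: lg_cst.
- apply: lgs_mul => //; last by move=> w; rewrite le_max lexx.
  by apply: lg_max; [exact: lg_cst|exact: lgN].
apply/funext => w; rewrite -mulrBr; congr (_ * _).
case: (leP 0 (v w)) => [v0|/ltW v0].
  by have -> : Num.max 0 (- v w) = 0 by [apply/max_idPl; rewrite oppr_le0|]; rewrite subr0.
have -> : Num.max 0 (- v w) = - v w by apply/max_idPr; rewrite oppr_ge0.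
by rewrite opprK add0r.
Qed.

Lemma lgd_LGs1 T Z z : (0 <= T)%E -> measurable_fun setT Z -> lgd T z -> ver Z z -> LGs1 T Z.
Proof.
move=> T0 mZ [x [y [hx hy ->]]] Zz; split => //; exists (EFin \o x), (EFin \o y); split => //.
  apply/LG1sP => //; split; last by exists x => //; exact: ver_refl.
  by apply/measurable_EFinP; have [h _ _] := hx; exact: L1_measurable h.
apply/LG1sP => //; split; last by exists y => //; exact: ver_refl.
by apply/measurable_EFinP; have [h _ _] := hy; exact: L1_measurable h.
Qed.

(* If [Y_n] decreases to [Y], then [X - Y_n] increases to [X - Y]. *)
Lemma lgd_LGbar T Z z : (0 <= T)%E -> measurable_fun setT Z -> lgd T z -> ver Z z -> LGbar T Z.
Proof.
move=> T0 mZ [x [y [hx hy ->]]] Zz; apply: (LG1ss_LGbar h0 hs).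
have [lx ix _] := hx; have [ly iy [yn lyn cy]] := hy.
split.
  apply/(LL1P h0 hs); split => //; exists (fun w => x w - y w); split => //; first exact: L1B.
  by move=> w; rewrite ix iy.
exists (fun n => EFin \o (fun w => x w - yn n w)).
  move=> n; have h : lgs T (fun w => x w - yn n w) by apply: lgsD => //; apply/lg_lgs/lgN.
  apply/LG1sP => //; split; last by exists (fun w => x w - yn n w) => //; exact: ver_refl.
  by apply/measurable_EFinP; have [k _ _] := h; exact: L1_measurable k.
apply/(qs_incr_ver h0 hs (fun n => ver_refl h0 hs (fun w => x w - yn n w)) Zz).
apply: (qs_sub h0 hs) cy => w [m c]; split; first by move=> n; rewrite lerD2l lerN2.
by apply: cvgB => //; exact: cvg_cst.
Qed.

(* The set where two elements of [L_G^1] agree is approximated from above by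
   [max (0, 1 - n |x - y|)]. *)
Lemma lgs_indic_eq T x y : lg T x -> lg T y -> lgs T (\1_[set w | x w = y w] : Omega -> R).
Proof.
move=> hx hy; have [lx ix _] := hx; have [ly iy _] := hy.
have mx := L1_measurable h0 hs lx; have my := L1_measurable h0 hs ly.
have mA : measurable [set w | x w = y w].
  rewrite (_ : [set w | _] = (fun w => x w - y w) @^-1` [set 0]).
    by rewrite -[X in measurable X]setTI; exact: measurable_funB.
  by apply/seteqP; split => w /= => [->|/eqP]; rewrite ?subrr// subr_eq0 => /eqP.
split.
- exists 1; apply: nb_bound; first exact: measurable_indic.
  by move=> w; rewrite indicE; case: (_ \in _); rewrite ?normr1 ?normr0.
- move=> w; rewrite !indicE (_ : (stp T w \in _) = (w \in [set w | x w = y w]))//.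
  by apply/idP/idP; rewrite !inE /= ix iy.
exists (fun n w => Num.max 0 (1 - n%:R * `|x w - y w|)).
  move=> n; apply: lg_max; first exact: lg_cst.
  by apply: lgB; [exact: lg_cst|apply: lgZ; apply: lg_abs; exact: lgB].
apply: qs_T => // w; split.
  move=> n; rewrite ge_max le_max lexx/= le_max lerD2l lerN2; apply/orP; right.
  by rewrite ler_wpM2r// ler_nat.
have [[e ->]|[e ->]] := indicP [set w | x w = y w] w.
  rewrite e subrr normr0 (_ : (fun n : nat => _) = fun=> 1); first exact: cvg_cst.
  by apply/funext => n; rewrite mulr0 subr0; apply/max_idPr.
have d0 : 0 < `|x w - y w| by rewrite normr_gt0 subr_eq0; apply/eqP.
apply/cvgrPdist_le => eps e0; exists (Num.truncn `|x w - y w|^-1).+1 => // n /= hn.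
suff -> : Num.max 0 (1 - n%:R * `|x w - y w|) = 0 by rewrite subrr normr0 ltW.
apply/max_idPl; rewrite subr_le0 -ler_pdivrMr// mul1r.
by apply: (le_trans (ltW (truncnS_gt _))); rewrite ler_nat.
Qed.

End stopping.

(** * Stopped processes *)

Section stopped_processes.
Context (R : realType) (sl sh : R).
Hypotheses (h0 : 0 <= sl) (hs : sl <= sh).
Local Notation Omega := (Omega R).
Local Notation Prob := (probability Omega R).
Local Notation PP := (PP sl sh).
Local Notation qs := (qs sl sh).
Local Notation qs_eq := (qs_eq sl sh).
Local Notation qs_le := (qs_le sl sh).
Local Notation L1 := (L1 sl sh).
Local Notation ver := (ver sl sh).
Local Notation ce := (ce sl sh).
Local Notation CE := (CE sl sh).
Local Notation lg := (lg sl sh).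
Local Notation lgs := (lgs sl sh).
Local Notation lgd := (lgd sl sh).
Local Notation LG1 := (LG1 sl sh).
Local Notation LG1s := (LG1s sl sh).
Local Notation LGs1 := (LGs1 sl sh).
Local Notation LGbar := (LGbar sl sh).
Local Notation condE := (condE sl sh).
Local Notation G_stopping_time := (G_stopping_time sl sh).
Implicit Types (x y z : Omega -> R) (w : Omega) (s t K : R) (P : Prob) (A S : set Omega)
  (X Y Z : Omega -> \bar R) (T : \bar R) (tau : Omega -> nat).

Lemma time_ge0 n : (0 <= (n%:R%:E : \bar R))%E.
Proof. by rewrite lee_fin. Qed.

Lemma indicE01 A w : 0 <= (\1_A w : R) <= 1.
Proof. by rewrite indicE; case: (_ \in _); rewrite lexx ler01. Qed.

(** The event that tau <= n is prior to n only up to a polar set; [i] is exactly so, and it is cut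
    to [0, 1] at every path for [lgd_mul]. *)
Lemma stopping_version tau n : G_stopping_time (fun w => (tau w)%:R) ->
  measurable [set w | (tau w <= n)%N] /\ exists i,
  [/\ lgs n%:R%:E i, (forall w, 0 <= i w <= 1) & qs [set w | i w = \1_[set w | (tau w <= n)%N] w]].
Proof.
move=> [_ /(_ n%:R (ler0n _ _))]; rewrite (_ : [set w | _] = [set w | (tau w <= n)%N]); last first.
  by apply/seteqP; split => w /=; rewrite ler_nat.
move=> /(LG1sP h0 hs _ (time_ge0 n))[mI [i hi Ii]]; split.
  rewrite (_ : [set w | _] = (fun w => (\1_[set w | (tau w <= n)%N] w)%:E : \bar R) @^-1` [set 1%E]).
    by rewrite -[X in measurable X]setTI; apply: mI => //; exact: emeasurable_set1.
  apply/seteqP; split => w /=; first by move=> h; rewrite indicE mem_set.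
  have [[//]|[_ ->]] := @indicP R [set w | (tau w <= n)%N] w.
  by move=> [/eqP]; rewrite eq_sym oner_eq0.
have [li ii [xn lxn cx]] := hi; have mi := L1_measurable h0 hs li.
pose c (a : R) := Num.max 0 (Num.min a 1).
have cI w : c (\1_[set w | (tau w <= n)%N] w) = \1_[set w | (tau w <= n)%N] w.
  rewrite /c; have /andP[a b] := indicE01 [set w | (tau w <= n)%N] w.
  by rewrite (min_idPl b); apply/max_idPr.
have ei : qs [set w | c (i w) = i w].
  by apply: (qs_sub h0 hs) Ii => w [/= <-].
have c01 a : 0 <= c a <= 1 by rewrite /c le_max lexx ge_max ler01 ge_min lexx orbT.
exists (c \o i); split => //.
- split; last 2 [by move=> w /=; rewrite ii].
    exists 1; apply: nb_bound => [|w]; last by have /andP[a b] := c01 (i w); rewrite ger0_norm.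
    by apply: measurable_maxr => //; apply: measurable_minr.
  exists xn => //; apply: (qs_sub h0 hs) (qs_and h0 hs ei cx) => w [/= -> h]; exact: h.
- by move=> w; exact: c01.
by apply: (qs_sub h0 hs) Ii => w [/= <-].
Qed.

(* [V_(n+1 /\ tau) = V_(n /\ tau) + (1 - 1_(tau <= n)) (V_(n+1) - V_n)]. *)
Lemma stopped_version tau (Y : nat -> Omega -> \bar R) n :
  G_stopping_time (fun w => (tau w)%:R) -> (forall k, LG1 k%:R%:E (Y k)) ->
  exists2 z, lgd n%:R%:E z & ver (fun w => Y (minn n (tau w)) w) z.
Proof.
move=> st hY; elim: n => [|n [z hz Zz]].
  have /(LG1P h0 hs _ (time_ge0 0))[_ [y hy Yy]] := hY 0%N.
  exists y; first exact/lgs_lgd/lg_lgs.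
  by apply: (qs_sub h0 hs) Yy => w; rewrite /= min0n.
have [_ [i [hi i01 ei]]] := stopping_version n st.
have /(LG1P h0 hs _ (time_ge0 n))[_ [y hy Yy]] := hY n.
have /(LG1P h0 hs _ (time_ge0 n.+1))[_ [y' hy' Yy']] := hY n.+1.
have le : ((n%:R%:E : \bar R) <= n.+1%:R%:E)%E by rewrite lee_fin ler_nat.
have hd : lg n.+1%:R%:E (fun w => y' w - y w) by apply: lgB => //; exact: lg_le le _ hy.
exists (fun w => z w + ((y' w - y w) + - (i w * (y' w - y w)))).
  apply: lgdD => //; first exact: lgd_le le _ hz.
  apply: lgdD => //; first exact/lgs_lgd/lg_lgs.
  by apply: lgdN; apply: lgd_mul => //; exact: lgs_le le _ hi.
apply: (qs_sub h0 hs) (qs_and h0 hs (qs_and h0 hs Zz ei) (qs_and h0 hs Yy Yy')) => w [[/= Zw ew] [e e']].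
have [[/= tn h]|[/= tn h]] := @indicP R [set w | (tau w <= n)%N] w; rewrite ew h.
  have tn' := leqW tn; rewrite (minn_idPr tn') mul1r subrr addr0 -Zw.
  by rewrite (minn_idPr tn).
move: tn => /negP; rewrite -ltnNge => nt; rewrite (minn_idPl nt) e' mul0r subr0.
move: Zw; rewrite (minn_idPl (ltnW nt)) e => -[->]; congr EFin; ring.
Qed.

Lemma measurable_stopped tau (Y : nat -> Omega -> \bar R) n :
  G_stopping_time (fun w => (tau w)%:R) -> (forall k, measurable_fun setT (Y k)) ->
  measurable_fun setT (fun w => Y (minn n (tau w)) w).
Proof.
move=> st mY; elim: n => [|n IH]; first by under eq_fun do rewrite min0n; exact: mY.
have [mA _] := stopping_version n st.
rewrite (_ : (fun w => _) = (fun w => if (tau w <= n)%N then Y (minn n (tau w)) w else Y n.+1 w)).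
  apply: measurable_fun_ifT => //; apply: (measurable_fun_bool true) => //.
  by rewrite setTI; exact: mA.
apply/funext => w; case: leqP => tn; last by rewrite (minn_idPl tn).
by rewrite (minn_idPr (leqW tn)).
Qed.

Lemma stopped_LGs1 tau (Y : nat -> Omega -> \bar R) n :
  G_stopping_time (fun w => (tau w)%:R) -> (forall k, LG1 k%:R%:E (Y k)) ->
  LGs1 n%:R%:E (fun w => Y (minn n (tau w)) w) /\ LGbar n%:R%:E (fun w => Y (minn n (tau w)) w).
Proof.
move=> st hY; have [z hz Zz] := stopped_version n st hY.
have m : measurable_fun setT (fun w => Y (minn n (tau w)) w).
  by apply: measurable_stopped => // k; have /(LG1P h0 hs _ (time_ge0 k))[] := hY k.
by split; [apply: lgd_LGs1 hz Zz => //; exact: time_ge0|apply: lgd_LGbar hz Zz => //; exact: time_ge0].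
Qed.

Lemma LGbar_CE t T X : 0 <= t -> (0 <= T)%E -> LGbar T X -> CE t X (condE t X).
Proof.
move=> t0 T0 hX; apply: (proj2 (condEP h0 hs t0 _)).
by apply: LGbar_le hX => //; rewrite leey.
Qed.

Lemma LGbar_condE_eq t T X Y : 0 <= t -> (0 <= T)%E -> LGbar T X -> CE t X Y -> qs_eq (condE t X) Y.
Proof. by move=> t0 T0 hX c; apply: (CE_uniq h0 hs t0 (LGbar_CE t0 T0 hX) c); exact: qs_eq_refl. Qed.

(** Y is not known to have a conditional expectation at s, so X and Z are compared by their
    integrals over events prior to s. *)
Lemma CE_super s t X Y Z U W : 0 <= s -> s <= t -> CE t X Y -> qs_le Y Z -> CE s X U -> CE s Z W ->
  qs_le U W.
Proof.
move=> s0 st [x [y [Xx Yy c]]] YZ [x' [u [Xx' Uu cu]]] [z [v [Zz Wv cv]]].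
have [hx hy ay H] := c; have [hx' hu au _] := cu; have [hz hv av _] := cv.
have t0 := le_trans s0 st.
have uv : qs [set w | u w <= v w].
  apply: (qs_measurable_le h0 hs); [exact: L1_measurable hu|exact: L1_measurable hv|].
  apply: (ce_mono_int h0 hs s0 cu cv) => Q A PP_Q FA.
  have mA := Filt_measurable FA; have [H1 _] := H Q PP_Q.
  have ex := qs_ae h0 hs (ver_uniq h0 hs Xx' Xx) PP_Q.
  rewrite (int_ae_eq mA (L1_ig hx' PP_Q) (L1_ig hx PP_Q) ex).
  apply: le_trans (H1 Q A (QQ_refl h0 hs t0 PP_Q) (Filt_le st FA)) _.
  apply: int_ae_le => //; [exact: L1_ig hy PP_Q|exact: L1_ig hz PP_Q|].
  apply: (qs_ae h0 hs _ PP_Q).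
  apply: (qs_sub h0 hs) (qs_and h0 hs YZ (qs_and h0 hs Yy Zz)) => w [/= h [e1 e2]].
  by move: h; rewrite e1 e2 lee_fin.
by apply: (qs_sub h0 hs) (qs_and h0 hs uv (qs_and h0 hs Uu Wv)) => w [/= h [e1 e2]]; rewrite e1 e2 lee_fin.
Qed.

Lemma supermartingale_step j N (M : nat -> Omega -> \bar R) :
  (forall n, (j <= n <= N)%N -> LGbar n%:R%:E (M n)) ->
  (forall n, (j <= n)%N -> (n < N)%N -> qs_le (condE n%:R (M n.+1)) (M n)) ->
  G_supermartingale sl sh j N M.
Proof.
move=> hM step; split => // m n /andP[jm mn]; rewrite -(subnKC mn).
elim: (n - m)%N => [|d IH] mN.
  rewrite addn0 in mN *; have hm : LGbar m%:R%:E (M m) by apply: hM; rewrite jm.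
  apply: (qs_eq_le h0 hs); apply: (LGbar_condE_eq _ (time_ge0 m)) => //.
  by apply: CE_self => //; case: hm.
rewrite addnS in mN *; have mN' := ltnW mN.
have jn : (j <= m + d)%N by exact: leq_trans jm (leq_addr _ _).
have h1 : LGbar (m + d)%:R%:E (M (m + d)%N) by apply: hM; rewrite jn.
have h2 : LGbar (m + d).+1%:R%:E (M (m + d).+1) by apply: hM; rewrite mN leqW.
apply: (qs_le_trans h0 hs) (IH mN').
apply: (CE_super _ _ (LGbar_CE _ (time_ge0 _) h2) (step _ jn mN) (LGbar_CE _ (time_ge0 _) h2) (LGbar_CE _ (time_ge0 _) h1)) => //.
by rewrite ler_nat leq_addr.
Qed.

Lemma martingale_step j N (M : nat -> Omega -> \bar R) :
  (forall n, (j <= n <= N)%N -> LGbar n%:R%:E (M n)) ->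
  (forall n, (j <= n)%N -> (n < N)%N -> CE n%:R (M n.+1) (M n)) ->
  G_martingale sl sh j N M.
Proof.
move=> hM step; split => // m n /andP[jm mn] nN.
apply: (LGbar_condE_eq _ (time_ge0 n)) => //; first by apply: hM; rewrite (leq_trans jm mn).
move: nN; rewrite -(subnKC mn).
elim: (n - m)%N => [|d IH] mN.
  rewrite addn0 in mN *; have hm : LGbar m%:R%:E (M m) by apply: hM; rewrite jm.
  by apply: CE_self => //; case: hm.
rewrite addnS in mN *; have jn : (j <= m + d)%N by exact: leq_trans jm (leq_addr _ _).
apply: (CE_tower h0 hs _ _ (step _ jn mN) (IH (ltnW mN))) => //.
by rewrite ler_nat leq_addr.
Qed.

(* On [tau > n] the stopped process moves as [Y] does, and elsewhere it is frozen. *)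
Lemma stopped_step tau (Y : nat -> Omega -> \bar R) n :
  G_stopping_time (fun w => (tau w)%:R) -> (forall k, LG1 k%:R%:E (Y k)) ->
  CE n%:R (fun w => Y (minn n.+1 (tau w)) w)
    (fun w => if (n < tau w)%N then condE n%:R (Y n.+1) w else Y (minn n (tau w)) w).
Proof.
move=> st hY; have [_ [i [[li ii _] i01 ei]]] := stopping_version n st.
have [z [x [y [[lx ix _] [ly iy _] ez]]] Zz] := stopped_version n st hY.
have Lz : L1 z by rewrite ez; exact: L1B.
have az : adapted n%:R z by move=> w; rewrite ez; have /= -> := ix w; have /= -> := iy w.
(* Exactly prior to n, and quasi-surely the event that tau > n. *)
pose A := [set w | i w < 2^-1].
have FA : Filt n%:R%:E A.
  apply: Filt_gt => //; exact: L1_measurable li.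
have [v [u [Vv Uu c]]] := LGbar_CE (ler0n R n) (time_ge0 _) (LG1_LGbar h0 hs (hY n.+1)).
have := ce_local h0 hs (ler0n R n) c Lz az FA => c'.
exists (fun w => \1_A w * v w + \1_(~` A) w * z w), (fun w => \1_A w * u w + \1_(~` A) w * z w).
split; last exact: c'.
all: apply: (qs_sub h0 hs) (qs_and h0 hs (qs_and h0 hs Zz ei) (qs_and h0 hs Vv Uu)) => w [[/= Zw ew] [e e']].
all: have Aw : (w \in A) = (n < tau w)%N.
  1,3: by apply/idP/idP; rewrite inE /A /= ew; have [[/= h ->]|[/= h ->]] := @indicP R [set w | (tau w <= n)%N] w;
    [lra|rewrite ltnNge => _; exact/negP|rewrite ltnNge h|rewrite invr_gt0].
all: rewrite !indicE in_setC Aw; case: ltnP => h /=; rewrite ?mul1r ?mul0r ?addr0 ?add0r.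
- by rewrite (minn_idPl h).
- by rewrite -Zw (minn_idPr h) (minn_idPr (leqW h)).
- by rewrite e'.
- by rewrite -Zw (minn_idPr h).
Qed.

End stopped_processes.

(** * The Snell envelope *)

Section snell_envelope.
Context (R : realType) (sl sh : R).
Hypotheses (h0 : 0 <= sl) (hs : sl <= sh).
Local Notation Omega := (Omega R).
Local Notation qs := (qs sl sh).
Local Notation qs_eq := (qs_eq sl sh).
Local Notation qs_le := (qs_le sl sh).
Local Notation ver := (ver sl sh).
Local Notation CE := (CE sl sh).
Local Notation LG1 := (LG1 sl sh).
Local Notation LGs1 := (LGs1 sl sh).
Local Notation LGbar := (LGbar sl sh).
Local Notation condE := (condE sl sh).
Local Notation G_stopping_time := (G_stopping_time sl sh).
Implicit Types (w : Omega) (T : \bar R) (tau sigma : Omega -> nat).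

Lemma LG1_max T (Y Z : Omega -> \bar R) : (0 <= T)%E -> LG1 T Y -> LG1 T Z -> LG1 T (fun w => maxe (Y w) (Z w)).
Proof.
move=> T0 /(LG1P h0 hs _ T0)[mY [y hy Yy]] /(LG1P h0 hs _ T0)[mZ [z hz Zz]].
apply/(LG1P h0 hs _ T0); split; first exact: measurable_maxe.
exists (fun w => Num.max (y w) (z w)); first exact: lg_max.
by apply: (qs_sub h0 hs) (qs_and h0 hs Yy Zz) => w [/= -> ->]; rewrite EFin_max.
Qed.

Variables (N : nat) (X V : nat -> Omega -> \bar R).
Hypotheses (hX : forall n, (n <= N)%N -> LG1 n%:R%:E (X n)) (hVN : V N = X N).
Hypothesis hV : forall n, (n < N)%N -> V n = fun w => maxe (X n w) (condE n%:R (V n.+1) w).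

Let le_y (n : nat) : ((n%:R%:E : \bar R) <= +oo)%E. Proof. by rewrite leey. Qed.

(** The recursion stays in L_G^1, which brings the contact events within reach of [lgs_indic_eq]. *)
Lemma snell_LG1 n : (n <= N)%N -> LG1 n%:R%:E (V n).
Proof.
move=> nN; rewrite -(subKn nN); have := leq_subr n N; elim: (N - n)%N => [|d IH] dN.
  by rewrite subn0 hVN; exact: hX.
have mN : (N - d.+1 < N)%N by rewrite ltn_subrL (leq_trans _ dN).
rewrite hV// subnSK//.
apply: LG1_max; [exact: time_ge0|apply: hX; exact: leq_subr|].
apply: condE_LG1 => //.
by apply: LG1_le (IH (ltnW dN)) => //; exact: time_ge0.
Qed.

Lemma snell_LGbar n : (n <= N)%N -> LGbar n%:R%:E (V n).
Proof. by move=> nN; apply: LG1_LGbar => //; exact: snell_LG1. Qed.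

Lemma snell_supermartingale j : G_supermartingale sl sh j N V.
Proof.
apply: supermartingale_step => // [n /andP[_ nN]|n _ nN]; first exact: snell_LGbar.
by apply: qs_T => // w /=; rewrite [in leRHS]hV// le_max lexx orbT.
Qed.

Lemma snell_dominates : dominates sl sh N V X.
Proof.
move=> n; rewrite leq_eqVlt => /orP[/eqP->|nN]; apply: qs_T => // w /=; first by rewrite hVN.
by rewrite hV// le_max lexx.
Qed.

(** Backward induction: U m dominates X m, and it dominates the conditional expectation of U (m +
    1), hence that of V (m + 1). *)
Lemma snell_smallest U : G_supermartingale sl sh 0 N U -> dominates sl sh N U X ->
  dominates sl sh N U V.
Proof.
move=> [hU sU] dU n nN; rewrite -(subKn nN); have := leq_subr n N.
elim: (N - n)%N => [|d IH] dN; first by rewrite subn0 hVN; exact: dU.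
have mN : (N - d.+1 < N)%N by rewrite ltn_subrL (leq_trans _ dN).
have e : (N - d)%N = (N - d.+1).+1 by rewrite subnSK.
rewrite e in IH; move: (N - d.+1)%N mN (IH (ltnW dN)) => m mN VU {IH e}.
have h1 := LGbar_CE h0 hs (ler0n R m) (time_ge0 R m.+1) (snell_LGbar mN).
have h2 := LGbar_CE h0 hs (ler0n R m) (time_ge0 R m.+1) (hU m.+1 mN).
have h3 := CE_mono h0 hs (ler0n R m) h1 h2 VU.
have h4 := sU m m.+1 (leqnSn m) mN; have h5 := dU m (ltnW mN).
apply: (qs_sub h0 hs) (qs_and h0 hs (qs_and h0 hs h3 h4) h5) => w [[/= k3 k4] k5].
by rewrite hV// ge_max k5/= (le_trans k3).
Qed.

(** The processes are continued as constants beyond N, since the stopping lemmas ask for all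
    times. *)
Let V' n := V (minn n N).
Let X' n := X (minn n N).

Let V'_LG1 n : LG1 n%:R%:E (V' n).
Proof.
apply: (LG1_le h0 hs _ (time_ge0 R _) (snell_LG1 (geq_minr n N))).
by rewrite lee_fin ler_nat geq_minl.
Qed.

Let X'_LG1 n : LG1 n%:R%:E (X' n).
Proof.
apply: (LG1_le h0 hs _ (time_ge0 R _) (hX (geq_minr n N))).
by rewrite lee_fin ler_nat geq_minl.
Qed.

(** Unions are taken on the events themselves, while an exact version of the indicator is carried
    along. *)
Definition lgs_set T (A : set Omega) :=
  measurable A /\ exists2 i : Omega -> R, lgs sl sh T i & qs [set w | \1_A w = i w].

Lemma lgs_set_LG1s T A : (0 <= T)%E -> lgs_set T A -> LG1s sl sh T (fun w => (\1_A w)%:E).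
Proof.
move=> T0 [mA [i hi ei]]; apply/(LG1sP h0 hs _ T0); split.
  by apply/measurable_EFinP; exact: measurable_indic.
by exists i => //; apply: (qs_sub h0 hs) ei => w /= ->.
Qed.

Lemma lgs_set0 T : lgs_set T set0.
Proof.
split => //; exists (fun=> 0); first exact/lg_lgs/lg_cst.
by apply: qs_T => // w /=; rewrite indic0.
Qed.

Lemma lgs_set_le T T' A : (T <= T')%E -> (0 <= T)%E -> lgs_set T A -> lgs_set T' A.
Proof. by move=> TT' T0 [mA [i hi ei]]; split => //; exists i => //; exact: lgs_le TT' _ hi. Qed.

Lemma lgs_setU T A A' : lgs_set T A -> lgs_set T A' -> lgs_set T (A `|` A').
Proof.
move=> [mA [i hi ei]] [mA' [i' hi' ei']]; split; first exact: measurableU.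
exists (fun w => Num.max (i w) (i' w)); first exact: lgs_max.
apply: (qs_sub h0 hs) (qs_and h0 hs ei ei') => w [/= <- <-].
rewrite !indicE in_setU; case: (_ \in A); case: (_ \in A') => /=;
  rewrite ?maxxx//; apply/esym; [apply/max_idPl|apply/max_idPr] => //; exact: ler01.
Qed.

Lemma lgs_set_eq T (Y Z : Omega -> \bar R) : (0 <= T)%E -> LG1 T Y -> LG1 T Z ->
  lgs_set T [set w | Y w = Z w].
Proof.
move=> T0 /(LG1P h0 hs _ T0)[mY [y hy Yy]] /(LG1P h0 hs _ T0)[mZ [z hz Zz]]; split.
  by rewrite -[X in measurable X]setTI; exact: measurable_eqe.
exists (\1_[set w | y w = z w]); first exact: lgs_indic_eq.
apply: (qs_sub h0 hs) (qs_and h0 hs Yy Zz) => w [/= eY eZ].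
have [[/= e ->]|[/= e ->]] := indicP [set w | y w = z w] w.
  by rewrite indicE mem_set//= eY eZ e.
by rewrite indicE memNset//= eY eZ => -[].
Qed.

Lemma first_contact_stopping j : (j <= N)%N ->
  G_stopping_time (fun w => (first_contact j N X V w)%:R).
Proof.
move=> jN; split => // t t0; set k := Num.truncn t.
have kt : k%:R <= t by rewrite truncn_le.
have eA : [set w | (first_contact j N X V w)%:R <= t] = [set w | (first_contact j N X V w <= k)%N].
  by apply/seteqP; split => w /=; rewrite truncn_ge_nat.
have [Nk|kN] := leqP N k.
  rewrite eA (_ : [set w | _] = setT); last first.
    by apply/seteqP; split => w //= _; exact: leq_trans (first_contact_le _ _ _ _ _) Nk.
  apply/LG1sP => //; split; first by apply/measurable_EFinP; exact: measurable_indic.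
  by exists (fun=> 1); [exact/lg_lgs/lg_cst|apply: qs_T => // w /=; rewrite indicT].
apply: lgs_set_LG1s; first by rewrite lee_fin.
rewrite eA (_ : [set w | _] = [set w | exists2 l, (j <= l < k.+1)%N & V l w = X l w]); last first.
  by apply/seteqP; split => w /= h; apply/(first_contact_leP _ _ _ _ kN).
(* Induction on the end m of the union; m <= k + 1 is kept so that each contact event is known by
   time t. *)
have : (k.+1 <= k.+1)%N by []; move: {1 3}k.+1; elim=> [_|m IH mk].
  rewrite (_ : [set w | _] = set0); first exact: lgs_set0.
  by apply/seteqP; split => w //= [l]; rewrite ltn0 andbF.
have mt : ((m%:R%:E : \bar R) <= t%:E)%E by rewrite lee_fin (le_trans _ kt)// ler_nat.
have [jm|mj] := leqP j m; last first.
  rewrite (_ : [set w | _] = set0); first exact: lgs_set0.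
  by apply/seteqP; split => w //= [l /andP[jl lm] _]; have := leq_trans jl lm; rewrite leqNgt mj.
rewrite (_ : [set w | _] = [set w | exists2 l, (j <= l < m)%N & V l w = X l w] `|` [set w | V m w = X m w]).
  have mN : (m <= N)%N by by rewrite (leq_trans _ (ltnW kN)).
  apply: lgs_setU; first exact: IH (ltnW mk).
  apply: (lgs_set_le mt (time_ge0 _ _)); apply: lgs_set_eq; [exact: time_ge0|exact: snell_LG1|exact: hX].
apply/seteqP; split => w /=.
  move=> [l /andP[jl]]; rewrite ltnS leq_eqVlt => /orP[/eqP->|lm] e; [by right|left].
  by exists l => //; rewrite jl.
move=> [[l /andP[jl lm] e]|e]; [exists l|exists m] => //; rewrite ?jl ?jm/= ?ltnSn//.
exact: ltnW.
Qed.

Section stopped_snell.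
Variable sigma : Omega -> nat.
Hypotheses (sN : forall w, (sigma w <= N)%N) (st : G_stopping_time (fun w => (sigma w)%:R)).

Let minnN n w : minn (minn n (sigma w)) N = minn n (sigma w).
Proof. by apply/minn_idPl; rewrite geq_min sN orbT. Qed.

Let V'E n : (fun w => V' (minn n (sigma w)) w) = (fun w => V (minn n (sigma w)) w).
Proof. by apply/funext => w; rewrite /V' minnN. Qed.

Lemma snell_stopped n :
  LGs1 n%:R%:E (fun w => V (minn n (sigma w)) w) /\ LGbar n%:R%:E (fun w => V (minn n (sigma w)) w).
Proof. by rewrite -V'E; exact: stopped_LGs1. Qed.

Lemma reward_stopped : LGbar N%:R%:E (fun w => X (sigma w) w).
Proof.
rewrite (_ : (fun w => _) = (fun w => X' (minn N (sigma w)) w)).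
  by have [] := stopped_LGs1 h0 hs N st X'_LG1.
by apply/funext => w; rewrite /X' minnN (minn_idPr (sN w)).
Qed.

Lemma snell_stopped_step n : (n < N)%N -> CE n%:R (fun w => V (minn n.+1 (sigma w)) w)
  (fun w => if (n < sigma w)%N then condE n%:R (V n.+1) w else V (minn n (sigma w)) w).
Proof.
move=> nN; have := stopped_step h0 hs n st V'_LG1; rewrite V'E /V' (minn_idPl nN).
by under [X in CE _ _ X -> _]eq_fun do rewrite minnN.
Qed.

Lemma snell_stopped_supermartingale j :
  G_supermartingale sl sh j N (fun n w => V (minn n (sigma w)) w).
Proof.
apply: supermartingale_step => // [n _|n _ nN]; first by case: (snell_stopped n).
have := LGbar_condE_eq h0 hs (ler0n R n) (time_ge0 R n.+1) (snell_stopped n.+1).2 (snell_stopped_step nN).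
apply: (qs_sub h0 hs) => w /= ->; case: ltnP => // ns.
by rewrite [in leRHS]hV// le_max lexx orbT.
Qed.

(** X at sigma is below V at sigma, and V stopped at sigma is a supermartingale between j and N that
    starts from V j. *)
Lemma reward_le_snell j : (forall w, (j <= sigma w)%N) -> (j <= N)%N ->
  qs_le (condE j%:R (fun w => X (sigma w) w)) (V j).
Proof.
move=> js jN; have [_ hM] := snell_stopped_supermartingale j.
have := hM j N; rewrite leqnn jN => /(_ isT (leqnn N)).
have -> : (fun w => V (minn j (sigma w)) w) = V j by apply/funext => w; rewrite (minn_idPl (js w)).
apply: (qs_le_trans h0 hs).
have c1 := LGbar_CE h0 hs (ler0n R j) (time_ge0 R N) reward_stopped.
have c2 := LGbar_CE h0 hs (ler0n R j) (time_ge0 R N) (snell_stopped N).2.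
apply: (CE_mono h0 hs (ler0n R j) c1 c2).
(* Domination at a random index needs one polar set common to all indices. *)
have := qs_all h0 hs (S := fun n => [set w | (n <= N)%N -> (X n w <= V n w)%E]).
move=> H; apply: (qs_sub h0 hs) (H _) => [w /= k|n].
  by rewrite (minn_idPr (sN w)); exact: k.
have [nN|Nn] := leqP n N; last by apply: qs_T.
by apply: (qs_sub h0 hs) (snell_dominates nN) => w /=.
Qed.
End stopped_snell.

(** Before contact V n differs from X n, so the maximum defining it is the conditional expectation
    of V (n + 1). *)
Lemma snell_martingale j : (j <= N)%N ->
  G_martingale sl sh j N (fun n w => V (minn n (first_contact j N X V w)) w).
Proof.
move=> jN; have st := first_contact_stopping jN.
have tN w : (first_contact j N X V w <= N)%N by exact: first_contact_le.
apply: martingale_step => // [n _|n jn nN]; first by case: (snell_stopped tN st n).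
have := snell_stopped_step tN st nN; congr (CE _ _); apply/funext => w; case: ltnP => // nt.
have := first_contact_before jn nt; rewrite hV//.
by case: (leP (X n w) (condE n%:R (V n.+1) w)).
Qed.

End snell_envelope.

Theorem theorem3p2 (R : realType) (sl sh : R) (h0 : 0 <= sl) (hs : sl <= sh)
    (N : nat) (X V : nat -> Omega R -> \bar R)
    (hX : forall n, (n <= N)%N -> LG1 sl sh n%:R%:E (X n))
    (hVN : V N = X N)
    (hV : forall n, (n < N)%N ->
       V n = fun w => maxe (X n w) (condE sl sh n%:R (V n.+1) w)) :
  smallest_dominating_supermartingale sl sh N X V /\
  forall j, (j <= N)%N ->
    let tau := first_contact j N X V in
    [/\ G_stopping_time sl sh (fun w => (tau w)%:R),
        forall n, (n <= N)%N ->
          LGs1 sl sh n%:R%:E (fun w => V (minn n (tau w)) w),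
        G_martingale sl sh j N (fun n w => V (minn n (tau w)) w),
        qs_eq sl sh (V j) (condE sl sh j%:R (fun w => X (tau w) w))
      & is_ess_sup sl sh
          [set condE sl sh j%:R (fun w => X (sigma w) w)
             | sigma in stopping_times sl sh j N]
          (V j)].
Proof.
split.
  split.
  - exact: (snell_supermartingale h0 hs hX hVN hV).
  - exact: (snell_dominates h0 hs hVN hV).
  - by move=> U; exact: (snell_smallest h0 hs hX hVN hV).
move=> j jN tau; have tN w : (tau w <= N)%N by exact: first_contact_le.
have jt w : (j <= tau w)%N by have [] := first_contact_stop jN hVN w.
have st := first_contact_stopping h0 hs hX hVN hV jN.
have mart := snell_martingale h0 hs hX hVN hV jN.
have eV : qs_eq sl sh (V j) (condE sl sh j%:R (fun w => X (tau w) w)).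
  have [_ h] := mart; have := h j N; rewrite leqnn jN => /(_ isT (leqnn N)).
  rewrite -/tau (_ : (fun w => V (minn j (tau w)) w) = V j); last first.
    by apply/funext => w; rewrite (minn_idPl (jt w)).
  rewrite (_ : (fun w => V (minn N (tau w)) w) = fun w => X (tau w) w); first exact: qs_eq_sym.
  by apply/funext => w; rewrite (minn_idPr (tN w)); have [] := first_contact_stop jN hVN w.
split => //; first by move=> n nN; have [] := snell_stopped h0 hs hX hVN hV tN st n.
split.
- move=> _ [sigma [js ss] <-]; have sN w : (sigma w <= N)%N by have /andP[] := js w.
  have hR := LGbar_le h0 hs (leey _) (time_ge0 R N) (reward_stopped h0 hs hX sN ss).
  have [mY [x [y [_ Yy c]]]] := condEP h0 hs (ler0n R j) hR.
  by apply/(LL1P h0 hs); split => //; exists y; split => //; case: c.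
- by have /(LG1P h0 hs _ (time_ge0 R j))[] := snell_LG1 h0 hs hX hVN hV jN.
- move=> _ [sigma [js ss] <-]; apply: (reward_le_snell h0 hs hX hVN hV _ ss _ jN).
    by move=> w; have /andP[] := js w.
  by move=> w; have /andP[] := js w.
(* The supremum is attained: V j is quasi-surely the member of the family given by [tau]. *)
move=> eta _ h; apply: (qs_le_trans h0 hs (qs_eq_le h0 hs eV)); apply: h.
by exists tau => //; split => // w; rewrite jt tN.
Qed.
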